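(* Let $V=\mathbb{C}\cdot E_2\oplus M_{\ast}$ and let $\mathbb{C}\langle V\rangle$ be the shuffle algebra on $V$. The $QM_{\ast}$-linear map $$\varphi^{QM}: QM_{\ast}\otimes_{\mathbb{C}}\mathbb{C}\langle V\rangle\to \mathcal{I}^{QM},\qquad [f_1|\ldots|f_n]\mapsto I(f_1,\ldots,f_n;\tau)$$ is an isomorphism of $QM_{\ast}$-algebras.
   Context: All modular and quasimodular forms are for $\mathrm{SL}_2(\mathbb{Z})$; $\mathfrak{H}$ is the upper half-plane with coordinate $\tau$ and $q=e^{2\pi i\tau}$. $M_{\ast}=\bigoplus_k M_k=\mathbb{C}[E_4,E_6]$ is the algebra of holomorphic modular forms, where $E_{2k}(\tau)=1-\frac{4k}{B_{2k}}\sum_{n\ge1}n^{2k-1}\frac{q^n}{1-q^n}$ (with $B_{2k}$ the Bernoulli numbers) is the normalized Eisenstein series of weight $2k$. $QM_{\ast}=\mathbb{C}[E_2,E_4,E_6]$ is the algebra of quasimodular forms, viewed as an algebra of holomorphic functions on $\mathfrak{H}$ (the functions $E_2,E_4,E_6$ are algebraically independent over $\mathbb{C}$). Shuffle algebra: for a $\mathbb{C}$-vector space $U$, $\mathbb{C}\langle U\rangle=\bigoplus_{n\ge0}U^{\otimes n}$ as a vector space, with $f_1\otimes\cdots\otimes f_n$ written $[f_1|\ldots|f_n]$ (for $n=0$ the empty word, which is the unit), and product the shuffle product $[f_1|\ldots|f_r]\,⧢\,[f_{r+1}|\ldots|f_{r+s}]=\sum_{\sigma\in\Sigma_{r,s}}[f_{\sigma(1)}|\ldots|f_{\sigma(r+s)}]$,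 where $\Sigma_{r,s}$ is the set of permutations $\sigma$ of $\{1,\ldots,r+s\}$ with $\sigma^{-1}(1)<\ldots<\sigma^{-1}(r)$ and $\sigma^{-1}(r+1)<\ldots<\sigma^{-1}(r+s)$. Regularized iterated integrals: let $W$ be the $\mathbb{C}$-algebra of holomorphic $f:\mathfrak{H}\to\mathbb{C}$ with an everywhere convergent Fourier series $f=\sum_{n\ge0}a_nq^n$ (so $QM_{\ast}\subset W$), and let $f^{\infty}=a_0$. Define a linear map $R:\mathbb{C}\langle W\rangle\to\mathbb{C}\langle W\rangle$ by $R[f_1|\ldots|f_n]=\sum_{i=0}^n(-1)^{n-i}[f_1|\ldots|f_i]\,⧢\,[f_n^{\infty}|\ldots|f_{i+1}^{\infty}]$. For $f_1,\ldots,f_n\in W$ set $$I(f_1,\ldots,f_n;\tau)=(2\pi i)^n\sum_{i=0}^n(-1)^{n-i}\int_{\tau}^{i\infty}R[f_1|\ldots|f_i]\int_0^{\tau}[f_n^{\infty}|\ldots|f_{i+1}^{\infty}],$$ where $\int_a^b[f_1|\ldots|f_n]=\int_{0\le t_1\le\ldots\le t_n\le1}(\gamma_a^b)^*(f_1(\tau_1)d\tau_1)\cdots(\gamma_a^b)^*(f_n(\tau_n)d\tau_n)$ is the usual iterated integral along the straight line path $\gamma_a^b$ from $a$ to $b$, extended linearly to $\mathbb{C}\langle W\rangle$ (equal to $1$ for $n=0$); the integral of $R[\cdots]$ up to $i\infty$ is along the vertical ray, as a limit of the whole linear combination, which converges. $\mathcal{I}^{QM}=\mathrm{Span}_{QM_{\ast}}\{I(f_1,\ldots,f_n;\tau)\mid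 n\ge0,\ f_i\in QM_{\ast}\}$, a $QM_{\ast}$-algebra of holomorphic functions on $\mathfrak{H}$ under multiplication of functions. *)

(* Defs.v *)
From HB Require Import structures.
From mathcomp Require Import all_boot all_order all_algebra.
From mathcomp Require Import complex perm zify.
From mathcomp Require Import all_classical all_reals all_analysis.
From mathcomp Require Import freeg.

Set Implicit Arguments.
Unset Strict Implicit.
Unset Printing Implicit Defensive.

Import Order.TTheory GRing.Theory Num.Theory.
Import numFieldNormedType.Exports.

Local Open Scope classical_set_scope.
Local Open Scope ring_scope.
Local Open Scope quotient_scope.

Lemma linear_for0 (K : pzRingType) (U M : lmodType K) (f : U -> M) :
  linear f -> f 0 = 0.
Proof. by move=> fl; have := fl (-1) 0 0; rewrite scaler0 addr0 scaleN1r addNr. Qed.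

Section FreeModule.
Variables (K : comNzRingType) (S : choiceType).

Lemma freeg_ind (P : {freeg S / K} -> Prop) :
  P 0 -> (forall c s x, P x -> P (c *: << s >> + x)) -> forall x, P x.
Proof.
move=> P0 PD x; rewrite -(freeg_sumE x).
elim: (dom x) => [|s l IH]; first by rewrite big_nil.
rewrite big_cons; suff -> : << coeff s x *g s >> = coeff s x *: << s >> :> {freeg S / K}.
  exact: PD.
by apply/eqP/freeg_eqP => z; rewrite coeffZ !coeffU mul1r.
Qed.

Lemma fglift_is_linear (M : lmodType K) (f : S -> M) : linear (fglift f).
Proof.
have fgD : {morph fglift f : x y / x + y}.
  have fgB := lift_is_additive f.
  move=> x y; have fg0 : fglift f 0 = 0 by rewrite -[0]subr0 fgB subrr.
  have fgN z : fglift f (- z) = - fglift f z by rewrite -[- z]sub0r fgB fg0 sub0r.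
  by rewrite -{1}[y]opprK fgB fgN opprK.
move=> c x y; rewrite fgD; congr (_ + _).
have fg0 : fglift f 0 = 0 by apply: (addIr (fglift f 0)); rewrite -fgD !add0r.
have fgU d s : fglift f (d *: << s >>) = d *: f s.
  rewrite -(liftU f); congr (fglift f _).
  by apply/eqP/freeg_eqP => z; rewrite coeffZ !coeffU mul1r.
elim/freeg_ind: x => [|d s x IH]; first by rewrite scaler0 fg0 scaler0.
by rewrite scalerDr !fgD IH scalerA !fgU scalerDr scalerA.
Qed.

HB.instance Definition _ (M : lmodType K) (f : S -> M) :=
  GRing.isLinear.Build K {freeg S / K} M _ (fglift f) (fglift_is_linear f).

Lemma fgliftU (M : lmodType K) (f : S -> M) s : fglift f << s >> = f s.
Proof. by rewrite liftU scale1r. Qed.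

Lemma fglift0 (M : lmodType K) (f : S -> M) : fglift f 0 = 0.
Proof. exact: linear0. Qed.

Lemma fgliftP (M : lmodType K) (f : S -> M) c s x :
  fglift f (c *: << s >> + x) = c *: f s + fglift f x.
Proof. by rewrite fglift_is_linear fgliftU. Qed.

End FreeModule.

Definition is_submod (K : pzRingType) (U : lmodType K) (N : set U) : Prop :=
  N 0 /\ (forall (c : K) x y, N x -> N y -> N (c *: x + y)).

Section PresentedModule.
Variables (K : comNzRingType) (S : choiceType) (rels : set {freeg S / K}).

Definition relspan : set {freeg S / K} := smallest (@is_submod K _) rels.

Lemma relspan_submod : is_submod relspan.
Proof.
split; first by move=> N [[]].
move=> c x y Nx Ny N NC; have [[_ NP] _] := NC.
by apply: NP; [exact: Nx|exact: Ny].
Qed.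

Definition pres_rel : rel {freeg S / K} := [rel x y | `[< relspan (x - y) >]].

Lemma pres_relP x y : reflect (relspan (x - y)) (pres_rel x y).
Proof. exact: asboolP. Qed.

Lemma pres_rel_refl : reflexive pres_rel.
Proof. by move=> x; apply/pres_relP; rewrite subrr; case: relspan_submod. Qed.

Lemma relspan_opp x : relspan x -> relspan (- x).
Proof.
by move=> Nx; have [N0 NP] := relspan_submod; rewrite -[- x]addr0 -scaleN1r; apply: NP.
Qed.

Lemma relspan_add x y : relspan x -> relspan y -> relspan (x + y).
Proof. by move=> Nx Ny; have [N0 NP] := relspan_submod; rewrite -[x]scale1r; apply: NP. Qed.

Lemma relspan_scale c x : relspan x -> relspan (c *: x).
Proof. by move=> Nx; have [N0 NP] := relspan_submod; rewrite -[_ *: _]addr0; apply: NP. Qed.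

Lemma pres_rel_sym : symmetric pres_rel.
Proof.
by move=> x y; apply/pres_relP/pres_relP => /relspan_opp; rewrite opprB.
Qed.

Lemma pres_rel_trans : transitive pres_rel.
Proof.
move=> y x z /pres_relP xy /pres_relP yz; apply/pres_relP.
by have := relspan_add xy yz; rewrite addrA subrK.
Qed.

Definition pres_equiv := EquivRel pres_rel pres_rel_refl pres_rel_sym pres_rel_trans.

(* The K-module presented by the generators S and the relators rels. *)
Definition presmod := {eq_quot pres_equiv}.
HB.instance Definition _ := Choice.on presmod.
HB.instance Definition _ := EqQuotient.on presmod.

Lemma pres_eqP x y : reflect (relspan (x - y)) (x == y %[mod presmod]).
Proof. by rewrite eqmodE; exact: pres_relP. Qed.

Lemma pres_eq x y : relspan (x - y) -> \pi_presmod x = \pi_presmod y.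
Proof. by move=> h; apply/eqP/pres_eqP. Qed.

Lemma pres_reprP x : relspan (repr (\pi_presmod x) - x).
Proof. by apply/pres_eqP; rewrite reprK. Qed.

Definition pres_add (x y : presmod) : presmod := \pi_presmod (repr x + repr y).
Definition pres_opp (x : presmod) : presmod := \pi_presmod (- repr x).
Definition pres_scale c (x : presmod) : presmod := \pi_presmod (c *: repr x).

Lemma pres_addE x y : pres_add (\pi_presmod x) (\pi_presmod y) = \pi_presmod (x + y).
Proof.
apply: pres_eq; rewrite opprD addrACA.
by apply: relspan_add; exact: pres_reprP.
Qed.

Lemma pres_oppE x : pres_opp (\pi_presmod x) = \pi_presmod (- x).
Proof. by apply: pres_eq; rewrite -opprD; apply: relspan_opp; exact: pres_reprP. Qed.

Lemma pres_scaleE c x : pres_scale c (\pi_presmod x) = \pi_presmod (c *: x).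
Proof. by apply: pres_eq; rewrite -scalerBr; apply: relspan_scale; exact: pres_reprP. Qed.

Fact pres_addA : associative pres_add.
Proof.
elim/quotW=> x; elim/quotW=> y; elim/quotW=> z.
by rewrite (pres_addE x y) (pres_addE y z) (pres_addE x) pres_addE addrA.
Qed.
Fact pres_addC : commutative pres_add.
Proof. by elim/quotW=> x; elim/quotW=> y; rewrite !pres_addE addrC. Qed.
Fact pres_add0 : left_id (\pi_presmod 0) pres_add.
Proof. by elim/quotW=> x; rewrite !pres_addE add0r. Qed.
Fact pres_addN : left_inverse (\pi_presmod 0) pres_opp pres_add.
Proof. by elim/quotW=> x; rewrite (pres_oppE x) pres_addE addNr. Qed.

HB.instance Definition _ :=
  GRing.isZmodule.Build presmod pres_addA pres_addC pres_add0 pres_addN.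

Fact pres_scaleA a b x : pres_scale a (pres_scale b x) = pres_scale (a * b) x.
Proof. by elim/quotW: x => x; rewrite (pres_scaleE b x) !pres_scaleE scalerA. Qed.
Fact pres_scale1 : left_id 1 pres_scale.
Proof. by elim/quotW=> x; rewrite pres_scaleE scale1r. Qed.
Fact pres_scaleDr : right_distributive pres_scale +%R.
Proof.
move=> c; elim/quotW=> x; elim/quotW=> y.
by rewrite [_ + _]pres_addE (pres_scaleE c x) (pres_scaleE c y) pres_scaleE [RHS]pres_addE scalerDr.
Qed.
Fact pres_scaleDl x : {morph pres_scale^~ x : a b / a + b}.
Proof.
by elim/quotW: x => x a b; rewrite (pres_scaleE a x) (pres_scaleE b x) pres_scaleE [RHS]pres_addE scalerDl.
Qed.

HB.instance Definition _ := GRing.Zmodule_isLmodule.Build K presmod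
  pres_scaleA pres_scale1 pres_scaleDr pres_scaleDl.

Definition pres_gen (s : S) : presmod := \pi_presmod << s >>.

Lemma pres_pi_linear : linear (\pi_presmod : {freeg S / K} -> presmod).
Proof. move=> c x y.
have -> : c *: \pi_presmod x = \pi_presmod (c *: x) by exact: pres_scaleE.
by rewrite [RHS]pres_addE. Qed.

Lemma pres_piE x : \pi_presmod x = fglift pres_gen x.
Proof.
elim/freeg_ind: x => [|c s x IH]; first by rewrite fglift0.
by rewrite pres_pi_linear IH fgliftP.
Qed.

Lemma pres_rel0 r : rels r -> fglift pres_gen r = 0.
Proof.
move=> rr; rewrite -pres_piE; apply: pres_eq; rewrite subr0.
exact: sub_gen_smallest.
Qed.

Lemma pres_ind (P : presmod -> Prop) :
  P 0 -> (forall c s x, P x -> P (c *: pres_gen s + x)) -> forall x, P x.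
Proof.
move=> P0 PD; elim/quotW => x; rewrite pres_piE.
elim/freeg_ind: x => [|c s x IH]; first by rewrite fglift0.
by rewrite fgliftP; exact: PD.
Qed.

Section Lift.
Variables (M : lmodType K) (f : S -> M).

Definition pres_lift (x : presmod) : M := fglift f (repr x).

Hypothesis f_rel : forall r, rels r -> fglift f r = 0.

Lemma pres_lift_pi x : pres_lift (\pi_presmod x) = fglift f x.
Proof.
suff h y : relspan y -> fglift f y = 0.
  apply/eqP; rewrite -subr_eq0 -linearB; apply/eqP/h.
  exact: pres_reprP.
move=> /(_ [set z | fglift f z = 0]); apply; split; last exact: f_rel.
by split=> [|c u v /= u0 v0]; rewrite /= ?fglift0// fglift_is_linear u0 v0 scaler0 addr0.
Qed.

Lemma pres_liftU s : pres_lift (pres_gen s) = f s.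
Proof. by rewrite pres_lift_pi fgliftU. Qed.

Lemma pres_lift_linear : linear pres_lift.
Proof.
move=> c; elim/quotW=> x; elim/quotW=> y.
by rewrite -pres_pi_linear !pres_lift_pi fglift_is_linear.
Qed.
End Lift.

End PresentedModule.

(* A multiplication on a presented module: the product of the generators s and t
   is the sum of the generators listed in [pmul s t]. *)
Record presalg (K : comNzRingType) := PresAlg {
  pgen : choiceType;
  prel : set {freeg pgen / K};
  pone : pgen;
  pmul : pgen -> pgen -> seq pgen;
  pmul_rel : forall s r, prel r ->
    fglift (fun t => \sum_(w <- pmul t s) pres_gen prel w) r = 0;
  pmulC : forall s t, \sum_(w <- pmul s t) pres_gen prel w
                    = \sum_(w <- pmul t s) pres_gen prel w;
  pmul1 : forall s, pmul pone s = [:: s];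
  pmulA : forall s t u,
    \sum_(w <- pmul s t) \sum_(z <- pmul w u) pres_gen prel z
    = \sum_(w <- pmul t u) \sum_(z <- pmul s w) pres_gen prel z;
}.

Section PresentedAlgebra.
Variables (K : comNzRingType) (D : presalg K).

Definition quotalg := presmod (@prel K D).
HB.instance Definition _ := GRing.Lmodule.on quotalg.

Local Notation gen := (pres_gen (@prel K D) : pgen D -> quotalg).

Definition quotmul (x y : quotalg) : quotalg :=
  pres_lift (fun s => pres_lift (fun t => \sum_(w <- pmul s t) gen w) y) x.

Let mul_gen s : quotalg -> quotalg := pres_lift (fun t => \sum_(w <- pmul s t) gen w).

Let pmul_rel' s r : prel r ->
  fglift (fun t => \sum_(w <- pmul s t) gen w) r = 0.
Proof.
move=> /(pmul_rel s) h; rewrite -[RHS]h; congr (fglift _ _).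
by apply/funext => t; exact: pmulC.
Qed.

Let mul_gen_linear s : linear (mul_gen s).
Proof. exact/pres_lift_linear/pmul_rel'. Qed.

Let mul_genU s t : mul_gen s (gen t) = \sum_(w <- pmul s t) gen w.
Proof. exact/pres_liftU/pmul_rel'. Qed.

Let mul_gen_rel y r : prel r -> fglift (mul_gen^~ y) r = 0.
Proof.
move=> rr; elim/pres_ind: y => [|c t y IH].
  rewrite [X in fglift X](_ : _ = fun=> 0); last first.
    by apply/funext => s; exact: linear_for0 (mul_gen_linear s).
  elim/freeg_ind: {rr} r => [|d s r IH]; first by rewrite fglift0.
  by rewrite fgliftP scaler0 IH addr0.
rewrite [X in fglift X](_ : _ = fun s => c *: (\sum_(w <- pmul s t) gen w) + mul_gen s y); last first.
  by apply/funext => s; rewrite /= mul_gen_linear mul_genU.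
have E (f g : pgen D -> quotalg) z : fglift (fun s => c *: f s + g s) z = c *: fglift f z + fglift g z.
  elim/freeg_ind: z => [|d s z IHz]; first by rewrite !fglift0 scaler0 addr0.
  rewrite !fgliftP IHz !scalerDr !scalerA [d * c]mulrC -!addrA.
  by congr (_ + _); rewrite addrCA.
by rewrite E pmul_rel // scaler0 add0r IH.
Qed.

Let mul_linl y : linear (quotmul^~ y).
Proof. by apply: pres_lift_linear => r rr; exact: mul_gen_rel. Qed.

Let mulUl s y : quotmul (gen s) y = mul_gen s y.
Proof. by apply: pres_liftU => r rr; exact: mul_gen_rel. Qed.

Lemma quotmulU s t : quotmul (gen s) (gen t) = \sum_(w <- pmul s t) gen w.
Proof. by rewrite mulUl mul_genU. Qed.

Let mul_linr x : linear (quotmul x).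
Proof.
elim/pres_ind: x => [|c s x IH] d y z.
  by rewrite !(linear_for0 (mul_linl _)) scaler0 addr0.
rewrite !mul_linl !mulUl mul_gen_linear IH !scalerDr !scalerA [d * c]mulrC -!addrA.
by congr (_ + _); rewrite addrCA.
Qed.

Let mulr0' x : quotmul x 0 = 0.
Proof. exact: linear_for0 (mul_linr x). Qed.
Let mul0r' x : quotmul 0 x = 0.
Proof. exact: linear_for0 (mul_linl x). Qed.

Fact quotmulC : commutative quotmul.
Proof.
move=> x y; elim/pres_ind: x => [|c s x IH]; first by rewrite mulr0' mul0r'.
rewrite mul_linl mul_linr IH; congr (_ *: _ + _).
elim/pres_ind: y => [|d t y IHy] in IH *; first by rewrite mulr0' mul0r'.
rewrite mul_linl mul_linr.
have -> : quotmul (gen s) y = quotmul y (gen s).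
  elim/pres_ind: y {IH IHy} => [|e u y IHy]; first by rewrite mulr0' mul0r'.
  by rewrite mul_linl mul_linr IHy !quotmulU pmulC.
by rewrite !quotmulU pmulC.
Qed.

Let sum_linl (I : Type) (l : seq I) (F : I -> quotalg) y :
  quotmul (\sum_(i <- l) F i) y = \sum_(i <- l) quotmul (F i) y.
Proof.
elim: l => [|i l IH]; first by rewrite !big_nil mul0r'.
by rewrite !big_cons -[F i]scale1r mul_linl IH !scale1r.
Qed.

Fact quotmulA : associative quotmul.
Proof.
move=> x y z.
elim/pres_ind: x => [|c s x IH]; first by rewrite !mul0r'.
rewrite !mul_linl IH; congr (_ *: _ + _) => {c x IH}.
elim/pres_ind: y => [|d t y IH]; first by rewrite !(mul0r', mulr0').
rewrite !(mul_linl, mul_linr) IH; congr (_ *: _ + _) => {d y IH}.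
elim/pres_ind: z => [|e u z IH]; first by rewrite !(mul0r', mulr0').
rewrite !mul_linr IH; congr (_ *: _ + _) => {e z IH}.
rewrite !quotmulU quotmulC !sum_linl.
under eq_bigr do rewrite quotmulC quotmulU.
rewrite -pmulA.
by apply: eq_bigr => w _; rewrite quotmulU.
Qed.

Fact quotmul1 : left_id (gen (pone D)) quotmul.
Proof.
elim/pres_ind=> [|c s x IH]; first by rewrite mulr0'.
by rewrite mul_linr IH quotmulU pmul1 big_seq1.
Qed.

Fact quotmulDl : left_distributive quotmul +%R.
Proof. by move=> x y z; rewrite -[x]scale1r mul_linl !scale1r. Qed.

HB.instance Definition _ :=
  GRing.Zmodule_isComPzRing.Build quotalg quotmulA quotmulC quotmul1 quotmulDl.

Lemma quotmulZ c (x y : quotalg) : c *: (x * y) = (c *: x) * y.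
Proof. by rewrite -[c *: x]addr0 [RHS]mul_linl mul0r' addr0. Qed.

Lemma quotmul_gen s t : gen s * gen t = \sum_(w <- pmul s t) gen w.
Proof. exact: quotmulU. Qed.

End PresentedAlgebra.

Section Shuffle.
Variable T : Type.
Implicit Types u v w : seq T.

Fixpoint shuffle (u : seq T) : seq T -> seq (seq T) :=
  if u is x :: u' then
    fix shuffle_u (v : seq T) : seq (seq T) :=
      if v is y :: v' then
        [seq x :: w | w <- shuffle u' v] ++ [seq y :: w | w <- shuffle_u v']
      else [:: u]
  else fun v => [:: v].

Lemma shuffle0s v : shuffle [::] v = [:: v]. Proof. by []. Qed.

Lemma shuffles0 u : shuffle u [::] = [:: u]. Proof. by case: u. Qed.

Lemma shuffle_cons x u y v : shuffle (x :: u) (y :: v) =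
  [seq x :: w | w <- shuffle u (y :: v)] ++ [seq y :: w | w <- shuffle (x :: u) v].
Proof. by []. Qed.

Variable M : nmodType.
Implicit Types f : seq T -> M.

Lemma sum_shuffle_cons x u y v f :
  \sum_(w <- shuffle (x :: u) (y :: v)) f w =
  \sum_(w <- shuffle u (y :: v)) f (x :: w) + \sum_(w <- shuffle (x :: u) v) f (y :: w).
Proof. by rewrite shuffle_cons big_cat !big_map. Qed.

Lemma sum_shuffleC u v f :
  \sum_(w <- shuffle u v) f w = \sum_(w <- shuffle v u) f w.
Proof.
elim: u v f => [|x u IHu] v f; first by rewrite shuffles0.
elim: v f => [|y v IHv] f; first by rewrite shuffles0.
by rewrite !sum_shuffle_cons addrC IHv IHu.
Qed.

Lemma sum_shuffleA u v t f :
  \sum_(w <- shuffle u v) \sum_(z <- shuffle w t) f z =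
  \sum_(w <- shuffle v t) \sum_(z <- shuffle u w) f z.
Proof.
elim: u v t f => [|x u IHu] v t f.
  by rewrite big_seq1; apply: eq_bigr => z _; rewrite big_seq1.
elim: v t f => [|y v IHv] t f; first by rewrite !big_seq1.
elim: t f => [|z t IHt] f.
  by rewrite shuffles0 big_seq1; apply: eq_bigr => w _; rewrite shuffles0 big_seq1.
rewrite [LHS]sum_shuffle_cons [RHS]sum_shuffle_cons.
under eq_bigr do rewrite sum_shuffle_cons.
under [X in _ + X = _]eq_bigr do rewrite sum_shuffle_cons.
under [X in _ = X + _]eq_bigr do rewrite sum_shuffle_cons.
under [X in _ = _ + X]eq_bigr do rewrite sum_shuffle_cons.
rewrite !big_split /= addrACA.
have H := IHt (fun w => f (z :: w)); rewrite sum_shuffle_cons in H.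
rewrite H (IHu _ _ (fun w => f (x :: w))) (IHv _ (fun w => f (y :: w))).
rewrite (sum_shuffle_cons y v z t (fun w => \sum_(w0 <- shuffle u w) f (x :: w0))).
by rewrite addrACA addrA.
Qed.

End Shuffle.

Section ShuffleMultilinear.
Variables (K : pzRingType) (V M : lmodType K).

Definition multilinear (f : seq V -> M) := forall (u v : seq V) c x y,
  f (u ++ (c *: x + y) :: v) = c *: f (u ++ x :: v) + f (u ++ y :: v).

Lemma multilinear_shuffle f s : multilinear f ->
  multilinear (fun t => \sum_(w <- shuffle t s) f w).
Proof.
move=> + u; elim: u s f => [|a u IHu] s f fl v c x y; rewrite ?cat0s ?cat_cons.
  elim: s f fl => [|b s IHs] f fl; first by rewrite !shuffles0 !big_seq1; exact: (fl [::]).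
  rewrite !sum_shuffle_cons IHs; last first.
    by move=> p q d x' y'; exact: (fl (b :: p)).
  under eq_bigr do rewrite (fl [::]) /=.
  rewrite big_split /= -scaler_sumr scalerDr -!addrA; congr (_ + _).
  by rewrite addrCA.
elim: s f fl => [|b s IHs] f fl.
  by rewrite !shuffles0 !big_seq1; exact: (fl (a :: u)).
rewrite !sum_shuffle_cons IHs; last first.
  by move=> p q d x' y'; exact: (fl (b :: p)).
rewrite (IHu _ (fun w => f (a :: w))); last first.
  by move=> p q d x' y'; exact: (fl (a :: p)).
by rewrite scalerDr addrACA.
Qed.
End ShuffleMultilinear.

Section ShufflePerm.
Variable T : eqType.
Implicit Types u v w : seq T.

Lemma mem_shuffle u v w : uniq (u ++ v) ->
  (w \in shuffle u v) = [&& perm_eq w (u ++ v), subseq u w & subseq v w].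
Proof.
move=> uv; apply/idP/idP.
  elim: u v w {uv} => [|x u IHu] v w.
    by rewrite inE => /eqP ->; rewrite perm_refl sub0seq subseq_refl.
  elim: v w => [|y v IHv] w.
    by rewrite shuffles0 inE => /eqP ->; rewrite cats0 perm_refl sub0seq subseq_refl.
  rewrite shuffle_cons mem_cat => /orP[] /mapP[w' w'P ->].
    have /and3P[p s1 s2] := IHu _ _ w'P.
    rewrite /= perm_cons p eqxx s1 /=.
    exact: subseq_trans s2 (subseq_cons _ _).
  have /and3P[p s1 s2] := IHv _ w'P.
  rewrite [subseq (y :: v) _]/= eqxx s2 andbT; apply/andP; split; last first.
    exact: subseq_trans s1 (subseq_cons _ _).
  by rewrite perm_sym perm_catC /= perm_cons perm_catC perm_sym.
elim: w u v uv => [|a w IHw] u v uv.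
  by case/and3P=> _ /eqP-> /eqP->.
case/and3P=> p s1 s2.
have uw : uniq (a :: w) by rewrite (perm_uniq p).
have [[u' Eu]|nu] := pselect (exists u', u = a :: u').
  rewrite {u}Eu in uv p s1 *.
  have av : a \notin v by move: uv; rewrite /= mem_cat negb_or => /andP[/andP[]].
  suff h : w \in shuffle u' v.
    case: v {uv p s2 av} h => [|y v] h; last first.
      by rewrite shuffle_cons mem_cat map_f.
    by move: h; rewrite !shuffles0 !inE => /eqP ->.
  apply: IHw; first by move: uv => /= /andP[].
  move: p s1; rewrite /= perm_cons eqxx => -> -> /=.
  case: v s2 {uv} av => [_ _|y v /= s2']; first exact: sub0seq.
  rewrite inE negb_or eq_sym => /andP[/negbTE E _].
  by rewrite E in s2'.
have [[v' Ev]|nv] := pselect (exists v', v = a :: v').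
  rewrite {v}Ev in uv p s2 *.
  have au : a \notin u.
    by move: uv; rewrite uniq_catC /= mem_cat negb_or => /andP[/andP[]].
  suff h : w \in shuffle u v'.
    case: u {uv p s1 au nu} h => [|x u] h.
      by move: h; rewrite !shuffle0s !inE => /eqP ->.
    by rewrite shuffle_cons mem_cat orbC map_f.
  apply: IHw.
    by move: uv; rewrite uniq_catC /= => /andP[_]; rewrite uniq_catC.
  move: p s2; rewrite perm_sym perm_catC /= perm_cons eqxx perm_catC perm_sym => -> -> /=.
  rewrite andbT; case: u s1 {uv nu} au => [_ _|y u /= s1']; first exact: sub0seq.
  rewrite inE negb_or eq_sym => /andP[/negbTE E _].
  by rewrite E in s1'.
have aw : a \in u ++ v by rewrite -(perm_mem p) mem_head.
suff : a \in w by move: uw => /= /andP[/negbTE ->].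
have sub t : (~ exists t', t = a :: t') -> subseq t (a :: w) -> subseq t w.
  case: t => [|b t] nt; first by rewrite !sub0seq.
  by rewrite [subseq _ _]/=; case: eqP nt => // -> nt; case: nt; exists t.
move: aw; rewrite mem_cat => /orP[].
  exact: mem_subseq (sub _ nu s1) a.
exact: mem_subseq (sub _ nv s2) a.
Qed.

Lemma shuffle_uniq u v : uniq (u ++ v) -> uniq (shuffle u v).
Proof.
elim: u v => [|x u IHu] v //; elim: v => [|y v IHv] // uv.
rewrite shuffle_cons cat_uniq !map_inj_uniq; try by move=> ? ? [].
rewrite IHu; last by move: uv => /= /andP[].
rewrite IHv; last first.
  move: uv; rewrite uniq_catC /= => /andP[_]; by rewrite (uniq_catC v).
rewrite andbT /=; apply/hasPn => _ /mapP[w _ ->]; apply/negP => /mapP[w' _ [E _]].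
by move: uv; rewrite E /= mem_cat inE eqxx orbT.
Qed.

Lemma subseq_index u w : uniq w -> {subset u <= w} ->
  subseq u w = sorted (fun a b => (index a w < index b w)%N) u.
Proof.
move=> uw uSw.
have tr : transitive (fun a b => (index a w < index b w)%N).
  by move=> b a c; exact: ltn_trans.
have sw : sorted (fun a b => (index a w < index b w)%N) w.
  case: w uw {uSw tr} => // a w uw; apply/(sortedP a) => i iw.
  by rewrite !index_uniq// (ltn_trans _ iw).
apply/idP/idP => [|su]; first by move=> /subseq_sorted; apply.
suff -> : u = [seq a <- w | a \in u] by exact: filter_subseq.
apply: (@irr_sorted_eq _ (fun a b => (index a w < index b w)%N)) => //.
- by move=> a; rewrite ltnn.
- exact: subseq_sorted (filter_subseq _ _) _.
- by move=> a; rewrite mem_filter; apply/idP/andP => [au|[]//]; split=> //; exact: uSw.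
Qed.

End ShufflePerm.

Lemma shuffle_map (T T' : Type) (g : T -> T') u v :
  shuffle (map g u) (map g v) = map (map g) (shuffle u v).
Proof.
elim: u v => [|x u IHu] //; elim=> [|y v IHv] //.
by rewrite !map_cons !shuffle_cons map_cat -!map_cons IHu IHv -!map_comp.
Qed.

(* The permutations s with s^-1(1) < ... < s^-1(r) and s^-1(r+1) < ... < s^-1(n),
   for indices starting at 0. *)
Definition is_shuffle (n r : nat) (s : 'S_n) : bool :=
  [forall i : 'I_n, forall j : 'I_n,
    ((i < j < r) || (r <= i < j))%N ==> (s^-1%g i < s^-1%g j)%N].

(* [shuffle u v] lists, with multiplicity, the words [w_s(1) | ... | w_s(n)] where
   w = u ++ v and s runs over the shuffle permutations. *)
Lemma shuffleE (T : eqType) (x0 : T) (u v : seq T) (n := (size u + size v)%N) :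
  perm_eq (shuffle u v)
    [seq [seq nth x0 (u ++ v) (s i) | i <- enum 'I_n]
       | s : 'S_n <- enum 'S_n & is_shuffle (size u) s].
Proof.
set r := size u.
pose word (s : 'S_n) := [seq (s i : nat) | i <- enum 'I_n].
have Euv : u ++ v = map (nth x0 (u ++ v)) (iota 0 r ++ iota r (size v)).
  by rewrite -iotaD map_nth_iota0 ?size_cat// take_oversize ?size_cat.
have Eu : u = map (nth x0 (u ++ v)) (iota 0 r).
  by rewrite map_nth_iota0 ?size_cat ?leq_addr// take_size_cat.
have Ev : v = map (nth x0 (u ++ v)) (iota r (size v)).
  rewrite map_nth_iota; first by rewrite drop_size_cat// take_size.
  by rewrite size_cat addKn.
have -> : shuffle u v = map (map (nth x0 (u ++ v))) (shuffle (iota 0 r) (iota r (size v))).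
  by rewrite -shuffle_map -Eu -Ev.
rewrite [X in perm_eq _ X](_ : _ = map (map (nth x0 (u ++ v)))
    [seq word s | s : 'S_n <- enum 'S_n & is_shuffle r s]); last first.
  by rewrite -map_comp; apply: eq_map => s /=; rewrite /word -map_comp.
apply: perm_map; apply: uniq_perm.
- by apply: shuffle_uniq; rewrite -iotaD iota_uniq.
- rewrite map_inj_uniq; first exact: filter_uniq (enum_uniq _).
  move=> s t /eq_in_map E.
  by apply/permP => i; apply/val_inj/E; rewrite mem_enum.
have word_size s : size (word s) = n by rewrite size_map size_enum_ord.
have word_nth s (i : 'I_n) k : nth k (word s) i = s i.
  by rewrite (nth_map i) ?size_enum_ord// nth_ord_enum.
have word_uniq s : uniq (word s).
  by rewrite map_inj_uniq ?enum_uniq// => i j /val_inj /perm_inj.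
have word_index s (i : 'I_n) : index (i : nat) (word s) = s^-1%g i.
  rewrite -{1}(permKV s i) -(word_nth s (s^-1%g i) 0%N) index_uniq// word_size.
  exact: ltn_ord.
have word_mem s i : (i \in word s) = (i < n)%N.
  apply/mapP/idP => [[j _ ->]|ni]; first exact: ltn_ord.
  by exists (s^-1%g (Ordinal ni)); rewrite ?mem_enum// permKV.
have word_perm s : perm_eq (word s) (iota 0 r ++ iota r (size v)).
  rewrite -iotaD; apply: uniq_perm; rewrite ?iota_uniq// => i.
  by rewrite word_mem mem_iota.
have sortP (s : 'S_n) a b : (a + b <= n)%N ->
  reflect (forall i j : 'I_n, (a <= i)%N -> (i < j)%N -> (j < a + b)%N -> (s^-1%g i < s^-1%g j)%N)
    (subseq (iota a b) (word s)).
  move=> abn; rewrite subseq_index//; last first.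
    by move=> i; rewrite mem_iota word_mem => /andP[_ /leq_trans]; apply.
  have tr : transitive (fun c d => (index c (word s) < index d (word s))%N).
    by move=> c d e; exact: ltn_trans.
  apply: (iffP idP) => [so i j ai ij jb|H].
    rewrite -!word_index.
    have := @sorted_ltn_nth _ _ tr 0%N _ so (i - a)%N (j - a)%N.
    rewrite !inE size_iota !nth_iota; last 2 first.
    - by lia.
    - by lia.
    by rewrite !subnKC; [apply; lia|lia|lia].
  case: b abn H => // b abn H; apply/(sortedP 0%N) => i; rewrite size_iota => ib.
  rewrite !nth_iota; try lia.
  have h1 : (a + i < n)%N by lia.
  have h2 : (a + i.+1 < n)%N by lia.
  rewrite (word_index s (Ordinal h1)) (word_index s (Ordinal h2)).
  by apply: H => /=; lia.
move=> w; rewrite mem_shuffle -?iotaD ?iota_uniq//.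
apply/idP/mapP => [/and3P[p s1 s2]|[s]]; last first.
  rewrite mem_filter => /andP[/forallP sh _] ->.
  rewrite iotaD word_perm /=; apply/andP; split; apply/sortP; rewrite ?leq_addr// => i j h1 h2 h3.
    by move/forallP: (sh i) => /(_ j) /implyP; apply; rewrite h2 h3.
  by move/forallP: (sh i) => /(_ j) /implyP; apply; rewrite h1 h2 orbT.
have sw : size w = n by rewrite (perm_size p) size_iota.
have uw : uniq w by rewrite (perm_uniq p) iota_uniq.
have wn (i : 'I_n) : (nth 0%N w i < n)%N.
  have : nth 0%N w i \in w by rewrite mem_nth// sw.
  by rewrite (perm_mem p) mem_iota.
have inj : injective (fun i => Ordinal (wn i)).
  by move=> i j [] /eqP; rewrite nth_uniq ?sw// => /eqP /val_inj.
pose s := perm inj.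
have Ew : w = word s.
  apply: (@eq_from_nth _ 0%N) => [|i]; rewrite ?sw ?word_size// => ni.
  by rewrite (word_nth s (Ordinal ni)) permE.
exists s => //; rewrite mem_filter mem_enum andbT.
rewrite Ew in s1 s2.
apply/forallP => i; apply/forallP => j; apply/implyP => /orP[] /andP[h1 h2].
  by move/sortP: s1; apply => //; exact: leq_addr.
by move/sortP: s2; apply => //; exact: ltn_ord.
Qed.

Section ShuffleAlgebra.
Variables (K : comNzRingType) (V : lmodType K).

(* The relators of the tensor algebra: words are multilinear in their letters. *)
Definition shuf_rel : set {freeg (seq V) / K} :=
  [set r | exists u v c x y,
    r = << u ++ (c *: x + y) :: v >>
        - (c *: << u ++ x :: v >> + << u ++ y :: v >>)].

Lemma fglift_shuf_rel (M : lmodType K) (f : seq V -> M) :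
  multilinear f <-> (forall r, shuf_rel r -> fglift f r = 0).
Proof.
have E u v c x y : fglift f (<< u ++ (c *: x + y) :: v >>
    - (c *: << u ++ x :: v >> + << u ++ y :: v >>))
  = f (u ++ (c *: x + y) :: v) - (c *: f (u ++ x :: v) + f (u ++ y :: v)).
  by rewrite linearB /= fglift_is_linear !fgliftU.
split=> [fl _ [u [v [c [x [y ->]]]]]|f0 u v c x y].
  by rewrite E fl subrr.
by apply/eqP; rewrite -subr_eq0 -E f0//; exists u, v, c, x, y.
Qed.

Lemma pres_gen_multilinear : multilinear (pres_gen shuf_rel).
Proof. by apply/fglift_shuf_rel => r; exact: pres_rel0. Qed.

Fact shuf_pmul_rel (s : seq V) r : shuf_rel r ->
  fglift (fun t => \sum_(w <- shuffle t s) pres_gen shuf_rel w) r = 0.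
Proof.
by move: r; apply/fglift_shuf_rel/multilinear_shuffle/pres_gen_multilinear.
Qed.

Definition shuf_presalg : presalg K := @PresAlg K (seq V) shuf_rel [::]
  (@shuffle V) shuf_pmul_rel (fun s t => sum_shuffleC s t _)
  (@shuffle0s V) (fun s t u => sum_shuffleA s t u _).

(* K<V>: the n-letter words span the n-th tensor power of V, and the product is
   the shuffle product. *)
Definition shuf : Type := quotalg shuf_presalg.
HB.instance Definition _ := GRing.ComPzRing.on shuf.
HB.instance Definition _ := GRing.Lmodule.on shuf.

(* [f_1 | ... | f_n] *)
Definition word (s : seq V) : shuf := pres_gen shuf_rel s.

Fact shuf_oner_neq0 : (1 : shuf) != 0.
Proof.
pose f (w : seq V) : K^o := (w == [::])%:R.
have fr r : shuf_rel r -> fglift f r = 0.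
  by move: r; apply/fglift_shuf_rel => -[|a u] v c x y; rewrite /f /= scaler0 addr0.
apply/eqP => /(congr1 (@pres_lift _ _ shuf_rel _ f)).
rewrite [LHS](pres_liftU fr) (linear_for0 (pres_lift_linear fr)) /f eqxx.
by move/eqP; rewrite oner_eq0.
Qed.

HB.instance Definition _ := GRing.PzSemiRing_isNonZero.Build shuf shuf_oner_neq0.
HB.instance Definition _ := GRing.Lmodule_isLalgebra.Build K shuf
  (@quotmulZ K shuf_presalg).
HB.instance Definition _ := GRing.Lalgebra_isComAlgebra.Build K shuf.

Lemma word_mul s t : word s * word t = \sum_(w <- shuffle s t) word w.
Proof. exact: quotmul_gen. Qed.

Lemma word_nil : word [::] = 1.
Proof. by []. Qed.

Lemma word_multilinear : multilinear word.
Proof. exact: pres_gen_multilinear. Qed.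

End ShuffleAlgebra.

Section TensorProduct.
Variables (K : comNzRingType) (A B : comAlgType K).

Definition tens_rel : set {freeg (A * B) / K} :=
  [set r | exists c a a' b,
    r = << (c *: a + a', b) >> - (c *: << (a, b) >> + << (a', b) >>)] `|`
  [set r | exists c a b b',
    r = << (a, c *: b + b') >> - (c *: << (a, b) >> + << (a, b') >>)].

Lemma fglift_tens_rel (M : lmodType K) (f : A * B -> M) :
  (forall b, linear (fun a => f (a, b))) ->
  (forall a, linear (fun b => f (a, b))) ->
  (forall r, tens_rel r -> fglift f r = 0).
Proof.
move=> fl fr _ [[c [a [a' [b ->]]]]|[c [a [b [b' ->]]]]].
  by rewrite linearB /= fglift_is_linear !fgliftU fl subrr.
by rewrite linearB /= fglift_is_linear !fgliftU fr subrr.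
Qed.

Let gen := pres_gen tens_rel.

Let gen_linl b : linear (fun a => gen (a, b)).
Proof.
move=> c a a'; apply/eqP; rewrite -subr_eq0; apply/eqP.
have /pres_rel0 : tens_rel (<< (c *: a + a', b) >> - (c *: << (a, b) >> + << (a', b) >>)).
  by left; exists c, a, a', b.
by rewrite linearB /= fglift_is_linear !fgliftU.
Qed.

Let gen_linr a : linear (fun b => gen (a, b)).
Proof.
move=> c b b'; apply/eqP; rewrite -subr_eq0; apply/eqP.
have /pres_rel0 : tens_rel (<< (a, c *: b + b') >> - (c *: << (a, b) >> + << (a, b') >>)).
  by right; exists c, a, b, b'.
by rewrite linearB /= fglift_is_linear !fgliftU.
Qed.

Let tmul (s t : A * B) : seq (A * B) := [:: (s.1 * t.1, s.2 * t.2)].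

Fact tens_pmul_rel s r : tens_rel r ->
  fglift (fun t => \sum_(w <- tmul t s) gen w) r = 0.
Proof.
move: r; apply: fglift_tens_rel => [b c a a'|a c b b'].
  by rewrite !big_seq1 /= mulrDl -scalerAl gen_linl.
by rewrite !big_seq1 /= mulrDl -scalerAl gen_linr.
Qed.

Fact tens_pmulC s t : \sum_(w <- tmul s t) gen w = \sum_(w <- tmul t s) gen w.
Proof. by rewrite !big_seq1 mulrC [s.2 * _]mulrC. Qed.

Fact tens_pmul1 s : tmul (1, 1) s = [:: s].
Proof. by case: s => a b; rewrite /tmul !mul1r. Qed.

Fact tens_pmulA s t u : \sum_(w <- tmul s t) \sum_(z <- tmul w u) gen z =
  \sum_(w <- tmul t u) \sum_(z <- tmul s w) gen z.
Proof. by rewrite !big_seq1 /= !mulrA. Qed.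

Definition tens_presalg : presalg K := @PresAlg K (A * B)%type tens_rel (1, 1)
  tmul tens_pmul_rel tens_pmulC tens_pmul1 tens_pmulA.

(* The tensor product of A and B over K. It is made an A-module below, through
   a *: x = (a (x) 1) * x. *)
Definition tens : Type := quotalg tens_presalg.
HB.instance Definition _ := GRing.ComPzRing.on tens.

Definition tensor (a : A) (b : B) : tens := pres_gen tens_rel (a, b).

Lemma tensor_mul a b a' b' :
  tensor a b * tensor a' b' = tensor (a * a') (b * b').
Proof. by rewrite [LHS]quotmul_gen /= big_seq1. Qed.

Lemma tensor_one : tensor 1 1 = 1. Proof. by []. Qed.

Lemma tensorDl a a' b : tensor (a + a') b = tensor a b + tensor a' b.
Proof. by have := gen_linl b 1 a a'; rewrite !scale1r. Qed.

Lemma tensorDr a b b' : tensor a (b + b') = tensor a b + tensor a b'.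
Proof. by have := gen_linr a 1 b b'; rewrite !scale1r. Qed.

Lemma tensorZ c a b : tensor (c *: a) b = tensor a (c *: b).
Proof.
have l0 := linear_for0 (gen_linl b); have r0 := linear_for0 (gen_linr a).
have := gen_linl b c a 0; rewrite addr0 l0 => El.
have := gen_linr a c b 0; rewrite addr0 r0 => Er.
by rewrite [LHS]El [RHS]Er.
Qed.

Definition tens_scale (a : A) (x : tens) : tens := tensor a 1 * x.

Fact tens_scaleA a b x : tens_scale a (tens_scale b x) = tens_scale (a * b) x.
Proof. by rewrite /tens_scale mulrA tensor_mul mulr1. Qed.
Fact tens_scale1 : left_id 1 tens_scale.
Proof. by move=> x; rewrite /tens_scale tensor_one mul1r. Qed.
Fact tens_scaleDr : right_distributive tens_scale +%R.
Proof. by move=> a x y; rewrite /tens_scale mulrDr. Qed.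
Fact tens_scaleDl x : {morph tens_scale^~ x : a b / a + b}.
Proof. by move=> a b; rewrite /tens_scale tensorDl mulrDl. Qed.

HB.instance Definition _ := GRing.Zmodule_isLmodule.Build A tens
  tens_scaleA tens_scale1 tens_scaleDr tens_scaleDl.

Lemma tensorZl a' a b : a' *: tensor a b = tensor (a' * a) b.
Proof. by rewrite [LHS]tensor_mul mul1r. Qed.

Lemma tens_scalerAl (a : A) (x y : tens) : a *: (x * y) = (a *: x) * y.
Proof. exact: mulrA. Qed.

Lemma tens_ind (P : tens -> Prop) :
  P 0 -> (forall a b x, P x -> P (tensor a b + x)) -> forall x, P x.
Proof.
move=> P0 PD; apply: pres_ind => // c [a b] x Px.
suff -> : c *: gen (a, b) = tensor (c *: a) b by exact: PD.
by have := gen_linl b c a 0; rewrite addr0 (linear_for0 (gen_linl b)) addr0.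
Qed.

End TensorProduct.

Definition is_subalg (K : comNzRingType) (A : algType K) (N : set A) : Prop :=
  [/\ N 1, (forall (c : K) x y, N x -> N y -> N (c *: x + y))
         & (forall x y, N x -> N y -> N (x * y))].

(* K[X], the subalgebra generated by X. *)
Definition alg_gen (K : comNzRingType) (A : algType K) (X : set A) : set A :=
  smallest (@is_subalg K A) X.

Lemma alg_gen_subalg (K : comNzRingType) (A : algType K) (X : set A) :
  is_subalg (alg_gen X).
Proof.
split=> [N [[]]//|c x y Nx Ny N NX|x y Nx Ny N NX]; have [[_ NP NM] _] := NX.
  by apply: NP; [exact: Nx|exact: Ny].
by apply: NM; [exact: Nx|exact: Ny].
Qed.

Section Subalgebra.
Variables (K : comNzRingType) (A : comAlgType K) (X : set A).

Definition alg_gen_pred : pred A := fun x => `[< alg_gen X x >].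

Fact alg_gen_closed : GRing.subalg_closed alg_gen_pred.
Proof.
have [N1 NP NM] := alg_gen_subalg X.
split; first exact/asboolP.
  by move=> c x y /asboolP Nx /asboolP Ny; apply/asboolP; exact: NP.
by move=> x y /asboolP Nx /asboolP Ny; apply/asboolP; exact: NM.
Qed.

HB.instance Definition _ :=
  GRing.isSubalgClosed.Build K A alg_gen_pred alg_gen_closed.

Definition subalgebra : Type := {x : A | alg_gen_pred x}.
HB.instance Definition _ := SubType.on subalgebra.
HB.instance Definition _ := Choice.on subalgebra.
HB.instance Definition _ := [SubChoice_isSubComNzRing of subalgebra by <:].
HB.instance Definition _ := [SubZmodule_isSubLmodule of subalgebra by <:].
HB.instance Definition _ := [SubNzRing_SubLmodule_isSubLalgebra of subalgebra by <:].
HB.instance Definition _ := [SubLalgebra_isSubAlgebra of subalgebra by <:].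
End Subalgebra.

Section Bernoulli.

(* B_0, ..., B_n *)
Fixpoint bernoullis (n : nat) : seq rat :=
  if n is m.+1 then
    let s := bernoullis m in
    rcons s (- (\sum_(k < m.+1) 'C(m.+2, k)%:R * s`_k) / m.+2%:R)
  else [:: 1].

Definition bernoulli (n : nat) : rat := (bernoullis n)`_n.

Lemma bernoulli_sum (m : nat) :
  (0 < m)%N -> \sum_(k < m.+1) 'C(m.+1, k)%:R * bernoulli k = 0.
Proof.
case: m => // m _.
have sz n : size (bernoullis n) = n.+1 by elim: n => //= n IH; rewrite size_rcons IH.
have stab n k : (k <= n)%N -> (bernoullis n)`_k = bernoulli k.
  elim: n => [|n IH]; first by case: k.
  rewrite leq_eqVlt => /orP[/eqP -> //|kn].
  by rewrite /= nth_rcons sz kn IH.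
rewrite big_ord_recr /= {2}/bernoulli /= nth_rcons sz ltnn eqxx.
under [X in - X]eq_bigr => k _ do rewrite stab ?leq_ord//.
rewrite binSn mulrC divfK ?pnatr_eq0//.
by rewrite subrr.
Qed.

End Bernoulli.

Local Open Scope complex_scope.

Definition uhp (R : realType) : Type := {z : R[i] | 0 < complex.Im z}.
HB.instance Definition _ (R : realType) := SubType.on (uhp R).
HB.instance Definition _ (R : realType) := Choice.on (uhp R).

Fact uhp_i_subproof (R : realType) : 0 < complex.Im ('i%C : R[i]).
Proof. exact: ltr01. Qed.
HB.instance Definition _ (R : realType) :=
  isPointed.Build (uhp R) (exist _ 'i%C (uhp_i_subproof R)).

Definition hfun (R : realType) : Type := uhp R -> R[i].

Section HFun.
Variable R : realType.
HB.instance Definition _ := GRing.ComNzRing.copy (hfun R) (uhp R -> R[i]).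
HB.instance Definition _ := GRing.Lmodule.copy (hfun R) (uhp R -> R[i]).
Fact hfun_scalerAl (c : R[i]) (f g : hfun R) : c *: (f * g) = (c *: f) * g.
Proof. by apply/funext => z; exact: mulrA. Qed.
HB.instance Definition _ := GRing.Lmodule_isLalgebra.Build R[i] (hfun R) hfun_scalerAl.
HB.instance Definition _ := GRing.Lalgebra_isComAlgebra.Build R[i] (hfun R).
End HFun.

Section ModularForms.
Variable R : realType.
Local Notation C := R[i].

Definition cexp (z : C) : C :=
  (expR (complex.Re z))%:C * (cos (complex.Im z) +i* sin (complex.Im z)).

Definition twopii : C := 0 +i* (2 * pi).

Definition nome (tau : uhp R) : C := cexp (twopii * val tau).

(* The regular algebra C^o carries the topology of C. *)
Definition csum (u : nat -> C) : C := limn (series (u : nat -> C^o)).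

(* Eisenstein series, indexed by half the weight: [Eis k] is E_{2k}. *)
Definition Eis (k : nat) : hfun R := fun tau =>
  1 - (4 * k)%:R / ratr (bernoulli (2 * k)) *
      csum (fun m => let n := m.+1 in
        n%:R ^+ (2 * k - 1) * (nome tau ^+ n / (1 - nome tau ^+ n))).

Definition E2 : hfun R := Eis 1.
Definition E4 : hfun R := Eis 2.
Definition E6 : hfun R := Eis 3.

(* M_* = C[E4, E6] and QM_* = C[E2, E4, E6]. *)
Definition modforms : set (hfun R) := alg_gen [set E4; E6].
Definition QM : Type := subalgebra [set E2; E4; E6].
HB.instance Definition _ := GRing.ComAlgebra.on QM.
HB.instance Definition _ := SubType.on QM.

(* V = C E2 + M_*. *)
Definition Vset : set (hfun R) :=
  [set f | exists (c : C) (m : hfun R), modforms m /\ f = c *: E2 + m].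

Definition Vpred : pred (hfun R) := fun f => `[< Vset f >].

Fact Vset_closed : GRing.subsemimod_closed Vpred.
Proof.
have [N1 NP _] := alg_gen_subalg [set E4; E6].
have N0 : modforms 0 by rewrite -(addNr (1 : hfun R)) -scaleN1r; apply: NP.
split; first split.
- by apply/asboolP; exists 0, 0; rewrite scale0r addr0.
- move=> f g /asboolP[c [m [Mm ->]]] /asboolP[d [n [Mn ->]]]; apply/asboolP.
  exists (c + d), (m + n); rewrite scalerDl addrACA; split => //.
  by rewrite -[m]scale1r; apply: NP.
- move=> a f /asboolP[c [m [Mm ->]]]; apply/asboolP.
  exists (a * c), (a *: m); rewrite scalerDr scalerA; split => //.
  by rewrite -[_ *: _]addr0; apply: NP.
Qed.

HB.instance Definition _ :=
  GRing.isSubmodClosed.Build C (hfun R) Vpred Vset_closed.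

Definition V : Type := {f : hfun R | Vpred f}.
HB.instance Definition _ := SubType.on V.
HB.instance Definition _ := Choice.on V.
HB.instance Definition _ := [SubChoice_isSubLmodule of V by <:].

End ModularForms.

Section IteratedIntegrals.
Variable R : realType.
Local Notation C := R[i].

Definition is_fourier (f : hfun R) (a : nat -> C) : Prop := forall tau : uhp R,
  series (fun n => a n * nome tau ^+ n : C^o) @ \oo --> (f tau : C^o).

Definition fourier (f : hfun R) : nat -> C := xget (fun=> 0) (is_fourier f).

(* f^oo, as a constant function; meaningful when f has a Fourier expansion
   converging everywhere on the upper half-plane, as is the case on QM_*. *)
Definition finf (f : hfun R) : hfun R := fun=> fourier f 0.

(* Extension by 0. The paths below stay in the upper half-plane, except for the
   end point 0 of the path from 0 to tau, which does not affect the integrals. *)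
Definition hext (f : hfun R) (z : C) : C :=
  if insub z is Some tau then f tau else 0.

Definition cintegral (a b : R) (g : R -> C) : C :=
  (\int[lebesgue_measure]_(t in `[a, b]) complex.Re (g t))%R +i*
  (\int[lebesgue_measure]_(t in `[a, b]) complex.Im (g t))%R.

(* The integral of g_1(t_1) ... g_n(t_n) over t0 <= t_1 <= ... <= t_n <= 1. *)
Fixpoint simplex_int (gs : seq (R -> C)) (t0 : R) : C :=
  if gs is g :: gs' then cintegral t0 1 (fun t => g t * simplex_int gs' t)
  else 1.

(* The coefficient of dt in the pullback of f(z) dz to the segment [a, b]. *)
Definition pullback (a b : C) (f : hfun R) : R -> C :=
  fun t => hext f (a + t%:C * (b - a)) * (b - a).

Definition iterint (a b : C) (w : seq (hfun R)) : C^o :=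
  simplex_int [seq pullback a b f | f <- w] 0.

(* The regularization R, with values in formal linear combinations of words. *)
Definition reg (w : seq (hfun R)) : {freeg (seq (hfun R)) / C} :=
  \sum_(i < (size w).+1) (-1) ^+ (size w - i) *:
    \sum_(v <- shuffle (take i w) (rev [seq finf f | f <- drop i w])) << v >>.

(* The iterated integral, extended linearly, along the vertical ray from tau. *)
Definition int_ioo (tau : uhp R) (x : {freeg (seq (hfun R)) / C}) : C :=
  lim (fglift (iterint (val tau) (val tau + 0 +i* y)) x @[y --> +oo]).

Definition Iint (w : seq (hfun R)) : hfun R := fun tau =>
  twopii R ^+ size w *
  \sum_(i < (size w).+1) (-1) ^+ (size w - i) *
    int_ioo tau (reg (take i w)) *
    iterint 0 (val tau) (rev [seq finf f | f <- drop i w]).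

(* The QM_*-span of the functions I(f_1, ..., f_n; tau) with f_i in QM_*. *)
Definition IQM : set (hfun R) :=
  [set F | exists s : seq (QM R * seq (QM R)),
    F = \sum_(p <- s) val p.1 * Iint [seq val f | f <- p.2]].

End IteratedIntegrals.

Arguments IQM R : clear implicits.

(* Main.v *)
(* Write D = q d/dq. On a vertical line tau = x + i s the functions I(f_1,...,f_n) form the
   unique solution of the triangular system D I(f,w) = - f I(w) whose members agree, up to
   exponentially small terms, with polynomials in tau without constant term. Uniqueness
   gives multilinearity, the shuffle product and integration by parts. Since
   QM_* = V + D QM_*, integration by parts shows that the words in V span I^QM over QM_*.

   For injectivity, normalizing a shortest relation between words by a top coefficient b and
   differentiating it gives a, b in QM_* with D(a/b) = f a non-zero element of V. This is
   impossible. In top weight, f has no constant Fourier coefficient, hence is a cusp form of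
   some weight k, and a/b is one of its primitives. Comparing the values of a/b at tau and
   at its image under the inversion, the extreme power of s expresses the (k-1)-st iterated
   primitive of f, up to a constant, as a quotient A/B of modular forms in C[E4,E6], where
   the weight of A is smaller than that of B. But a zero of B that is not a zero of A would
   give a pole of the (k-1)-st derivative of A/B, which is f; so B divides A and A = 0.

   The inversion law is derived from Ramanujan's differential equations, themselves obtained
   from elementary convolution identities for divisor sums: Moebius maps preserve this
   system, so that by uniqueness some inversion s |-> s0^2 / s, around a zero i s0 of E6,
   maps (E2, E4, E6) to itself. The value s0 = 1 is not needed. *)

Require Import Defs.
From HB Require Import structures.
From mathcomp Require Import all_boot all_order all_algebra.
From mathcomp Require Import complex.
From mathcomp Require Import all_classical all_reals all_analysis.
From mathcomp Require Import ring lra zify.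
From mathcomp Require mpoly.
Import -(notations) mpoly.
From mathcomp Require freeg.
Import -(notations) freeg.

Set Implicit Arguments.
Unset Strict Implicit.
Unset Printing Implicit Defensive.

Import Order.TTheory GRing.Theory Num.Theory.
Import numFieldNormedType.Exports.
Local Open Scope classical_set_scope.
Local Open Scope ring_scope.
Local Open Scope complex_scope.

(** * Complex-valued functions of a real variable *)

Section ComplexCalculus.
Variable R : realType.
Local Notation C := R[i].
Local Notation Re := complex.Re.
Local Notation Im := complex.Im.

(** No complex analysis enters. A function on the upper half-plane is studied through its
    restrictions to vertical lines, as a complex function of the real height s; there D is - (1 / 2
    pi) d/ds, and a convergent Fourier expansion takes the place of holomorphy. Expansions at the
    cusp alone cannot exclude D(a/b) = f: a cusp form f does have a primitive given by a Fourier
    series. The obstruction is the clash of two behaviours under the inversion. A quotient of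
    quasimodular forms acquires only powers of 1/s with such quotients as coefficients, whereas the
    primitive of f acquires all its iterated primitives. Since powers of s are linearly independent
    over q-series, the two expressions can be compared power by power. Algebra takes place in an
    abstract polynomial ring in x, y, z of weights 1, 2, 3, half the weights of E2, E4, E6. The
    inversion law also shows that evaluation at these three series is injective, so that identities
    between functions become identities between polynomials, where degree and divisibility arguments
    are available. *)

Definition cn (z : C) : R := `|Re z| + `|Im z|.

Lemma ReD (x y : C) : Re (x + y) = Re x + Re y. Proof. by case: x y => [a b] [c d]. Qed.
Lemma ImD (x y : C) : Im (x + y) = Im x + Im y. Proof. by case: x y => [a b] [c d]. Qed.
Lemma ReN (x : C) : Re (- x) = - Re x. Proof. by case: x. Qed.
Lemma ImN (x : C) : Im (- x) = - Im x. Proof. by case: x. Qed.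
Lemma ReM (x y : C) : Re (x * y) = Re x * Re y - Im x * Im y.
Proof. by case: x y => [a b] [c d]. Qed.
Lemma ImM (x y : C) : Im (x * y) = Re x * Im y + Im x * Re y.
Proof. by case: x y => [a b] [c d]. Qed.
Lemma complex_eta (x : C) : Re x +i* Im x = x. Proof. by case: x. Qed.
Lemma ReIm_inj (x y : C) : Re x = Re y -> Im x = Im y -> x = y.
Proof. by case: x y => [a b] [c d] /= -> ->. Qed.

Lemma cn_ge0 z : 0 <= cn z. Proof. by rewrite addr_ge0. Qed.
Lemma cn0 : cn 0 = 0. Proof. by rewrite /cn /= normr0 addr0. Qed.
Lemma cn1 : cn 1 = 1. Proof. by rewrite /cn /= normr0 addr0 normr1. Qed.
Lemma cn_eq0 z : cn z = 0 -> z = 0.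
Proof.
move=> /eqP; rewrite paddr_eq0 // !normr_eq0 => /andP[/eqP a /eqP b].
by apply: ReIm_inj; rewrite ?a ?b.
Qed.
Lemma cnN z : cn (- z) = cn z. Proof. by rewrite /cn ReN ImN !normrN. Qed.
Lemma cnD x y : cn (x + y) <= cn x + cn y.
Proof. by rewrite /cn ReD ImD addrACA lerD // ler_normD. Qed.
Lemma cnB x y : cn (x - y) <= cn x + cn y.
Proof. by rewrite -(cnN y) cnD. Qed.
Lemma cnM x y : cn (x * y) <= cn x * cn y.
Proof.
rewrite /cn ReM ImM; apply: (le_trans (lerD (ler_normB _ _) (ler_normD _ _))).
by rewrite !normrM; lra.
Qed.
Lemma cnR (x : R) : cn x%:C = `|x|. Proof. by rewrite /cn /= normr0 addr0. Qed.
Lemma cnMR (x : R) z : cn (x%:C * z) = `|x| * cn z.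
Proof. by rewrite /cn ReM ImM /= !mul0r subr0 addr0 !normrM mulrDr. Qed.
Lemma cn_sum (I : Type) (l : seq I) (P : pred I) (F : I -> C) :
  cn (\sum_(i <- l | P i) F i) <= \sum_(i <- l | P i) cn (F i).
Proof.
elim/big_rec2: _ => [|i x y _ h]; first by rewrite cn0.
by apply: (le_trans (cnD _ _)); rewrite lerD2l.
Qed.
Lemma Re_le_cn z : `|Re z| <= cn z. Proof. by rewrite lerDl. Qed.
Lemma Im_le_cn z : `|Im z| <= cn z. Proof. by rewrite lerDr. Qed.
Lemma cnX z n : cn (z ^+ n) <= cn z ^+ n.
Proof.
elim: n => [|n IH]; first by rewrite !expr0 cn1.
by rewrite !exprS (le_trans (cnM _ _))// ler_wpM2l // cn_ge0.
Qed.

(** The norm of [R[i]] takes its values in [R[i]]. The equivalent norm [cn] is real-valued and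
    submultiplicative, so that later estimates stay in [R]; this bound and the next one transfer
    convergence. *)
Lemma norm_le_cn (z : C) : `|z| <= (cn z)%:C.
Proof.
have -> : z = (Re z)%:C + (Im z) *i%C.
  by apply: ReIm_inj; rewrite ?ReD ?ImD /= ?addr0 ?add0r.
apply: le_trans (ler_normD _ _) _.
rewrite !normc_def /= !expr0n /= addr0 add0r !sqrtr_sqr -rmorphD lecR.
by rewrite /cn /= addr0 add0r.
Qed.
Lemma cn_le_norm (z : C) (e : R) : `|z| < e%:C -> `|Re z| < e /\ `|Im z| < e.
Proof.
rewrite normc_def ltcR => h; split; apply: le_lt_trans h; rewrite -sqrtr_sqr ler_sqrt ?addr_ge0 ?sqr_ge0//.
  by rewrite lerDl sqr_ge0.
by rewrite lerDr sqr_ge0.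
Qed.

Lemma cvg_complexP (T : Type) (F : set_system T) {FF : Filter F} (f : T -> C) (l : C) :
  ((f : T -> C^o) @ F --> (l : C^o)) <->
  ((fun t => Re (f t)) @ F --> Re l /\ (fun t => Im (f t)) @ F --> Im l).
Proof.
split=> [h|[h1 h2]].
  have H e : 0 < e -> \forall t \near F, `|Re (l - f t)| < e /\ `|Im (l - f t)| < e.
    move=> e0; have e0' : (0 : C) < e%:C by rewrite ltcR.
    by move/cvgrPdist_lt: h => /(_ _ e0'); apply: filterS => t; exact: cn_le_norm.
  split; apply/cvgrPdist_lt => e /H; apply: filterS => t; rewrite ?ReD ?ImD ?ReN ?ImN; by case.
apply/cvgrPdist_lt => e e0.
have [r re r0] : exists2 r : R, e = r%:C & 0 < r.
  exists (Re e); last by case: e e0 => a b; rewrite ltcE /= => /andP[].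
  by case: e e0 => a b; rewrite ltcE /= => /andP[/eqP -> _].
have r20 : 0 < r / 2 by rewrite divr_gt0.
move/cvgrPdist_lt: h1 => /(_ _ r20) h1; move/cvgrPdist_lt: h2 => /(_ _ r20) h2.
near=> t; rewrite re (le_lt_trans (norm_le_cn _)) // ltcR /cn ReD ImD ReN ImN.
rewrite [r]splitr ltrD//.
  by near: t.
by near: t.
Unshelve. all: by end_near. Qed.

Lemma cvg_complex_lim (T : Type) (F : set_system T) {FF : ProperFilter F} (f : T -> C) (l : C) :
  ((f : T -> C^o) @ F --> (l : C^o)) -> lim ((f : T -> C^o) @ F) = (l : C^o).
Proof. by move=> h; apply/cvg_lim => //; exact: norm_hausdorff. Qed.

Definition cder (f : R -> C) (s : R) (l : C) : Prop :=
  is_derive s 1 (fun t => Re (f t)) (Re l) /\ is_derive s 1 (fun t => Im (f t)) (Im l).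

Lemma cder_eq f s l l' : cder f s l -> l = l' -> cder f s l'.
Proof. by move=> h <-. Qed.

Lemma cder_cst c s : cder (fun=> c) s 0.
Proof. by split; exact: is_derive_cst. Qed.

Lemma cder_real (g : R -> R) (s l : R) : is_derive s 1 g l -> cder (fun t => (g t)%:C) s l%:C.
Proof. by split => //; exact: is_derive_cst. Qed.

Lemma cderD f g s l m : cder f s l -> cder g s m -> cder (fun t => f t + g t) s (l + m).
Proof.
move=> [f1 f2] [g1 g2]; split; rewrite ?ReD ?ImD.
  by under eq_fun do rewrite ReD; exact: is_deriveD.
by under eq_fun do rewrite ImD; exact: is_deriveD.
Qed.

Lemma cderN f s l : cder f s l -> cder (fun t => - f t) s (- l).
Proof.
move=> [f1 f2]; split; rewrite ?ReN ?ImN.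
  by under eq_fun do rewrite ReN; exact: is_deriveN.
by under eq_fun do rewrite ImN; exact: is_deriveN.
Qed.

Lemma cderB f g s l m : cder f s l -> cder g s m -> cder (fun t => f t - g t) s (l - m).
Proof. by move=> f1 g1; apply: cderD => //; exact: cderN. Qed.

Lemma cderM f g s l m : cder f s l -> cder g s m ->
  cder (fun t => f t * g t) s (l * g s + f s * m).
Proof.
move=> [f1 f2] [g1 g2]; split.
  under eq_fun do rewrite ReM.
  have h1 := is_deriveM f1 g1; have h2 := is_deriveM f2 g2.
  have h := is_deriveB h1 h2; apply: (is_derive_eq h).
  by rewrite ReD !ReM /GRing.scale /=; ring.
under eq_fun do rewrite ImM.
have h1 := is_deriveM f1 g2; have h2 := is_deriveM f2 g1.
have h := is_deriveD h1 h2; apply: (is_derive_eq h).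
by rewrite ImD !ImM /GRing.scale /=; ring.
Qed.

Lemma cderZ c f s l : cder f s l -> cder (fun t => c * f t) s (c * l).
Proof. by move=> h; apply: cder_eq (cderM (cder_cst c s) h) _; rewrite mul0r add0r. Qed.

Lemma cder_sum (I : Type) (r : seq I) (F : I -> R -> C) (L : I -> C) s :
  (forall i, cder (F i) s (L i)) ->
  cder (fun t => \sum_(i <- r) F i t) s (\sum_(i <- r) L i).
Proof.
move=> h; elim: r => [|i r IH].
  by rewrite big_nil; under eq_fun do rewrite big_nil; exact: cder_cst.
by rewrite big_cons; under eq_fun do rewrite big_cons; apply: cderD.
Qed.

Lemma cder_near f g s l : (\forall t \near s, f t = g t) -> cder f s l -> cder g s l.
Proof.
move=> fg [h1 h2]; split.
  by apply: near_eq_is_derive h1; apply: filterS fg => t ->.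
by apply: near_eq_is_derive h2; apply: filterS fg => t ->.
Qed.

Lemma cder_gt a f g s l : a < s -> (forall t, a < t -> f t = g t) -> cder f s l -> cder g s l.
Proof.
move=> as_ fg; apply: cder_near; near=> t; apply: fg; near: t.
exact: lt_nbhsr.
Unshelve. all: by end_near. Qed.

Lemma cder_comp (f : R -> C) (g : R -> R) (s : R) l (m : R) : cder f (g s) l -> is_derive s 1 g m ->
  cder (fun t => f (g t)) s (m%:C * l).
Proof.
move=> [f1 f2] hg; split; rewrite ?ReM ?ImM /= ?mul0r ?subr0 ?addr0.
  have := is_derive1_comp f1 hg; rewrite mulrC; exact: id.
have := is_derive1_comp f2 hg; rewrite mulrC; exact: id.
Qed.

Lemma is_derive_continuous (f : R -> R) (s l : R) : is_derive s 1 f l -> {for s, continuous f}.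
Proof.
move=> h; have : derivable f s 1 by exact: (@ex_derive _ _ _ _ _ _ _ h).
by move/derivable1_diffP/differentiable_continuous.
Qed.

Lemma is_derive_within (f df : R -> R) (a b : R) :
  (forall s, a <= s <= b -> is_derive s 1 f (df s)) -> {within `[a, b], continuous f}.
Proof.
move=> h; apply: continuous_in_subspaceT => s; rewrite inE /= in_itv /= => sab.
exact: is_derive_continuous (h _ sab).
Qed.

Lemma mean_value_le (f df : R -> R) (a b K : R) : a <= b ->
  (forall s, a <= s <= b -> is_derive s 1 f (df s)) ->
  (forall s, a <= s <= b -> `|df s| <= K) -> `|f b - f a| <= K * (b - a).
Proof.
move=> ab h hK.
have h' s : s \in `]a, b[ -> is_derive s 1 f (df s).
  by rewrite in_itv /= => /andP[s1 s2]; apply: h; rewrite !ltW.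
have [c cab ->] := MVT_segment ab h' (is_derive_within h).
rewrite normrM [`|b - a|]ger0_norm ?subr_ge0// ler_wpM2r ?subr_ge0//.
by apply: hK; rewrite in_itv in cab.
Qed.

(** The mean value theorem is applied to the real and to the imaginary part, whence the factor 2. *)
Lemma cmean_value_le (f df : R -> C) a b K : a <= b ->
  (forall s, a <= s <= b -> cder f s (df s)) ->
  (forall s, a <= s <= b -> cn (df s) <= K) -> cn (f b - f a) <= 2 * K * (b - a).
Proof.
move=> ab h hK; rewrite /cn ReD ImD ReN ImN.
have h1 := @mean_value_le (fun t => Re (f t)) (fun t => Re (df t)) a b K ab
  (fun s hs => (h s hs).1) (fun s hs => le_trans (Re_le_cn _) (hK s hs)).
have h2 := @mean_value_le (fun t => Im (f t)) (fun t => Im (df t)) a b K ab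
  (fun s hs => (h s hs).2) (fun s hs => le_trans (Im_le_cn _) (hK s hs)).
lra.
Qed.

Lemma cder0_eq (f : R -> C) a b : a <= b ->
  (forall s, a <= s <= b -> cder f s 0) -> f a = f b.
Proof.
move=> ab h; have := @cmean_value_le f (fun=> 0) a b 0 ab h _.
rewrite mulr0 mul0r => /(_ _) H; apply/esym/eqP; rewrite -subr_eq0; apply/eqP/cn_eq0/eqP.
by rewrite eq_le cn_ge0 andbT; apply: H => s _; rewrite cn0.
Qed.

Lemma cder_uniq f s l l' : cder f s l -> cder f s l' -> l = l'.
Proof.
move=> [h1 h2] [h3 h4]; apply: ReIm_inj.
  by rewrite -(@derive_val _ _ _ _ _ _ _ h1) (@derive_val _ _ _ _ _ _ _ h3).
by rewrite -(@derive_val _ _ _ _ _ _ _ h2) (@derive_val _ _ _ _ _ _ _ h4).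
Qed.

Definition ccont (f : R -> C) (s : R) :=
  {for s, continuous (fun t => Re (f t))} /\ {for s, continuous (fun t => Im (f t))}.

Lemma cder_cont f s l : cder f s l -> ccont f s.
Proof. by move=> [h1 h2]; split; exact: is_derive_continuous. Qed.

Lemma ccontM f g s : ccont f s -> ccont g s -> ccont (fun t => f t * g t) s.
Proof.
move=> [f1 f2] [g1 g2]; split.
  rewrite (_ : (fun t => _) = (fun t => Re (f t) * Re (g t) - Im (f t) * Im (g t))); last first.
    by apply/funext => t; rewrite ReM.
  by apply: continuousB; apply: continuousM.
rewrite (_ : (fun t => _) = (fun t => Re (f t) * Im (g t) + Im (f t) * Re (g t))); last first.
  by apply/funext => t; rewrite ImM.
by apply: continuousD; apply: continuousM.
Qed.

End ComplexCalculus.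

(** * Power series and Fourier expansions *)

Section PowerSeries.
Variable R : realType.
Local Notation C := R[i].
Local Notation Re := complex.Re.
Local Notation Im := complex.Im.
Implicit Types (a b u v : nat -> C) (r t : R).

Definition ccvg (u : nat -> C) (l : C) : Prop :=
  (fun n => Re (u n)) @ \oo --> Re l /\ (fun n => Im (u n)) @ \oo --> Im l.

Lemma ccvg_uniq u l m : ccvg u l -> ccvg u m -> l = m.
Proof. by move=> [u1 u2] [v1 v2]; apply: ReIm_inj; [exact: cvg_unique u1 v1|exact: cvg_unique u2 v2]. Qed.

Lemma ccvg_squeeze u l (e : nat -> R) :
  (forall n, cn (u n - l) <= e n) -> e @ \oo --> (0 : R) -> ccvg u l.
Proof.
move=> ule e0; split; apply/cvgrPdist_lt => x x0;
  move/cvgrPdist_lt: e0 => /(_ _ x0); apply: filterS => n; rewrite sub0r normrN => h;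
  rewrite distrC (le_lt_trans _ h)//; apply: (le_trans _ (ler_norm _)); apply: (le_trans _ (ule n)).
  by have := Re_le_cn (u n - l); rewrite ReD ReN.
by have := Im_le_cn (u n - l); rewrite ImD ImN.
Qed.

Lemma ccvg_eq u v l : u =1 v -> ccvg u l -> ccvg v l.
Proof. by move=> /funext ->. Qed.

Lemma ccvg_cst l : ccvg (fun=> l) l.
Proof. by split; exact: cvg_cst. Qed.

Lemma ccvgD u v l m : ccvg u l -> ccvg v m -> ccvg (fun n => u n + v n) (l + m).
Proof.
move=> [u1 u2] [v1 v2]; split; rewrite ?ReD ?ImD.
  by under eq_fun do rewrite ReD; exact: cvgD.
by under eq_fun do rewrite ImD; exact: cvgD.
Qed.

Lemma ccvgM u v l m : ccvg u l -> ccvg v m -> ccvg (fun n => u n * v n) (l * m).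
Proof.
move=> [u1 u2] [v1 v2]; split; rewrite ?ReM ?ImM.
  by under eq_fun do rewrite ReM; apply: cvgB; exact: cvgM.
by under eq_fun do rewrite ImM; apply: cvgD; exact: cvgM.
Qed.

Lemma ccvgZ c u l : ccvg u l -> ccvg (fun n => c * u n) (c * l).
Proof. by apply: ccvgM; exact: ccvg_cst. Qed.

Lemma ccvg_S u l : ccvg (fun n => u n.+1) l <-> ccvg u l.
Proof.
split=> [[h1 h2]|[h1 h2]]; split.
- by rewrite -(cvg_shiftS (fun n => Re (u n))).
- by rewrite -(cvg_shiftS (fun n => Im (u n))).
- by rewrite (cvg_shiftS (fun n => Re (u n))).
- by rewrite (cvg_shiftS (fun n => Im (u n))).
Qed.

Lemma ccvg_cn_le u l K : (forall n, cn (u n) <= K) -> ccvg u l -> cn l <= 2 * K.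
Proof.
move=> uK [h1 h2].
have H (w : nat -> R) m : (forall n, `|w n| <= K) -> w @ \oo --> m -> `|m| <= K.
  move=> wK wm; have h : (fun n => `|w n|) @ \oo --> (`|m| : R) by exact: cvg_norm.
  rewrite -(cvg_lim (@Rhausdorff R) h); apply: limr_le; last exact: nearW.
  by apply/cvg_ex; exists (`|m|).
rewrite /cn mulr_natl mulr2n lerD//.
  by apply: H h1 => n; exact: le_trans (Re_le_cn _) (uK n).
by apply: H h2 => n; exact: le_trans (Im_le_cn _) (uK n).
Qed.

Lemma geometric_sum_le1 t n : 0 <= t -> (1 - t) * \sum_(k < n) t ^+ k <= 1.
Proof. by move=> t0; rewrite -opprB mulNr -subrX1 opprB gerBl exprn_ge0. Qed.

Lemma cvg0_scale (c : R) (u : nat -> R) : u @ \oo --> (0 : R) -> (fun n => c * u n) @ \oo --> (0 : R).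
Proof.
move=> u0; suff : (fun n => c * u n) @ \oo --> c * 0 by rewrite mulr0.
by apply: cvgM => //; exact: cvg_cst.
Qed.

(** Each of the n + 1 terms t^k with k <= n is at least t^n, and their sum is at most 1 / (1 - t).
    This absorbs the factors n + 1 below. *)
Lemma natS_expr_le t n : 0 <= t < 1 -> n.+1%:R * t ^+ n <= (1 - t)^-1.
Proof.
move=> /andP[t0 t1]; have t1' : 0 < 1 - t by rewrite subr_gt0.
rewrite -[leRHS]mul1r ler_pdivlMr// mulrC.
apply: (@le_trans _ _ ((1 - t) * \sum_(k < n.+1) t ^+ k)).
  rewrite ler_pM2l// mulr_natl -[n.+1 in leLHS]card_ord -sumr_const ler_sum// => i _.
  by apply: ler_wiXn2l => //; [rewrite ltW|exact: leq_ord].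
exact: geometric_sum_le1.
Qed.

(** The radius of convergence is at least 1. In this form, with bounded terms, the condition passes
    to products and to multiplication by n at the cost of a slightly larger t. *)
Definition subexp (a : nat -> C) : Prop :=
  forall t, 0 < t < 1 -> exists K, forall n, cn (a n) * t ^+ n <= K.

Lemma subexp_le a b (M : R) : 0 <= M -> (forall n, cn (a n) <= M * cn (b n)) ->
  subexp b -> subexp a.
Proof.
move=> M0 ab sb t t01; have [K HK] := sb t t01; exists (M * K) => n.
have t0 : 0 <= t ^+ n by rewrite exprn_ge0//; case/andP: t01 => /ltW.
by apply: (le_trans (ler_wpM2r t0 (ab n))); rewrite -mulrA ler_wpM2l.
Qed.

Lemma subexp0 : subexp (fun=> 0).
Proof. by move=> t _; exists 0 => n; rewrite cn0 mul0r. Qed.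

Lemma subexp_cst c : subexp (fun=> c).
Proof.
move=> t /andP[t0 t1]; exists (cn c) => n.
by rewrite ler_piMr ?cn_ge0// exprn_ile1// ltW.
Qed.

Lemma subexpD a b : subexp a -> subexp b -> subexp (fun n => a n + b n).
Proof.
move=> sa sb t t01; have [K HK] := sa t t01; have [L HL] := sb t t01.
exists (K + L) => n; apply: (le_trans _ (lerD (HK n) (HL n))).
have t0 : 0 <= t ^+ n by rewrite exprn_ge0//; case/andP: t01 => /ltW.
by rewrite -mulrDl ler_wpM2r// cnD.
Qed.

Lemma subexpZ c a : subexp a -> subexp (fun n => c * a n).
Proof. by apply: (@subexp_le _ _ (cn c)) => [|n]; [exact: cn_ge0|exact: cnM]. Qed.

Lemma subexp_S a : subexp a -> subexp (fun n => a n.+1).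
Proof.
move=> sa t t01; have [K HK] := sa t t01; exists (K / t) => n.
have t0 : 0 < t by case/andP: t01.
by rewrite ler_pdivlMr// -mulrA -exprSr.
Qed.

Lemma mid_lt1 t : 0 < t < 1 -> exists t', [/\ 0 < t' < 1, t < t', 0 < t / t' & t / t' < 1].
Proof.
move=> /andP[t0 t1]; exists ((t + 1) / 2).
have h : 0 < (t + 1) / 2 by lra.
by split; [lra|lra|rewrite divr_gt0|rewrite ltr_pdivrMr//; lra].
Qed.

Lemma subexp_natS a : subexp a -> subexp (fun n => n.+1%:R * a n).
Proof.
move=> sa t t01; have [t' [t'01 tt' q0 q1]] := mid_lt1 t01.
have [K HK] := sa t' t'01; exists ((1 - t / t')^-1 * K) => n.
have t'0 : 0 < t' by case/andP: t'01.
have -> : n.+1%:R = (n.+1%:R : R)%:C by rewrite rmorph_nat.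
rewrite cnMR normr_nat.
have -> : t ^+ n = (t / t') ^+ n * t' ^+ n by rewrite -exprMn divfK// gt_eqF.
have -> : n.+1%:R * cn (a n) * ((t / t') ^+ n * t' ^+ n) =
  (n.+1%:R * (t / t') ^+ n) * (cn (a n) * t' ^+ n) by ring.
rewrite ler_pM ?mulr_ge0 ?exprn_ge0 ?cn_ge0 ?ler0n ?(ltW t'0) ?(ltW q0)//.
by apply: natS_expr_le; rewrite (ltW q0).
Qed.

Lemma subexp_nat a : subexp a -> subexp (fun n => n%:R * a n).
Proof.
move=> sa; apply: (@subexp_le _ (fun n => n.+1%:R * a n) 1) => [//|n|]; last exact: subexp_natS.
have natE m : m%:R = (m%:R : R)%:C by rewrite rmorph_nat.
by rewrite mul1r !natE !cnMR !normr_nat ler_wpM2r ?cn_ge0// ler_nat.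
Qed.

Definition conv a b : nat -> C := fun n => \sum_(k < n.+1) a k * b (n - k)%N.

Lemma conv_bound a b t K L n :
  0 < t -> (forall n, cn (a n) * t ^+ n <= K) -> (forall n, cn (b n) * t ^+ n <= L) ->
  cn (conv a b n) * t ^+ n <= n.+1%:R * (K * L).
Proof.
move=> t0 HK HL; apply: (@le_trans _ _ (\sum_(k < n.+1) K * L)); last first.
  by rewrite sumr_const card_ord mulr_natl.
apply: (le_trans (ler_wpM2r _ (cn_sum _ _ _))); first by rewrite exprn_ge0// ltW.
rewrite mulr_suml ler_sum// => k _.
apply: (@le_trans _ _ ((cn (a k) * t ^+ k) * (cn (b (n - k)%N) * t ^+ (n - k)))).
  rewrite mulrACA -exprD subnKC ?leq_ord// ler_wpM2r ?cnM// exprn_ge0// ltW//.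
by rewrite ler_pM ?mulr_ge0 ?cn_ge0 ?exprn_ge0 ?(ltW t0).
Qed.

Lemma subexp_conv a b : subexp a -> subexp b -> subexp (conv a b).
Proof.
move=> sa sb t t01; have [t' [t'01 tt' q0 q1]] := mid_lt1 t01.
have [K HK] := sa t' t'01; have [L HL] := sb t' t'01; exists ((1 - t / t')^-1 * (K * L)) => n.
have t'0 : 0 < t' by case/andP: t'01.
have K0 : 0 <= K by apply: le_trans (HK 0%N); rewrite mulr_ge0 ?cn_ge0 ?exprn_ge0// ltW.
have L0 : 0 <= L by apply: le_trans (HL 0%N); rewrite mulr_ge0 ?cn_ge0 ?exprn_ge0// ltW.
have -> : t ^+ n = t' ^+ n * (t / t') ^+ n by rewrite -exprMn mulrC divfK// gt_eqF.
rewrite mulrA; apply: (@le_trans _ _ ((n.+1%:R * (K * L)) * (t / t') ^+ n)).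
  by apply: ler_wpM2r; [rewrite exprn_ge0// ltW|exact: conv_bound].
rewrite mulrAC ler_wpM2r ?mulr_ge0//.
by apply: natS_expr_le; rewrite ltW.
Qed.

Definition ps a r : C :=
  limn (pseries (fun n => Re (a n)) r) +i* limn (pseries (fun n => Im (a n)) r).

Lemma cvg_pseries_subexp (u : nat -> R) r :
  (forall t, 0 < t < 1 -> exists K, forall n, `|u n| * t ^+ n <= K) ->
  `|r| < 1 -> cvgn (pseries u r).
Proof.
move=> su r1.
have [t [/andP[t0 t1] rt]] : exists t, 0 < t < 1 /\ `|r| < t.
  exists ((`|r| + 1) / 2); have := normr_ge0 r; split; lra.
have [K HK] := su t (introT andP (conj t0 t1)).
have q1 : `|r| / t < 1 by rewrite ltr_pdivrMr// mul1r.
have q0 : 0 <= `|r| / t by rewrite divr_ge0// ltW.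
apply: normed_cvg.
apply: (@series_le_cvg _ _ (geometric K (`|r| / t))) => [n|n|n|].
- exact: normr_ge0.
- by rewrite /= mulr_ge0 ?exprn_ge0// (le_trans _ (HK 0%N))// mulr_ge0 ?exprn_ge0// ltW.
- rewrite /= normrM normrX exprMn exprVn mulrA mulrAC.
  have {1}-> : `|u n| = (`|u n| * t ^+ n) / t ^+ n by rewrite mulfK// expf_neq0// gt_eqF.
  by rewrite mulrAC [X in _ <= X]mulrAC; do 2! [apply: ler_wpM2r; first by rewrite ?invr_ge0 exprn_ge0// ltW].
- by apply: is_cvg_geometric_series; rewrite ger0_norm.
Qed.

Lemma subexp_Re a : subexp a -> forall t, 0 < t < 1 -> exists K, forall n, `|Re (a n)| * t ^+ n <= K.
Proof.
move=> sa t t01; have [K HK] := sa t t01; exists K => n; apply: le_trans (HK n).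
by rewrite ler_wpM2r ?Re_le_cn// exprn_ge0//; case/andP: t01 => /ltW.
Qed.

Lemma subexp_Im a : subexp a -> forall t, 0 < t < 1 -> exists K, forall n, `|Im (a n)| * t ^+ n <= K.
Proof.
move=> sa t t01; have [K HK] := sa t t01; exists K => n; apply: le_trans (HK n).
by rewrite ler_wpM2r ?Im_le_cn// exprn_ge0//; case/andP: t01 => /ltW.
Qed.

Definition psum a (r : R) N : C := \sum_(n < N) a n * (r%:C) ^+ n.

Lemma Re_mulr (z : C) (x : R) : Re (z * x%:C) = Re z * x.
Proof. by rewrite ReM /= mulr0 subr0. Qed.
Lemma Im_mulr (z : C) (x : R) : Im (z * x%:C) = Im z * x.
Proof. by rewrite ImM /= mulr0 add0r. Qed.
Lemma Re_sum (I : Type) (l : seq I) (F : I -> C) : Re (\sum_(i <- l) F i) = \sum_(i <- l) Re (F i).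
Proof. by elim: l => [|i l IH]; rewrite ?big_nil// !big_cons ReD IH. Qed.
Lemma Im_sum (I : Type) (l : seq I) (F : I -> C) : Im (\sum_(i <- l) F i) = \sum_(i <- l) Im (F i).
Proof. by elim: l => [|i l IH]; rewrite ?big_nil// !big_cons ImD IH. Qed.

Lemma psum_pseries a r :
  (fun N => Re (psum a r N)) = pseries (fun n => Re (a n)) r /\
  (fun N => Im (psum a r N)) = pseries (fun n => Im (a n)) r.
Proof.
by split; apply/funext => N; rewrite /psum /pseries /series /= big_mkord ?Re_sum ?Im_sum;
  apply: eq_bigr => i _; rewrite -rmorphXn ?Re_mulr ?Im_mulr.
Qed.

Lemma ps_ccvg a r : subexp a -> `|r| < 1 -> ccvg (psum a r) (ps a r).
Proof.
move=> sa r1; have [E1 E2] := psum_pseries a r; split; rewrite ?E1 ?E2 /=.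
  exact: cvg_pseries_subexp (subexp_Re sa) r1.
exact: cvg_pseries_subexp (subexp_Im sa) r1.
Qed.

Lemma psE a r l : subexp a -> `|r| < 1 -> ccvg (psum a r) l -> ps a r = l.
Proof. by move=> sa r1; apply: ccvg_uniq; exact: ps_ccvg. Qed.

Lemma eq_ps a b r : a =1 b -> ps a r = ps b r.
Proof. by move=> /funext ->. Qed.

Lemma psD a b r : subexp a -> subexp b -> `|r| < 1 ->
  ps (fun n => a n + b n) r = ps a r + ps b r.
Proof.
move=> sa sb r1; apply: psE => //; first exact: subexpD.
apply: ccvg_eq (ccvgD (ps_ccvg sa r1) (ps_ccvg sb r1)) => N.
by rewrite /psum -big_split; apply: eq_bigr => i _; rewrite mulrDl.
Qed.

Lemma psZ c a r : subexp a -> `|r| < 1 -> ps (fun n => c * a n) r = c * ps a r.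
Proof.
move=> sa r1; apply: psE => //; first exact: subexpZ.
apply: ccvg_eq (ccvgZ c (ps_ccvg sa r1)) => N.
by rewrite /psum mulr_sumr; apply: eq_bigr => i _; rewrite mulrA.
Qed.

Lemma ps_S a r : subexp a -> `|r| < 1 -> ps a r = a 0%N + r%:C * ps (fun n => a n.+1) r.
Proof.
move=> sa r1; apply: psE => //.
apply/ccvg_S; apply: ccvg_eq (ccvgD (ccvg_cst _) (ccvgZ r%:C (ps_ccvg (subexp_S sa) r1))) => N.
rewrite /psum big_ord_recl expr0 mulr1; congr (_ + _).
by rewrite mulr_sumr; apply: eq_bigr => i _; rewrite mulrCA -exprS.
Qed.

Lemma ps_bounded a t : subexp a -> 0 <= t < 1 ->
  exists2 K, 0 <= K & forall r, 0 <= r <= t -> cn (ps a r) <= K.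
Proof.
move=> sa /andP[t0 t1].
have [t' [t'0 t'1 tt']] : exists t', [/\ 0 < t', t' < 1 & t < t'].
  by exists ((t + 1) / 2); split; lra.
have [K HK] := sa t' (introT andP (conj t'0 t'1)).
have K0 : 0 <= K by apply: le_trans (HK 0%N); rewrite mulr_ge0 ?cn_ge0 ?exprn_ge0// ltW.
have q1 : 0 < 1 - t / t' by rewrite subr_gt0 ltr_pdivrMr// mul1r.
exists (2 * (K * (1 - t / t')^-1)) => [|r /andP[r0 rt]].
  by rewrite !mulr_ge0 ?invr_ge0 ?(ltW q1).
have r1 : `|r| < 1 by rewrite ger0_norm// (le_lt_trans rt).
apply: ccvg_cn_le (ps_ccvg sa r1) => N.
apply: (le_trans (cn_sum _ _ _)).
apply: (@le_trans _ _ (\sum_(n < N) K * (t / t') ^+ n)).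
  apply: ler_sum => n _; rewrite -rmorphXn mulrC cnMR ger0_norm ?exprn_ge0//.
  have -> : r ^+ n = t' ^+ n * (r / t') ^+ n by rewrite -exprMn mulrC divfK// gt_eqF.
  rewrite mulrC mulrA ler_pM ?mulr_ge0 ?cn_ge0 ?exprn_ge0 ?divr_ge0 ?(ltW t'0)//.
  by rewrite lerXn2r ?nnegrE ?divr_ge0 ?(ltW t'0)// ler_pM2r ?invr_gt0.
rewrite -mulr_sumr ler_wpM2l// -[leRHS]mul1r ler_pdivlMr// mulrC.
by apply: geometric_sum_le1; rewrite divr_ge0// ltW.
Qed.

Lemma cvg_natS_geometric (t : R) : 0 <= t < 1 -> (fun n => n.+1%:R * t ^+ n) @ \oo --> (0 : R).
Proof.
move=> t01.
have [t' [t'0 t'1 tt']] : exists t', [/\ 0 < t', t' < 1 & t < t'].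
  by exists ((t + 1) / 2); split; lra.
have t0 : 0 <= t by case/andP: t01.
have q1 : 0 < 1 - t / t' by rewrite subr_gt0 ltr_pdivrMr// mul1r.
have q0 : 0 <= t / t' by rewrite divr_ge0// ltW.
apply: (@squeeze_cvgr _ _ _ _ (fun=> 0) (fun n => (1 - t / t')^-1 * t' ^+ n)).
- apply: nearW => n; rewrite mulr_ge0 ?exprn_ge0//=.
  have -> : t ^+ n = (t / t') ^+ n * t' ^+ n by rewrite -exprMn divfK// gt_eqF.
  rewrite mulrA ler_wpM2r ?exprn_ge0 ?(ltW t'0)//; apply: natS_expr_le.
  by rewrite q0 -subr_gt0.
- exact: cvg_cst.
- have h : (fun n => t' ^+ n) @ \oo --> (0 : R) by apply: cvg_expr; rewrite ger0_norm// ltW.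
  exact: cvg0_scale.
Qed.

Lemma psum_horner a r N : psum a r N = (\poly_(i < N) a i).[r%:C].
Proof. by rewrite horner_poly. Qed.

Lemma psM a b r : subexp a -> subexp b -> 0 <= r < 1 -> ps (conv a b) r = ps a r * ps b r.
Proof.
move=> sa sb /andP[r0 r1]; have r1' : `|r| < 1 by rewrite ger0_norm.
apply: psE => //; first exact: subexp_conv.
have [t' [t'0 t'1 tt']] : exists t', [/\ 0 < t', t' < 1 & r < t'].
  by exists ((r + 1) / 2); split; lra.
(* In r / t' = (r / t) (t / t') the first factor will absorb n + 1 in the tail and the second will
   give the decay in N. *)
have [t [t0 t1 rt]] : exists t, [/\ 0 < t, t < t' & r < t].
  by exists ((r + t') / 2); split; lra.
have t'01 : 0 < t' < 1 by rewrite t'0.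
have [K HK] := sa t' t'01; have [L HL] := sb t' t'01.
have K0 : 0 <= K by apply: le_trans (HK 0%N); rewrite mulr_ge0 ?cn_ge0 ?exprn_ge0// ltW.
have L0 : 0 <= L by apply: le_trans (HL 0%N); rewrite mulr_ge0 ?cn_ge0 ?exprn_ge0// ltW.
have q0 : 0 <= r / t' by rewrite divr_ge0// ltW.
have rt0 : 0 < 1 - r / t by rewrite subr_gt0 ltr_pdivrMr// mul1r.
have tt0 : 0 < 1 - t / t' by rewrite subr_gt0 ltr_pdivrMr// mul1r.
(* the difference of the partial sums is the part of degree >= N of a product
   of two polynomials *)
have key N : cn (psum (conv a b) r N - psum a r N * psum b r N) <=
    (K * L) * \sum_(N <= n < N + N) n.+1%:R * (r / t') ^+ n.
  rewrite !psum_horner -hornerM -opprB cnN.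
  set p := \poly_(i < N) a i; set q := \poly_(i < N) b i.
  have sz : (size (p * q)%R <= N + N)%N.
    by apply: (leq_trans (size_polyMleq _ _)); rewrite (leq_trans (leq_pred _))// leq_add// size_poly.
  rewrite (horner_coef_wide _ sz) horner_poly.
  rewrite -(big_mkord xpredT (fun i => (p * q)`_i * r%:C ^+ i)).
  rewrite -(big_mkord xpredT (fun i => conv a b i * r%:C ^+ i)).
  rewrite (big_cat_nat (leq0n N) (leq_addr _ _))/=.
  have cM n : (n < N)%N -> (p * q)`_n = conv a b n.
    move=> nN; rewrite coefM; apply: eq_bigr => k _; rewrite !coef_poly.
    by rewrite (leq_ltn_trans (leq_ord k) nN) (leq_ltn_trans (leq_subr _ _) nN).
  rewrite (_ : \sum_(0 <= i < N) (p * q)`_i * r%:C ^+ i =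
      \sum_(0 <= i < N) conv a b i * r%:C ^+ i); last first.
    by apply: eq_big_nat => i /andP[_ iN]; rewrite cM.
  rewrite addrAC subrr add0r; apply: (le_trans (cn_sum _ _ _)); rewrite mulr_sumr.
  apply: ler_sum => n _; rewrite -rmorphXn mulrC cnMR ger0_norm ?exprn_ge0//.
  pose a' i := p`_i; pose b' i := q`_i.
  have -> : (p * q)`_n = conv a' b' n by rewrite coefM.
  have -> : r ^+ n = (r / t') ^+ n * t' ^+ n by rewrite -exprMn divfK// gt_eqF.
  have E : cn (conv a' b' n) * t' ^+ n <= n.+1%:R * (K * L).
    apply: conv_bound => // i; rewrite /a' /b' coef_poly; case: ifP => // _.
      by rewrite cn0 mul0r.
    by rewrite cn0 mul0r.
  have := ler_wpM2r (exprn_ge0 n q0) E.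
  by congr (_ <= _); ring.
have e0 : (fun N => (K * L) * \sum_(N <= n < N + N) n.+1%:R * (r / t') ^+ n) @ \oo --> (0 : R).
  have tt'1 : t / t' < 1 by rewrite ltr_pdivrMr// mul1r.
  have tt'0 : 0 <= t / t' by rewrite divr_ge0// ltW.
  apply: (@squeeze_cvgr _ _ _ _ (fun=> 0) (fun N => (K * L) * ((1 - r / t)^-1 * (N.+1%:R * (t / t') ^+ N)))).
  - apply: nearW => N; apply/andP; split.
      rewrite !mulr_ge0// sumr_ge0// => n _; rewrite mulr_ge0// exprn_ge0//.
    rewrite !ler_wpM2l ?mulr_ge0//.
    apply: (@le_trans _ _ (\sum_(N <= n < N + N) (1 - r / t)^-1 * (t / t') ^+ N)).
      apply: ler_sum_nat => n /andP[Nn _].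
      have -> : r / t' = (r / t) * (t / t') by rewrite mulrA divfK// gt_eqF.
      have rt'0 : 0 <= r / t by rewrite divr_ge0// ltW.
      rewrite exprMn mulrA; apply: ler_pM.
      - by rewrite mulr_ge0 ?exprn_ge0.
      - by rewrite exprn_ge0.
      - by apply: natS_expr_le; rewrite rt'0 -subr_gt0.
      - by apply: ler_wiXn2l => //; exact: ltW.
    rewrite sumr_const_nat addKn -mulrnAr ler_wpM2l ?invr_ge0 ?(ltW rt0)//.
    by rewrite -[leLHS]mulr_natl ler_wpM2r ?exprn_ge0// ler_nat.
  - exact: cvg_cst.
  - have h : (fun n => n.+1%:R * (t / t') ^+ n) @ \oo --> (0 : R).
      by apply: cvg_natS_geometric; rewrite tt'0.
    by apply: cvg0_scale; exact: cvg0_scale.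
have := ccvgD (ccvg_squeeze (l := 0) _ e0) (ccvgM (ps_ccvg sa r1') (ps_ccvg sb r1')).
move=> /(_ (fun N => psum (conv a b) r N - psum a r N * psum b r N)).
rewrite add0r => H; apply: ccvg_eq (H _) => N; first by rewrite subrK.
by rewrite subr0.
Qed.

End PowerSeries.

(** * Power series in q along a vertical line *)

Section ExpSeries.
Variable R : realType.
Local Notation C := R[i].
Local Notation Re := complex.Re.
Local Notation Im := complex.Im.
Implicit Types (a b : nat -> C) (f g : R -> C) (s : R).

(* |q| on the line of points of imaginary part s *)
Definition qnorm (s : R) : R := expR (- (2 * pi) * s).

Lemma pi2_gt0 : 0 < 2 * pi :> R. Proof. by rewrite mulr_gt0// pi_gt0. Qed.

Lemma qnorm_gt0 s : 0 < qnorm s. Proof. exact: expR_gt0. Qed.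

Lemma qnorm_lt1 s : 0 < s -> qnorm s < 1.
Proof. by move=> s0; rewrite /qnorm expR_lt1 mulNr oppr_lt0 mulr_gt0// pi2_gt0. Qed.

Lemma qnorm_norm s : 0 < s -> `|qnorm s| < 1.
Proof. by move=> s0; rewrite ger0_norm ?qnorm_lt1// ltW// qnorm_gt0. Qed.

Lemma qnorm_itv s : 0 < s -> 0 <= qnorm s < 1.
Proof. by move=> s0; rewrite ltW ?qnorm_gt0 ?qnorm_lt1. Qed.

Lemma qnorm_le s t : s <= t -> qnorm t <= qnorm s.
Proof.
by move=> st; rewrite /qnorm ler_expR !mulNr lerN2 ler_wpM2l// ltW// pi2_gt0.
Qed.

Lemma qnormX s n : qnorm s ^+ n = expR (- (2 * pi * n%:R) * s).
Proof. by rewrite /qnorm -expRM_natl; congr expR; ring. Qed.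

Lemma qnorm_der s : is_derive s 1 qnorm (- (2 * pi) * qnorm s).
Proof.
have h : is_derive s 1 (fun t : R => - (2 * pi) * t) (- (2 * pi)).
  by have := @is_deriveZ _ _ _ id (- (2 * pi)) s 1 1 _; rewrite /GRing.scale /= mulr1; apply.
have h2 := is_derive1_comp (is_derive_expR (- (2 * pi) * s)) h.
by apply: is_derive_eq h2 _; rewrite mulrC.
Qed.

(** This crude rate suffices wherever q only has to be made small. *)
Lemma qnorm_le_inv s : 0 < s -> qnorm s <= s^-1.
Proof.
move=> s0; rewrite /qnorm mulNr expRN lef_pV2 ?posrE ?expR_gt0//.
apply: le_trans (expR_ge1Dx _); have := pi_ge2 R; nra.
Qed.

Lemma ps_cder a (r : R) : subexp a -> `|r| < 1 ->
  cder (ps a) r (ps (fun n => n.+1%:R * a n.+1) r).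
Proof.
move=> sa r1; have [t [rt t1]] : exists t, `|r| < t /\ t < 1.
  by exists ((`|r| + 1) / 2); split; lra.
have t0 : 0 <= t by rewrite (le_trans (normr_ge0 r))// ltW.
have tt1 : `|t| < 1 by rewrite ger0_norm.
have ReS n (z : C) : Re (n%:R * z) = n%:R * Re z.
  have -> : n%:R = (n%:R : R)%:C :> C by rewrite rmorph_nat.
  by rewrite ReM /= mul0r subr0.
have ImS n (z : C) : Im (n%:R * z) = n%:R * Im z.
  have -> : n%:R = (n%:R : R)%:C :> C by rewrite rmorph_nat.
  by rewrite ImM /= mul0r addr0.
have sa1 := subexp_natS (subexp_S sa); have sa2 := subexp_natS (subexp_S sa1).
have E1 : pseries_diffs (fun n => Re (a n)) = fun n => Re (n.+1%:R * a n.+1).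
  by apply/funext => n; rewrite /pseries_diffs !ReS.
have E2 : pseries_diffs (fun n => Im (a n)) = fun n => Im (n.+1%:R * a n.+1).
  by apply/funext => n; rewrite /pseries_diffs !ImS.
have E3 : pseries_diffs (fun n => Re (n.+1%:R * a n.+1)) =
    fun n => Re (n.+1%:R * (n.+2%:R * a n.+2)).
  by apply/funext => n; rewrite /pseries_diffs !ReS.
have E4 : pseries_diffs (fun n => Im (n.+1%:R * a n.+1)) =
    fun n => Im (n.+1%:R * (n.+2%:R * a n.+2)).
  by apply/funext => n; rewrite /pseries_diffs !ImS.
have rt' : `|r| < `|t| by rewrite (ger0_norm t0).
split.
  have := @pseries_snd_diffs R (fun n => Re (a n)) t r _ _ _ rt'.
  rewrite E1 E3; apply.
  - exact: cvg_pseries_subexp (subexp_Re sa) _.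
  - exact: cvg_pseries_subexp (subexp_Re sa1) _.
  - exact: cvg_pseries_subexp (subexp_Re sa2) _.
have := @pseries_snd_diffs R (fun n => Im (a n)) t r _ _ _ rt'.
rewrite E2 E4; apply.
- exact: cvg_pseries_subexp (subexp_Im sa) _.
- exact: cvg_pseries_subexp (subexp_Im sa1) _.
- exact: cvg_pseries_subexp (subexp_Im sa2) _.
Qed.

Definition es a s : C := ps a (qnorm s).

Lemma es_cder a s : subexp a -> 0 < s ->
  cder (es a) s ((- (2 * pi))%:C * es (fun n => n%:R * a n) s).
Proof.
move=> sa s0; have r1 := qnorm_norm s0.
have h := cder_comp (ps_cder sa r1) (qnorm_der s).
apply: cder_eq h _; rewrite /es (ps_S (subexp_nat sa) r1) mul0r add0r.
by rewrite rmorphM mulrA.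
Qed.

Lemma es_S a s : subexp a -> 0 < s -> es a s = a 0%N + (qnorm s)%:C * es (fun n => a n.+1) s.
Proof. by move=> sa s0; exact: ps_S (qnorm_norm s0). Qed.

Lemma es_bounded a s0 : subexp a -> 0 < s0 ->
  exists2 K, 0 <= K & forall s, s0 <= s -> cn (es a s) <= K.
Proof.
move=> sa h; have [K K0 HK] := ps_bounded sa (qnorm_itv h).
by exists K => // s ss; apply: HK; rewrite ltW ?qnorm_gt0 ?qnorm_le.
Qed.

Lemma es_decay a s0 : subexp a -> 0 < s0 ->
  exists2 K, 0 <= K & forall s, s0 <= s -> cn (es a s - a 0%N) <= K * qnorm s.
Proof.
move=> sa h; have [K K0 HK] := es_bounded (subexp_S sa) h; exists K => // s ss.
have s_gt0 : 0 < s by exact: lt_le_trans ss.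
rewrite (es_S sa s_gt0) addrAC subrr add0r cnMR ger0_norm ?(ltW (qnorm_gt0 _))// mulrC.
by rewrite ler_wpM2r ?(ltW (qnorm_gt0 _))// HK.
Qed.

Definition qexp f a : Prop := subexp a /\ forall s, 0 < s -> f s = es a s.

Lemma qexpD f g a b : qexp f a -> qexp g b -> qexp (fun s => f s + g s) (fun n => a n + b n).
Proof.
move=> [sa fa] [sb gb]; split; first exact: subexpD.
by move=> s s0; rewrite fa// gb// /es psD// qnorm_norm.
Qed.

Lemma qexpZ c f a : qexp f a -> qexp (fun s => c * f s) (fun n => c * a n).
Proof.
move=> [sa fa]; split; first exact: subexpZ.
by move=> s s0; rewrite fa// /es psZ// qnorm_norm.
Qed.

Lemma qexpM f g a b : qexp f a -> qexp g b -> qexp (fun s => f s * g s) (conv a b).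
Proof.
move=> [sa fa] [sb gb]; split; first exact: subexp_conv.
by move=> s s0; rewrite fa// gb// /es psM// qnorm_itv.
Qed.

Definition cst_seq (c : C) : nat -> C := fun n => if n is 0%N then c else 0.

Lemma subexp_cst_seq c : subexp (cst_seq c).
Proof.
apply: (@subexp_le _ _ (fun=> c) 1) => // [n|]; last exact: subexp_cst.
by rewrite mul1r; case: n => [|n] //=; rewrite cn0 cn_ge0.
Qed.

Lemma es0 s : 0 < s -> es (fun=> 0) s = 0.
Proof.
move=> s0; have := psZ (r := qnorm s) 0 (@subexp0 R) (qnorm_norm s0).
by rewrite !mul0r.
Qed.

Lemma qexp_cst c : qexp (fun=> c) (cst_seq c).
Proof.
split; first exact: subexp_cst_seq.
move=> s s0; rewrite (es_S (subexp_cst_seq c) s0) /=.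
by rewrite (es0 s0) mulr0 addr0.
Qed.

Lemma qexp_cder f a s : qexp f a -> 0 < s ->
  cder f s ((- (2 * pi))%:C * es (fun n => n%:R * a n) s).
Proof.
move=> [sa fa] s0; apply: (cder_gt s0 _ (es_cder sa s0)) => t t0.
by rewrite fa.
Qed.

(** As s grows the series tends to its constant term, which is therefore 0; dividing by q leaves a
    series of the same kind, and the coefficients vanish one after the other. *)
Lemma es_eq0 a : subexp a -> (forall s, 0 < s -> es a s = 0) -> forall n, a n = 0.
Proof.
have base b : subexp b -> (forall s, 0 < s -> es b s = 0) ->
    b 0%N = 0 /\ (forall s, 0 < s -> es (fun n => b n.+1) s = 0).
  move=> sb b0; have b00 : b 0%N = 0.
    apply/cn_eq0/eqP; rewrite eq_le cn_ge0 andbT.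
    have [K K0 HK] := es_decay sb ltr01.
    apply/ler_addgt0Pl => e e0; rewrite addr0.
    (* The height s = 1 + K / e is chosen so that K / s <= e. *)
    have s1 : 1 <= 1 + K / e by rewrite lerDl divr_ge0// ltW.
    have s0 : 0 < 1 + K / e by rewrite (lt_le_trans ltr01).
    have := HK _ s1; rewrite b0// sub0r cnN => h; apply: le_trans h _.
    apply: (le_trans (ler_wpM2l K0 (qnorm_le_inv s0))).
    by rewrite ler_pdivrMr// mulrDr mulr1 mulrCA divff ?gt_eqF// mulr1 lerDr ltW.
  split=> // s s0; have := es_S sb s0; rewrite b0// b00 add0r => /esym/eqP.
  rewrite mulf_eq0 => /orP[/eqP h|/eqP//].
  by have := congr1 (@complex.Re R) h => /= /eqP; rewrite gt_eqF ?qnorm_gt0.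
move=> sa a0 n; elim: n a sa a0 => [|n IH] a sa a0; have [h1 h2] := base a sa a0 => //.
by have := IH _ (subexp_S sa) h2.
Qed.

Lemma qexp_uniq f a b : qexp f a -> qexp f b -> a = b.
Proof.
move=> fa fb; apply/funext => n.
have [sc h] := qexpD fa (qexpZ (-1) fb).
have := @es_eq0 _ sc _ n; rewrite mulN1r => H; apply/eqP; rewrite -subr_eq0; apply/eqP/H.
by move=> s s0; rewrite -h// mulN1r subrr.
Qed.

Lemma qexp_ext f g a : (forall s, 0 < s -> f s = g s) -> qexp f a -> qexp g a.
Proof. by move=> fg [sa h]; split=> // s s0; rewrite -fg// h. Qed.

End ExpSeries.

(** * Fourier expansions on the upper half-plane and Lambert series *)

Section Fourier.
Variable R : realType.
Local Notation C := R[i].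
Local Notation Re := complex.Re.
Local Notation Im := complex.Im.
Implicit Types (f g : hfun R) (a b : nat -> C) (x s : R).

Definition line f x (s : R) : C := hext f (x +i* s).

Lemma hextE f (tau : uhp R) : hext f (val tau) = f tau.
Proof. by rewrite /hext valK. Qed.

Lemma lineE f (tau : uhp R) : line f (Re (val tau)) (Im (val tau)) = f tau.
Proof. by rewrite /line complex_eta hextE. Qed.

Lemma line_uhp x s : 0 < s -> exists tau : uhp R, val tau = x +i* s.
Proof. by move=> s0; exists (exist _ (x +i* s) s0). Qed.

Lemma hfun_ext f g : (forall x s, 0 < s -> line f x s = line g x s) -> f = g.
Proof.
move=> fg; apply/funext => tau; rewrite -lineE -[RHS]lineE; apply: fg.
by case: tau.
Qed.

Lemma lineD f g x s : line (f + g) x s = line f x s + line g x s.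
Proof. by rewrite /line /hext; case: insubP => //= _; rewrite addr0. Qed.
Lemma lineM f g x s : line (f * g) x s = line f x s * line g x s.
Proof. by rewrite /line /hext; case: insubP => //= _; rewrite mul0r. Qed.
Lemma lineZ c f x s : line (c *: f) x s = c * line f x s.
Proof. by rewrite /line /hext; case: insubP => //= _; rewrite mulr0. Qed.
Lemma lineN f x s : line (- f) x s = - line f x s.
Proof. by rewrite -scaleN1r lineZ mulN1r. Qed.
Lemma lineB f g x s : line (f - g) x s = line f x s - line g x s.
Proof. by rewrite lineD lineN. Qed.
Lemma line0 x s : line 0 x s = 0.
Proof. by rewrite /line /hext; case: insubP. Qed.
Lemma line_cst (c : C) x s : 0 < s -> line (fun=> c) x s = c.
Proof. by move=> s0; have [tau E] := line_uhp x s0; rewrite /line -E hextE. Qed.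
Lemma line1 x s : 0 < s -> line 1 x s = 1.
Proof. exact: line_cst. Qed.

Definition e1 (x : R) : C := cos (2 * pi * x) +i* sin (2 * pi * x).

Lemma nome_line (tau : uhp R) :
  nome tau = (qnorm (Im (val tau)))%:C * e1 (Re (val tau)).
Proof.
rewrite /nome /cexp /qnorm /e1 /twopii; case: (val tau) => a b /=.
by rewrite !mul0r sub0r add0r mulNr.
Qed.

Lemma normc_e1 x : ComplexField.Normc.normc (e1 x) = 1.
Proof. by rewrite /e1 /= cos2Dsin2 sqrtr1. Qed.

Lemma cn_normc (z : C) : cn z <= 2 * ComplexField.Normc.normc z.
Proof.
case: z => a b; rewrite /cn /= mulr_natl mulr2n lerD// -sqrtr_sqr ler_sqrt ?addr_ge0 ?sqr_ge0//.
  by rewrite lerDl sqr_ge0.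
by rewrite lerDr sqr_ge0.
Qed.

Lemma normcX (z : C) n : ComplexField.Normc.normc (z ^+ n) = ComplexField.Normc.normc z ^+ n.
Proof.
elim: n => [|n IH]; first by rewrite !expr0 ComplexField.Normc.normc1.
by rewrite !exprS ComplexField.Normc.normcM IH.
Qed.

Lemma cn_e1X x n : cn (e1 x ^+ n) <= 2.
Proof. by rewrite (le_trans (cn_normc _))// normcX normc_e1 expr1n mulr1. Qed.

(** On the line of real part x one has q^n = |q|^n [e1 x]^n. Moving the unit factor into the
    coefficients leaves a power series in the real variable |q|. *)
Definition tw x a : nat -> C := fun n => a n * e1 x ^+ n.

Lemma subexp_tw x a : subexp a -> subexp (tw x a).
Proof.
apply: (@subexp_le _ _ _ 2) => // n; rewrite /tw (le_trans (cnM _ _))// mulrC.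
by rewrite ler_wpM2r ?cn_ge0 ?cn_e1X.
Qed.

Lemma tw0 a : tw 0 a = a.
Proof.
by apply/funext => n; rewrite /tw /e1 mulr0 cos0 sin0 expr1n mulr1.
Qed.

Lemma tw_at0 x a : tw x a 0%N = a 0%N. Proof. by rewrite /tw expr0 mulr1. Qed.

Lemma tw_conv x a b : conv (tw x a) (tw x b) = tw x (conv a b).
Proof.
apply/funext => n; rewrite /conv /tw mulr_suml; apply: eq_bigr => k _.
by rewrite mulrACA -exprD subnKC// leq_ord.
Qed.

(* Fourier expansions, read on all vertical lines. *)
Definition fexp f a : Prop := subexp a /\ forall x, qexp (line f x) (tw x a).

Lemma fexpD f g a b : fexp f a -> fexp g b -> fexp (f + g) (fun n => a n + b n).
Proof.
move=> [sa fa] [sb gb]; split=> [|x]; first exact: subexpD.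
have -> : line (f + g) x = fun s => line f x s + line g x s.
  by apply/funext => s; rewrite lineD.
have -> : tw x (fun n => a n + b n) = fun n => tw x a n + tw x b n.
  by apply/funext => n; rewrite /tw mulrDl.
exact: qexpD.
Qed.

Lemma fexpZ c f a : fexp f a -> fexp (c *: f) (fun n => c * a n).
Proof.
move=> [sa fa]; split=> [|x]; first exact: subexpZ.
have -> : line (c *: f) x = fun s => c * line f x s.
  by apply/funext => s; rewrite lineZ.
have -> : tw x (fun n => c * a n) = fun n => c * tw x a n.
  by apply/funext => n; rewrite /tw mulrA.
exact: qexpZ.
Qed.

Lemma fexpM f g a b : fexp f a -> fexp g b -> fexp (f * g) (conv a b).
Proof.
move=> [sa fa] [sb gb]; split=> [|x]; first exact: subexp_conv.
have -> : line (f * g) x = fun s => line f x s * line g x s.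
  by apply/funext => s; rewrite lineM.
by rewrite -tw_conv; exact: qexpM.
Qed.

Lemma fexp_cst (c : C) : fexp (fun=> c) (cst_seq c).
Proof.
split=> [|x]; first exact: subexp_cst_seq.
have -> : tw x (cst_seq c) = cst_seq c.
  by apply/funext => -[|n]; rewrite /tw /= ?expr0 ?mulr1// mul0r.
by apply: qexp_ext (qexp_cst c) => s s0; rewrite line_cst.
Qed.

Lemma cvg_complex_bounded (u : nat -> C) l : ccvg (fun n => \sum_(k < n) u k) l ->
  exists K, forall n, cn (u n) <= K.
Proof.
move=> [h1 h2].
have H (w : nat -> R) (m : R) : (fun n => \sum_(k < n) w k) @ \oo --> m ->
    exists K, forall n, `|w n| <= K.
  move=> wm; have wm' : cvgn (series w).
    apply/cvg_ex; exists m; rewrite /series /=.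
    by under eq_fun do rewrite big_mkord.
  have [K [_ HK]] := cvg_seq_bounded (cvgP _ (cvg_series_cvg_0 wm')).
  by exists (K + 1) => n; apply: HK; rewrite ?ltrDl.
have E1 : (fun n => Re (\sum_(k < n) u k)) = fun n => \sum_(k < n) Re (u k).
  by apply/funext => n; rewrite Re_sum.
have E2 : (fun n => Im (\sum_(k < n) u k)) = fun n => \sum_(k < n) Im (u k).
  by apply/funext => n; rewrite Im_sum.
rewrite E1 in h1; rewrite E2 in h2.
have [K HK] := H (fun k => Re (u k)) _ h1; have [L HL] := H (fun k => Im (u k)) _ h2.
by exists (K + L) => n; rewrite lerD.
Qed.

Lemma is_fourierP f a : is_fourier f a <->
  forall tau : uhp R, ccvg (fun N => \sum_(n < N) a n * nome tau ^+ n) (f tau).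
Proof.
have E (tau : uhp R) : series (fun n => a n * nome tau ^+ n : C^o) =
    fun N => \sum_(n < N) a n * nome tau ^+ n.
  by apply/funext => N; rewrite /series /= big_mkord.
split=> h tau; first by move: (h tau); rewrite E => /cvg_complexP.
by rewrite E; apply/cvg_complexP; exact: h.
Qed.

Lemma fourier_fexp f a : is_fourier f a <-> fexp f a.
Proof.
rewrite is_fourierP; split=> [h|[sa h] tau]; last first.
  have s0 : 0 < Im (val tau) by case: tau.
  have [st hs] := h (Re (val tau)).
  rewrite -(lineE f tau) hs//; apply: ccvg_eq (ps_ccvg st (qnorm_norm s0)) => N.
  by apply: eq_bigr => n _; rewrite nome_line exprMn [X in _ = _ * X]mulrC mulrA.
have sa : subexp a.
  move=> t t01; have [t0 t1] := andP t01.
  (* On the imaginary axis at this height q is real and equal to t; the terms of a convergent series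
     being bounded, this is the bound required by [subexp]. *)
  have s0 : 0 < - ln t / (2 * pi) by rewrite divr_gt0 ?pi2_gt0// oppr_gt0 ln_lt0.
  have [tau E] := line_uhp 0 s0.
  have [K HK] := cvg_complex_bounded (u := fun n => a n * nome tau ^+ n) (h tau); exists K => n; apply: le_trans (HK n).
  have qt : qnorm (- ln t / (2 * pi)) = t.
    rewrite /qnorm (_ : - (2 * pi) * (- ln t / (2 * pi)) = ln t) ?lnK ?posrE//.
    rewrite !mulNr mulrN opprK mulrCA divff ?mulr1//.
    by rewrite gt_eqF// pi2_gt0.
  rewrite nome_line E /= qt /e1 mulr0 cos0 sin0 mulr1 -rmorphXn mulrC [a n * _]mulrC cnMR.
  by rewrite ger0_norm// exprn_ge0// ltW.
split=> // x; split; first exact: subexp_tw.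
move=> s s0; have [tau E] := line_uhp x s0; apply/esym/psE.
- exact: subexp_tw.
- exact: qnorm_norm.
have := h tau; rewrite -(lineE f tau) E /=; apply: ccvg_eq => N.
by apply: eq_bigr => n _; rewrite nome_line E exprMn [X in _ * X]mulrC mulrA.
Qed.

Lemma fexp_fourier f a : fexp f a -> fourier f = a.
Proof.
move=> fa; have /fourier_fexp hf := fa.
have /fourier_fexp [_ /(_ 0)] := @xgetPex _ (fun=> 0) (is_fourier f) (ex_intro _ a hf).
case: fa => _ /(_ 0); rewrite !tw0 => h1 h2.
exact: qexp_uniq h2 h1.
Qed.

Lemma subexp_cvg0 a (r : R) : subexp a -> 0 <= r < 1 -> (fun n => cn (a n) * r ^+ n) @ \oo --> (0 : R).
Proof.
move=> sa /andP[r0 r1].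
have [t [rt t1]] : exists t : R, r < t /\ t < 1 by exists ((r + 1) / 2); split; lra.
have t0 : 0 < t by exact: le_lt_trans rt.
have [K HK] := sa t (introT andP (conj t0 t1)).
apply: (@squeeze_cvgr _ _ _ _ (fun=> 0) (fun n => K * (r / t) ^+ n)).
- apply: nearW => n; rewrite mulr_ge0 ?cn_ge0 ?exprn_ge0//=.
  have {1}-> : r ^+ n = t ^+ n * (r / t) ^+ n by rewrite -exprMn mulrC divfK// gt_eqF.
  by rewrite mulrA ler_wpM2r ?HK// exprn_ge0// divr_ge0// ltW.
- exact: cvg_cst.
- apply: cvg0_scale; apply: cvg_expr; rewrite ger0_norm ?divr_ge0 ?(ltW t0)//.
  by rewrite ltr_pdivrMr// mul1r.
Qed.

Lemma csumE (u : nat -> C) l : ccvg (fun N => \sum_(n < N) u n) l -> csum u = l.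
Proof.
move=> h; rewrite /csum; apply: cvg_complex_lim; apply/cvg_complexP.
have E : series (u : nat -> C^o) = fun N => \sum_(n < N) u n.
  by apply/funext => N; rewrite /series /= big_mkord.
by rewrite E.
Qed.

Definition sig (p n : nat) : nat := (\sum_(1 <= d < n.+1 | d %| n) d ^ p)%N.

Lemma subexp_natX p : subexp (fun n => n%:R ^+ p : C).
Proof.
elim: p => [|p IH]; first by under eq_fun do rewrite expr0; exact: subexp_cst.
by under eq_fun do rewrite exprS; exact: subexp_nat.
Qed.

Lemma cn_nat n : cn (n%:R : C) = n%:R.
Proof.
have -> : (n%:R : C) = (n%:R : R)%:C by rewrite rmorph_nat.
by rewrite cnR normr_nat.
Qed.

Lemma subexp_sig p : subexp (fun n => (sig p n)%:R : C).
Proof.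
apply: (@subexp_le _ _ (fun n => n%:R ^+ p.+1) 1) => // [n|]; last exact: subexp_natX.
rewrite mul1r -natrX !cn_nat ler_nat expnS /sig.
apply: (@leq_trans (\sum_(1 <= d < n.+1) n ^ p)); last by rewrite sum_nat_const_nat subn1.
rewrite big_mkcond /= big_nat [leqRHS]big_nat; apply: leq_sum => d /andP[_ dn].
by case: ifP => // _; case: p => // p; rewrite leq_exp2r// -ltnS.
Qed.

Lemma geometric_multiples (Q : C) m N : (0 < m)%N ->
  (\sum_(1 <= n < N.+1 | (m %| n)%N) Q ^+ n) * (1 - Q ^+ m) = Q ^+ m - Q ^+ (m * (N %/ m).+1).
Proof.
move=> m0; elim: N => [|N IH].
  by rewrite big_nil mul0r div0n muln1 subrr.
rewrite big_mkcond big_nat_recr//= -big_mkcond mulrDl IH divnS//.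
case: ifP => [mN|_]; last by rewrite mul0r addr0 add0n.
rewrite add1n; have -> : (N.+1 = m * (N %/ m).+1)%N.
  by have := divnK mN; rewrite divnS// mN add1n mulnC.
by rewrite mulrBr mulr1 -exprD -mulnSr addrA subrK.
Qed.

(* Truncating the Lambert series at N and the power series at q^N, the
   difference only involves exponents > N. *)
Lemma lambert_cvg (Q : C) (p : nat) : ComplexField.Normc.normc Q < 1 ->
  ccvg (fun N => \sum_(n < N) n.+1%:R ^+ p * (Q ^+ n.+1 / (1 - Q ^+ n.+1)) -
                 \sum_(n < N.+1) (sig p n)%:R * Q ^+ n) 0.
Proof.
set r := ComplexField.Normc.normc Q => r1.
have r0 : 0 <= r by rewrite /r; case: (Q) => a b; exact: sqrtr_ge0.
have nX m : (0 < m)%N -> 1 - r <= ComplexField.Normc.normc (1 - Q ^+ m).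
  move=> m0; rewrite lerBlDr.
  have := le_normcD (1 - Q ^+ m) (Q ^+ m).
  rewrite subrK ComplexField.Normc.normc1 normcX => /le_trans; apply.
  by rewrite lerD2l -/r -[leRHS]expr1 ler_wiXn2l// ltW.
have nz m : (0 < m)%N -> 1 - Q ^+ m != 0.
  move=> m0; apply/eqP => E; have := nX _ m0.
  by rewrite E ComplexField.Normc.normc0 leNgt subr_gt0 r1.
have key N : \sum_(n < N) n.+1%:R ^+ p * (Q ^+ n.+1 / (1 - Q ^+ n.+1)) -
    \sum_(n < N.+1) (sig p n)%:R * Q ^+ n =
    \sum_(1 <= m < N.+1) m%:R ^+ p * (Q ^+ (m * (N %/ m).+1) / (1 - Q ^+ m)).
  rewrite big_ord_recl /sig big_nil mul0r add0r.
  have -> : \sum_(n < N) n.+1%:R ^+ p * (Q ^+ n.+1 / (1 - Q ^+ n.+1)) =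
      \sum_(1 <= n < N.+1) n%:R ^+ p * (Q ^+ n / (1 - Q ^+ n)).
    by rewrite big_add1 /= big_mkord.
  rewrite (_ : \sum_(i < N) _ = \sum_(1 <= n < N.+1) (sig p n)%:R * Q ^+ n); last first.
    by rewrite big_add1 /= big_mkord.
  have -> : \sum_(1 <= n < N.+1) (sig p n)%:R * Q ^+ n =
      \sum_(1 <= m < N.+1) m%:R ^+ p * \sum_(1 <= n < N.+1 | (m %| n)%N) Q ^+ n.
    transitivity (\sum_(1 <= n < N.+1) \sum_(1 <= m < N.+1)
        (if (m %| n)%N then m%:R ^+ p * Q ^+ n else 0)).
      apply: eq_big_nat => n /andP[n1 nN]; rewrite /sig natr_sum mulr_suml big_mkcond /=.
      rewrite [RHS](big_cat_nat (n := n.+1)) //=.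
      rewrite [X in _ = _ + X]big_nat_cond [X in _ = _ + X]big1 ?addr0; last first.
        move=> m /andP[/andP[nm _] _]; case: ifP => // /(dvdn_leq n1).
        by rewrite leqNgt nm.
      by apply: eq_bigr => m _; case: ifP => // _; rewrite natrX.
    rewrite exchange_big /=; apply: eq_bigr => m _.
    rewrite mulr_sumr [RHS]big_mkcond /=; apply: eq_bigr => n _.
    by case: ifP.
  rewrite -sumrB; apply: eq_big_nat => m /andP[m1 _].
  rewrite -mulrBr; congr (_ * _); apply: (mulIf (nz m m1)).
  by rewrite mulrBl geometric_multiples// !divfK ?nz// opprB addrCA subrr addr0.
have e0 : (fun N => 2 / (1 - r) * (cn ((N%:R : C) ^+ p.+1) * r ^+ N)) @ \oo --> (0 : R).
  by apply: cvg0_scale; apply: subexp_cvg0; [exact: subexp_natX|rewrite r0].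
apply: ccvg_squeeze e0 => N; rewrite subr0 key.
apply: (le_trans (cn_normc _)); rewrite -mulrA ler_wpM2l//.
have nsum (I : Type) (l : seq I) (F : I -> C) : ComplexField.Normc.normc (\sum_(i <- l) F i)
    <= \sum_(i <- l) ComplexField.Normc.normc (F i).
  elim: l => [|i l IH]; first by rewrite !big_nil ComplexField.Normc.normc0.
  by rewrite !big_cons (le_trans (le_normcD _ _))// lerD2l.
apply: (le_trans (nsum _ _ _)).
apply: (@le_trans _ _ (\sum_(1 <= m < N.+1) N%:R ^+ p * (r ^+ N / (1 - r)))); last first.
  have -> : cn ((N%:R : C) ^+ p.+1) = N%:R ^+ p.+1 by rewrite -natrX cn_nat natrX.
  rewrite sumr_const_nat subn1 /= exprS -[leLHS]mulr_natl.
  by rewrite le_eqVlt; apply/orP; left; apply/eqP; ring.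
apply: ler_sum_nat => m /andP[m1 mN].
rewrite !ComplexField.Normc.normcM !normcX ComplexField.Normc.normcV.
have -> : ComplexField.Normc.normc (m%:R : C) = m%:R.
  have -> : (m%:R : C) = (m%:R : R)%:C by rewrite rmorph_nat.
  by rewrite /= expr0n /= addr0 sqrtr_sqr normr_nat.
apply: ler_pM.
- by rewrite exprn_ge0.
- by rewrite mulr_ge0 ?exprn_ge0// invr_ge0 (le_trans _ (nX _ m1))// subr_ge0 ltW.
- by rewrite -!natrX ler_nat; case: p {key} => // p; rewrite leq_exp2r// -ltnS.
apply: ler_pM.
- by rewrite exprn_ge0.
- by rewrite invr_ge0 (le_trans _ (nX _ m1))// subr_ge0 ltW.
- apply: ler_wiXn2l => //; first exact: ltW.
  by rewrite ltnW// mulnC ltn_ceil.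
rewrite lef_pV2 ?posrE ?nX ?subr_gt0//.
by rewrite (lt_le_trans _ (nX _ m1))// subr_gt0.
Qed.

End Fourier.

Section Convolution.
Local Open Scope nat_scope.

(** In a solution of a x + b y = n in positive integers all four numbers are at most n, so the
    search box is exhaustive. Sums of a^p b^r over this list are convolutions of divisor sums. *)
Definition quads (n : nat) : seq ((nat * nat) * (nat * nat)) :=
  [seq t <- [seq (p, q) | p <- [seq (a, b) | a <- iota 1 n, b <- iota 1 n],
                          q <- [seq (x, y) | x <- iota 1 n, y <- iota 1 n]]
   | t.1.1 * t.2.1 + t.1.2 * t.2.2 == n].

Lemma mem_quads n a b x y : (((a, b), (x, y)) \in quads n) =
  [&& 0 < a, 0 < b, 0 < x, 0 < y & a * x + b * y == n].
Proof.
have memp c d : ((c, d) \in [seq (a, b) | a <- iota 1 n, b <- iota 1 n]) = (0 < c <= n) && (0 < d <= n).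
  apply/allpairsP/idP => [[[u v] /= [+ + [-> ->]]]|/andP[h1 h2]].
    by rewrite !mem_iota !add1n !ltnS => -> ->.
  by exists (c, d); rewrite !mem_iota !add1n !ltnS.
have memq c d : ((c, d) \in [seq (x, y) | x <- iota 1 n, y <- iota 1 n]) = (0 < c <= n) && (0 < d <= n).
  exact: memp.
rewrite mem_filter /=; apply/andP/and5P => [[/eqP E]|[a0 b0 x0 y0 /eqP E]].
  move=> /allpairsP[[p q] /= [pin qin [pE qE]]]; rewrite -pE in pin; rewrite -qE in qin.
  move: pin qin; rewrite memp memq => /andP[/andP[-> _] /andP[-> _]] /andP[/andP[-> _] /andP[-> _]].
  by rewrite E eqxx.
split; first by rewrite E.
by apply/allpairsP; exists ((a, b), (x, y)) => /=; rewrite memp memq; split=> //; nia.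
Qed.

Lemma uniq_quads n : uniq (quads n).
Proof.
have up : uniq [seq (a, b) | a <- iota 1 n, b <- iota 1 n].
  by apply: allpairs_uniq; rewrite ?iota_uniq// => -[u v] [u' v'] _ _ [-> ->].
by apply/filter_uniq/allpairs_uniq => // -[u v] [u' v'] _ _ [-> ->].
Qed.

End Convolution.

(** * Convolutions of divisor sums and Ramanujan's equations *)

Section Skoruppa.
Variable F : numFieldType.
Local Notation ssum n H := (\sum_(t <- quads n) H t.1.1 t.1.2 : F).
Implicit Types H K : nat -> nat -> F.

(** With x = y the equation reads (a + b) x = n, so d = a + b runs through the divisors of n. *)
Lemma quads_diag n H : (0 < n)%N ->
  \sum_(t <- quads n | t.2.1 == t.2.2) H t.1.1 t.1.2 =
  \sum_(1 <= d < n.+1 | (d %| n)%N) \sum_(1 <= a < d) H a (d - a)%N.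
Proof.
move=> n0; rewrite -big_filter -[RHS]big_filter.
pose L := [seq ((a, d - a)%N, (n %/ d, n %/ d)%N) | d <- [seq d <- index_iota 1 n.+1 | (d %| n)%N], a <- index_iota 1 d].
rewrite (perm_big L) /=; first by rewrite /L big_allpairs_dep.
apply: uniq_perm; first exact: filter_uniq (uniq_quads n).
  apply: allpairs_uniq_dep => [|d _|]; rewrite ?filter_uniq ?iota_uniq//.
  move=> [d a] [d' a'] /allpairsPdep[u [v [+ + E]]] /allpairsPdep[u' [v' [+ + E']]].
  move: E E' => [-> ->] [-> ->]; rewrite !mem_index_iota => _ /andP[v0 vu] _ /andP[v0' vu'] /=.
  by case=> Ev Ed _; subst v'; have -> : u = u' by lia.
move=> [[a b] [x y]]; rewrite mem_filter mem_quads /=.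
apply/andP/allpairsPdep => [[/eqP E]|[d [c []]]].
  rewrite -{y}E; move=> /and5P[a0 b0 x0 _ /eqP E].
  have dn : ((a + b)%N %| n)%N by apply/dvdnP; exists x; rewrite -E [RHS]mulnC mulnDl.
  exists (a + b)%N, a; rewrite mem_filter dn !mem_index_iota; split.
  - by rewrite /= ltnS (dvdn_leq n0 dn) addn_gt0 a0.
  - by rewrite a0 -[X in (X < _)%N]addn0 ltn_add2l.
  - have -> : (n %/ (a + b) = x)%N by rewrite -E -mulnDl mulKn// addn_gt0 a0.
    by rewrite addKn.
rewrite mem_filter !mem_index_iota => /andP[dn /andP[d0 dln]] /andP[c0 cd] [-> -> -> ->].
split=> //; have q0 : (0 < n %/ d)%N by rewrite divn_gt0 ?(leq_trans _ d0)// dvdn_leq.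
by rewrite c0 subn_gt0 cd q0 /= -mulnDl subnKC ?(ltnW cd)// mulnC divnK.
Qed.

(** With a = b = d the equation reads d (x + y) = n, which leaves n / d - 1 choices for x. *)
Lemma quads_antidiag n H : (0 < n)%N ->
  \sum_(t <- quads n | t.1.1 == t.1.2) H t.1.1 t.1.2 =
  \sum_(1 <= d < n.+1 | (d %| n)%N) (n %/ d - 1)%:R * H d d.
Proof.
move=> n0; rewrite -big_filter -[RHS]big_filter.
pose L := [seq ((d, d), (x, n %/ d - x)%N) | d <- [seq d <- index_iota 1 n.+1 | (d %| n)%N], x <- index_iota 1 (n %/ d)].
rewrite (perm_big L) /=.
  rewrite /L big_allpairs_dep; apply: eq_bigr => d _ /=.
  by rewrite sumr_const_nat mulr_natl.
apply: uniq_perm; first exact: filter_uniq (uniq_quads n).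
  apply: allpairs_uniq_dep => [|d _|]; rewrite ?filter_uniq ?iota_uniq//.
  by move=> [d a] [d' a'] _ _ /= [*]; subst.
move=> [[a b] [x y]]; rewrite mem_filter mem_quads /=.
apply/andP/allpairsPdep => [[/eqP E]|[d [c []]]].
  rewrite -{b}E; move=> /and5P[a0 _ x0 y0 /eqP E].
  have dn : (a %| n)%N by rewrite -E -mulnDr dvdn_mulr.
  have q : (n %/ a = x + y)%N by rewrite -E -mulnDr mulKn.
  exists a, x; rewrite mem_filter dn !mem_index_iota; split.
  - by rewrite /= ltnS (dvdn_leq n0 dn) a0.
  - by rewrite q x0 -[X in (X < _)%N]addn0 ltn_add2l.
  - by rewrite q addKn.
rewrite mem_filter !mem_index_iota => /andP[dn /andP[d0 dln]] /andP[c0 cd] [-> -> -> ->].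
split=> //.
by rewrite d0 c0 subn_gt0 cd /= -mulnDr subnKC ?(ltnW cd)// mulnC divnK.
Qed.

(* Splitting the solutions of ax + by = n by x > y, x = y, x < y, the map
   (a, b, x, y) -> (a, a + b, x - y, y) sends the first part bijectively to the
   solutions with a < b. *)
Lemma quads_shift n H K : (0 < n)%N ->
  (forall a b, (0 < a < b)%N -> H a (b - a)%N = K a b) ->
  (forall a b, (0 < b < a)%N -> H (a - b)%N b = K a b) ->
  ssum n H - ssum n K =
  \sum_(1 <= d < n.+1 | (d %| n)%N)
     (\sum_(1 <= a < d) H a (d - a)%N - (n %/ d - 1)%:R * K d d).
Proof.
move=> n0 HK1 HK2; rewrite sumrB -(quads_diag _ n0) -(quads_antidiag _ n0).
have S1 : \sum_(t <- quads n | (t.2.2 < t.2.1)%N) H t.1.1 t.1.2 =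
          \sum_(t <- quads n | (t.1.1 < t.1.2)%N) K t.1.1 t.1.2.
  rewrite -big_filter -[RHS]big_filter.
  pose h (t : (nat * nat) * (nat * nat)) := ((t.1.1, t.1.2 - t.1.1), (t.2.1 + t.2.2, t.2.2))%N.
  rewrite (perm_big (map h [seq t <- quads n | (t.1.1 < t.1.2)%N])) /=.
    rewrite big_map big_seq [RHS]big_seq; apply: eq_bigr => -[[a b] [x y]] /=.
    by rewrite mem_filter mem_quads /= => /andP[ab /and3P[a0 _ _]]; rewrite HK1// a0.
  apply: uniq_perm; first exact: filter_uniq (uniq_quads n).
    rewrite map_inj_in_uniq; first exact: filter_uniq (uniq_quads n).
    move=> [[a b] [x y]] [[a' b'] [x' y']]; rewrite !mem_filter /= => /andP[ab _] /andP[ab' _].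
    rewrite /h /= => -[E1 E2 E3 E4]; subst; have -> : b = b' by lia.
    by have -> : x = x' by lia.
  move=> [[a b] [x y]]; rewrite mem_filter mem_quads /=; apply/idP/mapP.
    move=> /and5P[xy a0 b0 x0 /andP[y0 /eqP E]].
    exists ((a, a + b), (x - y, y))%N.
      by rewrite mem_filter mem_quads /= a0 y0 subn_gt0 xy; apply/and4P; split; [lia|lia|lia|apply/eqP; nia].
    by rewrite /h /= addKn subnK// ltnW.
  move=> [[[c d] [u v]]]; rewrite mem_filter mem_quads /= => /andP[cd /and5P[c0 d0 u0 v0 /eqP E]] [-> -> -> ->].
  by apply/and5P; split; [lia|lia|lia|lia|apply/andP; split; [lia|apply/eqP; nia]].
have S2 : \sum_(t <- quads n | (t.2.1 < t.2.2)%N) H t.1.1 t.1.2 =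
          \sum_(t <- quads n | (t.1.2 < t.1.1)%N) K t.1.1 t.1.2.
  rewrite -big_filter -[RHS]big_filter.
  pose h (t : (nat * nat) * (nat * nat)) := ((t.1.1 - t.1.2, t.1.2), (t.2.1, t.2.1 + t.2.2))%N.
  rewrite (perm_big (map h [seq t <- quads n | (t.1.2 < t.1.1)%N])) /=.
    rewrite big_map big_seq [RHS]big_seq; apply: eq_bigr => -[[a b] [x y]] /=.
    by rewrite mem_filter mem_quads /= => /andP[ab /and3P[_ b0 _]]; rewrite HK2// b0.
  apply: uniq_perm; first exact: filter_uniq (uniq_quads n).
    rewrite map_inj_in_uniq; first exact: filter_uniq (uniq_quads n).
    move=> [[a b] [x y]] [[a' b'] [x' y']]; rewrite !mem_filter /= => /andP[ab _] /andP[ab' _].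
    rewrite /h /= => -[E1 E2 E3 E4]; subst; have -> : a = a' by lia.
    by have -> : y = y' by lia.
  move=> [[a b] [x y]]; rewrite mem_filter mem_quads /=; apply/idP/mapP.
    move=> /and5P[xy a0 b0 x0 /andP[y0 /eqP E]].
    exists ((a + b, b), (x, y - x))%N.
      by rewrite mem_filter mem_quads /= b0 x0 subn_gt0 xy; apply/and4P; split; [lia|lia|lia|apply/eqP; nia].
    by rewrite /h /= addnK subnKC// ltnW.
  move=> [[[c d] [u v]]]; rewrite mem_filter mem_quads /= => /andP[cd /and5P[c0 d0 u0 v0 /eqP E]] [-> -> -> ->].
  by apply/and5P; split; [lia|lia|lia|lia|apply/andP; split; [lia|apply/eqP; nia]].
have split3 (u v : (nat * nat) * (nat * nat) -> nat) (G : nat -> nat -> F) :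
    \sum_(t <- quads n) G t.1.1 t.1.2 =
    \sum_(t <- quads n | (u t < v t)%N) G t.1.1 t.1.2 +
    \sum_(t <- quads n | (v t < u t)%N) G t.1.1 t.1.2 +
    \sum_(t <- quads n | u t == v t) G t.1.1 t.1.2.
  rewrite [X in X + _ + _]big_mkcond [X in _ + X + _]big_mkcond [X in _ + _ + X]big_mkcond /=.
  rewrite -!big_split /=.
  by apply: eq_bigr => t _; case: ltngtP => _; rewrite ?addr0 ?add0r.
rewrite (split3 (fun t => t.2.1) (fun t => t.2.2) H) (split3 (fun t => t.1.1) (fun t => t.1.2) K).
by rewrite S1 S2; ring.
Qed.

(** Sort the solutions by k = a x: then a is a divisor of k and b one of n - k. The terms k = 0 and
    k = n vanish because [sig p 0] is an empty sum. *)
Lemma ssum_conv n p r : \sum_(t <- quads n) (t.1.1%:R ^+ p * t.1.2%:R ^+ r) =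
  \sum_(k < n.+1) (sig p k)%:R * (sig r (n - k)%N)%:R :> F.
Proof.
have sigE q k : (k <= n)%N -> (sig q k)%:R =
    \sum_(1 <= a < n.+1) \sum_(1 <= x < n.+1) (if (a * x == k)%N then a%:R ^+ q else 0) :> F.
  move=> kn; rewrite /sig natr_sum.
  rewrite [RHS](big_cat_nat (n := k.+1)) //= [X in _ = _ + X]big_nat_cond [X in _ = _ + X]big1 ?addr0; last first.
    move=> a /andP[/andP[ka an] _]; rewrite big_nat_cond big1// => x /andP[/andP[x0 _] _].
    by case: eqP => // E; nia.
  rewrite big_mkcond big_nat_cond [RHS]big_nat_cond; apply: eq_bigr => a /andP[/andP[a0 ak] _].
  case: ifP => [/dvdnP[x E]|ndv]; last first.
    rewrite big1// => x _; case: eqP => // E; by rewrite -E dvdn_mulr in ndv.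
  have x0 : (0 < x)%N by lia.
  rewrite (bigD1_seq x) ?iota_uniq ?mem_index_iota//=; last by apply/andP; split=> //; nia.
  rewrite mulnC -E eqxx big1 ?addr0 ?natrX// => y yx; case: eqP => // E'.
  by case/eqP: yx; apply/eqP; rewrite -(eqn_pmul2l a0) E' E mulnC.
have flat (G : nat -> nat -> nat -> nat -> F) :
    \sum_(t <- quads n) G t.1.1 t.1.2 t.2.1 t.2.2 =
    \sum_(1 <= a < n.+1) \sum_(1 <= b < n.+1) \sum_(1 <= x < n.+1) \sum_(1 <= y < n.+1)
      (if (a * x + b * y == n)%N then G a b x y else 0).
  rewrite /quads big_filter big_mkcond /= big_allpairs big_allpairs /index_iota subn1 /=.
  apply: eq_bigr => a _; apply: eq_bigr => b _; rewrite big_allpairs.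
  by apply: eq_bigr => x _; apply: eq_bigr => y _.
rewrite (flat (fun a b _ _ => a%:R ^+ p * b%:R ^+ r)).
transitivity (\sum_(k < n.+1) \sum_(1 <= a < n.+1) \sum_(1 <= b < n.+1) \sum_(1 <= x < n.+1) \sum_(1 <= y < n.+1)
   (if (a * x == k)%N && (b * y == n - k)%N then a%:R ^+ p * b%:R ^+ r else 0 : F)).
  rewrite [RHS]exchange_big; apply: eq_bigr => a _; rewrite [RHS]exchange_big; apply: eq_bigr => b _.
  rewrite [RHS]exchange_big; apply: eq_bigr => x _; rewrite [RHS]exchange_big; apply: eq_bigr => y _.
  case: ifP => [/eqP E|ne]; last first.
    rewrite big1// => k _; case: ifP => // /andP[/eqP E1 /eqP E2].
    by move: ne; rewrite E1 E2 subnKC ?eqxx// -ltnS.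
  have xn : (a * x < n.+1)%N by lia.
  have nE : (n - a * x = b * y)%N by lia.
  rewrite (bigD1 (Ordinal xn)) //= eqxx nE eqxx /= big1 ?addr0// => k kx.
  case: ifP => // /andP[/eqP E1 _]; case/negP: kx; apply/eqP/val_inj; exact/esym.
apply: eq_bigr => k _.
rewrite (sigE p k (leq_ord k)) (sigE r (n - k)%N (leq_subr _ _)).
rewrite mulr_suml; apply: eq_bigr => a _; rewrite mulr_sumr.
apply: eq_bigr => b _; rewrite mulr_suml; apply: eq_bigr => x _; rewrite mulr_sumr.
apply: eq_bigr => y _; by do 2!case: eqP => _ //=; rewrite ?mulr0 ?mul0r.
Qed.

(** All power sums up to exponent 6 in a single identity. The closed forms on the right sum from a =
    0; only c0 notices the missing term, and the correction on the left restores it. *)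
Lemma faulhaber (c0 c1 c2 c3 c4 c5 c6 : F) n :
  \sum_(1 <= a < n) (c0 + c1 * a%:R + c2 * a%:R ^+ 2 + c3 * a%:R ^+ 3 + c4 * a%:R ^+ 4
      + c5 * a%:R ^+ 5 + c6 * a%:R ^+ 6) + c0 * (0 < n)%N%:R =
  let x : F := n%:R in
  c0 * x + c1 * (x ^+ 2 - x) / 2%:R + c2 * (2%:R * x ^+ 3 - 3%:R * x ^+ 2 + x) / 6%:R
  + c3 * (x ^+ 4 - 2%:R * x ^+ 3 + x ^+ 2) / 4%:R
  + c4 * (6%:R * x ^+ 5 - 15%:R * x ^+ 4 + 10%:R * x ^+ 3 - x) / 30%:R
  + c5 * (2%:R * x ^+ 6 - 6%:R * x ^+ 5 + 5%:R * x ^+ 4 - x ^+ 2) / 12%:R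
  + c6 * (6%:R * x ^+ 7 - 21%:R * x ^+ 6 + 21%:R * x ^+ 5 - 7%:R * x ^+ 3 + x) / 42%:R.
Proof.
elim: n => [|[|n] IH] /=.
- by rewrite big_geq//; ring.
- by rewrite big_geq//; field.
rewrite big_nat_recr//= mulr1 addrAC.
move: IH; rewrite /= mulr1 => ->; rewrite -[n.+2%:R]natr1; move: (n.+1%:R : F) => x; by field.
Qed.

End Skoruppa.

(** * The convolutions of divisor sums behind Ramanujan's equations *)

Section SigmaConvolutions.
Variable F : numFieldType.
Local Notation S p n := ((sig p n)%:R : F).
Local Notation scv p r n := (\sum_(k < n.+1) S p k * S r (n - k)%N).

Lemma sum_divisors_odd (c1 c3 c5 c7 : F) n :
  \sum_(1 <= d < n.+1 | (d %| n)%N) (c1 * d%:R + c3 * d%:R ^+ 3 + c5 * d%:R ^+ 5 + c7 * d%:R ^+ 7)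
  = c1 * S 1 n + c3 * S 3 n + c5 * S 5 n + c7 * S 7 n.
Proof.
rewrite !big_split /= -!mulr_sumr /sig !natr_sum.
by do ![congr (_ + _)|congr (_ * _)]; apply: eq_bigr => d _; rewrite natrX ?expr1.
Qed.

Lemma sig0 p : sig p 0 = 0%N. Proof. by rewrite /sig big_geq. Qed.

(** The form in which [quads_shift] is applied: on a + b = d, H is a polynomial in a with
    coefficients depending on d, so the inner sum is evaluated by [faulhaber]. In the last
    hypothesis Q stands for n / d, and everything has to collect into odd powers of d. *)
Lemma quads_poly n (H K : nat -> nat -> F) (c0 c1 c2 c3 c4 c5 c6 : F -> F) (C1 C3 C5 C7 : F) : (0 < n)%N ->
  (forall a b, (0 < a < b)%N -> H a (b - a)%N = K a b) ->
  (forall a b, (0 < b < a)%N -> H (a - b)%N b = K a b) ->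
  (forall a d, (0 < a < d)%N -> H a (d - a)%N =
     let x := d%:R in let y := a%:R in c0 x + c1 x * y + c2 x * y ^+ 2 + c3 x * y ^+ 3 + c4 x * y ^+ 4
      + c5 x * y ^+ 5 + c6 x * y ^+ 6) ->
  (forall (d : nat) (Q : F), Q * d%:R = n%:R ->
     let x : F := d%:R in
     c0 x * x + c1 x * (x ^+ 2 - x) / 2%:R + c2 x * (2%:R * x ^+ 3 - 3%:R * x ^+ 2 + x) / 6%:R
  + c3 x * (x ^+ 4 - 2%:R * x ^+ 3 + x ^+ 2) / 4%:R
  + c4 x * (6%:R * x ^+ 5 - 15%:R * x ^+ 4 + 10%:R * x ^+ 3 - x) / 30%:R
  + c5 x * (2%:R * x ^+ 6 - 6%:R * x ^+ 5 + 5%:R * x ^+ 4 - x ^+ 2) / 12%:R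
  + c6 x * (6%:R * x ^+ 7 - 21%:R * x ^+ 6 + 21%:R * x ^+ 5 - 7%:R * x ^+ 3 + x) / 42%:R - c0 x
  - (Q - 1) * K d d = C1 * x + C3 * x ^+ 3 + C5 * x ^+ 5 + C7 * x ^+ 7) ->
  \sum_(t <- quads n) (H t.1.1 t.1.2 - K t.1.1 t.1.2) = C1 * S 1 n + C3 * S 3 n + C5 * S 5 n + C7 * S 7 n.
Proof.
move=> n0 h1 h2 hp hd; rewrite sumrB (quads_shift n0 h1 h2) -sum_divisors_odd.
rewrite big_nat_cond [RHS]big_nat_cond; apply: eq_bigr => d /andP[/andP[d0 _] dn].
have qE : (n %/ d)%:R * d%:R = n%:R :> F by rewrite -natrM divnK.
apply: etrans (hd d _ qE); congr (_ - _ * _); last first.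
  by rewrite natrB// divn_gt0// dvdn_leq.
have h := @faulhaber F (c0 d%:R) (c1 d%:R) (c2 d%:R) (c3 d%:R) (c4 d%:R) (c5 d%:R) (c6 d%:R) d.
rewrite d0 mulr1 in h; apply: (canRL (addrK _)); apply: etrans h; congr (_ + _).
by apply: eq_big_nat => a /hp.
Qed.

(** The forms a^2 + a b + b^2 and a^2 - a b + b^2 correspond under the shift b -> b - a, and their
    difference is 2 a b. Their powers serve again below. *)
Lemma conv_sig11 n : scv 1 1 n = 5%:R / 12%:R * S 3 n + (1 / 12%:R - n%:R / 2%:R) * S 1 n.
Proof.
case: n => [|n]; first by rewrite big_ord1 !sig0 !mulr0 addr0.
have := @quads_poly n.+1
  (fun a b => a%:R ^+ 2 + a%:R * b%:R + b%:R ^+ 2) (fun a b => a%:R ^+ 2 - a%:R * b%:R + b%:R ^+ 2)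
  (fun x => x ^+ 2) (fun x => - x) (fun=> 1) (fun=> 0) (fun=> 0) (fun=> 0) (fun=> 0)
  (1 / 6%:R - n.+1%:R) (5%:R / 6%:R) 0 0 isT.
move: (n.+1) => {n} n h; rewrite -ssum_conv.
suff -> : \sum_(t <- quads n) (t.1.1%:R ^+ 1 * t.1.2%:R ^+ 1) =
   2%:R^-1 * \sum_(t <- quads n) (t.1.1%:R ^+ 2 + t.1.1%:R * t.1.2%:R + t.1.2%:R ^+ 2
     - (t.1.1%:R ^+ 2 - t.1.1%:R * t.1.2%:R + t.1.2%:R ^+ 2)) :> F.
  rewrite h; first by field.
  - by move=> a b /andP[a0 ab]; rewrite natrB ?(ltnW ab)//; ring.
  - by move=> a b /andP[a0 ab]; rewrite natrB ?(ltnW ab)//; ring.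
  - by move=> a b /andP[a0 ab] /=; rewrite natrB ?(ltnW ab)//; ring.
  - by move=> d Q <- /=; move: (d%:R : F) => x; field.
by rewrite mulr_sumr; apply: eq_bigr => t _; field.
Qed.

Lemma scvC p r n : scv p r n = scv r p n.
Proof.
rewrite (reindex_inj rev_ord_inj) /=; apply: eq_bigr => k _.
by rewrite subSS subKn ?leq_ord// mulrC.
Qed.

(** The squares of the two quadratic forms differ by 4 a b^3 + 4 a^3 b. *)
Lemma conv_sig13 n : scv 1 3 n = 21%:R / 240%:R * S 5 n + (10%:R - 30%:R * n%:R) / 240%:R * S 3 n - S 1 n / 240%:R.
Proof.
case: n => [|n]; first by rewrite big_ord1 !sig0 !mulr0 mul0r subr0 addr0.
have := @quads_poly n.+1
  (fun a b => (a%:R ^+ 2 + a%:R * b%:R + b%:R ^+ 2) ^+ 2) (fun a b => (a%:R ^+ 2 - a%:R * b%:R + b%:R ^+ 2) ^+ 2)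
  (fun x => x ^+ 4) (fun x => - 2%:R * x ^+ 3) (fun x => 3%:R * x ^+ 2) (fun x => - 2%:R * x) (fun=> 1) (fun=> 0) (fun=> 0)
  (- 1 / 30%:R) (1 / 3%:R - n.+1%:R) (7%:R / 10%:R) 0 isT.
move: (n.+1) => {n} n h.
have -> : scv 1 3 n = 8%:R^-1 * (4%:R * scv 1 3 n + 4%:R * scv 3 1 n) by rewrite (scvC 3 1); field.
rewrite -!ssum_conv.
suff -> : 4%:R * \sum_(t <- quads n) (t.1.1%:R ^+ 1 * t.1.2%:R ^+ 3) +
     4%:R * \sum_(t <- quads n) (t.1.1%:R ^+ 3 * t.1.2%:R ^+ 1) =
   \sum_(t <- quads n) ((t.1.1%:R ^+ 2 + t.1.1%:R * t.1.2%:R + t.1.2%:R ^+ 2) ^+ 2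
     - (t.1.1%:R ^+ 2 - t.1.1%:R * t.1.2%:R + t.1.2%:R ^+ 2) ^+ 2) :> F.
  rewrite h; first by field.
  - by move=> a b /andP[a0 ab]; rewrite natrB ?(ltnW ab)//; ring.
  - by move=> a b /andP[a0 ab]; rewrite natrB ?(ltnW ab)//; ring.
  - by move=> a b /andP[a0 ab] /=; rewrite natrB ?(ltnW ab)//; ring.
  - by move=> d Q <- /=; move: (d%:R : F) => x; field.
by rewrite !mulr_sumr -big_split; apply: eq_bigr => t _ /=; ring.
Qed.

(** The squares of a b (a + b) and a b (a - b) correspond under the shift and differ by 4 a^3
    b^3. *)
Lemma conv_sig33 n : scv 3 3 n = (S 7 n - S 3 n) / 120%:R.
Proof.
case: n => [|n]; first by rewrite big_ord1 !sig0 !mulr0 subr0 mul0r.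
have := @quads_poly n.+1
  (fun a b => (a%:R * b%:R * (a%:R + b%:R)) ^+ 2) (fun a b => (a%:R * b%:R * (a%:R - b%:R)) ^+ 2)
  (fun=> 0) (fun=> 0) (fun x => x ^+ 4) (fun x => - 2%:R * x ^+ 3) (fun x => x ^+ 2) (fun=> 0) (fun=> 0)
  0 (- 1 / 30%:R) 0 (1 / 30%:R) isT.
move: (n.+1) => {n} n h; rewrite -ssum_conv.
suff -> : \sum_(t <- quads n) (t.1.1%:R ^+ 3 * t.1.2%:R ^+ 3) =
   4%:R^-1 * \sum_(t <- quads n) ((t.1.1%:R * t.1.2%:R * (t.1.1%:R + t.1.2%:R)) ^+ 2
     - (t.1.1%:R * t.1.2%:R * (t.1.1%:R - t.1.2%:R)) ^+ 2) :> F.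
  rewrite h; first by field.
  - by move=> a b /andP[a0 ab]; rewrite natrB ?(ltnW ab)//; ring.
  - by move=> a b /andP[a0 ab]; rewrite natrB ?(ltnW ab)//; ring.
  - by move=> a b /andP[a0 ab] /=; rewrite natrB ?(ltnW ab)//; ring.
  - by move=> d Q _ /=; move: (d%:R : F) => x; field.
by rewrite mulr_sumr; apply: eq_bigr => t _; field.
Qed.

(** The cubes of the quadratic forms differ by 6 (a b^5 + a^5 b) + 14 a^3 b^3. The last term is
    known from [conv_sig33] and accounts for the fractions 7 / 60. *)
Lemma conv_sig15 n : scv 1 5 n = (20%:R * S 7 n - 42%:R * n%:R * S 5 n + 21%:R * S 5 n + S 1 n) / 504%:R.
Proof.
case: n => [|n]; first by rewrite big_ord1 !sig0 !mulr0 subr0 !addr0 mul0r.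
have := @quads_poly n.+1
  (fun a b => (a%:R ^+ 2 + a%:R * b%:R + b%:R ^+ 2) ^+ 3) (fun a b => (a%:R ^+ 2 - a%:R * b%:R + b%:R ^+ 2) ^+ 3)
  (fun x => x ^+ 6) (fun x => - 3%:R * x ^+ 5) (fun x => 6%:R * x ^+ 4) (fun x => - 7%:R * x ^+ 3)
  (fun x => 6%:R * x ^+ 2) (fun x => - 3%:R * x) (fun=> 1)
  (1 / 42%:R) (- 7%:R / 60%:R) (1 / 2%:R - n.+1%:R) (20%:R / 42%:R + 7%:R / 60%:R) isT.
move: (n.+1) => {n} n h.
have -> : scv 1 5 n = 12%:R^-1 * ((6%:R * scv 1 5 n + 6%:R * scv 5 1 n + 14%:R * scv 3 3 n) - 14%:R * scv 3 3 n).
  by rewrite (scvC 5 1); field.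
rewrite {2}conv_sig33 -!ssum_conv.
suff -> : 6%:R * \sum_(t <- quads n) (t.1.1%:R ^+ 1 * t.1.2%:R ^+ 5) +
     6%:R * \sum_(t <- quads n) (t.1.1%:R ^+ 5 * t.1.2%:R ^+ 1) +
     14%:R * \sum_(t <- quads n) (t.1.1%:R ^+ 3 * t.1.2%:R ^+ 3) =
   \sum_(t <- quads n) ((t.1.1%:R ^+ 2 + t.1.1%:R * t.1.2%:R + t.1.2%:R ^+ 2) ^+ 3
     - (t.1.1%:R ^+ 2 - t.1.1%:R * t.1.2%:R + t.1.2%:R ^+ 2) ^+ 3) :> F.
  rewrite h; first by field.
  - by move=> a b /andP[a0 ab]; rewrite natrB ?(ltnW ab)//; ring.
  - by move=> a b /andP[a0 ab]; rewrite natrB ?(ltnW ab)//; ring.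
  - by move=> a b /andP[a0 ab] /=; rewrite natrB ?(ltnW ab)//; ring.
  - by move=> d Q <- /=; move: (d%:R : F) => x; field.
by rewrite !mulr_sumr -!big_split; apply: eq_bigr => t _ /=; ring.
Qed.

End SigmaConvolutions.

Lemma bernoulli_values : [/\ bernoulli 2 = 1 / 6%:R, bernoulli 4 = - 1 / 30%:R & bernoulli 6 = 1 / 42%:R].
Proof.
have b0 : bernoulli 0 = 1 by [].
have E1 := @bernoulli_sum 1 isT; have E2 := @bernoulli_sum 2 isT; have E3 := @bernoulli_sum 3 isT.
have E4 := @bernoulli_sum 4 isT; have E5 := @bernoulli_sum 5 isT; have E6 := @bernoulli_sum 6 isT.
move: E1 E2 E3 E4 E5 E6; rewrite !big_ord_recl !big_ord0 /= /bump /= !addn0 !add1n b0.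
move: (bernoulli 1) (bernoulli 2) (bernoulli 3) (bernoulli 4) (bernoulli 5) (bernoulli 6).
move=> b1 b2 b3 b4 b5 b6; rewrite !binE.
by split; lra.
Qed.

(** * Ramanujan's differential equations for E2, E4 and E6 *)

Section Ramanujan.
Variable R : realType.
Local Notation C := R[i].
Local Notation Re := complex.Re.
Local Notation Im := complex.Im.
Implicit Types (f g : hfun R) (a b : nat -> C) (x s : R).

Local Notation S p := (fun n => (sig p n)%:R : C).

Definition eis_seq (c : C) p : nat -> C := fun n => cst_seq 1 n + c * (sig p n)%:R.

Lemma subexp_eis_seq c p : subexp (eis_seq c p).
Proof. by apply: subexpD; [exact: subexp_cst_seq|exact/subexpZ/subexp_sig]. Qed.

Lemma fexp_Eis k : (0 < k)%N ->
  fexp (Eis k : hfun R) (eis_seq (- ((4 * k)%:R / ratr (bernoulli (2 * k)))) (2 * k - 1)).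
Proof.
move=> k0; split=> [|x]; first exact: subexp_eis_seq.
split=> [|s s0]; first exact/subexp_tw/subexp_eis_seq.
have [tau E] := line_uhp x s0; rewrite /line -E hextE /Eis.
have nQ : ComplexField.Normc.normc (nome tau) < 1.
  rewrite nome_line ComplexField.Normc.normcM normc_e1 mulr1 E /= expr0n addr0 sqrtr_sqr.
  exact: qnorm_norm.
set c := _ / ratr _.
have sS := @subexp_sig R (2 * k - 1).
rewrite (@csumE _ _ (es (tw x (S (2 * k - 1)%N)) s)); last first.
  have h := ps_ccvg (subexp_tw x sS) (qnorm_norm s0); move/(iffRL (@ccvg_S R (psum (tw x (S (2 * k - 1)%N)) (qnorm s)) _)): h => h.
  have := ccvgD (lambert_cvg (2 * k - 1) nQ) h; rewrite add0r.
  apply: ccvg_eq => N; rewrite [X in _ - X](_ : _ = psum (tw x (S (2 * k - 1)%N)) (qnorm s) N.+1) ?subrK//.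
  by apply: eq_bigr => n _; rewrite nome_line E /= exprMn /tw [X in _ * X]mulrC mulrA.
have E1 : 1 = es (tw x (cst_seq 1)) s.
  by have [_ /(_ x)[_ /(_ s s0)]] := fexp_cst (1 : C); rewrite line_cst.
have h1 := psZ (- c) (subexp_tw x sS) (qnorm_norm s0).
have h2 := psD (subexp_tw x (subexp_cst_seq 1)) (subexpZ (- c) (subexp_tw x sS)) (qnorm_norm s0).
transitivity (es (tw x (cst_seq 1)) s + - c * es (tw x (S (2 * k - 1)%N)) s).
  by rewrite -E1 mulNr.
rewrite /es -h1 -h2.
by apply: eq_ps => n; rewrite /tw /eis_seq mulrDl mulrA.
Qed.

Lemma fexp_E2 : fexp (@E2 R) (eis_seq (- 24%:R) 1).
Proof.
have [b2 _ _] := bernoulli_values.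
have := fexp_Eis (isT : (0 < 1)%N); rewrite b2.
suff -> : (4 * 1)%:R / ratr (1 / 6%:R) = 24%:R :> C by [].
by rewrite fmorph_div rmorph1 !rmorph_nat; field.
Qed.

Lemma fexp_E4 : fexp (@E4 R) (eis_seq 240%:R 3).
Proof.
have [_ b4 _] := bernoulli_values.
have := fexp_Eis (isT : (0 < 2)%N); rewrite b4.
suff -> : - ((4 * 2)%:R / ratr (- 1 / 30%:R)) = 240%:R :> C by [].
by rewrite fmorph_div rmorphN rmorph1 !rmorph_nat; field.
Qed.

Lemma fexp_E6 : fexp (@E6 R) (eis_seq (- 504%:R) 5).
Proof.
have [_ _ b6] := bernoulli_values.
have := fexp_Eis (isT : (0 < 3)%N); rewrite b6.
suff -> : (4 * 3)%:R / ratr (1 / 42%:R) = 504%:R :> C by [].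
by rewrite fmorph_div rmorph1 !rmorph_nat; field.
Qed.

Lemma conv_cst_seq c b n : conv (cst_seq c) b n = c * b n.
Proof. by rewrite /conv big_ord_recl subn0 big1 ?addr0// => i _; rewrite mul0r. Qed.

Lemma convC a b n : conv a b n = conv b a n.
Proof.
rewrite /conv (reindex_inj rev_ord_inj) /=; apply: eq_bigr => k _.
by rewrite subSS subKn ?leq_ord// mulrC.
Qed.

Lemma conv_eis c d p r n : conv (eis_seq c p) (eis_seq d r) n =
  cst_seq 1 n + d * (sig r n)%:R + c * (sig p n)%:R +
  c * d * \sum_(k < n.+1) (sig p k)%:R * (sig r (n - k)%N)%:R.
Proof.
have -> : conv (eis_seq c p) (eis_seq d r) n =
    conv (cst_seq 1) (eis_seq d r) n + c * conv (S p) (eis_seq d r) n.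
  rewrite /conv mulr_sumr -big_split; apply: eq_bigr => k _ /=.
  by rewrite mulrDl mulrA.
rewrite conv_cst_seq mul1r (convC (S p)).
have -> : conv (eis_seq d r) (S p) n = conv (cst_seq 1) (S p) n + d * conv (S r) (S p) n.
  rewrite /conv mulr_sumr -big_split; apply: eq_bigr => k _ /=.
  by rewrite mulrDl mulrA.
by rewrite conv_cst_seq (convC (S r)) /conv; rewrite /eis_seq; ring.
Qed.

Lemma nat_cst_seq n (c : C) : n%:R * cst_seq c n = 0.
Proof. by case: n => [|n]; rewrite ?mul0r//= mulr0. Qed.

(* [hder f g]: g is (1 / 2 pi i) df/dtau *)
Definition hder (f g : hfun R) : Prop := forall x s, 0 < s ->
  cder (line f x) s ((- (2 * pi))%:C * line g x s).

Lemma fexp_hder f g a b : fexp f a -> fexp g b -> (forall n, b n = n%:R * a n) -> hder f g.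
Proof.
move=> [sa fa] [sb gb] bE x s s0; apply: cder_eq (qexp_cder (fa x) s0) _.
have [_ ->] := gb x => //; congr (_ * _); apply: eq_ps => n.
by rewrite /tw bE mulrA.
Qed.

(** Coefficient by coefficient, this is the formula for the convolution of sigma_1 with itself. The
    next two equations follow in the same way from the other convolutions. *)
Lemma hder_E2 : hder (@E2 R) (12%:R^-1 *: (@E2 R * @E2 R - @E4 R)).
Proof.
rewrite -scaleN1r.
apply: (fexp_hder fexp_E2 (fexpZ _ (fexpD (fexpM fexp_E2 fexp_E2) (fexpZ (-1) fexp_E4)))) => n.
rewrite conv_eis conv_sig11 /eis_seq [RHS]mulrDr nat_cst_seq add0r.
by move: (cst_seq 1 n) (n%:R : C) => u v; field.
Qed.

Lemma hder_E4 : hder (@E4 R) (3%:R^-1 *: (@E2 R * @E4 R - @E6 R)).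
Proof.
rewrite -scaleN1r.
apply: (fexp_hder fexp_E4 (fexpZ _ (fexpD (fexpM fexp_E2 fexp_E4) (fexpZ (-1) fexp_E6)))) => n.
rewrite conv_eis conv_sig13 /eis_seq [RHS]mulrDr nat_cst_seq add0r.
by move: (cst_seq 1 n) (n%:R : C) => u v; field.
Qed.

Lemma hder_E6 : hder (@E6 R) (2%:R^-1 *: (@E2 R * @E6 R - @E4 R * @E4 R)).
Proof.
rewrite -scaleN1r.
apply: (fexp_hder fexp_E6 (fexpZ _ (fexpD (fexpM fexp_E2 fexp_E6) (fexpZ (-1) (fexpM fexp_E4 fexp_E4))))) => n.
rewrite !conv_eis conv_sig15 conv_sig33 /eis_seq [RHS]mulrDr nat_cst_seq add0r.
by move: (cst_seq 1 n) (n%:R : C) => u v; field.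
Qed.

End Ramanujan.

(** * The inversion law on the imaginary axis *)

Section RealODE.
Variable R : realType.
Implicit Types (x y z u v w : R -> R) (s : R).

(* the Ramanujan system along a vertical line *)
Definition rama x y z s : Prop :=
  [/\ is_derive s 1 x (- (pi / 6) * (x s ^+ 2 - y s)),
      is_derive s 1 y (- (2 * pi / 3) * (x s * y s - z s))
    & is_derive s 1 z (- pi * (x s * z s - y s ^+ 2))].

Lemma derive_le0_le (g dg : R -> R) (a b : R) : a <= b ->
  (forall s, a <= s <= b -> is_derive s 1 g (dg s)) ->
  (forall s, a <= s <= b -> dg s <= 0) -> g b <= g a.
Proof.
move=> ab h h0.
have h' s : s \in `]a, b[ -> is_derive s 1 g (dg s).
  by rewrite in_itv /= => /andP[s1 s2]; apply: h; rewrite !ltW.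
have [c cab E] := MVT_segment ab h' (is_derive_within h).
rewrite -subr_le0 E mulr_le0_ge0 ?subr_ge0// h0//.
Qed.

Lemma within_bounded (f : R -> R) (a b : R) : a <= b -> {within `[a, b], continuous f} ->
  exists2 M, 0 <= M & forall s, a <= s <= b -> `|f s| <= M.
Proof.
move=> ab cf; have [c _ Hc] := EVT_max ab cf; have [d _ Hd] := EVT_min ab cf.
exists (`|f c| + `|f d|); first by rewrite addr_ge0.
move=> s sab; have s_in : s \in `[a, b] by rewrite in_itv.
have := Hc s s_in; have := Hd s s_in => h1 h2.
rewrite ler_norml; apply/andP; split.
  have := ler_norm (- f d); rewrite normrN; have := normr_ge0 (f c); lra.
have := ler_norm (f c); have := normr_ge0 (f d); lra.
Qed.

Lemma rder_cst (c s : R) : is_derive s 1 (fun=> c) (0 : R).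
Proof. exact: is_derive_cst. Qed.

Lemma rderD (f g : R -> R) (s df dg : R) : is_derive s 1 f df -> is_derive s 1 g dg ->
  is_derive s 1 (fun t => f t + g t) (df + dg).
Proof. by move=> h1 h2; exact: is_deriveD. Qed.

Lemma rderN (f : R -> R) (s df : R) : is_derive s 1 f df -> is_derive s 1 (fun t => - f t) (- df).
Proof. by move=> h; exact: is_deriveN. Qed.

Lemma rderB (f g : R -> R) (s df dg : R) : is_derive s 1 f df -> is_derive s 1 g dg ->
  is_derive s 1 (fun t => f t - g t) (df - dg).
Proof. by move=> h1 h2; exact: is_deriveB. Qed.

Lemma rderM (f g : R -> R) (s df dg : R) : is_derive s 1 f df -> is_derive s 1 g dg ->
  is_derive s 1 (fun t => f t * g t) (df * g s + f s * dg).
Proof.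
move=> hf hg; have h := is_deriveM hf hg; apply: is_derive_eq h _.
by rewrite /GRing.scale /=; ring.
Qed.

Lemma rder_comp (f g : R -> R) (s df dg : R) : is_derive (g s) 1 f df -> is_derive s 1 g dg ->
  is_derive s 1 (fun t => f (g t)) (df * dg).
Proof. by move=> h1 h2; exact: is_derive1_comp. Qed.

Lemma rder_id (s : R) : is_derive s 1 (fun t : R => t) (1 : R).
Proof. exact: is_derive_id. Qed.

(** Gronwall's argument: the squared distance d of the two solutions satisfies d' <= L d, so d e^(-L
    s) decreases from 0. The constant L is generous. Differences of products are split as x z - u w
    = x (z - w) + (x - u) w. *)
Lemma rama_uniq x y z u v w (a b : R) : a <= b ->
  (forall s, a <= s <= b -> rama x y z s) ->
  (forall s, a <= s <= b -> rama u v w s) ->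
  x a = u a -> y a = v a -> z a = w a -> [/\ x b = u b, y b = v b & z b = w b].
Proof.
move=> ab h1 h2 xa ya za.
have bd (f df : R -> R) : (forall s, a <= s <= b -> is_derive s 1 f (df s)) ->
    exists2 M : R, 0 <= M & forall s, a <= s <= b -> `|f s| <= M.
  by move=> h; apply: within_bounded => //; exact: is_derive_within h.
have [Mx Mx0 Hx] : exists2 M : R, 0 <= M & forall s, a <= s <= b -> `|x s| <= M.
  by apply: (bd _ (fun s => - (pi / 6) * (x s ^+ 2 - y s))) => s /h1[].
have [My My0 Hy] : exists2 M : R, 0 <= M & forall s, a <= s <= b -> `|y s| <= M.
  by apply: (bd _ (fun s => - (2 * pi / 3) * (x s * y s - z s))) => s /h1[].
have [Mu Mu0 Hu] : exists2 M : R, 0 <= M & forall s, a <= s <= b -> `|u s| <= M.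
  by apply: (bd _ (fun s => - (pi / 6) * (u s ^+ 2 - v s))) => s /h2[].
have [Mv Mv0 Hv] : exists2 M : R, 0 <= M & forall s, a <= s <= b -> `|v s| <= M.
  by apply: (bd _ (fun s => - (2 * pi / 3) * (u s * v s - w s))) => s /h2[].
have [Mw Mw0 Hw] : exists2 M : R, 0 <= M & forall s, a <= s <= b -> `|w s| <= M.
  by apply: (bd _ (fun s => - pi * (u s * w s - v s ^+ 2))) => s /h2[].
pose M := Mx + My + Mu + Mv + Mw.
pose L := 100 * (pi * (M + 1)).
pose d s := (x s - u s) ^+ 2 + (y s - v s) ^+ 2 + (z s - w s) ^+ 2.
pose dd s := 2 * ((x s - u s) * (- (pi / 6) * (x s ^+ 2 - y s) - - (pi / 6) * (u s ^+ 2 - v s))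
  + (y s - v s) * (- (2 * pi / 3) * (x s * y s - z s) - - (2 * pi / 3) * (u s * v s - w s))
  + (z s - w s) * (- pi * (x s * z s - y s ^+ 2) - - pi * (u s * w s - v s ^+ 2))).
have d0 s : 0 <= d s by rewrite !addr_ge0 ?sqr_ge0.
have ddL s : a <= s <= b -> dd s <= L * d s.
  move=> hs; have := Hx s hs; have := Hy s hs; have := Hu s hs; have := Hv s hs; have := Hw s hs.
  rewrite /dd /d /L.
  have xM : `|x s| <= M -> `|y s| <= M -> `|u s| <= M -> `|v s| <= M -> `|w s| <= M ->
     dd s <= L * d s.
    rewrite /dd /d /L.
    move: (x s) (y s) (z s) (u s) (v s) (w s) => x' y' z' u' v' w' h_x h_y h_u h_v h_w.
    pose A := x' - u'; pose B := y' - v'; pose D := z' - w'.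
    have M0 : 0 <= M by apply: le_trans h_x.
    have p0 : 0 <= pi :> R by exact: pi_ge0.
    set e := A ^+ 2 + B ^+ 2 + D ^+ 2.
    have e0 : 0 <= e by rewrite !addr_ge0 ?sqr_ge0.
    have tm (c p q : R) K : `|c| <= K -> `|p * q| <= e -> c * (p * q) <= K * e.
      move=> cK pq; apply: (le_trans (ler_norm _)); rewrite normrM ler_pM//.
    have prod (p q : R) : p ^+ 2 + q ^+ 2 <= e -> `|p * q| <= e.
      move=> h; rewrite ler_norml; apply/andP; split; nra.
    have AA : `|A * A| <= e by rewrite ler_norml /e; apply/andP; split; nra.
    have BB : `|B * B| <= e by rewrite ler_norml /e; apply/andP; split; nra.
    have DD : `|D * D| <= e by rewrite ler_norml /e; apply/andP; split; nra.
    have AB : `|A * B| <= e by apply: prod; rewrite /e lerDl sqr_ge0.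
    have AD : `|A * D| <= e by apply: prod; rewrite /e; have := sqr_ge0 B; lra.
    have BD : `|B * D| <= e by apply: prod; rewrite /e; have := sqr_ge0 A; lra.
    have cb (c k N : R) : `|c| <= N -> 0 <= k -> `|k * pi * c| <= k * pi * N.
      move=> cN k0; rewrite !normrM (ger0_norm k0) (ger0_norm p0) ler_wpM2l ?mulr_ge0//.
    have nD (p q : R) : `|p| <= M -> `|q| <= M -> `|p + q| <= 2 * M.
      move=> hp hq; apply: (le_trans (ler_normD _ _)); lra.
    rewrite -/A -/B -/D -/e.
    have -> : 2 * (A * (- (pi / 6) * (x' ^+ 2 - y') - - (pi / 6) * (u' ^+ 2 - v'))
  + B * (- (2 * pi / 3) * (x' * y' - z') - - (2 * pi / 3) * (u' * v' - w'))
  + D * (- pi * (x' * z' - y' ^+ 2) - - pi * (u' * w' - v' ^+ 2))) =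
      (3^-1 * pi * - (x' + u')) * (A * A) + (3^-1 * pi * 1) * (A * B)
      + (4 / 3 * pi * - x') * (B * B) + (4 / 3 * pi * - v') * (A * B) + (4 / 3 * pi * 1) * (B * D)
      + (2 * pi * - x') * (D * D) + (2 * pi * - w') * (A * D) + (2 * pi * (y' + v')) * (B * D).
      by rewrite /A /B /D; field.
    have t1 := tm _ _ _ _ (cb (- (x' + u')) 3^-1 (2 * M) _ _) AA.
    have t2 := tm _ _ _ _ (cb 1 3^-1 1 _ _) AB.
    have t3 := tm _ _ _ _ (cb (- x') (4 / 3) M _ _) BB.
    have t4 := tm _ _ _ _ (cb (- v') (4 / 3) M _ _) AB.
    have t5 := tm _ _ _ _ (cb 1 (4 / 3) 1 _ _) BD.
    have t6 := tm _ _ _ _ (cb (- x') 2 M _ _) DD.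
    have t7 := tm _ _ _ _ (cb (- w') 2 M _ _) AD.
    have t8 := tm _ _ _ _ (cb (y' + v') 2 (2 * M) _ _) BD.
    have {}t1 := t1 (eq_ind_r (fun r => r <= 2 * M) (nD _ _ h_x h_u) (normrN _)) ltac:(lra).
    have {}t2 := t2 (eq_ind_r (fun r => r <= 1) (lexx 1) (normr1 R)) ltac:(lra).
    have {}t3 := t3 (eq_ind_r (fun r => r <= M) h_x (normrN _)) ltac:(lra).
    have {}t4 := t4 (eq_ind_r (fun r => r <= M) h_v (normrN _)) ltac:(lra).
    have {}t5 := t5 (eq_ind_r (fun r => r <= 1) (lexx 1) (normr1 R)) ltac:(lra).
    have {}t6 := t6 (eq_ind_r (fun r => r <= M) h_x (normrN _)) ltac:(lra).
    have {}t7 := t7 (eq_ind_r (fun r => r <= M) h_w (normrN _)) ltac:(lra).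
    have {}t8 := t8 (nD _ _ h_y h_v) ltac:(lra).
    have eM : 0 <= pi * M * e by rewrite !mulr_ge0.
    have ep : 0 <= pi * e by rewrite mulr_ge0.
    lra.
  move=> hw hv hu hy hx; apply: xM; rewrite /M; lra.
have dder s : a <= s <= b -> is_derive s 1 d (dd s).
  move=> hs; have [d1 d2 d3] := h1 s hs; have [d4 d5 d6] := h2 s hs.
  have e1 := rderB d1 d4; have e2 := rderB d2 d5; have e3 := rderB d3 d6.
  have h := rderD (rderD (rderM e1 e1) (rderM e2 e2)) (rderM e3 e3).
  have -> : d = fun t => (x t - u t) * (x t - u t) + (y t - v t) * (y t - v t) + (z t - w t) * (z t - w t).
    by apply/funext => t; rewrite /d !expr2.
  by apply: is_derive_eq h _; rewrite /dd; ring.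
have g_le s : a <= s <= b -> is_derive s 1 (fun t => d t * expR (- L * t)) ((dd s - L * d s) * expR (- L * s)).
  move=> hs.
  have hl : is_derive s 1 (fun t : R => - L * t) (- L).
    by apply: is_derive_eq (rderM (rder_cst (- L) s) (rder_id s)) _; rewrite mul0r add0r mulr1.
  have he := rder_comp (is_derive_expR (- L * s)) hl.
  by apply: is_derive_eq (rderM (dder s hs) he) _ => /=; ring.
have da : d a = 0 by rewrite /d xa ya za !subrr !expr0n /= !addr0.
have H := derive_le0_le ab g_le; rewrite da mul0r in H.
have db : d b <= 0.
  have : d b * expR (- L * b) <= 0.
    apply: H => s hs; rewrite mulr_le0_ge0 ?expR_ge0// subr_le0; exact: ddL.
  by rewrite pmulr_lle0 ?expR_gt0.
have : d b == 0 by rewrite eq_le db d0.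
rewrite /d !paddr_eq0 ?addr_ge0 ?sqr_ge0// !sqrf_eq0 !subr_eq0 => /andP[/andP[/eqP -> /eqP ->] /eqP ->].
by [].
Qed.

(* Transport of a solution by the Moebius map s |-> m s with m' = - 1 / d^2. *)
Lemma rama_moebius x y z (s0 b s : R) :
  let d t := 1 + b * (t - s0) in let m t := s0 - (t - s0) / d t in
  d s != 0 -> rama x y z (m s) ->
  rama (fun t => - (d t) ^- 2 * x (m t) + 6 / pi * b / d t)
       (fun t => (d t) ^- 4 * y (m t)) (fun t => - (d t) ^- 6 * z (m t)) s.
Proof.
move=> d m ds [hx hy hz].
have p0 : pi != 0 :> R by rewrite gt_eqF ?pi_gt0.
have h : is_derive s 1 (fun t => t - s0) (1 : R).
  by apply: is_derive_eq (rderB (rder_id s) (rder_cst s0 s)) _; rewrite subr0.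
have hd : is_derive s 1 d b.
  apply: is_derive_eq (rderD (rder_cst 1 s) (rderM (rder_cst b s) h)) _.
  by rewrite mul0r !add0r mulr1.
have hdV : is_derive s 1 (fun t => (d t)^-1) (- b / d s ^+ 2).
  apply: is_derive_eq (is_deriveV ds hd) _; rewrite /GRing.scale /= -exprVn.
  by ring.
have hm : is_derive s 1 m (- (d s) ^- 2).
  apply: is_derive_eq (rderB (rder_cst s0 s) (rderM h hdV)) _.
  by rewrite /d in ds *; field.
have pw n : is_derive s 1 (fun t => (d t) ^- n) (- n%:R * b / d s ^+ n.+1).
  elim: n => [|n IH].
    rewrite oppr0 !mul0r; under eq_fun do rewrite expr0 invr1; exact: rder_cst.
  have -> : (fun t => d t ^- n.+1) = (fun t => d t ^- n * (d t)^-1).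
    by apply/funext => t; rewrite exprSr invfM mulrC.
  apply: is_derive_eq (rderM IH hdV) _.
  by rewrite -[n.+1%:R]natr1 !exprS; field; rewrite ds expf_neq0.
split.
- apply: is_derive_eq (rderD (rderM (rderN (pw 2)) (rder_comp hx hm))
    (rderM (rder_cst (6 / pi * b) s) hdV)) _ => /=.
  by move: (pi : R) p0 (x (m s)) (y (m s)) (d s) ds => P P0 X Y D D0; field; rewrite ?D0 ?P0.
- apply: is_derive_eq (rderM (pw 4) (rder_comp hy hm)) _ => /=.
  by move: (pi : R) p0 (x (m s)) (y (m s)) (z (m s)) (d s) ds => P P0 X Y Z D D0; field; rewrite ?D0 ?P0.
- apply: is_derive_eq (rderM (rderN (pw 6)) (rder_comp hz hm)) _ => /=.
  by move: (pi : R) p0 (x (m s)) (y (m s)) (z (m s)) (d s) ds => P P0 X Y Z D D0; field; rewrite ?D0 ?P0.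
Qed.

End RealODE.

(** * E2, E4 and E6 on the imaginary axis *)

Section InversionLaw.
Variable R : realType.
Local Notation C := R[i].
Local Notation Re := complex.Re.
Local Notation Im := complex.Im.
Implicit Types (s : R).

Lemma Im_es (a : nat -> C) s : (forall n, Im (a n) = 0) -> Im (es a s) = 0.
Proof.
move=> a0; rewrite /es /ps /=; apply: cvg_lim => //.
rewrite (_ : pseries _ _ = fun=> 0); first exact: cvg_cst.
apply/funext => N; rewrite /pseries /series /= big1// => i _.
by rewrite a0 mul0r.
Qed.

Lemma Re_psum_le (a : nat -> C) s N : subexp a -> 0 < s -> (forall n, 0 <= Re (a n)) ->
  \sum_(n < N) Re (a n) * qnorm s ^+ n <= Re (es a s).
Proof.
move=> sa s0 a0; have h := cvg_pseries_subexp (subexp_Re sa) (qnorm_norm s0).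
have -> : \sum_(n < N) Re (a n) * qnorm s ^+ n = pseries (fun n => Re (a n)) (qnorm s) N.
  by rewrite /pseries /series /= big_mkord.
apply: (nondecreasing_cvgn_le _ h).
apply/nondecreasing_seqP => n; rewrite /pseries /series /= big_nat_recr//= lerDl.
by rewrite mulr_ge0 ?a0// exprn_ge0// ltW// qnorm_gt0.
Qed.

Lemma Re_mull (r : R) (z : C) : Re (r%:C * z) = r * Re z.
Proof. by rewrite ReM /= mul0r subr0. Qed.

Definition ax2 s : R := Re (line (@E2 R) 0 s).
Definition ax4 s : R := Re (line (@E4 R) 0 s).
Definition ax6 s : R := Re (line (@E6 R) 0 s).

Lemma axis_es (f : hfun R) a s : fexp f a -> 0 < s -> line f 0 s = es a s.
Proof. by move=> [sa /(_ 0)[_ h]] s0; rewrite h// tw0. Qed.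

Lemma Im_eis_seq (r : R) p n : Im (eis_seq r%:C p n) = 0.
Proof.
rewrite /eis_seq ImD ImM /= mul0r addr0.
have -> : (sig p n)%:R = ((sig p n)%:R : R)%:C :> C by rewrite rmorph_nat.
by case: n => [|n] /=; rewrite mulr0 addr0.
Qed.

Lemma Re_eis_seq (r : R) p n : Re (eis_seq r%:C p n) = (n == 0%N)%:R + r * (sig p n)%:R.
Proof.
rewrite /eis_seq ReD ReM /= mul0r subr0.
have -> : (sig p n)%:R = ((sig p n)%:R : R)%:C :> C by rewrite rmorph_nat.
by case: n.
Qed.

Lemma natC n : (n%:R : C) = (n%:R : R)%:C. Proof. by rewrite rmorph_nat. Qed.

Lemma Re_eis_seq_nat k p n : Re (eis_seq (k%:R : C) p n) = (n == 0%N)%:R + k%:R * (sig p n)%:R.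
Proof. by rewrite natC Re_eis_seq. Qed.

Lemma Re_eis_seq_natN k p n : Re (eis_seq (- k%:R : C) p n) = (n == 0%N)%:R + - k%:R * (sig p n)%:R.
Proof. by rewrite natC -rmorphN Re_eis_seq. Qed.

Lemma Im_eis_seq_nat k p n : Im (eis_seq (k%:R : C) p n) = 0.
Proof. by rewrite natC Im_eis_seq. Qed.

Lemma Im_eis_seq_natN k p n : Im (eis_seq (- k%:R : C) p n) = 0.
Proof. by rewrite natC -rmorphN Im_eis_seq. Qed.

Lemma axis_real s : 0 < s ->
  [/\ line (@E2 R) 0 s = (ax2 s)%:C, line (@E4 R) 0 s = (ax4 s)%:C & line (@E6 R) 0 s = (ax6 s)%:C].
Proof.
move=> s0; rewrite /ax2 /ax4 /ax6.
rewrite (axis_es (fexp_E2 R) s0) (axis_es (fexp_E4 R) s0) (axis_es (fexp_E6 R) s0).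
split; apply: ReIm_inj => //=; apply: Im_es => n.
- by rewrite Im_eis_seq_natN.
- by rewrite Im_eis_seq_nat.
- by rewrite Im_eis_seq_natN.
Qed.

Lemma axis_rama s : 0 < s -> rama ax2 ax4 ax6 s.
Proof.
move=> s0; have [h2 h4 h6] := axis_real s0.
have [d2 _] := hder_E2 0 s0; have [d4 _] := hder_E4 0 s0; have [d6 _] := hder_E6 0 s0.
have nV n : (n%:R^-1 : C) = (n%:R^-1 : R)%:C by rewrite fmorphV rmorph_nat.
split.
- apply: is_derive_eq d2 _; rewrite lineZ lineB lineM h2 h4 nV -!(rmorphM, rmorphB) /=.
  by rewrite -/ax2; move: (pi : R) => P; field.
- apply: is_derive_eq d4 _; rewrite lineZ lineB lineM h2 h4 h6 nV -!(rmorphM, rmorphB) /=.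
  by move: (pi : R) => P; field.
- apply: is_derive_eq d6 _; rewrite lineZ lineB !lineM h2 h4 h6 nV -!(rmorphM, rmorphB) /=.
  by move: (pi : R) => P; field.
Qed.

Lemma sig_ge1 p n : (0 < n)%N -> (1 <= sig p n)%N.
Proof. by move=> n0; rewrite /sig big_ltn_cond// dvd1n exp1n. Qed.

(** All coefficients of E4 of exponent 1, ..., N are at least 1 and q < 1, so each of these N terms
    is at least q^N. *)
Lemma ax4_ge N s : 0 < s -> N%:R * qnorm s ^+ N <= ax4 s.
Proof.
move=> s0; rewrite /ax4 (axis_es (fexp_E4 R) s0).
have q1 := ltW (qnorm_lt1 s0); have q0 := ltW (qnorm_gt0 s).
apply: le_trans (@Re_psum_le _ s N.+1 _ s0 _); last 2 first.
- exact: subexp_eis_seq.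
- by move=> n; rewrite Re_eis_seq_nat addr_ge0 ?mulr_ge0 ?ler0n.
rewrite big_ord_recl Re_eis_seq_nat /= mulr1 -[leLHS]add0r lerD//.
rewrite -[N in N%:R]card_ord mulr_natl -sumr_const; apply: ler_sum => i _.
rewrite Re_eis_seq_nat /= add0r -[leLHS]mul1r ler_pM// ?exprn_ge0//; last first.
  by apply: ler_wiXn2l => //; exact: ltn_ord.
have : (1 : R) <= (sig 3 i.+1)%:R by rewrite ler1n sig_ge1.
by rewrite /bump /= add1n; lra.
Qed.

Lemma ax4_ge1 s : 0 < s -> 1 <= ax4 s.
Proof.
move=> s0; rewrite /ax4 (axis_es (fexp_E4 R) s0).
apply: le_trans (@Re_psum_le _ s 1 _ s0 _); last 2 first.
- exact: subexp_eis_seq.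
- by move=> n; rewrite Re_eis_seq_nat addr_ge0 ?mulr_ge0 ?ler0n.
by rewrite big_ord1 Re_eis_seq_nat /= expr0 mulr1 lerDl mulr_ge0 ?ler0n.
Qed.

Lemma ax4_bounded s0 : 0 < s0 -> exists2 K : R, 0 < K & forall s, s0 <= s -> ax4 s <= K.
Proof.
move=> h; have [K K0 HK] := es_bounded (subexp_eis_seq (240%:R : C) 3) h.
exists (K + 1); first by rewrite ltr_wpDl.
move=> s ss; have s_gt0 : 0 < s by exact: lt_le_trans ss.
rewrite /ax4 (axis_es (fexp_E4 R) s_gt0).
by have := HK s ss; have := Re_le_cn (es (eis_seq (240%:R : C) 3) s); have := ler_norm (Re (es (eis_seq (240%:R : C) 3) s)); lra.
Qed.

Lemma ax4_blowup (M : R) : exists2 e : R, 0 < e & forall s, 0 < s <= e -> M < ax4 s.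
Proof.
have [N HN] : exists N : nat, 2 * (`|M| + 1) <= N.+1%:R.
  exists (Num.trunc (2 * (`|M| + 1))); rewrite ltW// truncnS_gt//.
have c0 : 0 < 2 * pi * N.+1%:R :> R by rewrite mulr_gt0 ?pi2_gt0.
(* Below this height q^(N+1) >= 1 - 2 pi (N + 1) s >= 1/2, and [ax4_ge] gives at least (N + 1) / 2,
   which exceeds M. *)
exists (2^-1 / (2 * pi * N.+1%:R)) => [|s /andP[s0 se]]; first by rewrite divr_gt0.
apply: lt_le_trans (ax4_ge N.+1 s0).
have : 2^-1 <= qnorm s ^+ N.+1.
  rewrite qnormX; apply: le_trans (expR_ge1Dx _).
  move: se; rewrite ler_pdivlMr// => se; rewrite mulNr [_ * s]mulrC; lra.
move=> h; have := ler_norm M; have : 0 < N.+1%:R :> R by [].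
nra.
Qed.

(** E6 tends to 1 as s grows. All its other coefficients are negative, and at a height where q >=
    1/2 the term 504 q alone exceeds 1; the intermediate value theorem does the rest. *)
Lemma ax6_zero : exists2 s0 : R, 0 < s0 & ax6 s0 = 0.
Proof.
pose b := eis_seq (- 504%:R : C) 5.
have bS n : - Re (b n.+1) = 504 * (sig 5 n.+1)%:R.
  by rewrite /b Re_eis_seq_natN /= add0r mulNr opprK.
have sb : subexp b by exact: subexp_eis_seq.
have sbS : subexp (fun n => -1 * b n.+1) by apply/subexpZ/subexp_S.
have E s : 0 < s -> ax6 s = 1 - qnorm s * Re (es (fun n => -1 * b n.+1) s).
  move=> s0; rewrite /ax6 (axis_es (fexp_E6 R) s0) -/b (es_S sb s0) ReD Re_mull.
  have E2 := psZ (-1) (subexp_S sb) (qnorm_norm s0); rewrite /es E2.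
  rewrite mulN1r ReN mulrN opprK /b; congr (_ + _).
  by rewrite Re_eis_seq_natN /= sig0 mulr0 addr0.
have neg : exists2 s1 : R, 0 < s1 < 1 & ax6 s1 <= 0.
  have p0 := pi2_gt0 R; have p1 := pi_ge2 R.
  exists (2^-1 / (2 * pi)); first by rewrite divr_gt0//= ltr_pdivrMr// mul1r; lra.
  have s0 : 0 < 2^-1 / (2 * pi) :> R by rewrite divr_gt0.
  rewrite E// subr_le0.
  have h1 : 504 <= Re (es (fun n => -1 * b n.+1) (2^-1 / (2 * pi))).
    apply: le_trans (@Re_psum_le _ _ 1 sbS s0 _); last first.
      by move=> n; rewrite mulN1r ReN bS mulr_ge0 ?ler0n.
    rewrite big_ord1 mulN1r ReN bS expr0 mulr1.
    have : (1 : R) <= (sig 5 1)%:R by rewrite ler1n sig_ge1.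
    lra.
  have h2 : 2^-1 <= qnorm (2^-1 / (2 * pi)) :> R.
    rewrite /qnorm mulNr mulrCA divff ?gt_eqF// mulr1.
    apply: le_trans (expR_ge1Dx _); lra.
  nra.
have pos : exists2 s2 : R, 1 <= s2 & 0 <= ax6 s2.
  have [K K0 HK] := es_decay sb ltr01.
  exists (1 + K); first by rewrite lerDl.
  have s1 : 1 <= 1 + K by rewrite lerDl.
  have s0 : 0 < 1 + K by rewrite (lt_le_trans ltr01).
  rewrite /ax6 (axis_es (fexp_E6 R) s0) -/b.
  have := HK _ s1; have := Re_le_cn (es b (1 + K) - b 0%N); rewrite ReD ReN.
  have -> : Re (b 0%N) = 1 by rewrite /b Re_eis_seq_natN /= sig0 mulr0 addr0.
  have h : K * qnorm (1 + K) <= 1.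
    apply: (le_trans (ler_wpM2l K0 (qnorm_le_inv s0))).
    by rewrite ler_pdivrMr// mul1r lerDr.
  by rewrite ler_norml; case/andP; lra.
have [s1 /andP[s10 s11] h1] := neg; have [s2 s21 h2] := pos.
have s12 : s1 <= s2 by rewrite ltW// (lt_le_trans s11).
have cont : {within `[s1, s2], continuous ax6}.
  apply: (@is_derive_within _ _ (fun s => - pi * (ax2 s * ax6 s - ax4 s ^+ 2))) => s /andP[hs _].
  by have [] := axis_rama (lt_le_trans s10 hs).
have rng : Num.min (ax6 s1) (ax6 s2) <= 0 <= Num.max (ax6 s1) (ax6 s2).
  by rewrite ge_min h1 le_max h2 orbT.
have [s0 s0i E0] := IVT s12 cont rng.
exists s0 => //; move: s0i; rewrite in_itv /= => /andP[+ _]; exact: lt_le_trans.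
Qed.

(* The Moebius involution around the zero s0 of E6(is) matching the value of E2
   transports the solution to itself; the behaviour at 0 and at infinity forces
   this involution to exchange 0 and infinity. *)
Lemma axis_inversion : exists2 s0 : R, 0 < s0 & forall s, 0 < s ->
  let T := - (s / s0) ^+ 2 in
  [/\ ax2 (s0 ^+ 2 / s) = T * (ax2 s - 6 / (pi * s)),
      ax4 (s0 ^+ 2 / s) = T ^+ 2 * ax4 s
    & ax6 (s0 ^+ 2 / s) = T ^+ 3 * ax6 s].
Proof.
have [s0 s00 Z0] := ax6_zero; exists s0 => //.
have p0 : pi != 0 :> R by rewrite gt_eqF ?pi_gt0.
(* At the fixed point s0 the transport of [rama_moebius] leaves E4 unchanged and changes the sign of
   E6, which is why s0 is a zero of E6. This b solves - E2 + (6 / pi) b = E2 at s0. *)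
pose b := pi / 3 * ax2 s0.
pose d t := 1 + b * (t - s0); pose m t := s0 - (t - s0) / d t.
have transport s : s0 <= s -> (forall t, s0 <= t <= s -> 0 < d t /\ 0 < m t) ->
    [/\ ax2 s = - (d s) ^- 2 * ax2 (m s) + 6 / pi * b / d s,
        ax4 s = (d s) ^- 4 * ax4 (m s) & ax6 s = - (d s) ^- 6 * ax6 (m s)].
  move=> s0s H.
  have ds0 : d s0 = 1 by rewrite /d subrr mulr0 addr0.
  have ms0 : m s0 = s0 by rewrite /m subrr mul0r subr0.
  apply: (@rama_uniq _ ax2 ax4 ax6 (fun t => - (d t) ^- 2 * ax2 (m t) + 6 / pi * b / d t)
    (fun t => (d t) ^- 4 * ax4 (m t)) (fun t => - (d t) ^- 6 * ax6 (m t)) s0 s s0s).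
  - by move=> t /andP[h _]; exact: axis_rama (lt_le_trans s00 h).
  - move=> t /H[dt mt]; apply: rama_moebius; first by rewrite -/(d t) gt_eqF.
    exact: axis_rama mt.
  - by rewrite ds0 ms0 /b !expr1n invr1; move: (pi : R) p0 => P P0; field.
  - by rewrite ds0 ms0 !expr1n invr1 mul1r.
  - by rewrite ds0 ms0 Z0 mulr0.
have b1 : b * s0 = 1.
  apply/eqP; rewrite eq_le; apply/andP; split; rewrite leNgt; apply/negP => hb.
    (* m stays above s0 - 1 / b > 0 while m' tends to 0 *)
    have bpos : 0 < b by rewrite -(pmulr_lgt0 _ s00) (lt_trans ltr01).
    have t0 : 0 < s0 - b^-1 by rewrite subr_gt0 -div1r ltr_pdivrMr// mulrC.
    have [K K0 HK] := ax4_bounded t0.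
    (* Here d s = 1 + K, so that 1 <= E4(s) = E4(m s) / (d s)^4 would give (1 + K)^4 <= K. *)
    pose s := s0 + K / b.
    have dm t : s0 <= t -> 1 <= d t /\ s0 - b^-1 <= m t.
      move=> ht; have d1 : 1 <= d t by rewrite /d lerDl mulr_ge0 ?(ltW bpos)// subr_ge0.
      split=> //; rewrite /m lerD2l lerN2 ler_pdivrMr ?(lt_le_trans ltr01)//.
      by rewrite /d mulrDr mulr1 mulrA mulVf ?gt_eqF// mul1r lerDr invr_ge0 ltW.
    have s0s : s0 <= s by rewrite lerDl divr_ge0// ltW.
    have [|_ E4s _] := transport s s0s.
      move=> t /andP[/dm[h1 h2] _]; split; first exact: lt_le_trans h1.
      exact: lt_le_trans h2.
    have s_gt0 : 0 < s by exact: lt_le_trans s0s.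
    have := ax4_ge1 s_gt0; rewrite E4s.
    have [h1 h2] := dm s s0s; have h3 := HK _ h2.
    have dsE : d s = 1 + K by rewrite /d /s addrAC subrr add0r mulrCA divff ?gt_eqF// mulr1.
    have dpos : 0 < d s by exact: lt_le_trans h1.
    rewrite mulrC ler_pdivlMr ?exprn_gt0// mul1r dsE => h4.
    have : 1 + K <= K.
      apply: le_trans h3; apply: le_trans h4; rewrite -[leLHS]expr1 ler_eXn2l//.
      by rewrite ltrDl.
    by rewrite gerDr ler10.
  (* m reaches arbitrarily small values in bounded time *)
  pose k := Num.min 1 (1 - b * s0).
  have k0 : 0 < k by rewrite lt_min ltr01 subr_gt0.
  have [K K0 HK] := ax4_bounded s00.
  have [e e0 He] := ax4_blowup (K / k ^+ 4).
  pose ep := Num.min e (s0 / 2).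
  have ep0 : 0 < ep by rewrite lt_min e0 divr_gt0.
  have eps : ep < s0 by rewrite gt_min; apply/orP; right; rewrite ltr_pdivrMr// ltr_pMr// ltr1n.
  pose g := s0 - ep.
  have g0 : 0 < g by rewrite subr_gt0.
  have dg : k <= 1 - b * g.
    rewrite /k ge_min; have [b0|b0] := leP b 0; apply/orP.
      by left; rewrite lerDl oppr_ge0 mulr_le0_ge0// ltW.
    by right; rewrite lerD2l lerN2 ler_wpM2l// ltW// /g gtrBl.
  have dg0 : 0 < 1 - b * g by exact: lt_le_trans dg.
  (* This is the solution of m s = ep, with d s = 1 / (1 - b g). Hence E4(ep) = E4(s) / (1 - b g)^4
     <= K / k^4, against the choice of ep. *)
  pose s := s0 + g / (1 - b * g).
  have s0s : s0 <= s by rewrite lerDl divr_ge0// ltW.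
  have dpos t : s0 <= t <= s -> 0 < d t.
    move=> /andP[t1 t2]; rewrite /d; have [b0|b0] := leP b 0; last first.
      by rewrite ltr_pwDl// mulr_ge0 ?subr_ge0// ltW.
    have : b * (s - s0) <= b * (t - s0) by rewrite ler_wnM2l// lerD2r.
    rewrite /s addrAC subrr add0r => h; apply: (lt_le_trans _ (lerD (lexx 1) h)).
    rewrite mulrA -{1}(divff (lt0r_neq0 dg0)) -mulrDl subrK divr_gt0//.
  have mpos t : s0 <= t <= s -> 0 < m t.
    move=> ht; have := dpos t ht => dt; case/andP: ht => t1 t2.
    rewrite /m subr_gt0 ltr_pdivrMr// /d mulrDr mulr1.
    have : (t - s0) * (1 - b * s0) < s0.
      apply: (@le_lt_trans _ _ (g / (1 - b * g) * (1 - b * s0))).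
        rewrite ler_wpM2r ?subr_ge0 ?(ltW hb)//; move: t2; rewrite /s; lra.
      rewrite mulrAC ltr_pdivrMr//; rewrite /g in dg0 *; nra.
    move: (t - s0) => u; lra.
  have [|_ E4s _] := transport s s0s; first by move=> t ht; split; [exact: dpos|exact: mpos].
  have ss : s0 <= s <= s by rewrite s0s lexx.
  have dsE : d s = (1 - b * g)^-1.
    have aux (B G : R) : 1 - B * G != 0 -> 1 + B * (G / (1 - B * G)) = (1 - B * G)^-1.
      by move=> h; field.
    by rewrite /d /s addrAC subrr add0r aux// lt0r_neq0.
  have msE : m s = ep.
    rewrite /m dsE /s addrAC subrr add0r invrK divfK ?gt_eqF// /g opprB addrCA subrr addr0//.
  have := He ep; rewrite ep0 ge_min lexx => /(_ isT).
  rewrite ltNge => /negP; apply.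
  have H := HK s s0s; rewrite E4s msE dsE exprVn invrK in H.
  rewrite ler_pdivlMr ?exprn_gt0// mulrC; apply: le_trans H.
  apply: ler_wpM2r; first exact: le_trans ler01 (ax4_ge1 ep0).
  by rewrite lerXn2r ?nnegrE ?(ltW k0) ?(ltW dg0).
have sneq s : 0 < s -> s != 0 by move=> h; rewrite gt_eqF.
have bE : b = s0^-1 by rewrite -[LHS]mulr1 -(divff (sneq _ s00)) mulrA b1 mul1r.
have dE t : d t = t / s0 by rewrite /d bE mulrBr mulVf ?sneq// addrCA subrr addr0 mulrC.
have mE t : 0 < t -> m t = s0 ^+ 2 / t.
  by move=> t_gt0; rewrite /m dE; have := sneq _ t_gt0; have := sneq _ s00 => h h'; field; rewrite h h'.
have half s : s0 <= s -> [/\ ax2 s = - (s0 / s) ^+ 2 * ax2 (s0 ^+ 2 / s) + 6 / (pi * s),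
   ax4 s = (s0 / s) ^+ 4 * ax4 (s0 ^+ 2 / s) & ax6 s = - (s0 / s) ^+ 6 * ax6 (s0 ^+ 2 / s)].
  move=> ss; have s_gt0 : 0 < s by exact: lt_le_trans ss.
  have [|] := transport s ss.
    move=> t /andP[h _]; have t0 : 0 < t by exact: lt_le_trans h.
    by rewrite dE mE// !divr_gt0// exprn_gt0.
  rewrite mE// dE => -> -> ->.
  have := sneq _ s_gt0; have := sneq _ s00 => h h'.
  move: (ax2 _) (ax4 _) (ax6 _) (pi : R) p0 => X Y Z P P0.
  by rewrite bE; split; field; rewrite ?h ?h' ?P0.
move=> s s_gt0 T; have h := sneq _ s_gt0; have h' := sneq _ s00.
have invol : s0 ^+ 2 / (s0 ^+ 2 / s) = s by field; rewrite h h'.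
have [ss|/ltW ss] := leP s0 s.
  have [e2 e4 e6] := half s ss.
  rewrite /T e2 e4 e6; move: (ax2 _) (ax4 _) (ax6 _) (pi : R) p0 => X Y Z P P0.
  by split; field; rewrite ?h ?h' ?P0.
(* Below s0, the law already known at the reflected point is solved for the values there. *)
have ss' : s0 <= s0 ^+ 2 / s by rewrite ler_pdivlMr// expr2 ler_wpM2l// ltW.
have [e2 e4 e6] := half _ ss'; rewrite invol in e2 e4 e6.
rewrite /T e2 e4 e6; move: (ax2 _) (ax4 _) (ax6 _) (pi : R) p0 => X Y Z P P0.
by split; field; rewrite ?h ?h' ?P0.
Qed.

End InversionLaw.

(** * Regularized iterated integrals *)

Section IteratedIntegralCalculus.
Variable R : realType.
Local Notation C := R[i].
Local Notation Re := complex.Re.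
Local Notation Im := complex.Im.
Local Notation mu := (@lebesgue_measure R).
Implicit Types (f g h : R -> C) (a b s t : R).

Definition wcont (a : R) (f : R -> C) := forall b,
  {within `[a, b], continuous (fun t => Re (f t))} /\ {within `[a, b], continuous (fun t => Im (f t))}.

Lemma within_continuousM (A : set R) (F G : R -> R) :
  {within A, continuous F} -> {within A, continuous G} -> {within A, continuous (fun t => F t * G t)}.
Proof. move=> hf hg x; exact: (@cvgM _ (subspace A) (nbhs (x : subspace A)) _ F G _ _ (hf x) (hg x)). Qed.

Lemma wcontM a f g : wcont a f -> wcont a g -> wcont a (fun t => f t * g t).
Proof.
move=> hf hg b; have [f1 f2] := hf b; have [g1 g2] := hg b; split.
  rewrite (_ : (fun t => Re (f t * g t)) = fun t => Re (f t) * Re (g t) - Im (f t) * Im (g t)); last first.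
    by apply/funext => t; rewrite ReM.
  by apply: within_continuousB; exact: within_continuousM.
rewrite (_ : (fun t => Im (f t * g t)) = fun t => Re (f t) * Im (g t) + Im (f t) * Re (g t)); last first.
  by apply/funext => t; rewrite ImM.
by apply: within_continuousD; exact: within_continuousM.
Qed.

Lemma wcont_ccont a f : (forall t, a <= t -> ccont f t) -> wcont a f.
Proof.
move=> h b; split; apply: continuous_in_subspaceT => t; rewrite inE /= in_itv /= => /andP[ht _].
  by have [] := h t ht.
by have [] := h t ht.
Qed.

Lemma wcont_cst a c : wcont a (fun=> c).
Proof. by apply: wcont_ccont => t _; split; exact: cst_continuous. Qed.

Lemma within_integrable (F : R -> R) a b : {within `[a, b], continuous F} ->
  mu.-integrable `[a, b] (EFin \o F).
Proof. by move=> cF; apply: continuous_compact_integrable => //; exact: segment_compact. Qed.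

Lemma within_Rint_der (F : R -> R) a t : (forall b, {within `[a, b], continuous F}) -> a < t ->
  {for t, continuous F} -> is_derive t 1 (fun u => \int[mu]_(v in `[a, u]) F v)%R (F t).
Proof.
move=> cF at_ Ft.
have t1 : t < t + 1 by rewrite ltrDl.
have [h1 h2] := continuous_FTC1_closed t1 (within_integrable (cF (t + 1))) at_ Ft.
by apply: DeriveDef; [exact: h1|rewrite -derive1E h2].
Qed.

Lemma within_Rint_cont (F : R -> R) a b : {within `[a, b], continuous F} ->
  {within `[a, b], continuous (fun u => \int[mu]_(v in `[a, u]) F v)%R}.
Proof.
move=> cF; have [ab|ba] := leP a b; last first.
  by rewrite set_itv_ge -?ltNge// ; exact: continuous_subspace0.
exact: parameterized_integral_continuous ab (within_integrable cF).
Qed.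

Lemma cintegral_der f a t : wcont a f -> a < t -> ccont f t ->
  cder (fun u => cintegral a u f) t (f t).
Proof.
move=> cf at_ [f1 f2]; split.
  exact: (within_Rint_der (fun b => (cf b).1) at_ f1).
exact: (within_Rint_der (fun b => (cf b).2) at_ f2).
Qed.

Lemma cintegral_wcont f a : wcont a f -> wcont a (fun u => cintegral a u f).
Proof.
move=> cf b; split.
  exact: (within_Rint_cont (cf b).1).
exact: (within_Rint_cont (cf b).2).
Qed.

Lemma Rint_split (F : R -> R) a t b : {within `[a, b], continuous F} -> a <= t <= b ->
  (\int[mu]_(v in `[t, b]) F v = \int[mu]_(v in `[a, b]) F v - \int[mu]_(v in `[a, t]) F v)%R.
Proof.
move=> cF /andP[at_ tb]; have iF := within_integrable cF.
rewrite -Rintegral_itv_obnd_cbnd; last first.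
  by apply: integrableS iF => //; apply: subset_itvr; rewrite bnd_simp.
by rewrite (@Rintegral_itvB _ F (BLeft a) (BRight b) t)// bnd_simp.
Qed.

Lemma cintegral_split f a t b : wcont a f -> a <= t <= b ->
  cintegral t b f = cintegral a b f - cintegral a t f.
Proof.
move=> cf tab; apply: ReIm_inj; rewrite ?(ReD, ImD, ReN, ImN) /=.
  exact: Rint_split (cf b).1 tab.
exact: Rint_split (cf b).2 tab.
Qed.

(** The integrands may differ at the left end point: the path from 0 to tau starts on the boundary
    of the upper half-plane, where a constant function has been extended by 0. *)
Lemma eq_cintegral f g a b : (forall t, a < t <= b -> f t = g t) -> 
  (forall t, wcont t g) -> cintegral a b f = cintegral a b g.
Proof.
move=> fg cg.
have H (F G : R -> R) : (forall t, a < t <= b -> F t = G t) -> {within `[a, b], continuous G} ->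
    (\int[mu]_(v in `[a, b]) F v = \int[mu]_(v in `[a, b]) G v)%R.
  move=> FG cG; have iG := within_integrable cG.
  have iGo : mu.-integrable `]a, b] (EFin \o G).
    by apply: integrableS iG => //; apply: subset_itvr; rewrite bnd_simp.
  have iFo : mu.-integrable `]a, b] (EFin \o F).
    apply: eq_integrable iGo => // t; rewrite inE /= in_itv /= => h.
    by rewrite FG.
  rewrite -(Rintegral_itv_obnd_cbnd iFo) -(Rintegral_itv_obnd_cbnd iGo).
  by apply: eq_Rintegral => t; rewrite inE /= in_itv /= => h; rewrite FG.
by apply: ReIm_inj => /=; apply: H => [t /fg ->//|]; case: (cg a b).
Qed.

(* [simplex_int], with the base point of the integrals moved below the interval:
   this version is differentiable at the upper end point too. *)
Fixpoint sx (a : R) (gs : seq (R -> C)) (t : R) : C :=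
  if gs is g :: gs' then
    cintegral a 1 (fun u => g u * sx a gs' u) - cintegral a t (fun u => g u * sx a gs' u)
  else 1.

Definition allc (a : R) (gs : seq (R -> C)) : Prop :=
  forall g, List.In g gs -> forall t, a <= t -> ccont g t.

Lemma sx_wcont a gs : allc a gs -> wcont a (sx a gs).
Proof.
elim: gs => [|g gs IH] hg /=; first exact: wcont_cst.
have h : wcont a (fun u => g u * sx a gs u).
  apply: wcontM; first by apply: wcont_ccont; apply: hg; left.
  by apply: IH => k hk; apply: hg; right.
move=> b; have [h1 h2] := cintegral_wcont h b; split.
  rewrite (_ : (fun t => Re (cintegral a 1 (fun u => g u * sx a gs u) -
        cintegral a t (fun u => g u * sx a gs u))) =
      fun t => Re (cintegral a 1 (fun u => g u * sx a gs u)) -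
        Re (cintegral a t (fun u => g u * sx a gs u))); last first.
    by apply/funext => t; rewrite ReD ReN.
  by apply: within_continuousB h1 => t; exact: cst_continuous.
rewrite (_ : (fun t => Im (cintegral a 1 (fun u => g u * sx a gs u) -
      cintegral a t (fun u => g u * sx a gs u))) =
    fun t => Im (cintegral a 1 (fun u => g u * sx a gs u)) -
      Im (cintegral a t (fun u => g u * sx a gs u))); last first.
  by apply/funext => t; rewrite ImD ImN.
by apply: within_continuousB h2 => t; exact: cst_continuous.
Qed.

Lemma sx_ccont a gs t : allc a gs -> a < t -> ccont (sx a gs) t.
Proof.
elim: gs t => [|g gs IH] t hg at_ /=; first by split; exact: cst_continuous.
have hgs : allc a gs by move=> k hk; apply: hg; right.
have hw : wcont a (fun u => g u * sx a gs u).
  by apply: wcontM; [apply: wcont_ccont; apply: hg; left|exact: sx_wcont].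
have hc : ccont (fun u => g u * sx a gs u) t.
  by apply: ccontM; [apply: hg; [left|exact: ltW]|exact: IH].
exact: cder_cont (cderB (cder_cst _ t) (cintegral_der hw at_ hc)).
Qed.

Lemma sx_der a g gs t : allc a (g :: gs) -> a < t ->
  cder (sx a (g :: gs)) t (- (g t * sx a gs t)).
Proof.
move=> hg at_; have hgs : allc a gs by move=> k hk; apply: hg; right.
have hw : wcont a (fun u => g u * sx a gs u).
  by apply: wcontM; [apply: wcont_ccont; apply: hg; left|exact: sx_wcont].
have hc : ccont (fun u => g u * sx a gs u) t.
  by apply: ccontM; [apply: hg; [left|exact: ltW]|exact: sx_ccont].
by apply: cder_eq (cderB (cder_cst _ t) (cintegral_der hw at_ hc)) _; rewrite sub0r.
Qed.

Lemma sx_1 a g gs : sx a (g :: gs) 1 = 0.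
Proof. by rewrite /= subrr. Qed.

Lemma eq_cintegral_cc f g a b : (forall t, a <= t <= b -> f t = g t) -> cintegral a b f = cintegral a b g.
Proof.
move=> fg; apply: ReIm_inj => /=; apply: eq_Rintegral => t;
  by rewrite inE /= in_itv /= => h; rewrite fg.
Qed.

Lemma simplex_sx a gs t : allc a gs -> a <= t <= 1 -> simplex_int gs t = sx a gs t.
Proof.
elim: gs t => [|g gs IH] t hg tt //=.
have hgs : allc a gs by move=> k hk; apply: hg; right.
have hw : wcont a (fun u => g u * sx a gs u).
  by apply: wcontM; [apply: wcont_ccont; apply: hg; left|exact: sx_wcont].
rewrite -(cintegral_split hw tt); apply: eq_cintegral_cc => u /andP[tu u1].
by rewrite IH// u1 andbT; case/andP: tt => h _; exact: le_trans tu.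
Qed.

Lemma cderX f s l n : cder f s l -> cder (fun t => f t ^+ n) s (n%:R * f s ^+ n.-1 * l).
Proof.
move=> h; elim: n => [|n IH].
  by rewrite !mul0r; under eq_fun do rewrite expr0; exact: cder_cst.
under eq_fun do rewrite exprS.
apply: cder_eq (cderM h IH) _ => /=.
by case: n {IH} => [|n] /=; rewrite ?exprS ?expr0 -?[n.+2%:R]natr1; ring.
Qed.

Lemma cder_real_id s : cder (fun t : R => t%:C) s 1.
Proof. by apply: cder_real; exact: is_derive_id. Qed.

(* Iterated integrals of constants; the integrands are only prescribed on ]0, 1]. *)
Lemma simplex_cst (gs : seq (R -> C)) (cs : seq C) t :
  size gs = size cs ->
  (forall i u, (i < size gs)%N -> 0 < u <= 1 -> nth (fun=> 0) gs i u = cs`_i) ->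
  0 <= t <= 1 ->
  simplex_int gs t = (\prod_(c <- cs) c) * (1 - t)%:C ^+ size cs / (size cs)`!%:R.
Proof.
elim: gs cs t => [|g gs IH] [|c cs] t //= => [_ _ _|[sz] h t01].
  by rewrite big_nil expr0 fact0 !mul1r invr1.
pose P u : C := (\prod_(c <- cs) c) * (1 - u)%:C ^+ size cs / (size cs)`!%:R.
pose Q u : C := (\prod_(c <- c :: cs) c) * (1 - u)%:C ^+ (size cs).+1 / ((size cs).+1)`!%:R.
have dl u : cder (fun v : R => (1 - v)%:C) u (-1).
  have := cderB (cder_cst (1 : C) u) (cder_real_id u); rewrite sub0r.
  by apply: (@cder_gt _ (u - 1)) => [|v _]; rewrite ?rmorphB ?rmorph1// gtrBl.
have dP u : exists l, cder P u l.
  by eexists; exact: cderM (cderM (cder_cst _ u) (cderX _ (dl u))) (cder_cst _ u).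
have f0 n : (n`!%:R : C) != 0 by rewrite pnatr_eq0 -lt0n fact_gt0.
have dQ u : cder Q u (- (c * P u)).
  rewrite /Q; under eq_fun do rewrite mulrAC.
  apply: cder_eq (cderZ _ (cderX (size cs).+1 (dl u))) _.
  rewrite big_cons factS natrM /P /=; have := f0 (size cs).
  have : ((size cs).+1%:R : C) != 0 by rewrite pnatr_eq0.
  move: ((size cs).+1%:R : C) ((size cs)`!%:R : C) => n1 n2 h1 h2.
  by rewrite invfM; move: (_ ^+ _) (\prod_(_ <- _) _) => y z; field; rewrite h1 h2.
have cP a : wcont a (fun u => c * P u).
  apply: wcont_ccont => u _; have [l hl] := dP u.
  exact: cder_cont (cderZ c hl).
transitivity (cintegral t 1 (fun u => c * P u)).
  apply: eq_cintegral => // u /andP[tu u1]; case/andP: t01 => t0 t1.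
  have u0 : 0 < u by exact: le_lt_trans tu.
  have -> : g u = c by apply: (h 0%N u isT); rewrite u0.
  by congr (_ * _); apply: IH => [//|i v hi hv|]; [exact: (h i.+1 v)|rewrite (ltW u0)].
(* The auxiliary base point t - 1 puts t in the interior, where an integral can be differentiated in
   its upper bound. *)
have tt : t - 1 <= t <= 1 by rewrite gerBl ler01; case/andP: t01.
rewrite (cintegral_split (cP (t - 1)) tt).
have E u : t <= u -> cintegral (t - 1) u (fun u => c * P u) + Q u = 
                     cintegral (t - 1) t (fun u => c * P u) + Q t.
  move=> tu; apply/esym; apply: (@cder0_eq _ (fun v => cintegral (t - 1) v (fun u => c * P u) + Q v) _ _ tu).
  move=> v /andP[tv _]; have [l hl] := dP v.
  have t1v : t - 1 < v by apply: lt_le_trans tv; rewrite gtrBl.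
  have hc : ccont (fun u => c * P u) v by exact: cder_cont (cderZ c hl).
  by apply: cder_eq (cderD (cintegral_der (cP (t - 1)) t1v hc) (dQ v)) _; rewrite subrr.
have := E 1 (andP t01).2; rewrite {1}/Q subrr expr0n /= mulr0 mul0r addr0 => ->.
by rewrite addrAC subrr add0r.
Qed.

End IteratedIntegralCalculus.

(** * The triangular system on a vertical line *)

Section RegularizedIntegrals.
Variable R : realType.
Local Notation C := R[i].
Local Notation Re := complex.Re.
Local Notation Im := complex.Im.
Local Notation ii := (0 +i* 1 : C).
Implicit Types (s t : R) (z : C).

Definition expo n z : C := z ^+ n / n`!%:R.

Lemma fact_neq0 n : (n`!%:R : C) != 0.
Proof. by rewrite pnatr_eq0 -lt0n fact_gt0. Qed.

Lemma expo0 z : expo 0 z = 1. Proof. by rewrite /expo expr0 fact0 divr1. Qed.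

Lemma expoD n (z z' : C) : \sum_(i < n.+1) expo i z * expo (n - i) z' = expo n (z + z').
Proof.
rewrite /expo addrC exprDn mulr_suml; apply: eq_bigr => i _.
have le_in : (i <= n)%N by rewrite -ltnS.
have E : ('C(n, i)%:R : C) * (i`!%:R * (n - i)`!%:R) = n`!%:R.
  by rewrite -!natrM bin_fact.
rewrite -[_ *+ 'C(n, i)]mulr_natr -E.
have := fact_neq0 i; have := fact_neq0 (n - i).
have : ('C(n, i)%:R : C) != 0 by rewrite pnatr_eq0 -lt0n bin_gt0.
move: ('C(n, i)%:R : C) (i`!%:R : C) ((n - i)`!%:R : C) => u v w hu hv hw.
by field; rewrite hu hv hw.
Qed.

Lemma expo_der n (f : R -> C) s l : cder f s l ->
  cder (fun t => expo n.+1 (f t)) s (expo n (f s) * l).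
Proof.
move=> h; rewrite /expo.
apply: cder_eq (cderM (cderX n.+1 h) (cder_cst (n.+1`!%:R^-1 : C) s)) _.
rewrite mulr0 addr0 factS natrM /=.
have := fact_neq0 n; have : (n.+1%:R : C) != 0 by rewrite pnatr_eq0.
move: (n.+1%:R : C) (n`!%:R : C) => u v hu hv.
by field; rewrite hu hv.
Qed.

Lemma expr_fact_le_expR n (x : R) : 0 <= x -> x ^+ n / n`!%:R <= expR x.
Proof.
move=> x0; case: n => [|n].
  by rewrite expr0 fact0 divr1 (le_trans _ (expR_ge1Dx x))// lerDl.
by apply: le_trans (expR_ge1Dxn n x0); rewrite lerDr.
Qed.

Lemma cn_expo n z (x : R) : cn z <= x -> cn (expo n z) <= expR x.
Proof.
move=> zx; have x0 : 0 <= x := le_trans (cn_ge0 _) zx.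
apply: le_trans (expr_fact_le_expR n x0).
have -> : expo n z = (n`!%:R^-1 : R)%:C * z ^+ n.
  by rewrite /expo mulrC fmorphV rmorph_nat.
rewrite cnMR ger0_norm ?invr_ge0 ?ler0n// mulrC ler_wpM2r ?invr_ge0 ?ler0n//.
by apply: le_trans (cnX _ _) _; rewrite lerXn2r ?nnegrE ?cn_ge0.
Qed.

Definition nice (f : hfun R) : Prop := exists a, fexp f a.
Definition letter := {f : hfun R | nice f}.
Implicit Types (i : letter) (w u v : seq letter).

Definition c0 i : C := fourier (sval i) 0.

Lemma letter_fexp i : fexp (sval i) (fourier (sval i)).
Proof. by case: i => f [a fa] /=; rewrite (fexp_fourier fa). Qed.

Definition linf i : letter := exist _ (finf (sval i)) (ex_intro _ _ (fexp_cst (c0 i))).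

Lemma line_cder i x s : 0 < s -> exists l, cder (line (sval i) x) s l.
Proof. by move=> s0; eexists; exact: qexp_cder ((letter_fexp i).2 x) s0. Qed.

Lemma line_ccont i x s : 0 < s -> ccont (line (sval i) x) s.
Proof. by move=> /(line_cder i x)[l]; exact: cder_cont. Qed.

Lemma line_decay i x a : 0 < a ->
  exists2 K, 0 <= K & forall s, a <= s -> cn (line (sval i) x s - c0 i) <= K * qnorm s.
Proof.
move=> a0; have [sa H] := (letter_fexp i).2 x.
have [K K0 HK] := es_decay sa a0; exists K => // s sa'.
by rewrite H ?(lt_le_trans a0)//; have := HK _ sa'; rewrite tw_at0.
Qed.

(** As 2 pi >= 2, q supplies two factors e^(-s): one can absorb the growth of a polynomial in s, the
    other remains as decay. *)
Lemma qnorm_le_expRN2 s : 0 <= s -> qnorm s <= expR (- s) * expR (- s).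
Proof.
move=> s0; rewrite -expRD /qnorm ler_expR; have := pi_ge2 R; nra.
Qed.

(* The iterated integral from 0 to z of the constant terms of w. *)
Definition E w z : C := (\prod_(i <- w) c0 i) * expo (size w) z.

Lemma E_nil z : E [::] z = 1. Proof. by rewrite /E big_nil expo0 mulr1. Qed.

Lemma E_der i w (f : R -> C) s l : cder f s l ->
  cder (fun t => E (i :: w) (f t)) s (c0 i * E w (f s) * l).
Proof.
move=> h; apply: cder_eq (cderZ _ (expo_der (size w) h)) _.
by rewrite /E big_cons; ring.
Qed.

Lemma cn_E w z (x : R) : cn z <= x -> cn (E w z) <= cn (\prod_(i <- w) c0 i) * expR x.
Proof.
by move=> zx; apply: le_trans (cnM _ _) _; rewrite ler_wpM2l ?cn_ge0 ?cn_expo.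
Qed.

(* The deconcatenation product. *)
Definition dec (A B : seq letter -> C) w : C :=
  \sum_(k < (size w).+1) A (take k w) * B (drop k w).

Lemma dec_cons A B i w :
  dec A B (i :: w) = A [::] * B (i :: w) + dec (fun u => A (i :: u)) B w.
Proof. by rewrite /dec big_ord_recl /=. Qed.

Lemma dec_nil A B : dec A B [::] = A [::] * B [::].
Proof. by rewrite /dec big_ord_recl big_ord0 addr0. Qed.

(** For constant integrands, composition of paths is the binomial formula. *)
Lemma dec_E z z' w : dec (E^~ z) (E^~ z') w = E w (z + z').
Proof.
rewrite /dec /E -expoD mulr_sumr; apply: eq_bigr => k _.
have -> : \prod_(i <- w) c0 i = (\prod_(i <- take k w) c0 i) * \prod_(i <- drop k w) c0 i.
  by rewrite -big_cat cat_take_drop.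
rewrite size_drop size_takel; last by rewrite -ltnS.
by ring.
Qed.

Lemma decay_le0 (d K a : R) : 0 <= K -> (forall s, a < s -> d <= K * expR (- s)) -> d <= 0.
Proof.
move=> K0 h; rewrite leNgt; apply/negP => d0.
have kd : 0 <= K / d by rewrite divr_ge0// ltW.
pose s := `|a| + K / d + 1.
have as_ : a < s by have := ler_norm a; rewrite /s; lra.
have s0 : 0 < s by have := normr_ge0 a; rewrite /s; lra.
have := h s as_; rewrite expRN ler_pdivlMr ?expR_gt0// leNgt => /negP; apply.
apply: (@lt_le_trans _ _ (d * s)).
  by rewrite mulrC -ltr_pdivrMr// /s; have := normr_ge0 a; lra.
by rewrite ler_wpM2l ?(ltW d0)// (le_trans _ (expR_ge1Dx s))// lerDr.
Qed.

Lemma decaying_const (f : R -> C) (a K : R) : 0 <= K ->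
  (forall s, a < s -> cder f s 0) -> (forall s, a < s -> cn (f s) <= K * expR (- s)) ->
  forall s, a < s -> f s = 0.
Proof.
move=> K0 df hf s as_; apply/cn_eq0/eqP; rewrite eq_le cn_ge0 andbT.
apply: (@decay_le0 _ K s) => // t st; rewrite (@cder0_eq _ f s t (ltW st)).
  by apply: hf; exact: lt_trans st.
by move=> r /andP[sr _]; apply: df; exact: lt_le_trans sr.
Qed.

(** F + K e^(-s) is nonincreasing and F - K e^(-s) nondecreasing, so they enclose a common limit. *)
Lemma decaying_limit (F h : R -> R) (b K : R) : 0 <= K ->
  (forall s, b < s -> is_derive s 1 F (h s)) -> (forall s, b < s -> `|h s| <= K * expR (- s)) ->
  exists L, forall s, b < s -> `|F s - L| <= K * expR (- s).
Proof.
move=> K0 dF hK.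
have de t : is_derive t 1 (fun t : R => K * expR (- t)) (- (K * expR (- t))).
  apply: is_derive_eq (rderM (rder_cst K t) (rder_comp (is_derive_expR (- t)) (rderN (rder_id t)))) _.
  by rewrite mul0r add0r mulrN mulr1 mulrN.
have dec1 s t : b < s -> s <= t -> F t + K * expR (- t) <= F s + K * expR (- s).
  move=> bs st; apply: (derive_le0_le st (fun r (hr : s <= r <= t) =>
    rderD (dF r (lt_le_trans bs (andP hr).1)) (de r))) => r /andP[sr _].
  by rewrite subr_le0 (le_trans (ler_norm _))// hK// (lt_le_trans bs).
have dec2 s t : b < s -> s <= t -> - F t + K * expR (- t) <= - F s + K * expR (- s).
  move=> bs st; apply: (derive_le0_le st (fun r (hr : s <= r <= t) =>
    rderD (rderN (dF r (lt_le_trans bs (andP hr).1))) (de r))) => r /andP[sr _].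
  by rewrite subr_le0 (le_trans (ler_norm _))// normrN hK// (lt_le_trans bs).
have e0 (t : R) : 0 <= K * expR (- t) by rewrite mulr_ge0 ?expR_ge0.
have lb s : b < s -> lbound [set F t + K * expR (- t) | t in [set t | b < t]] (F s - K * expR (- s)).
  move=> bs _ [t /= bt <-]; have [st|/ltW ts] := leP s t.
    by have := dec2 _ _ bs st; have := e0 t; lra.
  by have := dec1 _ _ bt ts; have := e0 s; lra.
exists (inf [set F t + K * expR (- t) | t in [set t | b < t]]) => s bs.
have h1 : F s - K * expR (- s) <= inf [set F t + K * expR (- t) | t in [set t | b < t]].
  by apply: lb_le_inf (lb s bs); exists (F s + K * expR (- s)), s.
have h2 : inf [set F t + K * expR (- t) | t in [set t | b < t]] <= F s + K * expR (- s).
  apply: ge_inf; last by exists s.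
  by exists (F s - K * expR (- s)); exact: lb.
by rewrite ler_norml; lra.
Qed.

Lemma ccontD (f g : R -> C) s : ccont f s -> ccont g s -> ccont (fun t => f t + g t) s.
Proof.
move=> [f1 f2] [g1 g2]; split.
  rewrite (_ : (fun t => Re (f t + g t)) = fun t => Re (f t) + Re (g t)); last first.
    by apply/funext => t; rewrite ReD.
  exact: continuousD.
rewrite (_ : (fun t => Im (f t + g t)) = fun t => Im (f t) + Im (g t)); last first.
  by apply/funext => t; rewrite ImD.
exact: continuousD.
Qed.

Lemma ccontZ c (f : R -> C) s : ccont f s -> ccont (fun t => c * f t) s.
Proof. by move=> hf; apply: ccontM => //; exact: cder_cont (cder_cst c s). Qed.

Definition is_decprim (a : R) (h H : R -> C) : Prop := (forall s, a < s -> cder H s (h s)) /\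
  exists2 K, 0 <= K & forall s, a < s -> cn (H s) <= K * expR (- s).

(** On each ]b, oo[ with b > a, the integral from b minus its limit is a decaying primitive. Such a
    primitive is unique, so these functions agree on overlaps and glue to one on ]a, oo[. *)
Lemma decprim_exists (h : R -> C) (a K : R) : 0 <= K -> (forall s, a < s -> ccont h s) ->
  (forall s, a < s -> cn (h s) <= K * expR (- s)) -> exists H, is_decprim a h H.
Proof.
move=> K0 ch hK.
have loc b : a < b -> exists H : R -> C, (forall s, b < s -> cder H s (h s)) /\
    forall s, b < s -> cn (H s) <= (K + K) * expR (- s).
  move=> ab; pose G s := cintegral b s h.
  have wh : wcont b h by apply: wcont_ccont => t bt; apply: ch; exact: lt_le_trans bt.
  have dG s : b < s -> cder G s (h s).
    by move=> bs; apply: cintegral_der => //; apply: ch; exact: lt_trans bs.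
  have [L1 H1] := decaying_limit K0 (fun s bs => (dG s bs).1)
    (fun s bs => le_trans (Re_le_cn _) (hK s (lt_trans ab bs))).
  have [L2 H2] := decaying_limit K0 (fun s bs => (dG s bs).2)
    (fun s bs => le_trans (Im_le_cn _) (hK s (lt_trans ab bs))).
  exists (fun s => G s - (L1 +i* L2)); split=> s bs.
    by apply: cder_eq (cderB (dG s bs) (cder_cst _ s)) _; rewrite subr0.
  by rewrite /cn ReD ImD ReN ImN mulrDl /= lerD ?H1 ?H2.
have /choice[H HH] : forall b, exists H : R -> C, a < b -> (forall s, b < s -> cder H s (h s)) /\
    forall s, b < s -> cn (H s) <= (K + K) * expR (- s).
  by move=> b; case: (ltP a b) => [/loc[H HH]|_]; [exists H|exists (fun=> 0)].
have glue b b' s : a < b -> a < b' -> b < s -> b' < s -> H b s = H b' s.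
  move=> ab ab' bs bs'; apply/eqP; rewrite -subr_eq0; apply/eqP.
  have [d1 e1] := HH b ab; have [d2 e2] := HH b' ab'.
  apply: (@decaying_const (fun s => H b s - H b' s) (Num.max b b') (K + K + (K + K))).
  - by rewrite !addr_ge0.
  - move=> t; rewrite gt_max => /andP[bt bt'].
    by apply: cder_eq (cderB (d1 t bt) (d2 t bt')) _; rewrite subrr.
  - move=> t; rewrite gt_max => /andP[bt bt']; rewrite mulrDl.
    by rewrite (le_trans (cnB _ _))// lerD ?e1 ?e2.
  - by rewrite gt_max bs.
have mid s : a < s -> a < (a + s) / 2 /\ (a + s) / 2 < s by move=> h'; lra.
exists (fun s => H ((a + s) / 2) s); split; last first.
  exists (K + K); first exact: addr_ge0.
  by move=> s /mid[m1 m2]; exact: (HH _ m1).2.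
move=> s as_; have [m1 m2] := mid s as_.
apply: (cder_gt m2 _ ((HH _ m1).1 s m2)) => t mt.
have at_ : a < t by exact: lt_trans mt.
by have [n1 n2] := mid t at_; exact: glue.
Qed.

Section Line.
Variables (x a : R).
Hypothesis a0 : 0 < a.

(* [Sys] and [Asy] characterize the regularized iterated integrals from x + i s to i oo,
   with the constant terms integrated up to o; [sysm] is this solution. *)
Definition Sys (m : seq letter -> R -> C) : Prop := (forall s, m [::] s = 1) /\
  forall i w s, a < s -> cder (m (i :: w)) s (- (ii * line (sval i) x s * m w s)).

Definition Asy (o : C) (m : seq letter -> R -> C) : Prop := forall w, exists2 K, 0 <= K &
  forall s, a < s -> cn (m w s - E w (o - (x +i* s))) <= K * expR (- s).

Lemma path_der o s : cder (fun t : R => o - (x +i* t)) s (- ii).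
Proof.
have h := cderB (cder_cst (o - x%:C) s) (cderZ ii (cder_real_id s)).
rewrite sub0r mulr1 in h; move: h; congr (cder _ _ _); apply/funext => t.
by apply: ReIm_inj; rewrite !(ReD, ImD, ReN, ImN, ReM, ImM) /=; ring.
Qed.

Lemma Sys_uniq o m m' : Sys m -> Asy o m -> Sys m' -> Asy o m' ->
  forall w s, a < s -> m w s = m' w s.
Proof.
move=> [m0 dm] am [m0' dm'] am'; elim=> [|i w IH] s as_; first by rewrite m0 m0'.
have [K K0 HK] := am (i :: w); have [K' K0' HK'] := am' (i :: w).
apply/eqP; rewrite -subr_eq0; apply/eqP.
apply: (@decaying_const (fun s => m (i :: w) s - m' (i :: w) s) a (K + K')) => //.
- exact: addr_ge0.
- by move=> t at_; apply: cder_eq (cderB (dm i w t at_) (dm' i w t at_)) _; rewrite IH// subrr.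
move=> t at_; rewrite mulrDl; apply: le_trans (lerD (HK t at_) (HK' t at_)).
by rewrite (le_trans _ (cnB _ _))// opprB addrA subrK.
Qed.

(** The solution is sought as its polynomial part plus a decaying correction; the function under
    [is_decprim] is the right-hand side of the system minus the derivative of the polynomial part.
    That [xget] finds a primitive is the content of [sysm_step]. *)
Fixpoint sysm o w : R -> C :=
  if w is i :: w' then fun s => E (i :: w') (o - (x +i* s)) +
    xget (fun=> 0) (is_decprim a (fun s =>
      - ii * (line (sval i) x s * sysm o w' s - c0 i * E w' (o - (x +i* s))))) s
  else fun=> 1.

Lemma cn_path o (s : R) : 0 <= s -> cn (o - (x +i* s)) <= (cn o + `|x|) + s.
Proof.
move=> s0; apply: (le_trans (cnB _ _)).
have -> : cn (x +i* s) = `|x| + s by rewrite /cn /= (ger0_norm s0).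
by rewrite addrA.
Qed.

Lemma sysm_step o i w (m : R -> C) (K : R) : 0 <= K -> (forall s, a < s -> ccont m s) ->
  (forall s, a < s -> cn (m s - E w (o - (x +i* s))) <= K * expR (- s)) ->
  exists H, is_decprim a (fun s => - ii * (line (sval i) x s * m s - c0 i * E w (o - (x +i* s)))) H.
Proof.
move=> K0 cm hm; have [K1 K10 HK1] := line_decay i x a0.
pose K3 := cn (\prod_(i <- w) c0 i) * expR (cn o + `|x|).
have K30 : 0 <= K3 by rewrite mulr_ge0 ?cn_ge0 ?expR_ge0.
have cE s : ccont (fun s => E w (o - (x +i* s))) s.
  case: w {hm K3 K30} => [|j w]; last exact: cder_cont (E_der j w (path_der o s)).
  by under eq_fun do rewrite E_nil; exact: cder_cont (cder_cst _ s).
apply: (@decprim_exists _ a (K1 * K + K1 * K3 + cn (c0 i) * K)).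
- by rewrite !addr_ge0 ?mulr_ge0 ?cn_ge0.
- move=> s as_; apply: ccontZ; apply: ccontD.
    by apply: ccontM; [exact: line_ccont (lt_trans a0 as_)|exact: cm].
  rewrite (_ : (fun t => - (c0 i * E w (o - (x +i* t)))) = fun t => (- c0 i) * E w (o - (x +i* t))).
    exact: ccontZ.
  by apply/funext => t; rewrite mulNr.
move=> s as_; have s0 : 0 <= s by rewrite ltW// (lt_trans a0).
set e := expR (- s); have e0 : 0 <= e by exact: expR_ge0.
have e1 : e <= 1 by rewrite /e -expR0 ler_expR oppr_le0.
(* One of the two factors e will be spent on the polynomial p, which grows at most like e^s; the
   other gives the required decay. *)
have hl : cn (line (sval i) x s - c0 i) <= K1 * (e * e).
  by rewrite (le_trans (HK1 s (ltW as_)))// ler_wpM2l// qnorm_le_expRN2.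
have hp : cn (E w (o - (x +i* s))) * e <= K3.
  rewrite -ler_pdivlMr ?expR_gt0// -expRN opprK /K3 -mulrA -expRD.
  exact: cn_E (cn_path o s0).
have hd := hm s as_; move: hl hp hd; rewrite -/e.
set l := line _ _ _; set p := E w _ => hl hp hd.
have -> : - ii * (l * m s - c0 i * p) =
    - ii * ((l - c0 i) * (m s - p) + (l - c0 i) * p + c0 i * (m s - p)) by ring.
have cnii : cn (- ii) = 1 by rewrite /cn /= normrN normr0 normrN1 add0r.
apply: (le_trans (cnM _ _)); rewrite cnii mul1r.
apply: (le_trans (cnD _ _)); apply: (@le_trans _ _ (K1 * K * e + K1 * K3 * e + cn (c0 i) * K * e)); last by lra.
have cp := cn_ge0 p; have cd := cn_ge0 (m s - p); have cl := cn_ge0 (l - c0 i).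
apply: lerD; last by rewrite (le_trans (cnM _ _))// -mulrA ler_wpM2l ?cn_ge0.
apply: (le_trans (cnD _ _)); apply: lerD; apply: (le_trans (cnM _ _)).
  apply: (@le_trans _ _ (K1 * (e * e) * (K * e))); first by apply: ler_pM.
  have : e * e <= 1 by nra.
  move=> ee; have : K1 * K * e * (e * e) <= K1 * K * e by rewrite ler_piMr ?mulr_ge0.
  by lra.
apply: (@le_trans _ _ (K1 * (e * e) * cn p)); first by apply: ler_wpM2r.
have : K1 * e * (cn p * e) <= K1 * e * K3 by rewrite ler_wpM2l ?mulr_ge0.
by lra.
Qed.

(** Continuity and the asymptotic bound for w are what [sysm_step] needs in order to differentiate
    the solution at i :: w, so the three claims go through one induction. *)
Lemma sysm_spec o : Sys (sysm o) /\ Asy o (sysm o).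
Proof.
have key w : (forall s, a < s -> ccont (sysm o w) s) /\
    (exists2 K, 0 <= K & forall s, a < s -> cn (sysm o w s - E w (o - (x +i* s))) <= K * expR (- s)) /\
    (forall i s, a < s -> cder (sysm o (i :: w)) s (- (ii * line (sval i) x s * sysm o w s))).
  elim: w => [|j w [cw [[K K0 HK] dw]]].
    have c1 s : a < s -> ccont (sysm o [::]) s by move=> _; exact: cder_cont (cder_cst _ s).
    have b1 s : a < s -> cn (sysm o [::] s - E [::] (o - (x +i* s))) <= 0 * expR (- s).
      by rewrite E_nil subrr cn0 mul0r.
    split=> //; split; first by exists 0.
    move=> i s as_; have [H HH] := @sysm_step o i [::] _ 0 (lexx _) c1 b1.
    have [dH _] := xgetPex (fun=> 0) (ex_intro _ H HH).
    apply: cder_eq (cderD (E_der i [::] (path_der o s)) (dH s as_)) _.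
    by rewrite /= !E_nil; ring.
  have cj s : a < s -> ccont (sysm o (j :: w)) s by move=> as_; exact: cder_cont (dw j s as_).
  have [K' K'0 HK'] : exists2 K, 0 <= K & forall s, a < s ->
      cn (sysm o (j :: w) s - E (j :: w) (o - (x +i* s))) <= K * expR (- s).
    have [H HH] := @sysm_step o j w _ K K0 cw HK.
    have [_ [K' K'0 HK']] := xgetPex (fun=> 0) (ex_intro _ H HH).
    by exists K' => // s as_; rewrite /= addrAC subrr add0r; exact: HK'.
  split=> //; split; first by exists K'.
  move=> i s as_; have [H HH] := @sysm_step o i (j :: w) _ K' K'0 cj HK'.
  have [dH _] := xgetPex (fun=> 0) (ex_intro _ H HH).
  apply: cder_eq (cderD (E_der i (j :: w) (path_der o s)) (dH s as_)) _.
  by rewrite -/(sysm o (j :: w)); ring.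
split; last by move=> w; have [_ []] := key w.
by split=> // i w s; have [_ [_ h]] := key w; exact: h.
Qed.

(** Only the left factor depends on s, and differentiation removes its first letter, an operation
    that commutes with deconcatenation. *)
Lemma dec_Sys m z : Sys m -> Sys (fun w s => dec (m^~ s) (E^~ z) w).
Proof.
move=> [m0 dm]; split=> [s|i w s as_]; first by rewrite dec_nil m0 E_nil mulr1.
under eq_fun do rewrite dec_cons m0 mul1r.
have h : cder (fun t => \sum_(k < (size w).+1) m (i :: take k w) t * E (drop k w) z) s
    (\sum_(k < (size w).+1) - (ii * line (sval i) x s * m (take k w) s) * E (drop k w) z).
  apply: cder_sum => k.
  by apply: cder_eq (cderM (dm i _ s as_) (cder_cst _ s)) _; rewrite mulr0 addr0.
apply: cder_eq (cderD (cder_cst (E (i :: w) z) s) h) _.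
rewrite add0r /dec mulr_sumr -sumrN; apply: eq_bigr => k _.
by ring.
Qed.

(** By [dec_E], multiplying on the right by constants integrated up to z moves the regularization
    point from o to o + z. *)
Lemma dec_Asy o m z : Asy o m -> Asy (o + z) (fun w s => dec (m^~ s) (E^~ z) w).
Proof.
move=> am w; have /choice[K HK] : forall u, exists K, 0 <= K /\
    forall s, a < s -> cn (m u s - E u (o - (x +i* s))) <= K * expR (- s).
  by move=> u; have [K K0 HK] := am u; exists K.
exists (\sum_(k < (size w).+1) K (take k w) * cn (E (drop k w) z)).
  by apply: sumr_ge0 => k _; rewrite mulr_ge0 ?cn_ge0// (HK _).1.
move=> s as_; have -> : o + z - (x +i* s) = o - (x +i* s) + z by rewrite addrAC.
rewrite -dec_E /dec -sumrB mulr_suml; apply: (le_trans (cn_sum _ _ _)).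
apply: ler_sum => k _; rewrite -mulrBl (le_trans (cnM _ _))// mulrAC.
by rewrite ler_wpM2r ?cn_ge0// (HK _).2.
Qed.

(** By induction both sides have the same derivative, and for non-empty words both vanish at b. The
    vanishing hypothesis is that of honest iterated integrals with end point b. *)
Lemma Sys_shuffle m (b : R) : Sys m -> (forall i w, m (i :: w) b = 0) ->
  forall u v s, a < s <= b -> \sum_(z <- shuffle u v) m z s = m u s * m v s.
Proof.
move=> [m0 dm] mb; elim=> [|i u IHu] v s ab; first by rewrite big_seq1 m0 mul1r.
elim: v s ab => [|j v IHv] s ab; first by rewrite shuffles0 big_seq1 m0 mulr1.
case/andP: ab => as_ sb.
pose D t := \sum_(z <- shuffle (i :: u) (j :: v)) m z t - m (i :: u) t * m (j :: v) t.
suff : D s = 0 by move/eqP; rewrite subr_eq0 => /eqP.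
have -> : D s = D b.
  apply: cder0_eq sb _ => t /andP[st tb]; have at_ : a < t by exact: lt_le_trans st.
  have h1 : cder (fun t => \sum_(z <- shuffle u (j :: v)) m (i :: z) t) t
      (- (ii * line (sval i) x t * (m u t * m (j :: v) t))).
    rewrite -IHu ?at_// mulr_sumr -sumrN; apply: cder_sum => z; exact: dm.
  have h2 : cder (fun t => \sum_(z <- shuffle (i :: u) v) m (j :: z) t) t
      (- (ii * line (sval j) x t * (m (i :: u) t * m v t))).
    rewrite -IHv ?at_// mulr_sumr -sumrN; apply: cder_sum => z; exact: dm.
  have := cderB (cderD h1 h2) (cderM (dm i u t at_) (dm j v t at_)).
  rewrite (_ : _ - _ = 0); last by ring.
  by congr (cder _ _ _); apply/funext => r; rewrite /D sum_shuffle_cons.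
by rewrite /D sum_shuffle_cons !mb mul0r !big1 ?addr0 ?subr0.
Qed.

End Line.

End RegularizedIntegrals.

(** * Identification of the regularized integrals with the solution of the system *)

Section IteratedIntegralsOnLines.
Variable R : realType.
Local Notation C := R[i].
Local Notation Re := complex.Re.
Local Notation Im := complex.Im.
Local Notation ii := (0 +i* 1 : C).
Implicit Types (s t : R) (z : C) (i : letter R) (w u v : seq (letter R)).

Local Arguments E {R}.
Local Arguments sysm {R}.

Lemma E_N w z : E w (- z) = (-1) ^+ size w * E w z.
Proof. 
by rewrite /E /expo (exprNn z) -[_ * z ^+ _ / _]mulrA mulrCA. Qed.

Lemma E_rev w z : E (rev w) z = E w z.
Proof.
rewrite /E size_rev; congr (_ * _); elim: w => [//|i w IH].
by rewrite rev_cons -cats1 big_cat /= big_seq1 IH big_cons mulrC.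
Qed.

Lemma hext_finf i z : 0 < Im z -> hext (finf (sval i)) z = c0 i.
Proof. by move=> z0; rewrite -(complex_eta z); exact: line_cst. Qed.

Lemma iterint_cst (p q : C) w :
  (forall t, 0 < t <= 1 -> 0 < Im (p + t%:C * (q - p))) ->
  iterint p q [seq finf (sval i) | i <- w] = E w (q - p).
Proof.
move=> him; rewrite /iterint.
rewrite (@simplex_cst _ _ [seq c0 i * (q - p) | i <- w] 0) ?size_map ?lexx ?ler01//.
  rewrite subr0 rmorph1 expr1n mulr1 /E /expo big_map mulrA; congr (_ / _).
  by elim: w => [|i w IH]; rewrite ?big_nil ?mulr1// !big_cons IH /= exprS mulrACA.
move=> k t kw t01; case: w kw => [|j w] // kw; rewrite -map_comp.
by rewrite (nth_map j)// (nth_map j)//= /pullback hext_finf// him.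
Qed.

Section Segment.
Variables (x y Y : R) (tau : uhp R).
Hypotheses (y0 : 0 < y) (Y0 : 0 < Y) (tauE : val tau = x +i* y).

Let pb i (t : R) : C := line (sval i) x (y + t * Y) * (Y%:C * ii).

(** The iterated integral from x + i s to x + i (y + Y). The parameter t stands for the height y + t
    Y; the base point corresponds to the height y / 2, which leaves room to differentiate at s =
    y. *)
Definition Tseg w s : C := sx (- (y / 2) / Y) [seq pb i | i <- w] (- (y / Y) + s * Y^-1).

Let affine_der (p q t : R) : is_derive t 1 (fun t : R => p + t * q) q.
Proof.
apply: is_derive_eq (rderD (rder_cst p t) (rderM (rder_id t) (rder_cst q t))) _.
by rewrite add0r mul1r mulr0 addr0.
Qed.

Let pb_cont w : allc (- (y / 2) / Y) [seq pb i | i <- w].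
Proof.
elim: w => [//|i w IH] g /= [<-|]; last exact: IH.
move=> t; rewrite ler_pdivrMr// => ht; apply: ccontM; last exact: cder_cont (cder_cst _ t).
have s0 : 0 < y + t * Y.
  by apply: (@lt_le_trans _ _ (y - y / 2)); [have := y0; lra|rewrite lerD2l].
have [l hl] := line_cder i x s0.
exact: cder_cont (cder_comp (g := fun t => y + t * Y) hl (affine_der y Y t)).
Qed.

Let arg_gt s : y / 2 < s -> - (y / 2) / Y < - (y / Y) + s * Y^-1.
Proof. by move=> hs; rewrite -[- (y / Y)]mulNr -mulrDl ltr_pM2r ?invr_gt0//; lra. Qed.

Lemma Tseg_Sys : Sys x (y / 2) Tseg.
Proof.
split=> // i w s hs.
have h := @sx_der _ _ _ [seq pb i | i <- w] _ (@pb_cont (i :: w)) (arg_gt hs).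
apply: cder_eq (cder_comp (g := fun t => - (y / Y) + t * Y^-1) h (affine_der _ _ s)) _.
rewrite /pb /Tseg /=.
have -> : y + (- (y / Y) + s * Y^-1) * Y = s by field; rewrite gt_eqF.
have : (Y^-1)%:C * Y%:C = 1 by rewrite -rmorphM mulVf ?rmorph1// gt_eqF.
move: (Y^-1)%:C (Y%:C) (line _ _ _) (sx _ _ _) => u v l m uv.
by transitivity (- ((u * v) * (ii * l * m))); [ring|rewrite uv mul1r].
Qed.

Lemma Tseg_end i w : Tseg (i :: w) (y + Y) = 0.
Proof.
rewrite /Tseg; have -> : - (y / Y) + (y + Y) * Y^-1 = 1 by field; rewrite gt_eqF.
exact: sx_1.
Qed.

Lemma Tseg_iterint w : iterint (val tau) (val tau + 0 +i* Y) [seq sval i | i <- w] = Tseg w y.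
Proof.
rewrite /Tseg addNr -simplex_sx; last 2 first.
- exact: pb_cont.
- by rewrite ler01 andbT mulNr oppr_le0 !divr_ge0// ltW.
rewrite /iterint -map_comp; congr (simplex_int _ 0); apply: eq_map => i; apply/funext => t.
rewrite /pullback /pb /line tauE /=.
have -> : x +i* y + 0 +i* Y - x +i* y = Y%:C * ii.
  by apply: ReIm_inj; rewrite !(ReD, ImD, ReN, ImN, ReM, ImM) /=; ring.
congr (hext _ _ * _).
by apply: ReIm_inj; rewrite !(ReD, ImD, ReN, ImN, ReM, ImM) /=; ring.
Qed.

(** On a finite segment the shuffles in the regularization become products by [Sys_shuffle].
    Reversing the constant letters, together with the sign, integrates them along the opposite path,
    whence - i Y. *)
Lemma iterint_reg w : fglift (iterint (val tau) (val tau + 0 +i* Y)) (reg [seq sval i | i <- w]) =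
  dec (Tseg^~ y) (E^~ (- (Y%:C * ii))) w.
Proof.
rewrite /reg linear_sum /dec size_map; apply: eq_bigr => k _.
have kw : (k <= size w)%N by rewrite -ltnS.
rewrite linearZ /= linear_sum /= -map_take -map_drop -map_comp.
pose cs := rev [seq linf i | i <- drop k w].
have -> : rev [seq (@finf R \o sval) i | i <- drop k w] = [seq sval i | i <- cs].
  by rewrite /cs map_rev -map_comp.
rewrite shuffle_map big_map.
under eq_bigr do rewrite fgliftU Tseg_iterint.
rewrite (Sys_shuffle Tseg_Sys (b := y + Y)); first last.
- by apply/andP; have := y0; have := Y0; split; lra.
- by move=> *; exact: Tseg_end.
rewrite -[Tseg cs y]Tseg_iterint.
have -> : [seq sval i | i <- cs] = [seq finf (sval i) | i <- rev (drop k w)].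
  by rewrite /cs !map_rev -map_comp.
rewrite iterint_cst; last first.
  move=> t /andP[t0 _]; rewrite tauE !(ReD, ImD, ReN, ImN, ReM, ImM) /=.
  by rewrite !(mul0r, mulr0, addr0, add0r) addrAC subrr add0r addr_gt0// mulr_gt0.
have -> : val tau + 0 +i* Y - val tau = Y%:C * ii.
  by rewrite tauE; apply: ReIm_inj; rewrite !(ReD, ImD, ReN, ImN, ReM, ImM) /=; ring.
by rewrite E_rev E_N size_drop; exact: mulrCA.
Qed.

End Segment.

(** The derivative of the error is - i f times the error for the shorter word. It is integrated
    downwards from y + Y, where the truncated integrals vanish and the error is the one controlled
    by [Asy]; each letter costs a factor 1 + Y. *)
Lemma reg_error x y a w : 0 < a < y -> exists2 K, 0 <= K & forall Y s, 0 < Y -> y <= s <= y + Y ->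
  cn (dec ((Tseg x y Y)^~ s) (E^~ (- (Y%:C * ii))) w - sysm x a (x +i* y) w s)
    <= K * ((1 + Y) ^+ size w * expR (- Y)).
Proof.
move=> /andP[a0 ay]; have y0 : 0 < y by exact: lt_trans ay.
have [[m0 dm] am] := sysm_spec x a0 (x +i* y).
pose M Y w s := dec ((Tseg x y Y)^~ s) (E^~ (- (Y%:C * ii))) w.
have e0 (Y : R) n : 0 < Y -> 0 <= (1 + Y) ^+ n * expR (- Y).
  by move=> Y0; rewrite mulr_ge0 ?expR_ge0// exprn_ge0// addr_ge0// ltW.
elim: w => [|i w [K K0 IH]].
  by exists 0 => // Y s Y0 _; rewrite dec_nil E_nil m0 mulr1 subrr cn0 mul0r.
have [L L0 HL] : exists2 L, 0 <= L & forall s, y <= s -> cn (line (sval i) x s) <= L.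
  have [L L0 HL] := line_decay i x y0; exists (L + cn (c0 i)); first by rewrite addr_ge0 ?cn_ge0.
  move=> s ys; rewrite -[line _ _ _](subrK (c0 i)) (le_trans (cnD _ _))// lerD2r.
  rewrite (le_trans (HL s ys))// ler_piMr// ltW// qnorm_lt1//; exact: lt_le_trans ys.
have [Ka Ka0 HKa] := am (i :: w).
exists (2 * (L * K) + Ka); first by rewrite addr_ge0 ?mulr_ge0.
move=> Y s Y0 ys; have [ys1 ys2] := andP ys.
have sT : Sys x (y / 2) (Tseg x y Y) by apply: Tseg_Sys.
have [T0 dT] := @dec_Sys _ x (y / 2) (Tseg x y Y) (- (Y%:C * ii)) sT.
pose D s := M Y (i :: w) s - sysm x a (x +i* y) (i :: w) s.
have dD t : y <= t -> cder D t (- (ii * line (sval i) x t) * (M Y w t - sysm x a (x +i* y) w t)).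
  move=> yt; have h1 := dT i w t (lt_le_trans (_ : y / 2 < y) yt).
  have h2 := dm i w t (lt_le_trans ay yt).
  apply: cder_eq (cderB (h1 _) h2) _; first by lra.
  by rewrite /M; ring.
have De : cn (D (y + Y)) <= Ka * expR (- Y).
  have -> : D (y + Y) = - (sysm x a (x +i* y) (i :: w) (y + Y) - E (i :: w) (x +i* y - (x +i* (y + Y)))).
    rewrite /D /M dec_cons [dec _ _ w]big1 => [|k _]; last by rewrite Tseg_end// mul0r.
    have -> : x +i* y - (x +i* (y + Y)) = - (Y%:C * ii).
      by apply: ReIm_inj; rewrite !(ReD, ImD, ReN, ImN, ReM, ImM) /=; ring.
    by rewrite /Tseg /= mul1r addr0 opprB.
  rewrite cnN; apply: le_trans (HKa _ _) _; first by lra.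
  by rewrite ler_wpM2l// ler_expR; lra.
have Dd : cn (D (y + Y) - D s) <= 2 * (L * (K * ((1 + Y) ^+ size w * expR (- Y)))) * (y + Y - s).
  apply: cmean_value_le ys2 (fun t ht => dD t (le_trans ys1 (andP ht).1)) _ => t /andP[st tY].
  rewrite mulNr cnN; have yt : y <= t := le_trans ys1 st.
  rewrite (le_trans (cnM _ _))// ler_pM ?cn_ge0//.
    by rewrite (le_trans (cnM _ _))// /cn /= normr0 normr1 add0r mul1r -/(cn _) HL.
  by apply: IH => //; rewrite yt.
rewrite -/(D s) (_ : D s = D (y + Y) - (D (y + Y) - D s)); last by ring.
apply: (le_trans (cnB _ _)).
set e := expR (- Y) in De Dd *; set P := (1 + Y) ^+ size w in Dd *.
have P1 : 1 <= P by rewrite exprn_ege1// lerDl ltW.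
have ee : 0 <= e := expR_ge0 _.
have Pe : 0 <= P * e by rewrite mulr_ge0// (le_trans ler01).
rewrite /= exprS -/P mulrDl addrC; apply: lerD.
  apply: (le_trans Dd).
  have : (L * K * (P * e)) * (y + Y - s) <= (L * K * (P * e)) * (1 + Y).
    by rewrite ler_wpM2l ?mulr_ge0//; lra.
  by lra.
apply: (le_trans De); rewrite ler_wpM2l// ler_peMl//.
by rewrite mulr_ege1// lerDl ltW.
Qed.

Lemma poly_expR_le n (Y : R) : 0 < Y -> (1 + Y) ^+ n * expR (- Y) <= n.+1`!%:R * expR 1 / Y.
Proof.
move=> Y0; have Y1 : 0 <= 1 + Y by rewrite addr_ge0// ltW.
have := expr_fact_le_expR n.+1 Y1.
rewrite ler_pdivrMr ?ltr0n ?fact_gt0// expRD expRN => h.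
rewrite ler_pdivlMr// mulrAC ler_pdivrMr ?expR_gt0//.
apply: le_trans (_ : (1 + Y) ^+ n.+1 <= _); last by rewrite (le_trans h)// mulrC mulrA.
by rewrite exprSr ler_wpM2l ?exprn_ge0// lerDr.
Qed.

Lemma cvg_inv_pinfty (f : R -> C) (l : C) (K : R) :
  (forall Y, 0 < Y -> cn (f Y - l) <= K / Y) -> lim ((f : R -> C^o) @ +oo) = (l : C^o).
Proof.
move=> h; apply: cvg_complex_lim; apply/cvg_complexP.
have H (F : R -> R) (m : R) : (forall Y, 0 < Y -> `|F Y - m| <= K / Y) -> F @ +oo --> m.
  move=> HF; apply/cvgrPdist_le => e e0; near=> Y.
  have Y0 : 0 < Y by near: Y; exact: nbhs_pinfty_gt.
  have YK : K / e <= Y by near: Y; apply: nbhs_pinfty_ge; exact: num_real.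
  by rewrite distrC (le_trans (HF Y Y0))// ler_pdivrMr// mulrC -ler_pdivrMr.
split; apply: H => Y Y0; apply: le_trans (h Y Y0).
  by rewrite -ReN -ReD Re_le_cn.
by rewrite -ImN -ImD Im_le_cn.
Unshelve. all: by end_near. Qed.

Lemma int_ioo_reg x y a (tau : uhp R) w : 0 < a < y -> val tau = x +i* y ->
  int_ioo tau (reg [seq sval i | i <- w]) = sysm x a (x +i* y) w y.
Proof.
move=> ay tauE; have [K K0 HK] := reg_error x w ay.
have y0 : 0 < y by case/andP: ay => a0; exact: lt_trans.
apply: (@cvg_inv_pinfty _ _ (K * ((size w).+1`!%:R * expR 1))) => Y Y0.
rewrite (iterint_reg y0 Y0 tauE); apply: (le_trans (HK Y y Y0 _)).
  by rewrite lexx lerDl ltW.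
by rewrite -mulrA ler_wpM2l// poly_expR_le.
Qed.

(** The outer sum in [Iint] is a deconcatenation product with the constants along the path from 0 to
    tau. With reversal and sign it moves the regularization point from tau to 0, and [Sys_uniq]
    identifies the result. *)
Lemma Iint_line x a w s : 0 < a -> a < s ->
  line (Iint [seq sval i | i <- w]) x s = twopii R ^+ size w * sysm x a 0 w s.
Proof.
move=> a0 as_; have s0 : 0 < s := lt_trans a0 as_.
have [tau tauE] := line_uhp x s0.
rewrite /line -tauE hextE /Iint size_map; congr (_ * _).
transitivity (dec (fun u => sysm x a (x +i* s) u s) (E^~ (- (x +i* s))) w).
  rewrite /dec; apply: eq_bigr => k _; rewrite -map_take -map_drop -map_comp.
  have -> : rev [seq (@finf R \o sval) i | i <- drop k w] = [seq finf (sval i) | i <- rev (drop k w)].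
    by rewrite map_rev.
  rewrite iterint_cst; last first.
    move=> t /andP[t0 _]; rewrite tauE !(ReD, ImD, ReN, ImN, ReM, ImM) /=.
    by rewrite !(mul0r, mulr0, addr0, add0r, oppr0, subr0) mulr_gt0.
  by rewrite (@int_ioo_reg x s a)// ?a0// subr0 E_rev E_N size_drop tauE -mulrA mulrCA.
have [S1 A1] := sysm_spec x a0 (x +i* s); have [S2 A2] := sysm_spec x a0 0.
have := dec_Asy (- (x +i* s)) A1; rewrite subrr => A3.
have SU := Sys_uniq (dec_Sys (- (x +i* s)) S1) A3 S2 A2.
exact: (SU w s as_).
Qed.

End IteratedIntegralsOnLines.

(** * Derivatives and asymptotics of the functions I at the cusp *)

Section IteratedIntegrals.
Variable R : realType.
Local Notation C := R[i].
Local Notation Re := complex.Re.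
Local Notation Im := complex.Im.
Local Notation ii := (0 +i* 1 : C).
Local Notation normc := ComplexField.Normc.normc.
Implicit Types (s t x : R) (z c : C) (F G : hfun R) (i : letter R) (w u v : seq (letter R)).

Definition nice_word (w : seq (hfun R)) : Prop := forall f, List.In f w -> nice f.

Lemma nice_wordP (W : seq (hfun R)) : nice_word W -> exists w, W = [seq sval i | i <- w].
Proof.
elim: W => [|f W IH] hW; first by exists [::].
have [w ->] : exists w, W = [seq sval i | i <- w] by apply: IH => g hg; apply: hW; right.
have hf : nice f by apply: hW; left.
by exists (exist _ f hf :: w).
Qed.

Lemma Iint_nil : Iint [::] = 1 :> hfun R.
Proof.
apply: hfun_ext => x s s0; have h : 0 < s / 2 < s by lra.
case/andP: h => h1 h2.
by rewrite (@Iint_line _ x (s / 2) [::])// expr0 mul1r line1.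
Qed.

Lemma Iint_cder (f : hfun R) W x s : nice_word (f :: W) -> 0 < s ->
  cder (line (Iint (f :: W)) x) s ((2 * pi)%:C * (line f x s * line (Iint W) x s)).
Proof.
move=> /nice_wordP[[//|i w] [-> ->]] s0; have [a a0 as_] : exists2 a, 0 < a & a < s.
  by exists (s / 2); lra.
have [[_ dm] _] := sysm_spec x a0 0.
apply: (cder_gt as_ (f := fun s => twopii R ^+ (size w).+1 * sysm x a 0 (i :: w) s)) => [t ht|].
  by rewrite (@Iint_line _ x a (i :: w)).
apply: cder_eq (cderZ _ (dm i w s as_)) _.
rewrite (@Iint_line _ x a w)// exprS.
have -> : (2 * pi)%:C = twopii R * - ii.
  rewrite /twopii; move: (pi : R) => P.
  by apply: ReIm_inj; rewrite !(ReM, ImM, ReN, ImN) /=; ring.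
by move: (twopii R) (twopii R ^+ size w) => A B; ring.
Qed.

(* F(x + i s) = c (x + i s)^n up to an exponentially small error *)
Definition asym F x c n : Prop := exists K m, 0 <= K /\
  forall s, 1 < s -> cn (line F x s - c * (x +i* s) ^+ n) <= K * ((1 + s) ^+ m * expR (- s)).

Lemma poly_expR_mono (s : R) m m' : 1 < s -> (m <= m')%N ->
  (1 + s) ^+ m * expR (- s) <= (1 + s) ^+ m' * expR (- s).
Proof.
move=> s1 mm; rewrite ler_wpM2r ?expR_ge0//; apply: ler_weXn2l => //.
by lra.
Qed.

Lemma asymD F G x c d n : asym F x c n -> asym G x d n -> asym (F + G) x (c + d) n.
Proof.
move=> [K [m [K0 HK]]] [K' [m' [K0' HK']]]; exists (K + K'), (m + m')%N.
split=> [|s s1]; first exact: addr_ge0.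
rewrite lineD mulrDl opprD addrACA (le_trans (cnD _ _))// mulrDl lerD//.
  by rewrite (le_trans (HK s s1))// ler_wpM2l// poly_expR_mono// leq_addr.
by rewrite (le_trans (HK' s s1))// ler_wpM2l// poly_expR_mono// leq_addl.
Qed.

Lemma asymZ F x a c n : asym F x c n -> asym (a *: F) x (a * c) n.
Proof.
move=> [K [m [K0 HK]]]; exists (cn a * K), m; split=> [|s s1]; first by rewrite mulr_ge0 ?cn_ge0.
by rewrite lineZ -mulrA -mulrBr (le_trans (cnM _ _))// -mulrA ler_wpM2l ?cn_ge0 ?HK.
Qed.

Lemma asym0 x n : asym 0 x 0 n.
Proof.
exists 0, 0%N; split=> // s s1.
by rewrite line0 !mul0r subrr cn0.
Qed.

Lemma asym_sum (I : Type) (r : seq I) (P : I -> hfun R) x n :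
  (forall j, List.In j r -> exists c, asym (P j) x c n) -> exists c, asym (\sum_(j <- r) P j) x c n.
Proof.
elim: r => [|j r IH] h; first by exists 0; rewrite big_nil; exact: asym0.
have [c hc] := h j (or_introl erefl).
have [d hd] : exists c, asym (\sum_(j <- r) P j) x c n by apply: IH => k hk; apply: h; right.
by exists (c + d); rewrite big_cons; exact: asymD.
Qed.

Lemma cn_linepow x s n : 1 < s -> cn ((x +i* s) ^+ n) <= (`|x| + 1) ^+ n * (1 + s) ^+ n.
Proof.
move=> s1; rewrite -exprMn (le_trans (cnX _ _))// lerXn2r ?nnegrE ?cn_ge0//.
  by rewrite mulr_ge0//; have := normr_ge0 x; lra.
rewrite /cn /= (@ger0_norm _ s); last by lra.
have := normr_ge0 x; nra.
Qed.

Lemma asymM F G x c d n k : asym F x c n -> asym G x d k -> asym (F * G) x (c * d) (n + k).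
Proof.
move=> [K [m [K0 HK]]] [K' [m' [K0' HK']]].
pose A := cn d * (`|x| + 1) ^+ k; pose B := cn c * (`|x| + 1) ^+ n.
have A0 : 0 <= A by rewrite mulr_ge0 ?cn_ge0// exprn_ge0// addr_ge0.
have B0 : 0 <= B by rewrite mulr_ge0 ?cn_ge0// exprn_ge0// addr_ge0.
exists (K * K' + K * A + B * K'), (m + m' + n + k)%N; split.
  by apply: addr_ge0; [apply: addr_ge0|]; exact: mulr_ge0.
move=> s s1; have h1 := HK s s1; have h2 := HK' s s1.
have hz : cn (d * (x +i* s) ^+ k) <= A * (1 + s) ^+ k.
  by rewrite (le_trans (cnM _ _))// -mulrA ler_wpM2l ?cn_ge0// cn_linepow.
have hy : cn (c * (x +i* s) ^+ n) <= B * (1 + s) ^+ n.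
  by rewrite (le_trans (cnM _ _))// -mulrA ler_wpM2l ?cn_ge0// cn_linepow.
have e1 : expR (- s) <= 1 by rewrite -expR0 ler_expR oppr_le0; lra.
have e0 := expR_ge0 (- s).
have p1 j : 1 <= (1 + s) ^+ j by rewrite exprn_ege1//; lra.
rewrite lineM exprD mulrACA; move: hz hy h1 h2.
set y := c * _; set z := d * _; set f := line F x s; set g := line G x s => hz hy h1 h2.
have -> : f * g - y * z = (f - y) * (g - z) + (f - y) * z + y * (g - z) by ring.
apply: (le_trans (cnD _ _)); rewrite [leRHS]mulrDl [X in _ <= X + _]mulrDl; apply: lerD; first (apply: (le_trans (cnD _ _)); apply: lerD).
- apply: (le_trans (cnM _ _)); apply: (le_trans (ler_pM (cn_ge0 _) (cn_ge0 _) h1 h2)).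
  rewrite mulrACA ler_wpM2l ?mulr_ge0// mulrACA -exprD.
  apply: (@le_trans _ _ ((1 + s) ^+ (m + m') * expR (- s))).
    by rewrite ler_wpM2l ?exprn_ge0 ?ler_piMr//; lra.
  by apply: poly_expR_mono; [exact: s1|rewrite -addnA leq_addr].
- apply: (le_trans (cnM _ _)); apply: (le_trans (ler_pM (cn_ge0 _) (cn_ge0 _) h1 hz)).
  rewrite mulrACA; apply: ler_wpM2l; first exact: mulr_ge0.
  rewrite mulrAC -exprD.
  by apply: poly_expR_mono; [exact: s1|lia].
apply: (le_trans (cnM _ _)); apply: (le_trans (ler_pM (cn_ge0 _) (cn_ge0 _) hy h2)).
rewrite mulrACA; apply: ler_wpM2l; first exact: mulr_ge0.
rewrite mulrA -exprD.
by apply: poly_expR_mono; [exact: s1|lia].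
Qed.

Lemma asym_letters w x : asym (Iint [seq sval i | i <- w]) x
  (twopii R ^+ size w * (\prod_(i <- w) c0 i) * (-1) ^+ size w / (size w)`!%:R) (size w).
Proof.
have [_ A] := sysm_spec x (ltr01 : 0 < 1 :> R) 0.
have [K K0 HK] := A w; exists (cn (twopii R ^+ size w) * K), 0%N.
split=> [|s s1]; first by rewrite mulr_ge0 ?cn_ge0.
rewrite expr0 mul1r (@Iint_line _ x 1)//.
have := HK s s1; rewrite sub0r /E /expo (exprNn (x +i* s)) => h.
have := ler_wpM2l (cn_ge0 (twopii R ^+ size w)) h; rewrite [X in _ <= X -> _]mulrA.
apply: le_trans; apply: le_trans (cnM _ _); rewrite mulrBr le_eqVlt; apply/orP; left; apply/eqP.
congr (cn (_ - _)).
by rewrite -!mulrA [_^-1 * _]mulrC.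
Qed.

Lemma asym_Iint W x : nice_word W -> exists c, asym (Iint W) x c (size W).
Proof. by move=> /nice_wordP[w ->]; rewrite size_map; eexists; exact: asym_letters. Qed.

Lemma asym_fexp f a x : fexp f a -> asym f x (a 0%N) 0.
Proof.
move=> fa; have [K K0 HK] := line_decay (exist _ f (ex_intro _ a fa)) x (ltr01 : 0 < 1 :> R).
exists K, 0%N; split=> // s s1; rewrite !expr0 mulr1 mul1r.
have := HK s (ltW s1); rewrite /= /c0 /= (fexp_fourier fa) => h; apply: le_trans h _.
rewrite ler_wpM2l// (le_trans (qnorm_le_expRN2 _))//; first by lra.
by rewrite ler_piMl ?expR_ge0// -expR0 ler_expR oppr_le0; lra.
Qed.

(** With leading coefficient 0 the exponent is immaterial; this allows words of different lengths to
    be compared. *)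
Lemma asym_weaken F x n : asym F x 0 n -> forall k, asym F x 0 k.
Proof.
by move=> [K [m [K0 HK]]] k; exists K, m; split=> // s s1; have := HK s s1; rewrite !mul0r.
Qed.

(** The leading coefficient contains the product of the constant terms of all letters, so a single
    letter without constant term removes it. *)
Lemma asym_Iint_eq0 W f x n : nice_word W -> List.In f W -> fourier f 0 = 0 -> asym (Iint W) x 0 n.
Proof.
move=> /nice_wordP[w ->] fw f0; apply: asym_weaken.
suff E : \prod_(i <- w) c0 i = 0 by have := asym_letters w x; rewrite E mulr0 !mul0r; exact.
elim: w fw => [//|i w IH] [fi|/IH IHw]; rewrite big_cons; last by rewrite IHw mulr0.
by rewrite /c0 fi f0 mul0r.
Qed.

(** A constant can agree with c z^(n+1) up to a decaying error only if c = 0, and then it is 0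
    itself. The exponent n + 1 > 0 encodes that the polynomial part has no constant term. *)
Lemma const_asym_eq0 F : (forall x s, 0 < s -> cder (line F x) s 0) ->
  (forall x, exists c n, asym F x c n.+1) -> F = 0.
Proof.
move=> dF aF; apply: hfun_ext => x s s0; rewrite line0.
have const t : 0 < t -> line F x t = line F x 1.
  have c1 a b : 0 < a -> a <= b -> line F x a = line F x b.
    by move=> a0 ab; apply: cder0_eq ab _ => r /andP[ar _]; apply: dF; exact: lt_le_trans ar.
  by move=> t0; have [t1|/ltW t1] := leP t 1; [exact: c1|apply/esym/c1].
have [c [n [K [m [K0 HK]]]]] := aF x.
set d := line F x 1; have {HK}HK t : 1 < t -> cn (d - c * (x +i* t) ^+ n.+1) <= K * (m.+1`!%:R * expR 1) / t.
  move=> t1; have t0 : 0 < t by lra.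
  have := HK t t1; rewrite (const t)// => h; apply: le_trans h _.
  by rewrite -!mulrA ler_wpM2l// (le_trans (poly_expR_le _ t0))// mulrA.
set K' := K * _ in HK; have K'0 : 0 <= K' by rewrite mulr_ge0// mulr_ge0 ?expR_ge0.
have nle (u : C) : normc u <= cn u.
  case: u => u1 u2; rewrite /cn /= -[leRHS]ger0_norm ?addr_ge0// -sqrtr_sqr ler_sqrt ?sqr_ge0//.
  rewrite -(real_normK (num_real u1)) -(real_normK (num_real u2)).
  have := normr_ge0 u1; have := normr_ge0 u2; nra.
have c00 : c = 0.
  apply: ComplexField.Normc.eq0_normc; apply/eqP; rewrite eq_le; apply/andP; split; last first.
    by case: (c) => c1 c2; exact: sqrtr_ge0.
  rewrite leNgt; apply/negP => cpos.
  pose t := (cn d + K') / normc c + 2.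
  have q0 : 0 <= (cn d + K') / normc c by rewrite divr_ge0 ?addr_ge0 ?cn_ge0// ltW.
  have t2 : 2 <= t by rewrite /t; lra.
  have t1 : 1 < t by lra.
  have h : cn (c * (x +i* t) ^+ n.+1) <= cn d + K'.
    rewrite -[c * _](subrK d) -opprB (le_trans (cnD _ _))// cnN addrC lerD2l (le_trans (HK t t1))//.
    by rewrite ler_piMr// invf_le1; lra.
  have h2 : normc c * t <= normc (c * (x +i* t) ^+ n.+1).
    rewrite ComplexField.Normc.normcM normcX ler_wpM2l ?(ltW cpos)//.
    have tz : t <= normc (x +i* t).
      rewrite /= -[leLHS]ger0_norm; last by lra.
      by rewrite -sqrtr_sqr ler_sqrt ?addr_ge0 ?sqr_ge0// lerDr sqr_ge0.
    apply: (le_trans tz); rewrite -[leLHS]expr1 ler_weXn2l//; lra.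
  have := le_trans h2 (le_trans (nle _) h); rewrite leNgt => /negP; apply.
  rewrite mulrC -ltr_pdivrMr// /t; lra.
have d0 : cn d <= 0.
  rewrite leNgt; apply/negP => dpos; pose t := K' / cn d + 2.
  have q0 : 0 <= K' / cn d by rewrite divr_ge0// ltW.
  have t1 : 1 < t by rewrite /t; lra.
  have := HK t t1; rewrite c00 mul0r subr0 ler_pdivlMr; last by lra.
  rewrite leNgt => /negP; apply; rewrite mulrC -ltr_pdivrMr// /t; lra.
by rewrite const//; apply/cn_eq0/eqP; rewrite eq_le d0 cn_ge0.
Qed.

End IteratedIntegrals.

(** * Shuffle product, multilinearity and integration by parts *)

Section IteratedIntegralIdentities.
Variable R : realType.
Local Notation C := R[i].
Implicit Types (s x : R) (c : C) (F G f g h : hfun R) (u v w : seq (hfun R)).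

Lemma hder_eq F G G' : hder F G -> G = G' -> hder F G'.
Proof. by move=> hF <-. Qed.

Lemma hder_cst c : hder (fun=> c : C) (0 : hfun R).
Proof.
move=> x s s0; rewrite line0 mulr0; apply: (cder_gt s0 _ (cder_cst c s)) => t t0.
by rewrite line_cst.
Qed.

Lemma hderD F G F' G' : hder F F' -> hder G G' -> hder (F + G) (F' + G').
Proof.
move=> hF hG x s s0; rewrite lineD mulrDr (_ : line (F + G) x = fun t => line F x t + line G x t).
  exact: cderD (hF x s s0) (hG x s s0).
by apply/funext => t; rewrite lineD.
Qed.

Lemma hderZ a F F' : hder F F' -> hder (a *: F) (a *: F').
Proof.
move=> hF x s s0; rewrite lineZ mulrCA (_ : line (a *: F) x = fun t => a * line F x t).
  exact: cderZ (hF x s s0).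
by apply/funext => t; rewrite lineZ.
Qed.

Lemma hderN F F' : hder F F' -> hder (- F) (- F').
Proof. by rewrite -[- F]scaleN1r -[- F']scaleN1r; exact: hderZ. Qed.

Lemma hderB F G F' G' : hder F F' -> hder G G' -> hder (F - G) (F' - G').
Proof. by move=> hF hG; apply: hderD => //; exact: hderN. Qed.

Lemma hderM F G F' G' : hder F F' -> hder G G' -> hder (F * G) (F' * G + F * G').
Proof.
move=> hF hG x s s0; rewrite (_ : line (F * G) x = fun t => line F x t * line G x t).
  apply: cder_eq (cderM (hF x s s0) (hG x s s0)) _.
  by rewrite lineD !lineM; ring.
by apply/funext => t; rewrite lineM.
Qed.

Lemma hder_sum (I : Type) (r : seq I) (P Q : I -> hfun R) :
  (forall j, hder (P j) (Q j)) -> hder (\sum_(j <- r) P j) (\sum_(j <- r) Q j).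
Proof.
move=> h; elim: r => [|j r IH]; first by rewrite !big_nil; exact: hder_cst.
by rewrite !big_cons; exact: hderD.
Qed.

Lemma pi2C_neq0 : (- (2 * pi))%:C != 0 :> C.
Proof. by rewrite fmorph_eq0 oppr_eq0 gt_eqF// pi2_gt0. Qed.

Lemma hder_uniq F G G' : hder F G -> hder F G' -> G = G'.
Proof.
move=> h1 h2; apply: hfun_ext => x s s0; have := cder_uniq (h1 x s s0) (h2 x s s0).
by apply: mulfI; exact: pi2C_neq0.
Qed.

Lemma hder0_asym_eq0 F : hder F 0 -> (forall x, exists c n, asym F x c n.+1) -> F = 0.
Proof.
move=> hF; apply: const_asym_eq0 => x s s0.
by apply: cder_eq (hF x s s0) _; rewrite line0 mulr0.
Qed.

Lemma Iint_hder f w : nice_word (f :: w) -> hder (Iint (f :: w)) (- (f * Iint w)).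
Proof.
move=> fw x s s0; apply: cder_eq (Iint_cder x fw s0) _.
by rewrite lineN lineM rmorphN; ring.
Qed.

Lemma nice_word_cons f w : nice_word (f :: w) <-> nice f /\ nice_word w.
Proof.
split=> [h|[h1 h2] g [<-//|]]; last exact: h2.
by split=> [|g hg]; apply: h; [left|right].
Qed.

Lemma nice_word_cat u v : nice_word (u ++ v) <-> nice_word u /\ nice_word v.
Proof.
elim: u => [|f u IH]; first by split=> [h|[]//]; split.
rewrite cat_cons !nice_word_cons IH; tauto.
Qed.

Lemma shuffle_size (T : Type) (u v w : seq T) : List.In w (shuffle u v) -> size w = (size u + size v)%N.
Proof.
elim: u v w => [|a u IHu] v w; first by case=> // <-.
elim: v w => [|b v IHv] w; first by rewrite shuffles0 addn0 => -[<-|[]].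
rewrite shuffle_cons => /List.in_app_iff[] /List.in_map_iff[z [<- hz]] /=.
  by rewrite (IHu _ _ hz) addSn.
by rewrite (IHv _ hz) /= addnS.
Qed.

Lemma shuffle_nice u v w : nice_word u -> nice_word v -> List.In w (shuffle u v) -> nice_word w.
Proof.
elim: u v w => [|a u IHu] v w; first by move=> _ hv [<-|[]].
move=> /nice_word_cons[ha hu]; elim: v w => [|b v IHv] w hv.
  by rewrite shuffles0 => -[<-|[]//]; apply/nice_word_cons.
have [hb hv'] := iffLR (@nice_word_cons b v) hv.
rewrite shuffle_cons => /List.in_app_iff[] /List.in_map_iff[z [<- hz]] /=.
  by apply/nice_word_cons; split=> //; exact: IHu hz.
by apply/nice_word_cons; split=> //; exact: IHv hz.
Qed.

Lemma asym_shuffle u v x : nice_word u -> nice_word v ->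
  exists c, asym (\sum_(w <- shuffle u v) Iint w) x c (size u + size v).
Proof.
move=> hu hv; apply: asym_sum => w hw.
by rewrite -(shuffle_size hw); apply: asym_Iint; exact: shuffle_nice hw.
Qed.

Lemma Iint_shuffle u v : nice_word u -> nice_word v ->
  \sum_(w <- shuffle u v) Iint w = Iint u * Iint v.
Proof.
elim: u v => [|f u IHu] v; first by rewrite big_seq1 Iint_nil mul1r.
elim: v => [|g v IHv] hu hv; first by rewrite shuffles0 big_seq1 Iint_nil mulr1.
have [nf nu] := iffLR (@nice_word_cons f u) hu; have [ng nv] := iffLR (@nice_word_cons g v) hv.
apply/eqP; rewrite -subr_eq0; apply/eqP; apply: hder0_asym_eq0 => [|x].
  have h1 : hder (\sum_(z <- shuffle u (g :: v)) Iint (f :: z)) (- (f * (Iint u * Iint (g :: v)))).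
    have H r : (forall z, List.In z r -> nice_word z) ->
        hder (\sum_(z <- r) Iint (f :: z)) (- (f * \sum_(z <- r) Iint z)).
      elim: r => [_|z r IH hr]; first by rewrite !big_nil mulr0 oppr0; exact: hder_cst.
      rewrite !big_cons mulrDr opprD; apply: hderD.
        by apply: Iint_hder; apply/nice_word_cons; split=> //; apply: hr; left.
      by apply: IH => y hy; apply: hr; right.
    by rewrite -IHu//; apply: H => z; exact: shuffle_nice.
  have h2 : hder (\sum_(z <- shuffle (f :: u) v) Iint (g :: z)) (- (g * (Iint (f :: u) * Iint v))).
    have H r : (forall z, List.In z r -> nice_word z) ->
        hder (\sum_(z <- r) Iint (g :: z)) (- (g * \sum_(z <- r) Iint z)).
      elim: r => [_|z r IH hr]; first by rewrite !big_nil mulr0 oppr0; exact: hder_cst.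
      rewrite !big_cons mulrDr opprD; apply: hderD.
        by apply: Iint_hder; apply/nice_word_cons; split=> //; apply: hr; left.
      by apply: IH => y hy; apply: hr; right.
    by rewrite -IHv//; apply: H => z; exact: shuffle_nice.
  rewrite sum_shuffle_cons.
  apply: hder_eq (hderB (hderD h1 h2) (hderM (Iint_hder hu) (Iint_hder hv))) _.
  by ring.
have [c hc] := asym_shuffle x hu hv; have [d hd] := asym_Iint x hu; have [e he] := asym_Iint x hv.
exists (c + -1 * (d * e)), (size u + size (g :: v))%N; rewrite -scaleN1r.
by apply: asymD => //; apply: asymZ; exact: (asymM hd he).
Qed.

Lemma Iint_prefix (r : seq (C * seq (hfun R))) u :
  (forall p, List.In p r -> nice_word p.2) -> nice_word u ->
  (forall k u', nice_word (k :: u') -> forall x, exists c n,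
     asym (\sum_(p <- r) p.1 *: Iint ((k :: u') ++ p.2)) x c n.+1) ->
  \sum_(p <- r) p.1 *: Iint p.2 = 0 -> \sum_(p <- r) p.1 *: Iint (u ++ p.2) = 0.
Proof.
move=> hr + ha h0; elim: u => [//|k u IH] ku; have [nk nu] := iffLR (@nice_word_cons k u) ku.
apply: hder0_asym_eq0; last by move=> x; exact: ha.
apply: hder_eq (_ : - (k * \sum_(p <- r) p.1 *: Iint (u ++ p.2)) = 0); last first.
  by rewrite IH// mulr0 oppr0.
elim: r hr {ha h0 IH} => [_|p r IH hr]; first by rewrite !big_nil mulr0 oppr0; exact: hder_cst.
rewrite !big_cons mulrDr opprD; apply: hderD; last by apply: IH => q hq; apply: hr; right.
rewrite -scalerAr -scalerN; apply: hderZ; apply: Iint_hder.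
apply/nice_word_cons; split=> //; by apply/nice_word_cat; split=> //; apply: hr; left.
Qed.

Lemma asym3 (F1 F2 F3 : hfun R) a1 a2 a3 c1 c2 c3 x n :
  asym F1 x c1 n -> asym F2 x c2 n -> asym F3 x c3 n ->
  asym (a1 *: F1 + (a2 *: F2 + a3 *: F3)) x (a1 * c1 + (a2 * c2 + a3 * c3)) n.
Proof. by move=> h1 h2 h3; apply: asymD; [|apply: asymD]; exact: asymZ. Qed.

Lemma Iint_multilinear u v c f g : nice_word u -> nice_word v -> nice f -> nice g ->
  Iint (u ++ (c *: f + g) :: v) = c *: Iint (u ++ f :: v) + Iint (u ++ g :: v).
Proof.
move=> hu hv hf hg; have hfg : nice (c *: f + g).
  by have [a fa] := hf; have [b gb] := hg; eexists; exact: fexpD (fexpZ c fa) gb.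
pose r : seq (C * seq (hfun R)) := [:: (1, (c *: f + g) :: v); (- c, f :: v); (-1, g :: v)].
have nw k : nice k -> nice_word (k :: v) by move=> hk; exact/nice_word_cons.
have as_ u' x : nice_word u' -> exists d n, asym (\sum_(p <- r) p.1 *: Iint (u' ++ p.2)) x d n.+1.
  move=> hu'; have H k : nice k -> exists d, asym (Iint (u' ++ k :: v)) x d (size u' + size v).+1.
    move=> hk; have -> : (size u' + size v).+1 = size (u' ++ k :: v) by rewrite size_cat addnS.
    by apply: asym_Iint; apply/nice_word_cat; split=> //; exact: nw.
  have [a1 h1] := H _ hfg; have [a2 h2] := H _ hf; have [a3 h3] := H _ hg.
  eexists; eexists; rewrite !big_cons big_nil addr0 /=; exact: asym3 h1 h2 h3.
have base : \sum_(p <- r) p.1 *: Iint p.2 = 0.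
  apply: hder0_asym_eq0; last by move=> x; exact: (as_ [::]).
  rewrite !big_cons big_nil addr0 /=.
  apply: hder_eq (hderD (hderZ _ (Iint_hder (nw _ hfg))) (hderD (hderZ _ (Iint_hder (nw _ hf)))
    (hderZ _ (Iint_hder (nw _ hg))))) _.
  rewrite scale1r !scaleN1r opprK scaleNr scalerN opprK mulrDl -scalerAl; ring.
have := Iint_prefix _ hu _ base; rewrite !big_cons big_nil addr0 /= scale1r scaleN1r scaleNr -opprD.
move=> H; apply/eqP; rewrite -subr_eq0; apply/eqP; apply: H => [p|k u' ku x].
  by case=> [<-|[<-|[<-|[]]]] /=; exact: nw.
exact: (as_ (k :: u') x ku).
Qed.

Lemma fexp_hder_coef h h' a b : fexp h a -> fexp h' b -> hder h h' -> forall n, b n = n%:R * a n.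
Proof.
move=> ha hb hh n; have [sa qa] := ha; have [sb qb] := hb.
suff -> : b = fun n => n%:R * a n by [].
apply: (@qexp_uniq _ (line h' 0)); first by have := qb 0; rewrite tw0.
split=> [|s s0]; first exact: subexp_nat.
have := cder_uniq (hh 0 s s0) (qexp_cder (qa 0) s0); rewrite tw0.
by apply: mulfI; exact: pi2C_neq0.
Qed.

Section Parts.
Variables (h h' : hfun R).
Hypotheses (nh : nice h) (nh' : nice h') (hh : hder h h').

(** A derivative has no constant Fourier coefficient. Hence the words containing h' decay and can be
    compared with words that are one letter shorter. *)
Let h'0 : fourier h' 0 = 0.
Proof.
have [a ha] := nh; have [b hb] := nh'; rewrite (fexp_fourier hb).
by rewrite (fexp_hder_coef ha hb hh) mul0r.
Qed.

Lemma nice_mul f g : nice f -> nice g -> nice (f * g).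
Proof. by move=> [a fa] [b gb]; eexists; exact: fexpM fa gb. Qed.

Let w1 (k : hfun R) : nice k -> nice_word [:: k].
Proof. by move=> hk; apply/nice_word_cons; split. Qed.

Lemma Iint_parts1 : Iint [:: h'] = (fun=> fourier h 0) - h.
Proof.
apply/eqP; rewrite -subr_eq0; apply/eqP; apply: hder0_asym_eq0 => [|x].
  apply: hder_eq (hderB (Iint_hder (w1 nh')) (hderB (hder_cst _) hh)) _.
  by rewrite Iint_nil; ring.
have [a ha] := nh; exists (0 + -1 * (fourier h 0 + -1 * fourier h 0)), 0%N.
(* The constant terms cancel, so that the degree may be raised from 0 to the positive one
   required. *)
have z : asym ((fun=> fourier h 0 : C) - h) x (fourier h 0 + -1 * fourier h 0) 0.
  rewrite -[- h]scaleN1r {3}(fexp_fourier ha); apply: asymD; last by apply: asymZ; exact: asym_fexp.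
  by have := asym_fexp x (fexp_cst (fourier h 0)).
rewrite -[- (_ - h)]scaleN1r; apply: asymD; first by apply: (@asym_Iint_eq0 _ _ h'); [exact: w1|left|].
apply: asymZ; have E0 : fourier h 0 + -1 * fourier h 0 = 0 by rewrite mulN1r subrr.
by rewrite E0 in z *; exact: (asym_weaken z).
Qed.

Lemma Iint_parts g v : nice g -> nice_word v ->
  Iint (h' :: g :: v) = Iint (h * g :: v) - h * Iint (g :: v).
Proof.
move=> ng nv; have gv : nice_word (g :: v) by exact/nice_word_cons.
have hgv : nice_word (h * g :: v) by apply/nice_word_cons; split=> //; exact: nice_mul.
have h'gv : nice_word (h' :: g :: v) by exact/nice_word_cons.
apply/eqP; rewrite -subr_eq0; apply/eqP; apply: hder0_asym_eq0 => [|x].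
  apply: hder_eq (hderB (Iint_hder h'gv) (hderB (Iint_hder hgv) (hderM hh (Iint_hder gv)))) _.
  by ring.
have [a ha] := nh; have [c1 hc1] := asym_Iint x hgv; have [c2 hc2] := asym_Iint x gv.
exists (0 + -1 * (c1 + -1 * (a 0%N * c2))), (size v).
rewrite -[- (_ - _)]scaleN1r -[- (h * _)]scaleN1r; apply: asymD.
  by apply: (@asym_Iint_eq0 _ _ h') => //; left.
apply: asymZ; apply: asymD => //; apply: asymZ; exact: (asymM (asym_fexp x ha) hc2).
Qed.

Lemma Iint_parts_mid u f g v : nice_word u -> nice f -> nice g -> nice_word v ->
  Iint (u ++ f :: h' :: g :: v) = Iint (u ++ f :: h * g :: v) - Iint (u ++ f * h :: g :: v).
Proof.
move=> nu nf ng nv.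
have gv : nice_word (g :: v) by exact/nice_word_cons.
have w2 : nice_word (f :: h * g :: v).
  by apply/nice_word_cons; split=> //; apply/nice_word_cons; split=> //; exact: nice_mul.
have w3 : nice_word (f * h :: g :: v) by apply/nice_word_cons; split=> //; exact: nice_mul.
have w4 : nice_word (f :: h' :: g :: v).
  by apply/nice_word_cons; split=> //; exact/nice_word_cons.
pose r : seq (C * seq (hfun R)) := [:: (1, f :: h' :: g :: v); (-1, f :: h * g :: v); (1, f * h :: g :: v)].
have as_ u' x : nice_word u' -> exists d n, asym (\sum_(p <- r) p.1 *: Iint (u' ++ p.2)) x d n.+1.
  move=> hu'; have [a2 h2] := @asym_Iint _ (u' ++ f :: h * g :: v) x (iffRL (nice_word_cat _ _) (conj hu' w2)).
  have [a3 h3] := @asym_Iint _ (u' ++ f * h :: g :: v) x (iffRL (nice_word_cat _ _) (conj hu' w3)).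
  have h1 : asym (Iint (u' ++ f :: h' :: g :: v)) x 0 (size (u' ++ f :: h * g :: v)).
    apply: (@asym_Iint_eq0 _ _ h') => //; first exact/nice_word_cat.
    by apply/List.in_app_iff; right; right; left.
  eexists; exists (size u' + size v).+1; rewrite !big_cons big_nil addr0 /=.
  by move: h1 h2 h3; rewrite !size_cat /= !addnS => h1 h2 h3; exact: asym3 h1 h2 h3.
have base : \sum_(p <- r) p.1 *: Iint p.2 = 0.
  apply: hder0_asym_eq0; last by move=> x; exact: (as_ [::]).
  rewrite !big_cons big_nil addr0 /=.
  apply: hder_eq (hderD (hderZ _ (Iint_hder w4)) (hderD (hderZ _ (Iint_hder w2))
    (hderZ _ (Iint_hder w3)))) _.
  by rewrite !scale1r scaleN1r (Iint_parts ng nv); ring.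
have := Iint_prefix _ nu _ base; rewrite !big_cons big_nil addr0 /= !scale1r scaleN1r.
move=> H; apply/eqP; rewrite -subr_eq0 opprB addrCA addrC -addrA; apply/eqP.
rewrite addrC -addrA; rewrite -[RHS]H; first by ring.
  by move=> p [<-|[<-|[<-|[]]]].
by move=> k u' ku x; exact: (as_ (k :: u') x ku).
Qed.

Lemma Iint_parts_last u f : nice_word u -> nice f ->
  Iint (rcons (rcons u f) h') = fourier h 0 *: Iint (rcons u f) - Iint (rcons u (f * h)).
Proof.
move=> nu nf; rewrite -!cats1 -catA /=.
have w2 : nice_word [:: f] by exact: w1.
have w3 : nice_word [:: f * h] by apply: w1; exact: nice_mul.
have w4 : nice_word [:: f; h'] by apply/nice_word_cons; split=> //; exact: w1.
pose r : seq (C * seq (hfun R)) := [:: (1, [:: f; h']); (- fourier h 0, [:: f]); (1, [:: f * h])].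
have as_ u' x : nice_word u' -> exists d n, asym (\sum_(p <- r) p.1 *: Iint (u' ++ p.2)) x d n.+1.
  move=> hu'; have [a2 h2] := @asym_Iint _ (u' ++ [:: f]) x (iffRL (nice_word_cat _ _) (conj hu' w2)).
  have [a3 h3] := @asym_Iint _ (u' ++ [:: f * h]) x (iffRL (nice_word_cat _ _) (conj hu' w3)).
  have h1 : asym (Iint (u' ++ [:: f; h'])) x 0 (size (u' ++ [:: f])).
    apply: (@asym_Iint_eq0 _ _ h') => //; first exact/nice_word_cat.
    by apply/List.in_app_iff; right; right; left.
  eexists; exists (size u'); rewrite !big_cons big_nil addr0 /=.
  by move: h1 h2 h3; rewrite !size_cat /= !addn1 => h1 h2 h3; exact: asym3 h1 h2 h3.
have base : \sum_(p <- r) p.1 *: Iint p.2 = 0.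
  apply: hder0_asym_eq0; last by move=> x; exact: (as_ [::]).
  rewrite !big_cons big_nil addr0 /=.
  apply: hder_eq (hderD (hderZ _ (Iint_hder w4)) (hderD (hderZ _ (Iint_hder w2))
    (hderZ _ (Iint_hder w3)))) _.
  rewrite !scale1r scaleNr Iint_parts1 Iint_nil.
  have -> : ((fun=> fourier h 0) : hfun R) = fourier h 0 *: 1.
    by apply/funext => tau; exact/esym/mulr1.
  by rewrite mulrBr -scalerAr !mulr1 scalerN; ring.
have := Iint_prefix _ nu _ base; rewrite !big_cons big_nil addr0 /= !scale1r scaleNr.
move=> H; apply/eqP; rewrite -subr_eq0; apply/eqP; rewrite -[RHS]H; first by ring.
  by move=> p [<-|[<-|[<-|[]]]].
by move=> k u' ku x; exact: (as_ (k :: u') x ku).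
Qed.

End Parts.

End IteratedIntegralIdentities.

(** * Polynomials in E2, E4 and E6 *)

(* Polynomial rings in three variables, through their universal property. *)
Record poly3 (K : fieldType) := Poly3 {
  p3_ring :> idomainType;
  p3c : {rmorphism K -> p3_ring};
  p3x : p3_ring; p3y : p3_ring; p3z : p3_ring;
  p3_ind : forall Q : p3_ring -> Prop, Q 0 ->
    (forall c a i j p, Q p -> Q (p3c c * (p3x ^+ a * p3y ^+ i * p3z ^+ j) + p)) -> forall p, Q p;
  p3_lift : forall (S : comNzRingType) (f : {rmorphism K -> S}) (a b c : S),
    {g : {rmorphism p3_ring -> S} | (forall k, g (p3c k) = f k) /\
       [/\ g p3x = a, g p3y = b & g p3z = c]} }.

Lemma poly3_exists (K : fieldType) : poly3 K.
Proof.
pose o0 := ord0 : 'I_3; pose o1 := fintype.lift ord0 ord0 : 'I_3; pose o2 := fintype.lift ord0 (fintype.lift ord0 ord0) : 'I_3.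
apply: (@Poly3 K (mpoly 3 K) (@mpolyC 3 K) (mpolyX K (mnm1 o0)) (mpolyX K (mnm1 o1)) (mpolyX K (mnm1 o2))).
  move=> Q Q0 Qm p; rewrite [p]mpolyE; elim: (msupp p) => [|m s IH]; first by rewrite big_nil.
  by rewrite big_cons mpolyXE_id !big_ord_recl big_ord0 mulr1 mulrA -mul_mpolyC; exact: Qm.
move=> S f a b c; pose h (i : 'I_3) := nth 0 [:: a; b; c] i.
exists (mmap f h : {rmorphism _ -> _}); split=> [k|] /=; first exact: mmapC.
by split; rewrite mmapX mmap1U.
Qed.

Section RamanujanRing.
Variables (K : numClosedFieldType) (P : poly3 K).
Implicit Types (p q A B : P) (c : K).
Local Notation c_ := (p3c P).
Local Notation x := (p3x P).
Local Notation y := (p3y P).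
Local Notation z := (p3z P).

Definition mon a i j : P := x ^+ a * y ^+ i * z ^+ j.

Section Lift.
Variables (S : comNzRingType) (f : {rmorphism K -> S}) (a b c : S).

Definition mev : P -> S := sval (p3_lift P f a b c).
HB.instance Definition _ := GRing.RMorphism.on mev.

Lemma mev_c k : mev (c_ k) = f k. Proof. by rewrite /mev; case: p3_lift => g [h _] /=. Qed.
Lemma mev_x : mev x = a. Proof. by rewrite /mev; case: p3_lift => g [_ [h _ _]] /=. Qed.
Lemma mev_y : mev y = b. Proof. by rewrite /mev; case: p3_lift => g [_ [_ h _]] /=. Qed.
Lemma mev_z : mev z = c. Proof. by rewrite /mev; case: p3_lift => g [_ [_ _ h]] /=. Qed.
Lemma mev_mon k i j : mev (mon k i j) = a ^+ k * b ^+ i * c ^+ j.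
Proof. by rewrite /mon !rmorphM !rmorphXn /= mev_x mev_y mev_z. Qed.

End Lift.

Lemma alg_ind (Q : P -> Prop) : (forall c, Q (c_ c)) -> (forall p q, Q p -> Q q -> Q (p + q)) ->
  (forall p q, Q p -> Q q -> Q (p * q)) -> Q x -> Q y -> Q z -> forall p, Q p.
Proof.
move=> Qc QD QM hx hy hz; apply: p3_ind => [|c a i j p]; first by rewrite -(rmorph0 c_).
have QX p' n : Q p' -> Q (p' ^+ n).
  move=> hp; elim: n => [|n IH]; first by rewrite expr0 -(rmorph1 c_).
  by rewrite exprS; exact: QM.
apply: QD; apply: (QM (c_ c)) => //; apply: (QM (x ^+ a * y ^+ i) (z ^+ j)); last exact: QX.
by apply: (QM (x ^+ a) (y ^+ i)); exact: QX.
Qed.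

(* The derivation with given values on the variables: the coefficient of U in
   the image under x |-> x + a U, ... *)
Definition der (a b c : P) (p : P) : P :=
  (mev (polyC \o c_) (x%:P + a *: 'X) (y%:P + b *: 'X) (z%:P + c *: 'X) p)`_1.

Section Derivation.
Variables (a b c : P).
Local Notation d := (der a b c).
Local Notation g := (mev (polyC \o c_) (x%:P + a *: 'X) (y%:P + b *: 'X) (z%:P + c *: 'X)).

Let g0 p : (g p)`_0 = p.
Proof.
elim/alg_ind: p => [k|p q hp hq|p q hp hq|||].
- by rewrite mev_c /= coefC.
- by rewrite rmorphD coefD hp hq.
- by rewrite rmorphM coef0M hp hq.
- by rewrite mev_x coefD coefC coefZ coefX mulr0 addr0.
- by rewrite mev_y coefD coefC coefZ coefX mulr0 addr0.
- by rewrite mev_z coefD coefC coefZ coefX mulr0 addr0.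
Qed.

Lemma der_c k : d (c_ k) = 0. Proof. by rewrite /der mev_c /= coefC. Qed.
Lemma derD p q : d (p + q) = d p + d q. Proof. by rewrite /der rmorphD coefD. Qed.
Lemma derN p : d (- p) = - d p. Proof. by rewrite /der rmorphN coefN. Qed.
Lemma derB p q : d (p - q) = d p - d q. Proof. by rewrite derD derN. Qed.
Lemma derM p q : d (p * q) = d p * q + p * d q.
Proof. by rewrite /der rmorphM coefM big_ord_recl big_ord1 /= !g0 addrC. Qed.
Lemma der_x : d x = a.
Proof. by rewrite /der mev_x coefD coefC coefZ coefX mulr1 add0r. Qed.
Lemma der_y : d y = b.
Proof. by rewrite /der mev_y coefD coefC coefZ coefX mulr1 add0r. Qed.
Lemma der_z : d z = c.
Proof. by rewrite /der mev_z coefD coefC coefZ coefX mulr1 add0r. Qed.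
Lemma derZ k p : d (c_ k * p) = c_ k * d p.
Proof. by rewrite derM der_c mul0r add0r. Qed.
Lemma derX p n : d (p ^+ n) = n%:R * p ^+ n.-1 * d p.
Proof.
elim: n => [|n IH]; first by rewrite expr0 -(rmorph1 c_) der_c !mul0r.
rewrite exprS derM IH /=; case: n {IH} => [|n] /=.
  by rewrite !expr0 mulr0n !mul0r mulr0 addr0 mulr1 !mul1r.
by rewrite exprS -[(n.+2%:R : P)]natr1; ring.
Qed.
HB.instance Definition _ := GRing.isZmodMorphism.Build P P d derB.
End Derivation.

Definition dx : P -> P := der 1 0 0.
HB.instance Definition _ := GRing.Additive.on dx.
Definition g0 : P := c_ 12%:R^-1 * (x * x - y).
Definition g1 : P := c_ 3%:R^-1 * (x * y - z).
Definition g2 : P := c_ 2%:R^-1 * (x * z - y * y).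
Definition D : P -> P := der g0 g1 g2.
HB.instance Definition _ := GRing.Additive.on D.

Lemma map_der (a b c : P) (u v : {poly P}) :
  map_poly (der a b c) (u * v) = map_poly (der a b c) u * v + u * map_poly (der a b c) v.
Proof.
apply/polyP => k; rewrite coef_map coefD !coefM raddf_sum -big_split; apply: eq_bigr => j _.
by rewrite /= derM !coef_map.
Qed.

(** The coefficient of X^n is the component of weight n, for the halved weights 1, 2, 3 of x, y,
    z. *)
Definition phi : P -> {poly P} := mev (polyC \o c_) (x *: 'X) (y *: 'X^2) (z *: 'X^3).
HB.instance Definition _ := GRing.RMorphism.on phi.
(** Taylor expansion in x. Apart from the weight factor, the inversion translates E2 by a multiple
    of 1 / s, so these coefficients describe how a quasimodular form transforms. *)
Definition theta : P -> {poly P} := mev (polyC \o c_) (x%:P + 'X) y%:P z%:P.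
HB.instance Definition _ := GRing.RMorphism.on theta.

Lemma phi_c c : phi (c_ c) = (c_ c)%:P. Proof. exact: mev_c. Qed.
Lemma theta_c c : theta (c_ c) = (c_ c)%:P. Proof. exact: mev_c. Qed.

Definition hom n (p : P) : Prop := phi p = p *: 'X^n.

Lemma homD n p q : hom n p -> hom n q -> hom n (p + q).
Proof. by rewrite /hom rmorphD /= => -> ->; rewrite scalerDl. Qed.
Lemma homN n p : hom n p -> hom n (- p).
Proof. by rewrite /hom rmorphN /= => ->; rewrite scaleNr. Qed.
Lemma homB n p q : hom n p -> hom n q -> hom n (p - q).
Proof. by move=> hp hq; apply: homD => //; exact: homN. Qed.
Lemma homM m n p q : hom m p -> hom n q -> hom (m + n) (p * q).
Proof. by rewrite /hom rmorphM /= => -> ->; rewrite -scalerAl -scalerAr scalerA exprD. Qed.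
Lemma hom_c c : hom 0 (c_ c).
Proof. by rewrite /hom phi_c expr0 -mul_polyC mulr1. Qed.
Lemma homZ n c p : hom n p -> hom n (c_ c * p).
Proof. exact: homM (hom_c c). Qed.
Lemma hom0 n : hom n 0. Proof. by rewrite /hom rmorph0 scale0r. Qed.
Lemma hom_x : hom 1 x. Proof. exact: mev_x. Qed.
Lemma hom_y : hom 2 y. Proof. exact: mev_y. Qed.
Lemma hom_z : hom 3 z. Proof. exact: mev_z. Qed.
Lemma homX n p k : hom n p -> hom (n * k) (p ^+ k).
Proof.
move=> hp; elim: k => [|k IH]; first by rewrite muln0 expr0 -(rmorph1 c_); exact: hom_c.
by rewrite mulnS exprS; exact: homM.
Qed.

Lemma hom_mon a i j : hom (a + 2 * i + 3 * j) (mon a i j).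
Proof.
apply: homM (homX _ hom_z); apply: homM (homX _ hom_y).
by rewrite -[a in X in hom X _]mul1n; exact: homX hom_x.
Qed.

Lemma hom_coef n p : hom n p -> forall k, (phi p)`_k = if k == n then p else 0.
Proof. by move=> h k; rewrite h coefZ coefXn; case: eqP; rewrite ?mulr1 ?mulr0. Qed.

Lemma phi_coef_ind n (Q : P -> Prop) : Q 0 ->
  (forall c a i j p, (a + 2 * i + 3 * j = n)%N -> Q p -> Q (c_ c * mon a i j + p)) ->
  forall p, Q (phi p)`_n.
Proof.
move=> Q0 Qm; apply: p3_ind => [|c a i j p IH]; first by rewrite rmorph0 coef0.
rewrite -/(mon a i j) rmorphD rmorphM coefD /= phi_c (hom_mon a i j) -mul_polyC mulrA -polyCM mul_polyC.
rewrite coefZ coefXn; case: eqP => [E|_]; last by rewrite mulr0 add0r.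
by rewrite mulr1; exact: Qm.
Qed.

Lemma hom_ind n (Q : P -> Prop) : Q 0 ->
  (forall c a i j p, (a + 2 * i + 3 * j = n)%N -> Q p -> Q (c_ c * mon a i j + p)) ->
  forall p, hom n p -> Q p.
Proof. by move=> Q0 Qm p /hom_coef/(_ n); rewrite eqxx => <-; exact: phi_coef_ind. Qed.

Lemma hom_phi_coef n p : hom n (phi p)`_n.
Proof.
apply: phi_coef_ind => [|c a i j q <- hq]; first exact: hom0.
by apply: homD => //; apply: homZ; exact: hom_mon.
Qed.

Lemma phi1 p : (phi p).[1] = p.
Proof.
elim/alg_ind: p => [c|p q hp hq|p q hp hq|||].
- by rewrite phi_c hornerC.
- by rewrite rmorphD hornerD hp hq.
- by rewrite rmorphM hornerM hp hq.
- by rewrite hom_x hornerZ hornerXn expr1n mulr1.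
- by rewrite hom_y hornerZ hornerXn expr1n mulr1.
- by rewrite hom_z hornerZ hornerXn expr1n mulr1.
Qed.

Lemma phi_inj : injective phi.
Proof. by move=> p q h; rewrite -[p]phi1 h phi1. Qed.

(** Ramanujan's equations are homogeneous: D raises the weight by 1. *)
Lemma phi_D p : phi (D p) = 'X * map_poly D (phi p).
Proof.
have mapX n q : map_poly D (q *: 'X^n) = D q *: 'X^n.
  by apply/polyP => k; rewrite coef_map !coefZ coefXn /= /D derM -(rmorph_nat c_ (k == n)) der_c mulr0 addr0.
have XZ n q : 'X * (q *: 'X^n) = q *: 'X^(n.+1) :> {poly P} by rewrite -scalerAr -exprS.
elim/alg_ind: p => [c|p q hp hq|p q hp hq|||].
- by rewrite /D der_c rmorph0 phi_c map_polyC /= der_c mulr0.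
- by rewrite raddfD !rmorphD raddfD /= mulrDr hp hq.
- by rewrite {1}/D derM rmorphD !rmorphM /= -/D hp hq /D map_der; ring.
- rewrite hom_x mapX XZ /D der_x.
  by apply: homZ; apply: homB hom_y; exact: (homM hom_x hom_x).
- rewrite hom_y mapX XZ /D der_y.
  by apply: homZ; apply: homB hom_z; exact: (homM hom_x hom_y).
- rewrite hom_z mapX XZ /D der_z.
  by apply: homZ; apply: homB (homM hom_y hom_y); exact: (homM hom_x hom_z).
Qed.

Lemma theta0 p : (theta p)`_0 = p.
Proof.
elim/alg_ind: p => [c|p q hp hq|p q hp hq|||].
- by rewrite theta_c coefC.
- by rewrite rmorphD coefD hp hq.
- by rewrite rmorphM coef0M hp hq.
- by rewrite /theta mev_x coefD coefC coefX addr0.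
- by rewrite /theta mev_y coefC.
- by rewrite /theta mev_z coefC.
Qed.

Lemma theta_inj : injective theta.
Proof. by move=> p q h; rewrite -[p]theta0 h theta0. Qed.

Lemma theta_dx p : map_poly dx (theta p) = (theta p)^`().
Proof.
elim/alg_ind: p => [c|p q hp hq|p q hp hq|||].
- by rewrite theta_c map_polyC /= /dx der_c derivC.
- by rewrite rmorphD raddfD derivD /= hp hq.
- by rewrite rmorphM /= /dx map_der derivM -/dx hp hq.
- have -> : theta x = x%:P + 'X by exact: mev_x.
  apply/polyP => k; rewrite coef_map coef_deriv !coefD !coefC !coefX /=.
  case: k => [|k] /=; first by rewrite addr0 add0r mulr1n /dx der_x.
  by rewrite !add0r mul0rn -(rmorph_nat c_) /dx der_c.
- have -> : theta y = y%:P by exact: mev_y.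
  by rewrite map_polyC /= /dx der_y derivC.
- have -> : theta z = z%:P by exact: mev_z.
  by rewrite map_polyC /= /dx der_z derivC.
Qed.

Lemma dx_theta p k : dx (theta p)`_k = (theta p)`_k.+1 *+ k.+1.
Proof. by rewrite -coef_deriv -theta_dx coef_map. Qed.

Lemma dx0_theta p : dx p = 0 -> theta p = p%:P.
Proof.
move=> dp; apply/polyP => -[|k]; rewrite coefC ?theta0//=.
elim: k => [|k IH].
  by have := dx_theta p 0; rewrite theta0 dp mulr1n => <-.
apply/eqP; have := dx_theta p k.+1; rewrite IH raddf0 => /esym/eqP.
by rewrite -mulr_natr mulf_eq0 -(rmorph_nat c_) fmorph_eq0 pnatr_eq0 orbF.
Qed.

(** A polynomial killed by [dx] does not change when x is translated by - x, which leaves only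
    monomials in y and z. *)
Lemma hom_dx_ind n (Q : P -> Prop) : Q 0 ->
  (forall c i j p, (2 * i + 3 * j = n)%N -> Q p -> Q (c_ c * (y ^+ i * z ^+ j) + p)) ->
  forall p, hom n p -> dx p = 0 -> Q p.
Proof.
move=> Q0 Qm p hp dp.
have E : p = (theta p).[- x] by rewrite dx0_theta// hornerC.
suff H q : hom n q -> Q (theta q).[- x] by rewrite E; exact: H.
move: q; apply: hom_ind => [|c a i j q E' hq]; first by rewrite rmorph0 horner0.
rewrite rmorphD rmorphM hornerD hornerM /= theta_c hornerC.
rewrite {1}/theta mev_mon !hornerM !horner_exp hornerD !hornerC hornerX subrr.
case: a E' => [|a] E'; last by rewrite expr0n !mul0r mulr0 add0r.
by rewrite expr0 mul1r; exact: (Qm _ _ _ _ E').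
Qed.

(** Each X takes the place of a factor x of weight 1. *)
Lemma hom_theta n p k : hom n p -> (if (k <= n)%N then hom (n - k) (theta p)`_k else (theta p)`_k = 0).
Proof.
move: p; apply: hom_ind => [|c a i j p E hp].
  by rewrite rmorph0 coef0; case: ifP => // _; exact: hom0.
have H : if (k <= n)%N then hom (n - k) (theta (mon a i j))`_k else (theta (mon a i j))`_k = 0.
  have -> : (theta (mon a i j))`_k = 'C(a, k)%:R * mon (a - k) i j.
    rewrite /theta mev_mon -!rmorphXn /= -mulrA -rmorphM mulrC mul_polyC coefZ.
    rewrite exprDn coef_sum.
    transitivity (y ^+ i * z ^+ j * ('C(a, k)%:R * x ^+ (a - k))); last first.
      by rewrite /mon mulrC -!mulrA.
    congr (_ * _); have [ka|ak] := ltnP k a.+1.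
      rewrite (bigD1 (Ordinal ka)) //= big1 => [|m mk].
        by rewrite coefMn -rmorphXn /= mul_polyC coefZ coefXn eqxx mulr1 mulr_natl addr0.
      rewrite coefMn -rmorphXn /= mul_polyC coefZ coefXn; case: eqP => [E'|_]; last by rewrite mulr0 mul0rn.
      by case/eqP: mk; apply/val_inj.
    rewrite bin_small// mul0r big1 // => m _.
    rewrite coefMn -rmorphXn /= mul_polyC coefZ coefXn; case: eqP => [E'|_]; last by rewrite mulr0 mul0rn.
    by have := ltn_ord m; rewrite -E' ltnNge ak.
  have [ka|ak] := leqP k a; last first.
    by rewrite bin_small// mul0r; case: ifP => // _; exact: hom0.
  have kn : (k <= n)%N by rewrite -E -addnA (leq_trans ka)// leq_addr.
  rewrite kn -(rmorph_nat c_); apply: homZ.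
  have -> : (n - k = (a - k) + 2 * i + 3 * j)%N by lia.
  exact: hom_mon.
rewrite rmorphD rmorphM coefD /= theta_c mul_polyC coefZ; move: H hp; case: ifP => _.
  by move=> h1 h2; apply: homD => //; exact: homZ.
by move=> -> ->; rewrite mulr0 addr0.
Qed.

End RamanujanRing.

(** * Zeros and divisors of homogeneous polynomials in y and z *)

Section ModularDivisibility.
Variables (K : numClosedFieldType) (P : poly3 K).
Implicit Types (p q A B : P) (c : K).
Local Notation c_ := (p3c P).
Local Notation x := (p3x P).
Local Notation y := (p3y P).
Local Notation z := (p3z P).
Local Notation D := (@D K P).
Local Notation dx := (@dx K P).

Definition val_at (u v w : K) : P -> K := mev (idfun : {rmorphism K -> K}) u v w.
HB.instance Definition _ u v w := GRing.RMorphism.on (val_at u v w).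

Lemma val_c u v w c : val_at u v w (c_ c) = c. Proof. exact: mev_c. Qed.
Lemma val_x u v w : val_at u v w x = u. Proof. exact: mev_x. Qed.
Lemma val_y u v w : val_at u v w y = v. Proof. exact: mev_y. Qed.
Lemma val_z u v w : val_at u v w z = w. Proof. exact: mev_z. Qed.

Lemma valD u v w p q : val_at u v w (p + q) = val_at u v w p + val_at u v w q.
Proof. exact: rmorphD. Qed.
Lemma valN u v w p : val_at u v w (- p) = - val_at u v w p.
Proof. exact: rmorphN. Qed.
Lemma valM u v w p q : val_at u v w (p * q) = val_at u v w p * val_at u v w q.
Proof. exact: rmorphM. Qed.
Lemma valX u v w p n : val_at u v w (p ^+ n) = val_at u v w p ^+ n.
Proof. exact: rmorphXn. Qed.
Lemma val0 u v w : val_at u v w 0 = 0. Proof. exact: rmorph0. Qed.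
Lemma val1 u v w : val_at u v w 1 = 1. Proof. exact: rmorph1. Qed.
Lemma val_nat u v w n : val_at u v w n%:R = n%:R. Proof. exact: rmorph_nat. Qed.
Definition valE := (valD, valN, valM, valX, val_c, val_x, val_y, val_z, val0, val1).
Lemma c_eq0 c : (c_ c == 0) = (c == 0). Proof. exact: fmorph_eq0. Qed.

Lemma val_scale n p t u v w : hom n p -> val_at (t * u) (t ^+ 2 * v) (t ^+ 3 * w) p = t ^+ n * val_at u v w p.
Proof.
move: p; apply: hom_ind => [|c a i j p <- hp]; first by rewrite !val0 mulr0.
rewrite /mon !valE hp.
have -> : (t * u) ^+ a = t ^+ a * u ^+ a by exact: exprMn.
have -> : (t ^+ 2 * v) ^+ i = t ^+ (2 * i) * v ^+ i by rewrite exprMn -exprM.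
have -> : (t ^+ 3 * w) ^+ j = t ^+ (3 * j) * w ^+ j by rewrite exprMn -exprM.
by rewrite !exprD; ring.
Qed.

Lemma val_theta p u v w r : val_at (u + r) v w p = (map_poly (val_at u v w) (theta p)).[r].
Proof.
elim/alg_ind: p => [c|p q hp hq|p q hp hq|||].
- by rewrite theta_c map_polyC hornerC /= !val_c.
- by rewrite !rmorphD hornerD /= hp hq.
- by rewrite !rmorphM hornerM /= hp hq.
- have -> : theta x = x%:P + 'X by exact: mev_x.
  by rewrite rmorphD /= map_polyC map_polyX hornerD hornerC hornerX /= !val_x.
- have -> : theta y = y%:P by exact: mev_y.
  by rewrite map_polyC hornerC /= !val_y.
- have -> : theta z = z%:P by exact: mev_z.
  by rewrite map_polyC hornerC /= !val_z.
Qed.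

(* [pt u v] is an irreducible polynomial of C[y, z], up to a unit, vanishing at
   (y, z) = (u, v) <> (0, 0). *)
Definition pt (u v : K) : P := if u == 0 then y else if v == 0 then z else
  c_ (v ^+ 2) * y ^+ 3 - c_ (u ^+ 3) * z ^+ 2.
Definition ptw (u v : K) : nat := if u == 0 then 2 else if v == 0 then 3 else 6.

Lemma hom_pt u v : hom (ptw u v) (pt u v).
Proof.
rewrite /ptw /pt; case: ifP => _; first exact: hom_y.
case: ifP => _; first exact: hom_z.
by apply: homB; apply: homZ; [exact: (homX 3 (hom_y P))|exact: (homX 2 (hom_z P))].
Qed.

Lemma ptw_gt0 u v : (0 < ptw u v)%N.
Proof. by rewrite /ptw; case: (u == 0) => //; case: (v == 0). Qed.

Lemma dx_c c : dx (c_ c) = 0. Proof. exact: der_c. Qed.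
Lemma dx_y : dx y = 0. Proof. exact: der_y. Qed.
Lemma dx_z : dx z = 0. Proof. exact: der_z. Qed.
Lemma dxM p q : dx (p * q) = dx p * q + p * dx q. Proof. exact: derM. Qed.

Lemma dx_pt u v : dx (pt u v) = 0.
Proof.
rewrite /pt; case: ifP => _; first exact: dx_y.
case: ifP => _; first exact: dx_z.
by rewrite raddfB /= !(dxM, dx_c, dx_y, dx_z) !(mul0r, mulr0, addr0) subr0.
Qed.

Lemma pt_neq0 u v : pt u v != 0.
Proof.
rewrite /pt; have h r s p : val_at 0 r s p != 0 -> p != 0.
  by apply: contraNneq => ->; rewrite rmorph0.
case: ifP => u0; first by apply: (h 1 0); rewrite val_y oner_eq0.
case: ifP => v0; first by apply: (h 0 1); rewrite val_z oner_eq0.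
apply: (h 1 0); rewrite !valE.
by rewrite expr1n mulr1 expr0n /= mulr0 subr0 expf_neq0 ?v0.
Qed.

Lemma val_pt r u v : val_at r u v (pt u v) = 0.
Proof.
rewrite /pt; case: eqP => [->|_]; first by rewrite val_y.
case: eqP => [->|_]; first by rewrite val_z.
by rewrite !valE mulrC subrr.
Qed.

(* Modulo [pt u v], a homogeneous polynomial is a multiple of a single monomial. *)
Lemma pt_dvd n A r u v : hom n A -> dx A = 0 -> (u != 0) || (v != 0) ->
  val_at r u v A = 0 -> exists B, A = pt u v * B.
Proof.
move=> hA dA uv A0.
suff [i [j [h [B [c E]]]]] : exists i j, (u ^+ i * v ^+ j != 0) /\
    exists B c, A = pt u v * B + c_ c * (y ^+ i * z ^+ j).
  exists B; move: (A0); rewrite E valD valM val_pt !valE mul0r add0r.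
  by move/eqP; rewrite mulf_eq0 (negPf h) orbF => /eqP ->; rewrite rmorph0 mul0r addr0.
move: hA dA; rewrite /pt; case: (eqVneq u 0) uv => [u0 /= uv|u0 _].
  case: (boolP (3 %| n)%N) => n3.
    move=> hA dA; exists 0%N, (n %/ 3)%N; rewrite expr0 mul1r expf_neq0//; split=> //.
    apply: (@hom_dx_ind _ _ n (fun A => exists B c, A = y * B + c_ c * (y ^+ 0 * z ^+ (n %/ 3)))) hA dA => [|c i j p E [B [d ->]]].
      by exists 0, 0; rewrite rmorph0 mulr0 mul0r addr0.
    case: i E => [|i] E; last by exists (c_ c * (y ^+ i * z ^+ j) + B), d; rewrite exprS; ring.
    exists B, (c + d); have -> : j = (n %/ 3)%N by rewrite -E mulKn.
    by rewrite rmorphD; ring.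
  move=> hA dA; exists 0%N, 0%N; rewrite !expr0 mulr1 oner_eq0; split=> //.
  apply: (@hom_dx_ind _ _ n (fun A => exists B c, A = y * B + c_ c * (1 * 1))) hA dA => [|c i j p E [B [d ->]]].
    by exists 0, 0; rewrite rmorph0 mulr0 mul0r addr0.
  case: i E => [|i] E; last by exists (c_ c * (y ^+ i * z ^+ j) + B), d; rewrite exprS; ring.
  by move: n3; rewrite -E dvdn_mulr.
case: (eqVneq v 0) => [v0|v0].
  case: (boolP (2 %| n)%N) => n2 hA dA.
    exists (n %/ 2)%N, 0%N; rewrite expr0 mulr1 expf_neq0//; split=> //.
    apply: (@hom_dx_ind _ _ n (fun A => exists B c, A = z * B + c_ c * (y ^+ (n %/ 2) * z ^+ 0))) hA dA => [|c i j p E [B [d ->]]].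
      by exists 0, 0; rewrite rmorph0 mulr0 mul0r addr0.
    case: j E => [|j] E; last by exists (c_ c * (y ^+ i * z ^+ j) + B), d; rewrite exprS; ring.
    exists B, (c + d); have -> : i = (n %/ 2)%N by rewrite -E muln0 addn0 mulKn.
    by rewrite rmorphD; ring.
  exists 0%N, 0%N; rewrite !expr0 mulr1 oner_eq0; split=> //.
  apply: (@hom_dx_ind _ _ n (fun A => exists B c, A = z * B + c_ c * (1 * 1))) hA dA => [|c i j p E [B [d ->]]].
    by exists 0, 0; rewrite rmorph0 mulr0 mul0r addr0.
  case: j E => [|j] E; last by exists (c_ c * (y ^+ i * z ^+ j) + B), d; rewrite exprS; ring.
  by move: n2; rewrite -E muln0 addn0 dvdn_mulr.
move=> hA dA; set q := _ - _.
have red c m i j : exists B d, c_ c * (y ^+ (i + 3 * m) * z ^+ j) = q * B + c_ d * (y ^+ i * z ^+ (j + 2 * m)).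
  elim: m c j => [|m IH] c j; first by exists 0, c; rewrite mulr0 add0r !muln0 !addn0.
  have [B [d E]] := IH (c * (u ^+ 3 / v ^+ 2)) (j + 2)%N.
  exists (c_ (c / v ^+ 2) * (y ^+ (i + 3 * m) * z ^+ j) + B), d.
  have -> : (j + 2 * m.+1 = j + 2 + 2 * m)%N by lia.
  rewrite mulrDr -addrA -E (_ : (i + 3 * m.+1 = i + 3 * m + 3)%N); last by lia.
  have -> : c_ c = c_ (c / v ^+ 2) * c_ (v ^+ 2) by rewrite -rmorphM divfK// expf_neq0.
  have -> : c_ (c * (u ^+ 3 / v ^+ 2)) = c_ (c / v ^+ 2) * c_ (u ^+ 3) by rewrite -rmorphM; congr (c_ _); ring.
  by rewrite /q !exprD; ring.
pose i0 := ((2 * n) %% 3)%N.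
have [le_in|lt_ni] := leqP (2 * i0) n; last first.
  exists 0%N, 0%N; rewrite !expr0 mulr1 oner_eq0; split=> //.
  apply: (@hom_dx_ind _ _ n (fun A => exists B c, A = q * B + c_ c * (1 * 1))) hA dA => [|c i j p E _].
    by exists 0, 0; rewrite rmorph0 mulr0 mul0r addr0.
  by exfalso; move: lt_ni; rewrite /i0 -E; lia.
exists i0, ((n - 2 * i0) %/ 3)%N; rewrite mulf_neq0 ?expf_neq0//; split=> //.
apply: (@hom_dx_ind _ _ n (fun A => exists B c, A = q * B + c_ c * (y ^+ i0 * z ^+ ((n - 2 * i0) %/ 3)))) hA dA => [|c i j p E [B [d ->]]].
  by exists 0, 0; rewrite rmorph0 mulr0 mul0r addr0.
have [B' [d' E']] := red c (i %/ 3)%N i0 j.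
have Ei : (i0 + 3 * (i %/ 3) = i)%N by rewrite /i0 -E; lia.
have Ej : (j + 2 * (i %/ 3) = (n - 2 * i0) %/ 3)%N by rewrite /i0 -E; lia.
rewrite Ei Ej in E'; exists (B' + B), (d' + d).
by rewrite E' rmorphD; ring.
Qed.

(** Set z = 1. The resulting polynomial in y has a root in the closed field K unless it is a
    non-zero constant; in that case B contains no pure power of y and vanishes at (1, 0). *)
Lemma hom_zero n B : hom n B -> dx B = 0 -> (0 < n)%N ->
  exists u v, (u != 0) || (v != 0) /\ forall r, val_at r u v B = 0.
Proof.
move=> hB dB n0.
pose b : {poly K} := mev (polyC : {rmorphism K -> {poly K}}) 0 'X 1 B.
have val_r r s u v : val_at r u v B = val_at s u v B.
  by have := val_theta B s u v (r - s); rewrite addrC subrK dx0_theta// map_polyC hornerC.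
have val_b u : val_at 0 u 1 B = b.[u].
  rewrite /b; elim/alg_ind: (B) => [c|p q hp hq|p q hp hq|||].
  - by rewrite mev_c hornerC val_c.
  - by rewrite valD rmorphD hornerD /= hp hq.
  - by rewrite valM rmorphM hornerM /= hp hq.
  - by rewrite mev_x horner0 val_x.
  - by rewrite mev_y hornerX val_y.
  - by rewrite mev_z hornerC val_z.
have [b1|b1] := boolP (size b == 1%N); last first.
  have [u /rootP ru] := closed_rootP b b1.
  by exists u, 1; rewrite oner_eq0 orbT; split=> // r; rewrite (val_r r 0) val_b.
exists 1, 0; rewrite oner_eq0; split=> // r; rewrite (val_r r 0).
have Hb A : hom n A -> dx A = 0 ->
    val_at 0 1 0 A = (mev (polyC : {rmorphism K -> {poly K}}) 0 'X 1 A)`_(n %/ 2).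
  move: A; apply: hom_dx_ind => [|c i j A E IH]; first by rewrite !rmorph0 coef0.
  rewrite !valE IH rmorphD coefD !rmorphM !rmorphXn /= mev_c mev_y mev_z !expr1n ?mulr1 coefCM coefXn ?mul1r.
  congr (c * _ + _); case: j E => [|j] E; last by rewrite expr0n /= (_ : _ == _ = false)//; lia.
  by rewrite expr0 (_ : _ == _ = true)//; lia.
rewrite Hb// -/b; have /size_poly1P[c c0 ->] := b1; rewrite coefC.
case: eqP => // n2'; have n2 : (n %/ 2 = 0)%N := n2'.
have nn : n = 1%N by lia.
have B0 : B = 0.
  apply: (@hom_dx_ind _ _ n (fun A => A = 0)) hB dB => // c' i j p E _.
  by exfalso; lia.
by move: b1; rewrite /b B0 rmorph0 size_poly0.
Qed.

Lemma hom_mul_cancel n w p q : p != 0 -> q != 0 -> hom w p -> hom n (p * q) -> (w <= n)%N /\ hom (n - w) q.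
Proof.
rewrite /hom => p0 q0 hp; rewrite rmorphM /= hp => h.
have h2 : 'X^w * phi q = q *: 'X^n.
  have pX : p%:P != 0 by rewrite polyC_eq0.
  by apply: (mulfI pX); rewrite mulrA mul_polyC h mul_polyC scalerA.
have wn : (w <= n)%N.
  rewrite leqNgt; apply/negP => nw; have := congr1 (fun r : {poly P} => r`_n) h2.
  rewrite coefXnM nw coefZ coefXn eqxx mulr1 => /esym/eqP; exact/negP.
split=> //; apply: (mulfI (_ : 'X^w != 0)); first by rewrite monic_neq0// monicXn.
by rewrite h2 -scalerAr -exprD subnKC.
Qed.

Lemma dx_mul_cancel p q : p != 0 -> dx p = 0 -> dx (p * q) = 0 -> dx q = 0.
Proof. by move=> p0 dp; rewrite dxM dp mul0r add0r => /eqP; rewrite mulf_eq0 (negPf p0) => /eqP. Qed.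

Lemma hom0_cst B : hom 0 B -> exists c, B = c_ c.
Proof.
move: B; apply: hom_ind => [|c a i j p E [d ->]]; first by exists 0; rewrite rmorph0.
have [-> -> ->] : [/\ a = 0, i = 0 & j = 0]%N by split; lia.
by exists (c + d); rewrite /mon !expr0 !mulr1 rmorphD.
Qed.

Lemma pt_power n B u v : B != 0 -> hom n B -> dx B = 0 -> exists r B1 m,
  [/\ B = pt u v ^+ r * B1, hom m B1, dx B1 = 0 & ~ exists B2, B1 = pt u v * B2].
Proof.
elim/ltn_ind: n B => n IH B B0 hB dB.
have [[B2 E]|nB] := pselect (exists B2, B = pt u v * B2); last first.
  by exists 0%N, B, n; rewrite expr0 mul1r.
have p0 := pt_neq0 u v; have B20 : B2 != 0 by apply: contraNneq B0; rewrite E => ->; rewrite mulr0.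
rewrite E in hB dB; have [wn hB2] := hom_mul_cancel p0 B20 (hom_pt u v) hB.
have dB2 := dx_mul_cancel p0 (dx_pt u v) dB.
have lt_n : (n - ptw u v < n)%N by have := ptw_gt0 u v; lia.
have [r [B1 [m [E1 h1 d1 nd]]]] := IH _ lt_n B2 B20 hB2 dB2.
by exists r.+1, B1, m; rewrite E E1 exprS mulrA.
Qed.

(* The numerator over B^(i+1) of the i-th derivative of A / B. *)
Fixpoint dnum A B i : P :=
  if i is k.+1 then B * D (dnum A B k) - k.+1%:R * dnum A B k * D B else A.

Lemma DM p q : D (p * q) = D p * q + p * D q. Proof. exact: derM. Qed.
Lemma DX p n : D (p ^+ n) = n%:R * p ^+ n.-1 * D p. Proof. exact: derX. Qed.
Lemma DB p q : D (p - q) = D p - D q. Proof. exact: derB. Qed.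
Lemma DD p q : D (p + q) = D p + D q. Proof. exact: derD. Qed.

(* If the K-th derivative of A / B is a polynomial then A / B has no pole along p:
   a pole of order r becomes a pole of order r + K. *)
Lemma pole_order p r A B B1 m k u v w : B = p ^+ r.+1 * B1 ->
  dnum A B k = B ^+ k.+1 * m -> (0 < k)%N ->
  p != 0 -> val_at u v w p = 0 -> val_at u v w (D p) != 0 -> val_at u v w B1 != 0 ->
  val_at u v w A = 0.
Proof.
move=> EB Em k0 p0 vp vDp vB1.
(* The i-th derivative has a pole of order at most r + 1 + i along p, while B^(i+1) contributes (r +
   1) (i + 1); the difference of these exponents is i r. Modulo p the cofactor M is an explicit
   multiple of A (B1 D p)^i. *)
have H i : exists M S, dnum A B i = p ^+ (i * r) * M /\
    M = (-1) ^+ i * (\prod_(j < i) (j + r.+1)%:R) * A * (B1 * D p) ^+ i + p * S.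
  elim: i => [|i [M [S [E1 E2]]]].
    by exists A, 0; rewrite mul0n !expr0 big_ord0 mulr0 addr0 !mul1r !mulr1.
  exists (p * (B1 * D M - i.+1%:R * M * D B1) - (i + r.+1)%:R * M * (B1 * D p)).
  exists (B1 * D M - i.+1%:R * M * D B1 - (i + r.+1)%:R * S * (B1 * D p)); split; last first.
    rewrite {3}E2 big_ord_recr /= !exprS.
    move: ((-1) ^+ i) (\prod_(_ < _) _) ((B1 * D p) ^+ i) ((i + r.+1)%:R : P) (i.+1%:R : P) => s1 s2 s3 s4 s5.
    by ring.
  have hY : (i * r)%:R * p ^+ (i * r).-1 * p = i%:R * r%:R * p ^+ (i * r).
    by rewrite -natrM; case: (i * r)%N => [|e]; rewrite ?mulr0n ?mul0r//= exprSr mulrA.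
  rewrite /= E1 EB !DM !DX /= mulSn exprD; move: hY.
  move: ((i * r)%:R * p ^+ (i * r).-1) (p ^+ (i * r)) => Y X hY.
  rewrite exprS; move: (p ^+ r) => Z.
  transitivity (Z * B1 * D p * M * (Y * p) + p * Z * B1 * X * D M -
      i.+1%:R * (X * M) * (r.+1%:R * Z * D p * B1 + p * Z * D B1)); first by ring.
  by rewrite hY -[(i.+1%:R : P)]natr1 natrD -[(r.+1%:R : P)]natr1; ring.
have [M [S [E1 E2]]] := H k.
have pM : M = p ^+ (k + r.+1) * B1 ^+ k.+1 * m.
  apply: (mulfI (_ : p ^+ (k * r) != 0)); first exact: expf_neq0.
  rewrite -E1 Em EB exprMn -exprM !mulrA -exprD; congr (p ^+ _ * _ * _).
  by rewrite mulnS mulnC; lia.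
have := congr1 (val_at u v w) E2; rewrite pM addnS exprS !valE vp !mul0r addr0.
rewrite rmorph_prod /= => /esym/eqP; rewrite !mulf_eq0 !expf_eq0 k0 /= mulf_eq0 (negPf vDp) (negPf vB1) !orbF.
case/orP=> [/orP[|/prodf_eq0 [j _]]|/eqP //].
  by rewrite oppr_eq0 oner_eq0.
by rewrite val_nat addnS pnatr_eq0.
Qed.

(** When u and v are non-zero, the value at x = 0 is u^2 v (u^3 - v^2). On the excluded curve [pt]
    is proportional to y^3 - z^2, which divides its own image under D. *)
Lemma D_pt_neq0 u v : (u == 0) || (v == 0) || (u ^+ 3 != v ^+ 2) -> (u != 0) || (v != 0) ->
  val_at 0 u v (D (pt u v)) != 0.
Proof.
have Dy : D y = g1 P by exact: der_y.
have Dz : D z = g2 P by exact: der_z.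
have n0 k : (k.+1%:R : K) != 0 by rewrite pnatr_eq0.
rewrite /pt; case: (eqVneq u 0) => [-> _|u0] /=.
  by move=> v0; rewrite Dy /g1 !valE !mul0r sub0r mulrN oppr_eq0 mulf_neq0 ?invr_eq0.
case: (eqVneq v 0) => [-> _ _|v0 /= uv _].
  by rewrite Dz /g2 !valE !mul0r sub0r mulrN oppr_eq0 !mulf_neq0 ?invr_eq0.
have DZ c p : D (c_ c * p) = c_ c * D p by exact: derZ.
rewrite DB !DZ !DX Dy Dz /g1 /g2 -(rmorph_nat c_ 3) -(rmorph_nat c_ 2) /=.
rewrite !valE !mul0r !sub0r.
have -> : v ^+ 2 * (3%:R * u ^+ 2 * (3%:R^-1 * - v)) - u ^+ 3 * (2%:R * v ^+ 1 * (2%:R^-1 * - (u * u))) =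
    u ^+ 2 * v * (u ^+ 3 - v ^+ 2).
  by field.
by rewrite !mulf_neq0 ?expf_neq0// subr_eq0.
Qed.

End ModularDivisibility.

(** * Fourier series: Wronskians and primitives *)

Section FourierAlgebra.
Variable R : realType.
Local Notation C := R[i].
Implicit Types (a b : nat -> C) (f g : hfun R) (s : R).

Lemma nice_fexp f : nice f -> fexp f (fourier f).
Proof. by case=> a fa; rewrite (fexp_fourier fa). Qed.

Lemma nice_axis_eq0 f : nice f -> (forall s, 0 < s -> line f 0 s = 0) -> f = 0.
Proof.
move=> nf h; have [sa fa] := nice_fexp nf.
have z n : fourier f n = 0.
  apply: es_eq0 => // s s0; rewrite -(h s s0).
  by have [_ ->] := fa 0; rewrite ?tw0.
apply: hfun_ext => x s s0; rewrite line0; have [_ ->] := fa x => //.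
rewrite -(es0 s0); congr (es _ s); apply/funext => n; by rewrite /tw z mul0r.
Qed.

Lemma nice_eq0 f : nice f -> (forall n, fourier f n = 0) -> f = 0.
Proof.
move=> nf z; apply: nice_axis_eq0 => // s s0; have [sa fa] := nice_fexp nf.
have [_ ->] := fa 0 => //; rewrite -(es0 s0); congr (es _ s).
by apply/funext => n; rewrite /tw z mul0r.
Qed.

Lemma nice_low f : nice f -> f <> 0 -> exists r, fourier f r != 0 /\ forall i, (i < r)%N -> fourier f i = 0.
Proof.
move=> nf f0; have ex : exists r, fourier f r != 0.
  apply: contrapT => h; apply: f0; apply: nice_eq0 => // n.
  by apply/eqP/negPn/negP => hn; apply: h; exists n.
exists (ex_minn ex); case: ex_minnP => r hr min; split=> // i ir.
by apply/eqP/negPn/negP => /min; rewrite leqNgt ir.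
Qed.

Lemma conv_low a b r t : (forall i, (i < r)%N -> a i = 0) -> (forall i, (i < t)%N -> b i = 0) ->
  conv a b (r + t) = a r * b t /\ forall n, (n < r + t)%N -> conv a b n = 0.
Proof.
move=> ha hb; have H n (k : 'I_n.+1) : (k != r :> nat) || (n < r + t)%N -> (n <= r + t)%N -> a k * b (n - k)%N = 0.
  move=> hk hn; have [kr|rk] := ltnP k r; first by rewrite ha// mul0r.
  rewrite hb ?mulr0//; have := ltn_ord k; case/orP: hk => [/eqP|]; lia.
split; last by move=> n hn; rewrite /conv big1// => k _; apply: H; rewrite ?hn ?orbT// ltnW.
have rr : (r < (r + t).+1)%N by rewrite ltnS leq_addr.
rewrite /conv (bigD1 (Ordinal rr)) //= addKn big1 ?addr0// => k kr.
by apply: H => //; rewrite kr.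
Qed.

Lemma fourierM f g : nice f -> nice g -> fourier (f * g) = conv (fourier f) (fourier g).
Proof. by move=> /nice_fexp hf /nice_fexp hg; rewrite (fexp_fourier (fexpM hf hg)). Qed.

Lemma fourierB c f g n : nice f -> nice g -> fourier (f - c *: g) n = fourier f n - c * fourier g n.
Proof.
move=> /nice_fexp hf /nice_fexp hg; rewrite -scaleNr (fexp_fourier (fexpD hf (fexpZ (- c) hg))).
by rewrite mulNr.
Qed.

Lemma niceZ c f : nice f -> nice (c *: f).
Proof. by move=> [a fa]; eexists; exact: fexpZ fa. Qed.
Lemma niceD f g : nice f -> nice g -> nice (f + g).
Proof. by move=> [a fa] [b gb]; eexists; exact: fexpD fa gb. Qed.
Lemma niceB f g : nice f -> nice g -> nice (f - g).
Proof. by move=> nf ng; rewrite -scaleN1r; apply: niceD => //; exact: niceZ. Qed.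

(** The product of the lowest coefficients of two non-zero expansions is a non-zero coefficient of
    the product. *)
Lemma nice_mulf_eq0 f g : nice f -> nice g -> f * g = 0 -> f = 0 \/ g = 0.
Proof.
move=> nf ng fg; have [f0|f0] := pselect (f = 0); first by left.
right; apply: contrapT => g0; have [r [hr hr0]] := nice_low nf f0.
have [t [ht ht0]] := nice_low ng g0; have [E _] := conv_low hr0 ht0.
move: E; rewrite -fourierM// fg -(scale0r 0).
have [a fa] := nf; rewrite (_ : 0 *: 0 = 0 *: f); last by rewrite !scale0r.
rewrite (fexp_fourier (fexpZ 0 fa)) mul0r => /esym/eqP.
by rewrite mulf_eq0 (negPf hr) (negPf ht).
Qed.

Lemma fourier_hder f f' : nice f -> nice f' -> hder f f' -> forall n, fourier f' n = n%:R * fourier f n.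
Proof. by move=> /nice_fexp hf /nice_fexp hf'; exact: fexp_hder_coef. Qed.

Section Wronskian.
Variables (f f' g g' : hfun R).
Hypotheses (nf : nice f) (nf' : nice f') (ng : nice g) (ng' : nice g').
Hypotheses (df : hder f f') (dg : hder g g') (g0 : g <> 0).

(* Subtracting a multiple of g, we may assume that f and g have different orders
   t and r at the cusp; the lowest coefficient of g f' - f g' is (t - r) f_t g_r. *)
Lemma wronskian_low : exists c, f - c *: g = 0 \/ exists r t,
  [/\ r <> t, forall n, (n < r + t)%N -> fourier (g * f' - f * g') n = 0,
      fourier (g * f' - f * g') (r + t) != 0, fourier g r != 0 & forall i, (i < r)%N -> fourier g i = 0].
Proof.
have [r [hr hr0]] := nice_low ng g0; pose c := fourier f r / fourier g r; exists c.
pose e := f - c *: g; pose e' := f' - c *: g'.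
have ne : nice e by apply: niceB => //; exact: niceZ.
have ne' : nice e' by apply: niceB => //; exact: niceZ.
have de : hder e e' by apply: hderB => //; exact: hderZ.
have [e0|e0] := pselect (e = 0); [by left|right].
have [t [ht ht0]] := nice_low ne e0; exists r, t.
have er : fourier e r = 0 by rewrite /e fourierB// /c divfK// subrr.
have E : g * f' - f * g' = g * e' - 1 *: (e * g').
  by rewrite scale1r /e /e' mulrBr mulrBl -scalerAr -scalerAl; ring.
clearbody e e'.
have he'0 i : (i < t)%N -> fourier e' i = 0 by move=> it; rewrite (fourier_hder ne)// ht0// mulr0.
have hg'0 i : (i < r)%N -> fourier g' i = 0 by move=> it; rewrite (fourier_hder ng)// hr0// mulr0.
have [l1 l1'] := conv_low hr0 he'0; have [l2 l2'] := conv_low ht0 hg'0.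
have ng_e' : nice (g * e') by exact: nice_mul.
have ne_g' : nice (e * g') by exact: nice_mul.
have F n : fourier (g * f' - f * g') n = conv (fourier g) (fourier e') n - conv (fourier e) (fourier g') n.
  by rewrite E fourierB// !fourierM// mul1r.
have Z (u v u1 v1 w : C) : u = u1 -> v = v1 -> u1 - v1 = w -> u - v = w by move=> -> ->.
have rt : r <> t by move=> rt; move: ht; rewrite -rt er eqxx.
split; [exact: rt| | |exact: hr|exact: hr0].
  move=> n hn; have z1 := l1' n hn; have z2 : conv (fourier e) (fourier g') n = 0.
    by apply: l2'; rewrite addnC.
  exact: (eq_trans (F n) (Z _ _ _ _ _ z1 z2 (subr0 0))).
have E2 : fourier (g * f' - f * g') (r + t) = (t%:R - r%:R) * (fourier g r * fourier e t).
  have h1 := etrans l1 (congr1 (fun u => fourier g r * u) (fourier_hder ne ne' de t)).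
  have l2n : conv (fourier e) (fourier g') (r + t) = fourier e t * fourier g' r.
    by move: l2; rewrite [(t + r)%N]addnC.
  have h2 := etrans l2n (congr1 (fun u => fourier e t * u) (fourier_hder ng ng' dg r)).
  apply: (eq_trans (F _) (Z _ _ _ _ _ h1 h2 _)).
  by move: (fourier g r) (fourier e t) (t%:R : C) (r%:R : C) => u1 u2 u3 u4; ring.
rewrite E2; apply: mulf_neq0; last exact: mulf_neq0.
by rewrite subr_eq0 eqr_nat; apply/eqP => /esym; exact: rt.
Qed.

Lemma wronskian0 : g * f' = f * g' -> exists c, f = c *: g.
Proof.
move=> W; have [c [/subr0_eq|[r [t [_ _ h _ _]]]]] := wronskian_low; first by exists c.
exfalso; move: h; rewrite W subrr; have [a fa] := nf.
by rewrite -(scale0r f) (fexp_fourier (fexpZ 0 fa)) mul0r eqxx.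
Qed.

(** If g has order r, the Wronskian has order r + t with t <> r, while g^2 h has order at least 2 r.
    Hence t > r, and the coefficient g_r^2 h_0 of q^(2 r) vanishes. *)
Lemma wronskian_cusp h : nice h -> g * f' - f * g' = g * g * h -> fourier h 0 = 0.
Proof.
move=> nh W; have ngg : nice (g * g) by exact: nice_mul.
have [c [/subr0_eq fc|[r [t [rt lo h0 gr gr0]]]]] := wronskian_low.
  have f'c : f' = c *: g' by apply: hder_uniq df _; rewrite fc; exact: hderZ.
  have : g * g * h = 0 by rewrite -W f'c fc -scalerAr -scalerAl mulrC subrr.
  case/(nice_mulf_eq0 ngg nh) => [/(nice_mulf_eq0 ng ng)[]/g0 //|->].
  by rewrite -(scale0r h); have [a ha] := nh; rewrite (fexp_fourier (fexpZ 0 ha)) mul0r.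
have [l1 l1'] := conv_low gr0 gr0.
have gg0 i : (i < r + r)%N -> fourier (g * g) i = 0 by move=> hi; rewrite fourierM// l1'.
have hh i : (i < 0)%N -> fourier h i = 0 by rewrite ltn0.
have [l2 l2'] := conv_low gg0 hh.
rewrite addn0 in l2 l2'.
have [tr|rt'] := ltnP t r.
  exfalso; move: h0; rewrite W (fourierM ngg nh) (l2' (r + t)%N); last by rewrite ltn_add2l.
  by rewrite eqxx.
have : fourier (g * f' - f * g') (r + r) = 0 by apply: lo; rewrite ltn_add2l; lia.
rewrite W (fourierM ngg nh) l2 (fourierM ng ng) l1 => /eqP.
by rewrite mulf_eq0 (negPf (mulf_neq0 gr gr)) => /eqP.
Qed.

End Wronskian.

Lemma nice_primitive g : nice g -> fourier g 0 = 0 ->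
  exists G, [/\ nice G, hder G g & fourier G 0 = 0].
Proof.
move=> /nice_fexp fg g0; pose a n : C := (n%:R^-1 : R)%:C * fourier g n.
have sa : subexp a.
  apply: (@subexp_le _ _ (fourier g) 1) => // [n|]; last by case: fg.
  rewrite /a cnMR mul1r ler_piMl ?cn_ge0// ger0_norm ?invr_ge0//.
  by case: n => [|n]; rewrite ?invr0// invf_le1// ler1n.
pose G : hfun R := fun tau => es (tw (complex.Re (val tau)) a) (complex.Im (val tau)).
have fG : fexp G a.
  split=> // x; split=> [|s s0]; first exact: subexp_tw.
  by have [tau E] := line_uhp x s0; rewrite /line -E hextE /G E.
exists G; split; first by exists a.
  apply: (fexp_hder fG fg) => -[|n]; first by rewrite mul0r.
  have -> : (n.+1%:R : C) = (n.+1%:R : R)%:C by rewrite rmorph_nat.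
  by rewrite /a mulrA -rmorphM mulfV ?pnatr_eq0// rmorph1 mul1r.
by rewrite (fexp_fourier fG) /a g0 mulr0.
Qed.

Lemma poly_decay_eq0 J (a : nat -> C) (K : R) : 0 <= K ->
  (forall s, 1 < s -> cn (\sum_(j < J) a j * s%:C ^+ j) <= K / s) -> forall j, (j < J)%N -> a j = 0.
Proof.
elim: J a K => [//|J IH] a K K0 h.
have aJ : a J = 0.
  pose L := K + \sum_(j < J) cn (a j).
  have L0 : 0 <= L by rewrite addr_ge0// sumr_ge0// => j _; exact: cn_ge0.
  have key s : 1 < s -> cn (a J) * s <= L.
    move=> s1; have s0 : 0 < s by lra.
    have sX n : cn (s%:C ^+ n) = s ^+ n.
      by rewrite -rmorphXn cnR ger0_norm// exprn_ge0// ltW.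
    have e : (s ^+ J)%:C * a J = \sum_(j < J.+1) a j * s%:C ^+ j - \sum_(j < J) a j * s%:C ^+ j.
      by rewrite big_ord_recr /= addrAC subrr add0r rmorphXn mulrC.
    have h1 : s ^+ J * cn (a J) <= K / s + \sum_(j < J) cn (a j) * s ^+ j.
      rewrite -[s ^+ J]ger0_norm ?exprn_ge0 ?(ltW s0)// -cnMR e (le_trans (cnB _ _))// lerD ?h//.
      apply: (le_trans (cn_sum _ _ _)); apply: ler_sum => j _.
      by rewrite mulrC -rmorphXn cnMR ger0_norm ?exprn_ge0 ?(ltW s0)// mulrC.
    have sJ : 0 < s ^+ J by rewrite exprn_gt0.
    rewrite -(ler_pM2l sJ) mulrA; apply: (le_trans (ler_wpM2r (ltW s0) h1)).
    rewrite mulrDl mulrDr divfK ?gt_eqF//; apply: lerD.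
      by rewrite ler_peMl// exprn_ege1// ltW.
    rewrite mulr_suml mulr_sumr; apply: ler_sum => j _.
    rewrite -mulrA -exprSr mulrC ler_wpM2r ?cn_ge0//.
    by apply: ler_weXn2l; rewrite ?ltW// ltn_ord.
  apply/cn_eq0/eqP; rewrite eq_le cn_ge0 andbT leNgt; apply/negP => c0.
  have q0 : 0 <= L / cn (a J) by rewrite divr_ge0// ltW.
  have t1 : 1 < L / cn (a J) + 2 by lra.
  by have := key _ t1; rewrite mulrDr mulrC divfK ?gt_eqF//; lra.
move=> j; rewrite ltnS leq_eqVlt => /orP[/eqP -> //|]; apply: (IH a K) => // s s1.
by have := h s s1; rewrite big_ord_recr /= aJ mul0r addr0.
Qed.

Lemma es_indep0 J (b : nat -> nat -> C) : (forall j, subexp (b j)) ->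
  (forall s, 0 < s -> \sum_(j < J) s%:C ^+ j * es (b j) s = 0) -> forall j, (j < J)%N -> b j 0%N = 0.
Proof.
move=> sb h.
  have /choice[K HK] : forall j, exists K, 0 <= K /\ forall s, 1 <= s -> cn (es (b j) s - b j 0%N) <= K * qnorm s.
    by move=> j; have [K K0 HK] := es_decay (sb j) (ltr01 : 0 < 1 :> R); exists K.
  pose L := \sum_(j < J) K j; have L0 : 0 <= L by rewrite sumr_ge0// => j _; case: (HK j).
  apply: (@poly_decay_eq0 J (fun j => b j 0%N) (L * (J.+1`!%:R * expR 1))) => [|s s1].
    by rewrite mulr_ge0// mulr_ge0 ?expR_ge0.
  have s0 : 0 < s by lra.
  have -> : \sum_(j < J) b j 0%N * s%:C ^+ j = - \sum_(j < J) (s ^+ j)%:C * (es (b j) s - b j 0%N).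
    apply/eqP; rewrite -addr_eq0 -big_split /= -[X in _ == X](h s s0); apply/eqP.
    by apply: eq_bigr => j _; rewrite rmorphXn; ring.
  rewrite cnN (le_trans (cn_sum _ _ _))// -mulrA -mulrA mulr_suml; apply: ler_sum => j _.
  have [Kj HKj] := HK j; rewrite cnMR ger0_norm ?exprn_ge0 ?(ltW s0)//.
  apply: (@le_trans _ _ (K j * ((1 + s) ^+ J * expR (- s)))); last first.
    by rewrite ler_wpM2l// mulrA poly_expR_le.
  have e0 := expR_ge0 (- s).
  apply: (le_trans (ler_wpM2l _ (HKj s (ltW s1)))); first by rewrite exprn_ge0// ltW.
  rewrite mulrCA ler_wpM2l// ler_pM ?exprn_ge0 ?(ltW s0) ?(ltW (qnorm_gt0 _))//.
    apply: (@le_trans _ _ ((1 + s) ^+ j)); first by apply: lerXn2r; rewrite ?nnegrE; lra.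
    by apply: ler_weXn2l; [lra|exact: ltnW].
  apply: le_trans (qnorm_le_expRN2 (ltW s0)) _.
  by rewrite ler_piMl// -expR0 ler_expR oppr_le0 ltW.
Qed.

(** The constant terms form a polynomial in s that decays, so they are 0; dividing by q reduces to
    the next coefficients. Thus powers of s are independent over q-series. *)
Lemma es_indep J (b : nat -> nat -> C) : (forall j, subexp (b j)) ->
  (forall s, 0 < s -> \sum_(j < J) s%:C ^+ j * es (b j) s = 0) -> forall n j, (j < J)%N -> b j n = 0.
Proof.
move=> sb h n; elim: n b sb h => [|n IH] b sb h; first exact: es_indep0.
have b0 := es_indep0 sb h.
apply: (IH (fun j n => b j n.+1)) => [j|s s0]; first exact: subexp_S.
apply: (mulfI (_ : (qnorm s)%:C != 0)); first by rewrite fmorph_eq0 gt_eqF// qnorm_gt0.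
rewrite mulr0 mulr_sumr -[RHS](h s s0); apply: eq_bigr => j _.
by rewrite (es_S (sb j) s0) b0// add0r mulrCA.
Qed.

End FourierAlgebra.

(** * Algebraic independence of E2, E4 and E6 *)

Section QuasimodularForms.
Variables (R : realType) (P : poly3 R[i]).
Local Notation C := R[i].
Implicit Types (p q A B : P) (c : C) (f g : hfun R) (s : R) (G : {poly hfun R}).
Local Notation c_ := (p3c P).
Local Notation x := (p3x P).
Local Notation y := (p3y P).
Local Notation z := (p3z P).

Definition ev : P -> hfun R := mev (in_alg (hfun R)) (@E2 R) (@E4 R) (@E6 R).
HB.instance Definition _ := GRing.RMorphism.on ev.

Lemma ev_c c : ev (c_ c) = c%:A. Proof. exact: mev_c. Qed.
Lemma ev_x : ev x = @E2 R. Proof. exact: mev_x. Qed.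
Lemma ev_y : ev y = @E4 R. Proof. exact: mev_y. Qed.
Lemma ev_z : ev z = @E6 R. Proof. exact: mev_z. Qed.
Lemma evD p q : ev (p + q) = ev p + ev q. Proof. exact: rmorphD. Qed.
Lemma evN p : ev (- p) = - ev p. Proof. exact: rmorphN. Qed.
Lemma evM p q : ev (p * q) = ev p * ev q. Proof. exact: rmorphM. Qed.
Lemma evX p n : ev (p ^+ n) = ev p ^+ n. Proof. exact: rmorphXn. Qed.
Lemma ev0 : ev 0 = 0. Proof. exact: rmorph0. Qed.
Lemma ev1 : ev 1 = 1. Proof. exact: rmorph1. Qed.
Lemma evZ c p : ev (c_ c * p) = c *: ev p.
Proof. by rewrite evM ev_c -scalerAl mul1r. Qed.
Definition evE := (evD, evN, evM, evX, ev_x, ev_y, ev_z, ev0, ev1).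

Lemma hder_ev p : hder (ev p) (ev (D p)).
Proof.
elim/alg_ind: p => [c|p q hp hq|p q hp hq|||].
- by rewrite /D der_c ev_c ev0 -(scaler0 _ c); exact/hderZ/hder_cst.
- by rewrite /D derD !evD; exact: hderD.
- by rewrite /D derM evD !evM; exact: hderM.
- by rewrite /D der_x /g0 evZ !evE; exact: hder_E2.
- by rewrite /D der_y /g1 evZ !evE; exact: hder_E4.
- by rewrite /D der_z /g2 evZ !evE; exact: hder_E6.
Qed.

Lemma nice_ev p : nice (ev p).
Proof.
elim/alg_ind: p => [c|p q hp hq|p q hp hq|||].
- by rewrite ev_c; eexists; exact: fexpZ (fexp_cst 1).
- by rewrite evD; exact: niceD.
- by rewrite evM; exact: nice_mul.
- by rewrite ev_x; eexists; exact: (fexp_E2 R).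
- by rewrite ev_y; eexists; exact: (fexp_E4 R).
- by rewrite ev_z; eexists; exact: (fexp_E6 R).
Qed.

(** E2, E4 and E6 have constant term 1: the cusp is the point (1, 1, 1). *)
Lemma fourier0_ev p : fourier (ev p) 0 = val_at 1 1 1 p.
Proof.
have e0 c k : eis_seq c k 0 = 1 :> C by rewrite /eis_seq sig0 mulr0 addr0.
elim/alg_ind: p => [c|p q hp hq|p q hp hq|||].
- rewrite ev_c val_c (fexp_fourier (fexpZ c (fexp_cst 1))) /= mulr1 //.
- by rewrite evD valD -hp -hq (fexp_fourier (fexpD (nice_fexp (nice_ev p)) (nice_fexp (nice_ev q)))).
- rewrite evM valM -hp -hq (fourierM (nice_ev p) (nice_ev q)).
  by rewrite /conv big_ord_recl big_ord0 addr0 subn0.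
- by rewrite ev_x val_x (fexp_fourier (fexp_E2 R)) e0.
- by rewrite ev_y val_y (fexp_fourier (fexp_E4 R)) e0.
- by rewrite ev_z val_z (fexp_fourier (fexp_E6 R)) e0.
Qed.

(** The constant coefficient settles everything except u^3 = v^2 with both non-zero, where [pt] is a
    multiple of the discriminant and its coefficient of q is 1728 u^3. *)
Lemma ev_pt_neq0 u v : (u != 0) || (v != 0) -> ev (pt P u v) <> 0.
Proof.
move=> uv E; have z0 n : fourier (ev (pt P u v)) n = 0.
  rewrite E -(scale0r 0) (_ : 0 *: 0 = 0 *: ev 0); last by rewrite !scale0r.
  by rewrite (fexp_fourier (fexpZ 0 (nice_fexp (nice_ev 0)))) mul0r.
have := z0 0%N; rewrite fourier0_ev /pt; case: (eqVneq u 0) uv z0 => [_ _ _|u0 _ z0].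
  by rewrite val_y => /eqP; rewrite oner_eq0.
case: (eqVneq v 0) z0 => [_ _|v0 z0]; first by rewrite val_z => /eqP; rewrite oner_eq0.
rewrite !valE !expr1n !mulr1 => /subr0_eq uv.
have := z0 1%N; rewrite /pt (negPf u0) (negPf v0).
have F4 n : fourier (@E4 R) n = eis_seq 240%:R 3 n by rewrite (fexp_fourier (fexp_E4 R)).
have F6 n : fourier (@E6 R) n = eis_seq (- 504%:R) 5 n by rewrite (fexp_fourier (fexp_E6 R)).
have n4 : nice (@E4 R) by rewrite -ev_y; exact: nice_ev.
have n6 : nice (@E6 R) by rewrite -ev_z; exact: nice_ev.
have e0 c k : eis_seq c k 0 = 1 :> C by rewrite /eis_seq sig0 mulr0 addr0.
have e1 c k : eis_seq c k 1 = c :> C.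
  by rewrite /eis_seq /sig /= big_mkcond big_nat1 dvdnn exp1n mulr1 add0r.
rewrite evD evN !evZ !evX ev_y ev_z -scaleN1r scalerA.
have y3 : fourier (@E4 R ^+ 3) 1 = 720%:R.
  rewrite exprS expr2 fourierM//; last exact: nice_mul.
  rewrite {1}/conv !big_ord_recl big_ord0 /= fourierM// /conv !big_ord_recl !big_ord0 /= /bump /= !subn0 ?subnn ?addn0.
  by rewrite !F4 !e0 !e1; ring.
have z2 : fourier (@E6 R ^+ 2) 1 = - 1008%:R.
  rewrite expr2 fourierM// /conv !big_ord_recl big_ord0 /= /bump /= !subn0 ?subnn ?addn0.
  by rewrite !F6 !e0 !e1; ring.
have n43 : nice (@E4 R ^+ 3) by rewrite -ev_y -evX; exact: nice_ev.
have n62 : nice (@E6 R ^+ 2) by rewrite -ev_z -evX; exact: nice_ev.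
rewrite (fexp_fourier (fexpD (fexpZ (v ^+ 2) (nice_fexp n43)) (fexpZ (-1 * u ^+ 3) (nice_fexp n62)))).
rewrite y3 z2 uv => E1; have : (1728%:R : C) * u ^+ 3 = 0 by rewrite -E1; ring.
by move/eqP; rewrite mulf_eq0 expf_eq0 (negPf u0) andbF orbF pnatr_eq0.
Qed.

(** A non-zero B of positive weight has a zero, hence a factor [pt], whose image is not 0;
    cancelling it lowers the weight. *)
Lemma ev_modular_inj n B : hom n B -> dx B = 0 -> ev B = 0 -> B = 0.
Proof.
elim/ltn_ind: n B => n IH B hB dB eB; case: (posnP n) => [n0|n0].
  rewrite n0 in hB; have [c Ec] := hom0_cst hB; move: eB.
  rewrite Ec ev_c => /(congr1 (fun f => f (exist _ 'i%C (@uhp_i_subproof R)))).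
  move=> h; have -> : c = 0 by apply: etrans (esym (mulr1 c)) h.
  by rewrite rmorph0.
case: (eqVneq B 0) => // B0; have [u [v [uv zB]]] := hom_zero hB dB n0.
have [B1 E] := pt_dvd hB dB uv (zB 0).
have p0 := pt_neq0 P u v; have B10 : B1 != 0 by apply: contraNneq B0 => h; rewrite E h mulr0.
rewrite E in hB dB eB; have [wn hB1] := hom_mul_cancel p0 B10 (hom_pt P u v) hB.
have dB1 := dx_mul_cancel p0 (dx_pt P u v) dB.
have [h|eB1] := nice_mulf_eq0 (nice_ev _) (nice_ev _) (etrans (esym (evM _ _)) eB); first by case: (ev_pt_neq0 uv h).
have lt_n : (n - ptw u v < n)%N by have := ptw_gt0 u v; lia.
by move/eqP: B10; case; exact: IH lt_n _ hB1 dB1 eB1.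
Qed.

Section AtPoint.
Variable tau : uhp R.
Definition at_pt (f : hfun R) : C := f tau.
Fact at_pt_additive : zmod_morphism at_pt. Proof. by []. Qed.
Fact at_pt_monoid : GRing.monoid_morphism at_pt. Proof. by []. Qed.
HB.instance Definition _ := GRing.isZmodMorphism.Build (hfun R) C at_pt at_pt_additive.
HB.instance Definition _ := GRing.isMonoidMorphism.Build (hfun R) C at_pt at_pt_monoid.
End AtPoint.

Lemma at_line tau s f : val tau = 0 +i* s -> at_pt tau f = line f 0 s.
Proof. by move=> E; rewrite /at_pt /line -E hextE. Qed.

(** Multiplication by the top power of s turns the values at k / s into a polynomial in s with
    q-series as coefficients, to which [es_indep] applies. *)
Lemma poly_hfun_indep G (k : C) : k != 0 -> (forall j, nice G`_j) ->
  (forall s tau, 0 < s -> val tau = 0 +i* s -> (map_poly (at_pt tau) G).[k / s%:C] = 0) -> G = 0.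
Proof.
move=> k0 nG h; pose N := size G.
pose b j n : C := k ^+ (N.-1 - j) * fourier G`_(N.-1 - j) n.
have sb j : subexp (b j) by apply: subexpZ; have [] := nice_fexp (nG (N.-1 - j)%N).
have hb s : 0 < s -> \sum_(j < N) s%:C ^+ j * es (b j) s = 0.
  move=> s0; have [tau E] := line_uhp 0 s0.
  have sC0 : s%:C != 0 :> C by rewrite fmorph_eq0 gt_eqF.
  have := h s tau s0 E; rewrite (@horner_coef_wide _ N); last exact: size_poly.
  move/(congr1 (fun u => s%:C ^+ N.-1 * u)); rewrite mulr0 mulr_sumr => E0.
  rewrite -[RHS]E0 [RHS](reindex_inj rev_ord_inj) /=; apply: eq_bigr => j _.
  have jN : (j <= N.-1)%N by have := ltn_ord j; lia.
  have -> : (N - j.+1 = N.-1 - j)%N by lia.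
  rewrite coef_map /= (at_line _ E); have [sj lj] := nice_fexp (nG (N.-1 - j)%N).
  have [_ ->] := lj 0 => //; rewrite tw0 /b /es (psZ _ sj (qnorm_norm s0)) expr_div_n.
  have -> : s%:C ^+ N.-1 = s%:C ^+ j * s%:C ^+ (N.-1 - j) by rewrite -exprD subnKC.
  set u := s%:C ^+ (N.-1 - j).
  have u0 : u != 0 by rewrite expf_neq0.
  by field.
have b0 := es_indep sb hb.
apply/polyP => j; rewrite coef0; have [jN|Nj] := ltnP j N; last by rewrite nth_default.
apply: nice_eq0 => // n; have hj : (N.-1 - j < N)%N by lia.
have := b0 n _ hj; rewrite /b subKn; last by lia.
by move/eqP; rewrite mulf_eq0 expf_eq0 (negPf k0) andbF /= => /eqP.
Qed.

Lemma at_ptA tau c : at_pt tau c%:A = c. Proof. exact: mulr1. Qed.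

(** With T = - (s / s0)^2 and W = - 6 / (pi s), the inversion multiplies weight n by T^n and
    translates E2 by W. As W^2 T is the constant c0, multiplying by W^(2 n) leaves a polynomial in W
    = k / s. *)
Lemma ev_inversion : exists (s0 : R) (k c0 : C), [/\ 0 < s0, k != 0, c0 != 0 &
  forall s tau tau' n p, 0 < s -> val tau = 0 +i* s -> val tau' = 0 +i* (s0 ^+ 2 / s) -> hom n p ->
  (k / s%:C) ^+ (2 * n) * ev p tau' =
  c0 ^+ n * (map_poly (at_pt tau) (map_poly ev (theta p))).[k / s%:C]].
Proof.
have pi0 : (pi : R) != 0 by rewrite gt_eqF// pi_gt0.
have [s0 s00 inv] := axis_inversion R.
exists s0, (- (6 / pi))%:C, (- (6 / (pi * s0)) ^+ 2)%:C.
have s0n0 : s0 != 0 by rewrite gt_eqF.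
split=> //; [|by rewrite fmorph_eq0 oppr_eq0 expf_neq0// mulf_neq0 ?invr_eq0 ?mulf_neq0 ?pnatr_eq0|].
  by rewrite fmorph_eq0 oppr_eq0 mulf_neq0 ?invr_eq0 ?pnatr_eq0.
move=> s tau tau' n p sp Et Et' hp; have sn0 : s != 0 by rewrite gt_eqF.
have -> : (- (6 / pi))%:C / s%:C = (- (6 / (pi * s)))%:C.
  by rewrite -fmorph_div /=; congr (_%:C); rewrite invfM mulNr mulrA.
set W := (- (6 / (pi * s)))%:C.
have Eev t p' : ev p' t = val_at (@E2 R t) (@E4 R t) (@E6 R t) p'.
  elim/alg_ind: p' => [c|p' q hp' hq|p' q hp' hq|||].
  - by rewrite ev_c val_c; exact: mulr1.
  - by rewrite evD valD -hp' -hq.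
  - by rewrite evM valM -hp' -hq.
  - by rewrite ev_x val_x.
  - by rewrite ev_y val_y.
  - by rewrite ev_z val_z.
have sp' : 0 < s0 ^+ 2 / s by rewrite divr_gt0// exprn_gt0.
have [r1 r2 r3] := axis_real sp; have [r1' r2' r3'] := axis_real sp'.
have [i1 i2 i3] := inv s sp; rewrite i1 i2 i3 in r1' r2' r3'.
have L f t u : val t = 0 +i* u -> f t = line f 0 u by move=> E; rewrite -(at_line f E).
rewrite Eev (L _ _ _ Et') (L _ _ _ Et') (L _ _ _ Et') r1' r2' r3'.
have rM (a b : R) : (a * b)%:C = a%:C * b%:C := rmorphM _ _ _.
have rX (a : R) k : (a ^+ k)%:C = a%:C ^+ k := rmorphXn _ _ _.
rewrite !(rM (_ ^+ 2)) !(rM (_ ^+ 3)) (rM (- _)) !(rX (- _)).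
set T := (- (s / s0) ^+ 2)%:C.
have := val_scale T (ax2 s - 6 / (pi * s))%:C (ax4 s)%:C (ax6 s)%:C hp.
have -> : (ax2 s - 6 / (pi * s))%:C = (ax2 s)%:C + W by rewrite /W -rmorphD.
move=> ->; rewrite val_theta -r1 -r2 -r3 -!(L _ _ _ Et).
have -> : map_poly (val_at (@E2 R tau) (@E4 R tau) (@E6 R tau)) (theta p) =
    map_poly (at_pt tau) (map_poly ev (theta p)).
  by apply/polyP => j; rewrite !coef_map /= -Eev.
rewrite mulrA exprM -exprMn; congr (_ ^+ _ * _); rewrite /W /T -!rmorphXn -rmorphM /=; congr (_%:C).
by move: pi0; move: (pi : R) => q q0; field; rewrite sn0 s0n0 q0.
Qed.

Lemma nice_map_ev (q : {poly P}) j : nice (map_poly ev q)`_j.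
Proof. by rewrite coef_map; exact: nice_ev. Qed.

Lemma phi_sum N p : (size (phi p) <= N)%N -> p = \sum_(n < N) (phi p)`_n.
Proof.
move=> sN; rewrite -{1}[p]phi1 (horner_coef_wide _ sN).
by apply: eq_bigr => n _; rewrite expr1n mulr1.
Qed.

Lemma nice_sum (I : Type) (r : seq I) (F : I -> hfun R) : (forall i, nice (F i)) -> nice (\sum_(i <- r) F i).
Proof.
move=> h; elim: r => [|i r IH]; first by rewrite big_nil -ev0; exact: nice_ev.
by rewrite big_cons; exact: niceD.
Qed.

(* Under the inversion, the components of p of different weights acquire
   different powers of s. *)
Lemma ev_top_eq0 N p : (size (phi p) <= N.+1)%N -> ev p = 0 -> ev (phi p)`_N = 0.
Proof.
move=> sN ep; have [s0 [k [c0 [s00 k0 c00 inv]]]] := ev_inversion.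
(* This is W^(2 N) times [ev p] at the inverted point, written as a polynomial in W. The component
   of weight n starts in degree 2 (N - n), so only the top weight reaches the constant
   coefficient. *)
pose G : {poly hfun R} := \sum_(n < N.+1)
  map_poly ev ((c_ (c0 ^+ n))%:P * 'X^(2 * (N - n)) * theta (phi p)`_n).
have G0 : G = 0.
  apply: (poly_hfun_indep k0) => [j|s tau sp Et].
    by rewrite coef_sum; apply: nice_sum => n; exact: nice_map_ev.
  have sp' : 0 < s0 ^+ 2 / s by rewrite divr_gt0// exprn_gt0.
  have [tau' Et'] := line_uhp 0 sp'.
  have sC0 : s%:C != 0 :> C by rewrite fmorph_eq0 gt_eqF.
  set W := k / s%:C; transitivity (W ^+ (2 * N) * ev p tau'); last by rewrite ep; exact: mulr0.
  have -> : ev p tau' = \sum_(n < N.+1) at_pt tau' (ev (phi p)`_n).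
    by rewrite -!rmorph_sum -(phi_sum sN).
  rewrite mulr_sumr rmorph_sum horner_sum.
  apply: eq_bigr => n _; have nN : (n <= N)%N by rewrite -ltnS.
  have -> : (2 * N = 2 * (N - n) + 2 * n)%N by rewrite -mulnDr subnK.
  have := inv s tau tau' n _ sp Et Et' (hom_phi_coef n p); rewrite -/W -/(at_pt tau' _) => E.
  rewrite exprD -[RHS]mulrA E.
  rewrite !rmorphM /= !hornerM !map_polyXn hornerXn !map_polyC /= hornerC ev_c at_ptA.
  by rewrite mulrCA mulrA.
have := congr1 (fun g : {poly hfun R} => g.[0]) G0; rewrite horner0 horner_sum big_ord_recr /=.
rewrite big1 => [|n _]; last first.
  rewrite !rmorphM /= map_polyXn !hornerM hornerXn expr0n muln_eq0 subn_eq0 leqNgt ltn_ord /=.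
  by rewrite mulr0 mul0r.
rewrite add0r subnn muln0 expr0 mulr1 rmorphM /= map_polyC hornerM hornerC horner_coef0 coef_map theta0 /=.
rewrite ev_c => h; have := congr1 (fun g : hfun R => (c0 ^+ N)^-1 *: g) h.
by rewrite scaler0 -scalerAl mul1r scalerA mulVf ?expf_neq0// scale1r.
Qed.

(** All coefficients of [theta p] evaluate to 0. The leading one is killed by [dx], so it falls
    under [ev_modular_inj]. *)
Lemma ev_hom_eq0 n p : hom n p -> ev p = 0 -> p = 0.
Proof.
move=> hp ep; have [s0 [k [c0 [s00 k0 c00 inv]]]] := ev_inversion.
have G0 : map_poly ev (theta p) = 0.
  apply: (poly_hfun_indep k0) => [j|s tau sp Et]; first exact: nice_map_ev.
  have sp' : 0 < s0 ^+ 2 / s by rewrite divr_gt0// exprn_gt0.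
  have [tau' Et'] := line_uhp 0 sp'.
  apply: (mulfI (expf_neq0 n c00)); rewrite -(inv s tau tau' n _ sp Et Et' hp) ep [RHS]mulr0.
  exact: mulr0.
case: (eqVneq p 0) => // p0; pose d := (size (theta p)).-1.
have t0 : theta p != 0 by apply: contra_neq p0 => h; apply: theta_inj; rewrite h rmorph0.
have Bd : (theta p)`_d != 0 by rewrite -/(lead_coef _) lead_coef_eq0.
have dB : dx (theta p)`_d = 0.
  by rewrite dx_theta nth_default ?mul0rn// /d prednK// size_poly_gt0.
have eB : ev (theta p)`_d = 0 by rewrite -coef_map G0 coef0.
have := hom_theta d hp; case: ifP => _ hB; last by rewrite hB eqxx in Bd.
by rewrite (ev_modular_inj hB dB eB) eqxx in Bd.
Qed.

Lemma ev_inj : injective ev.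
Proof.
suff ker p : ev p = 0 -> p = 0.
  by move=> p q h; apply/subr0_eq/ker; rewrite evD evN h subrr.
suff H N : (size (phi p) <= N)%N -> ev p = 0 -> p = 0 by exact: H.
elim: N p => [|N IH] p sN ep.
  by apply: phi_inj; rewrite rmorph0; apply/eqP; rewrite -size_poly_leq0.
have pN0 := ev_hom_eq0 (hom_phi_coef N p) (ev_top_eq0 sN ep).
apply: IH ep; apply/leq_sizeP => j; rewrite leq_eqVlt => /orP[/eqP <- //|Nj].
by rewrite nth_default// (leq_trans sN).
Qed.

End QuasimodularForms.

(** * Quotients of quasimodular forms with derivative in V *)

Section ModularRatios.
Variables (R : realType) (P : poly3 R[i]).
Local Notation C := R[i].
Implicit Types (p q a b m A B : P) (c : C) (f g : hfun R) (s : R).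
Local Notation c_ := (p3c P).
Local Notation D := (@D C P).
Local Notation dx := (@dx C P).
Local Notation ev := (@ev R P).

Lemma ev_neq0 p : p != 0 -> ev p <> 0.
Proof. by move=> /eqP p0 e; apply: p0; apply: ev_inj; rewrite e ev0. Qed.

(** The sequence [eta] consists of A / B and its successive derivatives; this is the quotient rule
    without division. *)
Lemma dnum_ev A B (eta : nat -> hfun R) N : (forall i, (i < N)%N -> hder (eta i) (eta i.+1)) ->
  ev A = ev B * eta 0%N -> forall i, (i <= N)%N -> ev (dnum A B i) = ev B ^+ i.+1 * eta i.
Proof.
move=> de e0; elim=> [|i IH] iN; first by rewrite expr1.
have {}IH := IH (ltnW iN).
have E : ev (D (dnum A B i)) = ev (D (B ^+ i.+1)) * eta i + ev (B ^+ i.+1) * eta i.+1.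
  apply: hder_uniq (hder_ev _) _; rewrite IH -evX.
  exact: hderM (hder_ev _) (de i iN).
rewrite /= evD evN !evM E DX !evM IH evX !(rmorph_nat ev) /= !exprS evX.
by move: (ev B ^+ i) (ev B) (ev (D B)) (eta i) (eta i.+1) (i.+1%:R : hfun R) => *; ring.
Qed.

(* At a zero of B, also A vanishes: on the orbit of (1, 1), where Delta vanishes, because
   the value of A there is a constant Fourier coefficient; elsewhere by [pole_order]. *)
Lemma common_factor k l A B eta N m : B != 0 -> hom k B -> dx B = 0 -> hom l A -> dx A = 0 ->
  (0 < k)%N -> (forall i, (i <= N)%N -> hder (eta i) (eta i.+1)) -> nice (eta 0%N) ->
  eta N.+1 = ev m -> ev A = ev B * eta 0%N ->
  exists u v A2 B2, [/\ (u != 0) || (v != 0), A = pt P u v * A2 & B = pt P u v * B2].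
Proof.
move=> B0 hB dB hA dA k0 de n0 eN e0; have [u [v [uv zB]]] := hom_zero hB dB k0.
have [good|] := boolP ((u == 0) || (v == 0) || (u ^+ 3 != v ^+ 2)).
  have [B2 EB] := pt_dvd hB dB uv (zB 0).
  have [[|r] [B1 [n1 [E h1 d1 nd]]]] := pt_power u v B0 hB dB.
    by case: nd; exists B2; rewrite -EB E expr0 mul1r.
  have vB1 : val_at 0 u v B1 != 0 by apply/eqP => z; apply: nd; exact: pt_dvd h1 d1 uv z.
  have dE : dnum A B N.+1 = B ^+ N.+2 * m.
    by apply: ev_inj; rewrite (dnum_ev (N := N.+1) _ e0)// eN evM evX.
  have vA := pole_order E dE isT (pt_neq0 P u v) (val_pt P 0 u v) (D_pt_neq0 P good uv) vB1.
  have [A2 EA] := pt_dvd hA dA uv vA.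
  by exists u, v, A2, B2.
rewrite !negb_or negbK => /andP[/andP[u0 v0] /eqP uv3].
pose t := v / u; have t0 : t != 0 by rewrite mulf_neq0 ?invr_eq0.
have ut : u = t ^+ 2 by rewrite /t expr_div_n -uv3; field.
have vt : v = t ^+ 3.
  by rewrite /t expr_div_n uv3 exprS; field.
have zB1 : val_at 1 1 1 B = 0.
  have := val_scale t 1 1 1 hB; rewrite !mulr1 -ut -vt zB => /esym/eqP.
  by rewrite mulf_eq0 expf_eq0 (negPf t0) andbF => /eqP.
have zA1 : val_at 1 1 1 A = 0.
  rewrite -fourier0_ev e0 (fourierM (nice_ev _) n0) /conv big_ord_recl big_ord0 addr0 subn0.
  by rewrite fourier0_ev zB1 mul0r.
have uv1 : (1 != 0 :> C) || (1 != 0 :> C) by rewrite oner_eq0.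
have [A2 EA] := pt_dvd hA dA uv1 zA1; have [B2 EB] := pt_dvd hB dB uv1 zB1.
by exists 1, 1, A2, B2.
Qed.

(** A zero of B yields a common factor of A and B. Cancelling it preserves the difference k - l = r
    + 1 of the weights, so the weight of B stays positive and the descent can only end with A =
    0. *)
Lemma modular_ratio_eq0 k l r A B eta N m : B != 0 -> hom k B -> dx B = 0 -> hom l A -> dx A = 0 ->
  (l + r.+1 = k)%N -> (forall i, (i <= N)%N -> hder (eta i) (eta i.+1)) -> nice (eta 0%N) ->
  eta N.+1 = ev m -> ev A = ev B * eta 0%N -> A = 0.
Proof.
move=> + + + + + + de n0 eN; elim/ltn_ind: k l A B => k IH l A B B0 hB dB hA dA lk e0.
have k0 : (0 < k)%N by lia.
have [u [v [A2 [B2 [uv EA EB]]]]] := common_factor B0 hB dB hA dA k0 de n0 eN e0.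
case: (eqVneq A2 0) => [A20|A20]; first by rewrite EA A20 mulr0.
have p0 := pt_neq0 P u v; have B20 : B2 != 0 by apply: contraNneq B0; rewrite EB => ->; rewrite mulr0.
rewrite EB in hB dB; rewrite EA in hA dA.
have [wk hB2] := hom_mul_cancel p0 B20 (hom_pt P u v) hB.
have [wl hA2] := hom_mul_cancel p0 A20 (hom_pt P u v) hA.
have dB2 := dx_mul_cancel p0 (dx_pt P u v) dB.
have dA2 := dx_mul_cancel p0 (dx_pt P u v) dA.
have lt_k : (k - ptw u v < k)%N by have := ptw_gt0 u v; lia.
have lk2 : (l - ptw u v + r.+1 = k - ptw u v)%N by lia.
have e2 : ev A2 = ev B2 * eta 0%N.
  apply/subr0_eq; have nn : nice (ev A2 - ev B2 * eta 0%N).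
    by apply: niceB; [exact: nice_ev|apply: nice_mul n0; exact: nice_ev].
  have := e0; rewrite EA EB !evM => e.
  have [//||//] := nice_mulf_eq0 (nice_ev (pt P u v)) nn; last by move/(ev_pt_neq0 uv).
  by rewrite mulrBr mulrA e subrr.
by rewrite (IH _ lt_k _ _ _ B20 hB2 dB2 hA2 dA2 lk2 e2) eqxx in A20.
Qed.

Lemma hom_dx_low n m : hom n m -> dx m = 0 -> (n < 2)%N -> val_at 1 1 1 m = 0 -> m = 0.
Proof.
move=> hm dm n2; case: n n2 hm => [|[|//]] _ hm.
  by have [c ->] := hom0_cst hm; rewrite val_c => ->; rewrite rmorph0.
by move=> _; apply: (@hom_dx_ind _ _ 1 (fun A => A = 0)) hm dm => // c i j p E _; exfalso; lia.
Qed.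

(* The derivative of s |-> g_1(s0^2 / s) is a multiple of s^N g_0(s), which integrates
   by parts N times. *)
Lemma eichler_inversion (g : nat -> hfun R) N s0 (e : C) : 0 < s0 -> e != 0 ->
  (forall j, hder (g j.+1) (g j)) ->
  (forall s, 0 < s -> line (g 0%N) 0 (s0 ^+ 2 / s) = e * s%:C ^+ N.+2 * line (g 0%N) 0 s) ->
  exists (c : C) (cs : nat -> C), cs N != 0 /\ forall s, 0 < s ->
    line (g 1%N) 0 (s0 ^+ 2 / s) = c + \sum_(j < N.+1) cs j * s%:C ^+ (N - j) * line (g j.+1) 0 s.
Proof.
move=> s00 e0 dg inv; have [q qE q0] : exists2 q : C, (- (2 * pi))%:C = - q & q != 0.
  by exists (2 * pi)%:C; rewrite ?rmorphN// -oppr_eq0 -rmorphN; exact: pi2C_neq0.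
(* Each integration by parts brings down the exponent N - i of s and divides by 2 pi; the initial
   value comes from the derivative - s0^2 / s^2 of the inversion. *)
pose cs j := iteri j (fun i c => (N - i)%:R / q * c) (- s0%:C ^+ 2 * e) : C.
have csS j : cs j.+1 = (N - j)%:R / q * cs j by [].
have cs_neq0 j : (j <= N)%N -> cs j != 0.
  elim: j => [|j IH] jN; first by rewrite mulf_neq0// oppr_eq0 expf_neq0// fmorph_eq0 gt_eqF.
  by rewrite csS !mulf_neq0 ?invr_eq0 ?IH ?(ltnW jN)// pnatr_eq0 subn_eq0 -ltnNge.
pose F s := \sum_(j < N.+1) cs j * s%:C ^+ (N - j) * line (g j.+1) 0 s.
have dF s : 0 < s -> cder F s (q * s0%:C ^+ 2 * e * s%:C ^+ N * line (g 0%N) 0 s).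
  move=> sp; pose T j := cs j * s%:C ^+ (N - j) * q * line (g j) 0 s.
  have dj (j : 'I_N.+1) : cder (fun s => cs j * s%:C ^+ (N - j) * line (g j.+1) 0 s) s
      ((if (j < N)%N then T j.+1 else 0) - T j).
    apply: cder_eq (cderM (cderZ (cs j) (cderX (N - j) (cder_real_id s))) (dg j 0 s sp)) _.
    rewrite /T csS qE; case: ltnP => jN; last first.
      have -> : (N - j = 0)%N by lia.
      by rewrite mulr0n !mul0r mulr0 mul0r !add0r expr0; ring.
    have -> : (N - j.+1 = (N - j).-1)%N by lia.
    move: (_ ^+ (N - j)) (_ ^+ (N - j).-1) (line _ 0 s) (line _ 0 s) ((N - j)%:R : C) (cs j) => a1 a2 a3 a4 a5 a6.
    by field.
  apply: cder_eq (cder_sum (index_enum _) dj) _.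
  rewrite sumrB -(big_mkord xpredT (fun j => if (j < N)%N then T j.+1 else 0)).
  rewrite -(big_mkord xpredT T) big_nat_recr// [X in _ - X]big_nat_recl//= ltnn addr0.
  rewrite (eq_big_nat _ _ (F2 := fun j => T j.+1)) => [|j /andP[_ ->]//].
  by rewrite opprD addrCA subrr addr0 /T subn0 /cs /=; ring.
have dL s : 0 < s -> cder (fun s => line (g 1%N) 0 (s0 ^+ 2 / s)) s
    (q * s0%:C ^+ 2 * e * s%:C ^+ N * line (g 0%N) 0 s).
  move=> sp; have sn0 : s != 0 by rewrite gt_eqF.
  have sp' : 0 < s0 ^+ 2 / s by rewrite divr_gt0// exprn_gt0.
  have di : is_derive s 1 (fun t : R => s0 ^+ 2 / t) (- (s0 ^+ 2 / s ^+ 2)).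
    have dV : is_derive s 1 (fun t : R => t^-1) (- s ^- 2).
      by apply: is_derive_eq (is_deriveV (f := id) sn0 (is_derive_id s 1)) _; rewrite /GRing.scale /= mulr1.
    apply: is_derive_eq (is_deriveZ _ dV) _; rewrite /GRing.scale /=; exact: mulrN.
  apply: cder_eq (@cder_comp _ (line (g 1%N) 0) (fun t => s0 ^+ 2 / t) s _ _ (dg 0%N 0 _ sp') di) _.
  rewrite inv// qE -[N.+2]addn2 exprD rmorphN fmorph_div !rmorphXn /=.
  have : s%:C != 0 :> C by rewrite fmorph_eq0.
  move: (s%:C ^+ N) (line (g 0%N) 0 s) (s%:C) (s0%:C) => a1 a2 a3 a4 a5.
  by field.
exists (line (g 1%N) 0 (s0 ^+ 2 / 1) - F 1), cs; split=> [|s sp]; first exact: cs_neq0.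
pose H s := line (g 1%N) 0 (s0 ^+ 2 / s) - F s.
have dH t : 0 < t -> cder H t 0.
  by move=> t0; apply: cder_eq (cderB (dL t t0) (dF t t0)) _; rewrite subrr.
have E : H s = H 1.
  have [s1|s1] := leP s 1.
    by apply: cder0_eq s1 _ => t /andP[st _]; apply: dH; exact: lt_le_trans st.
  by apply/esym/(cder0_eq (ltW s1)) => t /andP[st _]; apply: dH; exact: lt_le_trans st.
by rewrite -/(H 1) -E /H subrK.
Qed.

Lemma size_polyM_le (S : comNzRingType) (p q : {poly S}) d N : (size p <= d.+1)%N -> (size q <= N.+1)%N ->
  (size (p * q)%R <= (d + N).+1)%N.
Proof.
move=> sp sq; apply: leq_trans (size_polyMleq _ _) _.
by apply: (@leq_trans (d.+1 + N.+1).-1); [rewrite -!subn1 leq_sub2r// leq_add|rewrite addSn addnS].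
Qed.

Lemma coefM_top (S : comNzRingType) (p q : {poly S}) d N : (size p <= d.+1)%N -> (size q <= N.+1)%N ->
  (p * q)`_(d + N) = p`_d * q`_N.
Proof.
move=> sp sq; have dN : (d < (d + N).+1)%N by lia.
rewrite coefM (bigD1 (Ordinal dN))//= big1 => [|i /eqP ne]; first by rewrite addr0 addnC addnK.
have [id|di] := ltnP i d; last first.
  have {}di : (d < i)%N.
    by rewrite ltn_neqAle di andbT; apply/eqP => E; apply: ne; apply: val_inj.
  by rewrite (nth_default _ (leq_trans sp di)) mul0r.
by rewrite [q`_ _]nth_default ?mulr0// (leq_trans sq)//; have := ltn_ord i; lia.
Qed.

Lemma primitive_tower f : nice f -> fourier f 0 = 0 ->
  exists g : nat -> hfun R, [/\ g 0%N = f, (forall j, nice (g j)) & forall j, hder (g j.+1) (g j)].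
Proof.
move=> nf f0.
have [F hF] : exists F : hfun R -> hfun R, forall g, nice g -> fourier g 0 = 0 ->
    [/\ nice (F g), hder (F g) g & fourier (F g) 0 = 0].
  suff /choice[F hF] : forall g, exists G, nice g -> fourier g 0 = 0 ->
      [/\ nice G, hder G g & fourier G 0 = 0] by exists F.
  move=> g; have [[ng g0]|n] := pselect (nice g /\ fourier g 0 = 0).
    by have [G hG] := nice_primitive ng g0; exists G.
  by exists 0 => ng g0; case: n.
pose g j := iter j F f.
have gj j : nice (g j) /\ fourier (g j) 0 = 0.
  by elim: j => [//|j [n0 z0]]; have [] := hF _ n0 z0.
by exists g; split=> // j; have [n0 z0] := gj j; have [] := hF _ n0 z0.
Qed.

(** In ordinary weights m has weight N + 2. The identity a / b = c1 + g_1 is transported by the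
    inversion on both sides, which gives theta(a') = theta(b') eta with eta of degree at most N. The
    top coefficient of eta involves only the deepest primitive g_(N+1), up to a constant. *)
Lemma eichler_ratio n k b a m : hom k b -> hom (k + n.+1) a -> hom n.+2 m -> b != 0 -> dx m = 0 ->
  b * D a - a * D b = b * b * m -> fourier (ev m) 0 = 0 -> m = 0.
Proof.
move=> hb ha hm b0 dm W m0; set N := (2 * n.+1)%N.
have [g [g0 ng dg]] := primitive_tower (nice_ev m) m0.
have [c1 Ec] : exists c1, ev a - ev b * g 1%N = c1 *: ev b.
  apply: (wronskian0 (f' := ev (D a) - (ev (D b) * g 1%N + ev b * ev m)) (g' := ev (D b))) => //.
  - by apply: niceB; [exact: nice_ev|apply: nice_mul => //; exact: nice_ev].
  - apply: niceB; [exact: nice_ev|apply: niceD; apply: nice_mul => //; exact: nice_ev].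
  - exact: nice_ev.
  - exact: nice_ev.
  - by apply: hderB (hder_ev _) _; rewrite -g0; exact: hderM (hder_ev _) (dg 0%N).
  - exact: hder_ev.
  - exact: ev_neq0.
  - have := congr1 ev W; rewrite evD evN !evM => E.
    transitivity (ev b * ev (D a) - ev b * ev b * ev m - ev b * ev (D b) * g 1%N); first by ring.
    by rewrite -E; ring.
have Ea : ev a = ev b * (c1%:A + g 1%N).
  by rewrite mulrDr mulr_algr -Ec subrK.
have [s0 [k1 [c0 [s00 k0 c00 inv]]]] := ev_inversion P.
have sC0 s : 0 < s -> s%:C != 0 :> C by move=> sp; rewrite fmorph_eq0 gt_eqF.
have inv_m s : 0 < s -> line (g 0%N) 0 (s0 ^+ 2 / s) = (c0 ^+ n.+2 / k1 ^+ N.+2) * s%:C ^+ N.+2 * line (g 0%N) 0 s.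
  move=> sp; have sp' : 0 < s0 ^+ 2 / s by rewrite divr_gt0// exprn_gt0.
  have [tau Et] := line_uhp 0 sp; have [tau' Et'] := line_uhp 0 sp'.
  have := inv s tau tau' _ m sp Et Et' hm; rewrite -/(at_pt tau' _) (at_line _ Et').
  rewrite dx0_theta// !map_polyC hornerC /= (at_line _ Et) -g0 mulnS -/N expr_div_n => E.
  have h0 := expf_neq0 N.+2 k0; have h1 := expf_neq0 N.+2 (sC0 s sp).
  apply: (mulfI (mulf_neq0 h0 (invr_neq0 h1))); rewrite E.
  by move: (_ ^+ N.+2) (_ ^+ N.+2) h0 h1 (c0 ^+ _) (line _ 0 s) => z1 z2 h0 h1 z3 z4; field; rewrite h0 h1.
have e0 : c0 ^+ n.+2 / k1 ^+ N.+2 != 0 by rewrite mulf_neq0 ?invr_eq0 ?expf_neq0.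
have [c2 [cs [csN HL]]] := eichler_inversion s00 e0 dg inv_m.
(* W^N times the inverted function c1 + g_1, read off from [eichler_inversion] with s = k1 / W. The
   constant c2 of that expansion joins c1. *)
pose eta : {poly hfun R} := ((c1 + c2)%:A)%:P * 'X^N +
  \sum_(j < N.+1) (cs j * k1 ^+ (N - j)) *: (g j.+1) *: 'X^j.
pose a' := c_ (c0 ^+ (k + n.+1)) * a; pose b' := c_ (c0 ^+ k) * b.
have b'0 : b' != 0 by rewrite mulf_neq0 ?c_eq0 ?expf_neq0.
have hb' : hom k b' by exact: homZ.
have ha' : hom (k + n.+1) a' by exact: homZ.
have etaC j : eta`_j = (j == N)%:R * (c1 + c2)%:A + (if (j <= N)%N then (cs j * k1 ^+ (N - j)) *: g j.+1 else 0).
  rewrite coefD coefCM coefXn mulrC coef_sum; congr (_ + _); case: leqP => jN.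
    rewrite (bigD1 (Ordinal (jN : (j < N.+1)%N)))//= big1 => [|i /eqP ne].
      by rewrite coefZ coefXn eqxx mulr1 addr0.
    by rewrite coefZ coefXn; case: eqP => [E|_]; [case: ne; exact: val_inj|rewrite mulr0].
  rewrite big1// => i _; rewrite coefZ coefXn; case: eqP => [E|_]; last by rewrite mulr0.
  by have := ltn_ord i; rewrite -E ltnNge jN.
have neta j : nice eta`_j.
  rewrite etaC; apply: niceD.
    by rewrite -(rmorph_nat ev) -(ev_c P); apply: nice_mul; exact: nice_ev.
  by case: ifP => _; [exact: niceZ|rewrite -(ev0 P); exact: nice_ev].
have nprod (p : {poly P}) j : nice (map_poly ev p * eta)`_j.
  by rewrite coefM; apply: (nice_sum P) => i; apply: nice_mul => //; exact: nice_map_ev.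
have G0 : map_poly ev (theta a') - map_poly ev (theta b') * eta = 0.
  apply: (poly_hfun_indep k0) => [j|s tau sp Et].
    by rewrite coefB; apply: niceB; [exact: nice_map_ev|exact: nprod].
  have sp' : 0 < s0 ^+ 2 / s by rewrite divr_gt0// exprn_gt0.
  have [tau' Et'] := line_uhp 0 sp'; set W1 := k1 / s%:C.
  have Ia := inv s tau tau' _ a sp Et Et' ha; have Ib := inv s tau tau' _ b sp Et Et' hb.
  rewrite -/W1 -/(at_pt tau' _) in Ia Ib.
  have evc c p : (map_poly (at_pt tau) (map_poly ev (theta (c_ c * p)))).[W1] =
      c * (map_poly (at_pt tau) (map_poly ev (theta p))).[W1].
    by rewrite !rmorphM /= theta_c !map_polyC /= ev_c at_ptA hornerM hornerC.
  rewrite rmorphB /= hornerD hornerN.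
  have -> : map_poly (at_pt tau) (map_poly ev (theta b') * eta) =
      map_poly (at_pt tau) (map_poly ev (theta b')) * map_poly (at_pt tau) eta by exact: rmorphM.
  rewrite hornerM !evc.
  rewrite -Ia -Ib mulnDr exprD Ea rmorphM rmorphD /= at_ptA (at_line (g 1%N) Et') HL//.
  have -> : (map_poly (at_pt tau) eta).[W1] = W1 ^+ N * (c1 + (c2 + \sum_(j < N.+1) cs j * s%:C ^+ (N - j) * line (g j.+1) 0 s)).
    rewrite rmorphD rmorphM /= map_polyXn map_polyC hornerD hornerM hornerC hornerXn /= at_ptA.
    rewrite rmorph_sum horner_sum addrA [RHS]mulrDr mulr_sumr mulrC; congr (_ + _).
    apply: eq_bigr => j _; rewrite /= map_polyZ /= map_polyXn hornerZ hornerXn.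
    have -> : at_pt tau ((cs j * k1 ^+ (N - j)) *: g j.+1) = cs j * k1 ^+ (N - j) * line (g j.+1) 0 s.
      by rewrite -(at_line _ Et).
    have jN : (j <= N)%N by rewrite -ltnS.
    have -> : k1 = W1 * s%:C by rewrite /W1 divfK// sC0.
    have -> : W1 ^+ N = W1 ^+ (N - j) * W1 ^+ j by rewrite -exprD subnK.
    rewrite exprMn; move: (W1 ^+ (N - j)) (W1 ^+ j) (s%:C ^+ (N - j)) (line _ 0 s) => *.
    by ring.
  by rewrite mulrACA; exact: subrr.
(* A and B are the coefficients of top degree compared in theta(a') = theta(b') eta. Their weights
   are k + n + 1 - d - N = (k - d) - (n + 1) and k - d. *)
pose d := (size (theta b')).-1; pose B := (theta b')`_d; pose A := (theta a')`_(d + N).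
have tb0 : theta b' != 0 by apply: contra_neq b'0 => h; apply: theta_inj; rewrite h rmorph0.
have sb : (size (theta b') <= d.+1)%N by rewrite /d prednK// size_poly_gt0.
have B0 : B != 0 by rewrite /B -/(lead_coef _) lead_coef_eq0.
have dB : dx B = 0 by rewrite /B dx_theta nth_default ?mul0rn.
have seta : (size eta <= N.+1)%N.
  by apply/leq_sizeP => j Nj; rewrite etaC gtn_eqF// leqNgt Nj mul0r addr0.
have sb' : (size (map_poly ev (theta b')) <= d.+1)%N.
  by apply: leq_trans (size_poly _ _) sb.
have Gc j : ev (theta a')`_j = (map_poly ev (theta b') * eta)`_j.
  by rewrite -(subr0_eq G0) coef_map.
have eA : ev A = ev B * eta`_N by rewrite /A Gc coefM_top// coef_map.
have dA : dx A = 0.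
  rewrite /A dx_theta (_ : (theta a')`_(d + N).+1 = 0) ?mul0rn//.
  apply: ev_inj; rewrite ev0 Gc nth_default//.
  exact: size_polyM_le.
have hB : (d <= k)%N /\ hom (k - d) B.
  by have := hom_theta d hb'; rewrite -/B; case: ifP => // _ h; rewrite h eqxx in B0.
(* The successive derivatives of A / B: N + 1 differentiations lead from g_(N+1) back to a non-zero
   multiple of m. *)
pose ch i : hfun R := if i is 0 then eta`_N else cs N *: g (N.+1 - i)%N.
have ch0 : ch 0%N = (c1 + c2)%:A + cs N *: g N.+1.
  by rewrite /ch etaC eqxx mul1r leqnn subnn expr0 mulr1.
have dch i : (i <= N)%N -> hder (ch i) (ch i.+1).
  case: i => [|i] iN.
    rewrite ch0 /ch subSS subn0 -[cs N *: g N]add0r; apply: hderD; last exact: hderZ.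
    by rewrite -(scaler0 _ (c1 + c2)); apply: hderZ; exact: hder_cst.
  rewrite /ch; apply: hderZ; have -> : (N.+1 - i.+1 = (N.+1 - i.+2).+1)%N by lia.
  exact: dg.
have chN : ch N.+1 = ev (c_ (cs N) * m) by rewrite /ch subnn g0 evZ.
have A0 : A = 0.
  case: (leqP (d + N)%N (k + n.+1)%N) => dN; have := hom_theta (d + N) ha'; last by rewrite leqNgt dN.
  rewrite dN => hA; have [dk hB'] := hB.
  apply: (modular_ratio_eq0 (r := n) B0 hB' dB hA dA _ dch _ chN) => //; last exact: neta.
  by rewrite /N; lia.
have ch00 : ch 0%N = 0.
  have [|//] := nice_mulf_eq0 (nice_ev B) (neta N) (etrans (esym eA) (etrans (congr1 ev A0) (ev0 P))).
  by move/(ev_neq0 B0).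
have chi i : (i <= N.+1)%N -> ch i = 0.
  elim: i => [//|i IH] iN; apply: hder_uniq (dch i iN) _; rewrite IH ?(ltnW iN)//.
  exact: hder_cst.
have := chi N.+1 (leqnn _); rewrite chN -(ev0 P) => /ev_inj/eqP.
by rewrite mulf_eq0 c_eq0 (negPf csN) => /eqP.
Qed.

Lemma phi_dx p : phi (dx p) * 'X = map_poly dx (phi p).
Proof.
have mapX n q : map_poly dx (q *: 'X^n) = dx q *: 'X^n.
  by apply/polyP => k; rewrite coef_map !coefZ coefXn /= dxM -(rmorph_nat c_ (k == n)) dx_c mulr0 addr0.
elim/alg_ind: p => [c|p q hp hq|p q hp hq|||].
- by rewrite dx_c rmorph0 mul0r phi_c map_polyC /= dx_c.
- by rewrite raddfD !rmorphD raddfD /= mulrDl hp hq.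
- rewrite dxM rmorphD !rmorphM /= mulrDl mulrAC hp -mulrA hq.
  by rewrite /dx map_der.
- by rewrite hom_x mapX /dx der_x rmorph1 mul1r expr1 scale1r.
- by rewrite hom_y mapX /dx der_y rmorph0 mul0r scale0r.
- by rewrite hom_z mapX /dx der_z rmorph0 mul0r scale0r.
Qed.

(** By [wronskian_cusp], f has no constant Fourier coefficient. If c were non-zero, f would be c x,
    whose constant coefficient is c. Otherwise f lies in C[y, z]: below weight 2 it is 0, and from
    weight 2 on [eichler_ratio] applies. *)
Lemma no_hom_primitive k l n a b (f : P) c : hom l a -> hom k b -> hom n f -> b != 0 -> f != 0 ->
  (l + 1 + k = 2 * k + n)%N -> dx f = c_ c -> b * D a - a * D b <> b * b * f.
Proof.
move=> ha hb hf b0 f0 wt df W.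
have ff0 : fourier (ev f) 0 = 0.
  apply: (wronskian_cusp (nice_ev a) (nice_ev (D a)) (nice_ev b) (nice_ev (D b)) (hder_ev a) (hder_ev b)).
  - exact: ev_neq0.
  - exact: nice_ev.
  - by rewrite -!evM -evN -evD W.
have vf0 : val_at 1 1 1 f = 0 by rewrite -fourier0_ev.
have [c0|c0] := eqVneq c 0; last first.
  have n1 : n = 1%N.
    have := phi_dx f; rewrite df phi_c hf => /(congr1 (fun q : {poly P} => q`_1)).
    rewrite coefMX coefC eqxx coef_map coefZ coefXn /=; case: (n =P 1%N) => // ne.
    rewrite (_ : (1 == n)%N = false); last by apply/eqP => E; exact: ne.
    by rewrite mulr0 raddf0 => /eqP; rewrite c_eq0 (negPf c0).
  have h1 : hom 1 (f - c_ c * p3x P) by rewrite n1 in hf; apply: homB hf _; exact: homZ (hom_x _).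
  have d1 : dx (f - c_ c * p3x P) = 0 by rewrite raddfB /= dxM dx_c mul0r add0r df /dx der_x mulr1 subrr.
  have [e h2] : exists e, f - c_ c * p3x P = c_ e.
    exists 0; rewrite rmorph0; apply: (@hom_dx_ind _ _ 1 (fun A => A = 0)) h1 d1 => // *.
    by exfalso; lia.
  have : f - c_ c * p3x P = 0.
    apply: (@hom_dx_ind _ _ 1 (fun A => A = 0)) h1 d1 => // *; by exfalso; lia.
  move/subr0_eq => E; move: vf0; rewrite E !valE mulr1 => /eqP; exact/negP.
rewrite c0 rmorph0 in df.
have [n2|n2] := ltnP n 2; first by rewrite (hom_dx_low hf df n2 vf0) eqxx in f0.
move/eqP: f0; apply; apply: (@eichler_ratio n.-2 k b a) => //.
  by have -> : (k + n.-2.+1 = l)%N by lia.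
by have -> : (n.-2.+2 = n)%N by lia.
Qed.

(* If the top weight parts of a and b have zero Wronskian then they are proportional, and
   subtracting a multiple of b from a lowers its weight; otherwise [no_hom_primitive]
   applies to the top weight parts. *)
Lemma no_primitive a b (f : P) c : b != 0 -> dx f = c_ c -> b * D a - a * D b = b * b * f -> f = 0.
Proof.
move=> b0 df; case: (eqVneq f 0) => // f0.
have pb0 : phi b != 0 by rewrite -(rmorph0 (@phi C P)) (inj_eq (@phi_inj C P)).
have pf0 : phi f != 0 by rewrite -(rmorph0 (@phi C P)) (inj_eq (@phi_inj C P)).
pose k := (size (phi b)).-1; pose n := (size (phi f)).-1.
have sb : size (phi b) = k.+1 by rewrite /k prednK// size_poly_gt0.
have sf : size (phi f) = n.+1 by rewrite /n prednK// size_poly_gt0.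
have bk0 : (phi b)`_k != 0 by rewrite /k -/(lead_coef _) lead_coef_eq0.
have fn0 : (phi f)`_n != 0 by rewrite /n -/(lead_coef _) lead_coef_eq0.
have mD (q : {poly P}) d : (size q <= d.+1)%N -> (size ('X * map_poly D q)%R <= d.+2)%N.
  move=> sq; rewrite mulrC; apply: leq_trans (size_polyMleq _ _) _.
  by rewrite size_polyX addn2 /= ltnS (leq_trans (size_poly _ _)).
have cD (q : {poly P}) d : ('X * map_poly D q)`_d.+1 = D q`_d by rewrite coefXM coef_map.
suff H l : (size (phi a) <= l)%N -> b * D a - a * D b = b * b * f -> False.
  by move=> /(H (size (phi a)) (leqnn _)).
elim: l a => [|l IH] a sa W.
  have a0 : a = 0 by apply: phi_inj; rewrite rmorph0; apply/eqP; rewrite -size_poly_leq0.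
  move: W; rewrite a0 raddf0 mulr0 mul0r subrr => /esym/eqP.
  by rewrite !mulf_eq0 (negPf b0) (negPf f0).
have [al0|al0] := eqVneq (phi a)`_l 0.
  apply: (IH a) => //; apply/leq_sizeP => j; rewrite leq_eqVlt => /orP[/eqP <- //|lj].
  by rewrite nth_default// (leq_trans sa).
have top : (phi (b * D a - a * D b))`_(k + l.+1) = (phi b)`_k * D (phi a)`_l - (phi a)`_l * D (phi b)`_k.
  rewrite rmorphB !rmorphM /= !phi_D coefB coefM_top ?sb// ?mD// cD; congr (_ - _).
  by rewrite addnS -addSn addnC coefM_top ?mD ?sb// cD.
have sff : (size (phi (b * b * f)) <= (k + k + n).+1)%N.
  rewrite !rmorphM /=; apply: leq_trans (size_polyMleq _ _) _; rewrite sf addnS /= -addSn leq_add2r.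
  by apply: leq_trans (size_polyMleq _ _) _; rewrite sb addnS.
have ctop : (phi (b * b * f))`_(k + k + n) = (phi b)`_k * (phi b)`_k * (phi f)`_n.
  rewrite !rmorphM /= coefM_top ?sf// ?coefM_top ?sb//.
  by apply: leq_trans (size_polyMleq _ _) _; rewrite sb addnS.
have hbk := hom_phi_coef k b; have hal := hom_phi_coef l a; have hfn := hom_phi_coef n f.
(* The Wronskian has weight at most k + l + 1 and the right-hand side has top weight 2 k + n.
   Equality is the homogeneous case, the second case makes the top parts proportional, and the third
   is absurd. *)
have [E|[lt|lt]] : (k + l.+1 = k + k + n \/ (k + k + n < k + l.+1 \/ k + l.+1 < k + k + n))%N by lia.
- have [c' df'] : exists c', dx (phi f)`_n = c_ c'.
    have -> : dx (phi f)`_n = (phi (dx f) * 'X)`_n by rewrite phi_dx coef_map.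
    rewrite df phi_c coefMX; case: ifP => _.
      by exists 0; rewrite rmorph0.
    by rewrite coefC; case: ifP => _; [exists c|exists 0; rewrite rmorph0].
  apply: (no_hom_primitive hal hbk hfn bk0 fn0 _ df'); first lia.
  by rewrite -top W E ctop.
- have z : (phi b)`_k * D (phi a)`_l - (phi a)`_l * D (phi b)`_k = 0.
    by rewrite -top W nth_default// (leq_trans sff).
  have [c' Ec] : exists c', ev (phi a)`_l = c' *: ev (phi b)`_k.
    apply: (wronskian0 (nice_ev _) (nice_ev (D (phi a)`_l)) (nice_ev _) (nice_ev (D (phi b)`_k)) (hder_ev _) (hder_ev _)).
      exact: ev_neq0.
    by rewrite -!evM; congr (ev _); exact: subr0_eq.
  have {}Ec : (phi a)`_l = c_ c' * (phi b)`_k by apply: ev_inj; rewrite evZ.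
  have hal2 : hom k (phi a)`_l by rewrite Ec; exact: homZ.
  have lk : l = k.
    have := hom_coef hal2 l; rewrite (hom_coef hal) eqxx.
    by case: eqP => // _ E; rewrite E eqxx in al0.
  apply: (IH (a - c_ c' * b)).
    apply/leq_sizeP => j; rewrite rmorphB rmorphM /= phi_c mul_polyC coefB coefZ leq_eqVlt => /orP[/eqP <-|lj].
      by rewrite Ec lk subrr.
    by rewrite !nth_default ?mulr0 ?subr0 ?sb -?lk// (leq_trans sa).
  have DZ : D (c_ c' * b) = c_ c' * D b by exact: derZ.
  rewrite -W raddfB /= DZ.
  by move: (D a) (D b) (c_ c') => *; ring.
- have := ctop; rewrite -W nth_default.
    by move/esym/eqP; rewrite !mulf_eq0 (negPf bk0) (negPf fn0).
  rewrite rmorphB !rmorphM /= !phi_D; apply: leq_trans (size_polyD _ _) _; rewrite size_polyN geq_max.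
  apply/andP; split; apply: leq_trans (size_polyMleq _ _) _.
    rewrite sb addSn /= (leq_trans (leq_add (leqnn k) (mD _ _ sa)))//; lia.
  have mb := mD (phi b) k; rewrite sb in mb; have {}mb := mb (leqnn _).
  by apply: (@leq_trans (l.+1 + k.+2).-1); [rewrite -!subn1 leq_sub2r// leq_add|lia].
Qed.

End ModularRatios.

(** * Linear independence of the iterated integrals *)

Section Words.
Variable J : finType.

Fixpoint words_le (L : nat) : seq (seq J) :=
  if L is M.+1 then [::] :: [seq j :: u | j <- enum J, u <- words_le M] else [:: [::]].

Lemma mem_words_le L u : (u \in words_le L) = (size u <= L)%N.
Proof.
elim: L u => [|L IH] [|j u]; rewrite ?inE //=.
apply/allpairsP/idP => [[[i w] /= [_ wL [_ ->]]]|uL]; first by rewrite ltnS -IH.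
by exists (j, u); rewrite /= mem_enum IH; split.
Qed.

Lemma uniq_words_le L : uniq (words_le L).
Proof.
elim: L => [//|L IH] /=; apply/andP; split; first by apply/allpairsP => -[[i w] [_ _]].
by apply: allpairs_uniq => //; [exact: enum_uniq|move=> [i w] [i' w'] _ _ /= [-> ->]].
Qed.

Variable M : nmodType.
Implicit Types G : seq J -> M.

Lemma sum_words_leS L G : \sum_(u <- words_le L.+1) G u =
  G [::] + \sum_(j : J) \sum_(u <- words_le L) G (j :: u).
Proof. by rewrite /= big_cons big_allpairs_dep big_enum. Qed.

Lemma sum_words_le_support L G : (forall u, (L < size u)%N -> G u = 0) ->
  \sum_(u <- words_le L.+1) G u = \sum_(u <- words_le L) G u.
Proof.
elim: L G => [|L IH] G G0.
  rewrite sum_words_leS /= big1 => [|j _]; last by rewrite big_seq1 G0.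
  by rewrite addr0 big_seq1.
rewrite sum_words_leS [RHS]sum_words_leS; congr (_ + _); apply: eq_bigr => j _.
by rewrite IH// => u hu; rewrite G0.
Qed.

End Words.

Section LinearIndependence.
Variables (R : realType) (P : poly3 R[i]) (J : finType) (v : J -> P).
Local Notation C := R[i].
Implicit Types (p q b : P) (u w : seq J) (a : seq J -> P).
Local Notation c_ := (p3c P).
Local Notation D := (@D C P).
Local Notation dx := (@dx C P).
Local Notation ev := (@ev R P).
Hypothesis dv : forall j, exists c, dx (v j) = c_ c.
Hypothesis indep : forall g : J -> C, \sum_j c_ (g j) * v j = 0 -> forall j, g j = 0.

Let I u : hfun R := Iint [seq ev (v j) | j <- u].

Let nice_I u : nice_word [seq ev (v j) | j <- u].
Proof. by elim: u => [//|j u IH] /=; apply/nice_word_cons; split=> //; exact: nice_ev. Qed.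

(** The coefficient of [I u] in the derivative of the sum of the a(u) I(u): differentiating I(j ::
    u) returns - v_j I(u). *)
Definition word_der a u : P := D (a u) - \sum_j a (j :: u) * v j.

Lemma hder_word_sum L a : (forall u, (L < size u)%N -> a u = 0) ->
  hder (\sum_(u <- words_le J L) ev (a u) * I u) (\sum_(u <- words_le J L) ev (word_der a u) * I u).
Proof.
move=> a0; pose I' u : hfun R := if u is j :: w then - (ev (v j) * I w) else 0.
have dI u : hder (I u) (I' u).
  case: u => [|j w]; first by apply: (hder_eq _ (erefl 0)); rewrite /I /= Iint_nil; exact: hder_cst.
  by have := @nice_I (j :: w); rewrite /= => /Iint_hder.
apply: hder_eq (hder_sum _ (fun u => hderM (hder_ev (a u)) (dI u))) _.
rewrite big_split /=; have -> : \sum_(u <- words_le J L) ev (a u) * I' u =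
    - \sum_(u <- words_le J L) ev (\sum_j a (j :: u) * v j) * I u.
  have X0 u : (L <= size u)%N -> ev (\sum_j a (j :: u) * v j) * I u = 0.
    by move=> Lu; rewrite big1 => [|j _]; [rewrite rmorph0 mul0r|rewrite a0// mul0r].
  case: L a0 X0 => [|L] a0 X0; first by rewrite !big_seq1 mulr0 X0// oppr0.
  rewrite sum_words_leS mulr0 add0r sum_words_le_support// exchange_big /= -sumrN.
  apply: eq_bigr => u _; rewrite rmorph_sum mulr_suml -sumrN.
  by apply: eq_bigr => j _; rewrite rmorphM mulrN mulrA.
rewrite -sumrB; apply: eq_bigr => u _.
by rewrite /word_der evD evN mulrBl.
Qed.

(** The outer induction is on the maximal length, the inner one on a list containing all words of
    that length with a non-zero coefficient. *)
Lemma Iint_indep L a : (forall u, (L < size u)%N -> a u = 0) ->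
  \sum_(u <- words_le J L) ev (a u) * I u = 0 -> forall u, a u = 0.
Proof.
elim: L a => [|L IH] a a0 F0 u.
  have [u0|] := posnP (size u); last exact: a0.
  rewrite (size0nil u0); move: F0; rewrite big_seq1 /I /= Iint_nil mulr1 -(ev0 P).
  exact: ev_inj.
suff H (l : seq (seq J)) a' : (forall u, (L.+1 < size u)%N -> a' u = 0) ->
    (forall u, size u = L.+1 -> a' u != 0 -> u \in l) ->
    \sum_(u <- words_le J L.+1) ev (a' u) * I u = 0 -> forall u, a' u = 0.
  by apply: (H (words_le J L.+1)) => // w sw _; rewrite mem_words_le sw.
elim: l a' {a a0 F0 u} => [|u0 l IHl] a a0 al F0.
  have a1 u : (L < size u)%N -> a u = 0.
    rewrite leq_eqVlt => /orP[/eqP su|]; last exact: a0.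
    by apply/eqP; apply: contraT => /(al u (esym su)).
  by apply: (IH a a1); rewrite -[RHS]F0 sum_words_le_support// => u /a1 ->; rewrite rmorph0 mul0r.
have [b0|b0] := eqVneq (a u0) 0.
  apply: IHl a0 _ F0 => w sw wn; have := al w sw wn; rewrite inE => /orP[/eqP E|//].
  by rewrite E b0 eqxx in wn.
have [su0|su0] := eqVneq (size u0) L.+1; last first.
  apply: IHl a0 _ F0 => w sw wn; have := al w sw wn; rewrite inE => /orP[/eqP E|//].
  by rewrite -E sw eqxx in su0.
(* These are the coefficients of b D(F) - F D(b) for the relation F, that is of b^2 D(F / b). The
   word u0 drops out, so by the inner induction all of them vanish; at words of top length this
   makes a(u) / b constant. *)
set b := a u0 in b0; pose a2 u := b * word_der a u - a u * D b.
have a2top u : (L < size u)%N -> a2 u = b * D (a u) - a u * D b.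
  by move=> su; rewrite /a2 /word_der big1 ?subr0// => j _; rewrite a0 ?mul0r.
have a20 : forall u, a2 u = 0.
  apply: IHl => [u su|u su|].
  - by rewrite a2top ?(ltnW su)// a0// raddf0 mulr0 mul0r subrr.
  - rewrite a2top ?su// => h; have au : a u != 0.
      by apply: contra_neq h => ->; rewrite raddf0 mulr0 mul0r subrr.
    have := al u su au; rewrite inE => /orP[/eqP E|//].
    by move: h; rewrite E -/b mulrC subrr eqxx.
  - have dF : \sum_(u <- words_le J L.+1) ev (word_der a u) * I u = 0.
      apply: hder_uniq (hder_word_sum a0) _; rewrite F0; exact: hder_cst.
    transitivity (ev b * (\sum_(u <- words_le J L.+1) ev (word_der a u) * I u) -
        ev (D b) * (\sum_(u <- words_le J L.+1) ev (a u) * I u)).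
      rewrite !mulr_sumr -sumrB; apply: eq_bigr => u _.
      by rewrite /a2 evD evN !evM; ring.
    by rewrite dF F0 !mulr0 subrr.
have ratio u : size u = L.+1 -> exists c, a u = c_ c * b.
  move=> su; have := a20 u; rewrite a2top ?su// => /subr0_eq W.
  have [c Ec] : exists c, ev (a u) = c *: ev b.
    apply: (wronskian0 (nice_ev _) (nice_ev (D (a u))) (nice_ev _) (nice_ev (D b)) (hder_ev _) (hder_ev _)).
      exact: ev_neq0.
    by rewrite -!evM W.
  by exists c; apply: ev_inj; rewrite evZ.
have [j0 [w [E0 sw]]] : exists j0 w, u0 = j0 :: w /\ size w = L.
  by case: (u0) su0 => [//|j0 w] [sw]; exists j0, w.
have /choice[g hg] : forall j : J, exists c, a (j :: w) = c_ c * b.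
  by move=> j; apply: ratio; rewrite /= sw.
pose f := \sum_j c_ (g j) * v j.
have [c df] : exists c, dx f = c_ c.
  have [e he] := choice dv; exists (\sum_j g j * e j).
  rewrite /f raddf_sum rmorph_sum; apply: eq_bigr => j _.
  by rewrite /= dxM dx_c mul0r add0r he rmorphM.
have f0 : f = 0.
  (* At w, which is u0 without its first letter, the vanishing of a2 reads b D(a w) - a w D(b) = b^2
     f. *)
  apply: (@no_primitive _ _ (a w) b f c) => //.
  have := a20 w; rewrite /a2 /word_der => /eqP; rewrite mulrBr addrAC subr_eq0 => /eqP ->.
  rewrite /f -mulrA; congr (b * _); rewrite mulr_sumr; apply: eq_bigr => j _.
  by rewrite hg mulrCA mulrA.
have := hg j0; rewrite (indep f0 j0) rmorph0 mul0r -E0 -/b => b00.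
by rewrite b00 eqxx in b0.
Qed.

End LinearIndependence.

(** * Reduction to letters in V *)

Section Range.
Variables (R : realType) (P : poly3 R[i]).
Local Notation C := R[i].
Implicit Types (p q b m f g : P) (u v w : seq P) (F G : hfun R).
Local Notation c_ := (p3c P).
Local Notation x := (p3x P).
Local Notation y := (p3y P).
Local Notation z := (p3z P).
Local Notation D := (@D C P).
Local Notation dx := (@dx C P).
Local Notation ev := (@ev R P).
Local Notation mon := (@mon C P).

(* C x + C[y, z], which corresponds to V. *)
Definition polyV p : Prop := exists c, dx p = c_ c.

Lemma polyV_add c p q : polyV p -> polyV q -> polyV (c_ c * p + q).
Proof.
move=> [d hd] [e he]; exists (c * d + e).
by rewrite raddfD /= dxM dx_c mul0r add0r hd he rmorphD rmorphM.
Qed.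

(** Ramanujan's equations express multiplication by x through D up to terms of lower degree in x. So
    a monomial divisible by x is, up to a factor, a derivative modulo such terms. Where a
    predecessor is truncated at 0, its coefficient is 0. *)
Lemma D_mon a i j : c_ (a%:R / 12%:R + i%:R / 3%:R + j%:R / 2%:R) * mon a.+1 i j =
  D (mon a i j) + c_ (a%:R / 12%:R) * mon a.-1 i.+1 j + c_ (i%:R / 3%:R) * mon a i.-1 j.+1 +
  c_ (j%:R / 2%:R) * mon a i.+2 j.-1.
Proof.
have Dx : D x = g0 P by exact: der_x.
have Dy : D y = g1 P by exact: der_y.
have Dz : D z = g2 P by exact: der_z.
have E1 t : c_ (a%:R / 12%:R) * (x ^+ a.+1 * t) =
    a%:R * x ^+ a.-1 * g0 P * t + c_ (a%:R / 12%:R) * (x ^+ a.-1 * (y * t)).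
  rewrite rmorphM rmorph_nat /g0; case: a => [|a]; first by rewrite !mulr0n !mul0r addr0.
  by rewrite !exprS /=; move: (x ^+ a) (c_ _) => X k; ring.
have E2 t : c_ (i%:R / 3%:R) * (x * (y ^+ i * t)) =
    i%:R * y ^+ i.-1 * g1 P * t + c_ (i%:R / 3%:R) * (y ^+ i.-1 * (z * t)).
  rewrite rmorphM rmorph_nat /g1; case: i => [|i]; first by rewrite !mulr0n !mul0r addr0.
  by rewrite !exprS /=; move: (y ^+ i) (c_ _) => X k; ring.
have E3 t : c_ (j%:R / 2%:R) * (x * (z ^+ j * t)) =
    j%:R * z ^+ j.-1 * g2 P * t + c_ (j%:R / 2%:R) * (z ^+ j.-1 * (y ^+ 2 * t)).
  rewrite rmorphM rmorph_nat /g2; case: j => [|j]; first by rewrite !mulr0n !mul0r addr0.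
  by rewrite !exprS /=; move: (z ^+ j) (c_ _) => X k; ring.
have F1 := E1 (y ^+ i * z ^+ j); have F2 := E2 (x ^+ a * z ^+ j); have F3 := E3 (x ^+ a * y ^+ i).
rewrite /mon !rmorphD !mulrDl /D !derM !derX -/D Dx Dy Dz.
have -> : c_ (a%:R / 12%:R) * (x ^+ a.+1 * y ^+ i * z ^+ j) = c_ (a%:R / 12%:R) * (x ^+ a.+1 * (y ^+ i * z ^+ j)).
  by rewrite !mulrA.
have -> : c_ (i%:R / 3%:R) * (x ^+ a.+1 * y ^+ i * z ^+ j) = c_ (i%:R / 3%:R) * (x * (y ^+ i * (x ^+ a * z ^+ j))).
  by rewrite exprS; move: (x ^+ a) (y ^+ i) (z ^+ j) (c_ _) => *; ring.
have -> : c_ (j%:R / 2%:R) * (x ^+ a.+1 * y ^+ i * z ^+ j) = c_ (j%:R / 2%:R) * (x * (z ^+ j * (x ^+ a * y ^+ i))).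
  by rewrite exprS; move: (x ^+ a) (y ^+ i) (z ^+ j) (c_ _) => *; ring.
rewrite F1 F2 F3 !exprS {F1 F2 F3 E1 E2 E3}.
move: (a%:R * x ^+ a.-1 * g0 P) (i%:R * y ^+ i.-1 * g1 P) (j%:R * z ^+ j.-1 * g2 P) => t1 t2 t3.
move: (x ^+ a) (x ^+ a.-1) (y ^+ i) (y ^+ i.-1) (z ^+ j) (z ^+ j.-1) => X X1 Y Y1 Z Z1.
move: (c_ (a%:R / 12%:R)) (c_ (i%:R / 3%:R)) (c_ (j%:R / 2%:R)) => k1 k2 k3.
by rewrite !expr0 !mulr1; ring.
Qed.

(** Induction on the degree in x by [D_mon]. The factor (a + 4 i + 6 j) / 12 vanishes only for the
    monomial x itself, which is why E2 has to belong to V. *)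
Lemma polyV_D p : exists m q, polyV m /\ p = m + D q.
Proof.
pose Q p := exists m q, polyV m /\ p = m + D q.
have V0 : polyV 0 by exists 0; rewrite raddf0 rmorph0.
have QD c p' q' : Q p' -> Q q' -> Q (c_ c * p' + q').
  move=> [m [r [hm ->]]] [m' [r' [hm' ->]]]; exists (c_ c * m + m'), (c_ c * r + r'); split.
    exact: polyV_add.
  have DZ : D (c_ c * r) = c_ c * D r by exact: derZ.
  by rewrite DD DZ; ring.
have QZ c p' : Q p' -> Q (c_ c * p').
  move=> hp; rewrite -[_ * _]addr0; apply: QD => //.
  by exists 0, 0; rewrite raddf0 addr0.
have QDq r : Q (D r) by exists 0, r; rewrite add0r.
suff Qm a i j : Q (mon a i j).
  have /(_ p) : forall p, Q p; last by [].
  apply: p3_ind => [|c a i j q hq]; last by apply: QD => //; exact: Qm.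
  by exists 0, 0; rewrite raddf0 addr0.
elim/ltn_ind: a i j => -[|a] IH i j.
  exists (mon 0 i j), 0; rewrite raddf0 addr0; split=> //; exists 0.
  have dX r n : dx (r ^+ n) = n%:R * r ^+ n.-1 * dx r by exact: derX.
  by rewrite rmorph0 /mon expr0 mul1r dxM !dX dx_y dx_z !mulr0 mul0r addr0.
have [[-> [-> ->]]|n0] := pselect (a = 0%N /\ i = 0%N /\ j = 0%N).
  exists (mon 1 0 0), 0; rewrite raddf0 addr0; split=> //; exists 1.
  by rewrite /mon !expr0 !mulr1 /dx der_x rmorph1.
pose k : C := a%:R / 12%:R + i%:R / 3%:R + j%:R / 2%:R.
have k0 : k != 0.
  have -> : k = (a + 4 * i + 6 * j)%N%:R / 12%:R.
    by rewrite /k (natrD _ (a + 4 * i)) (natrD _ a) !natrM; move: (a%:R : C) (i%:R : C) (j%:R : C) => *; field.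
  rewrite mulf_neq0 ?invr_eq0 ?pnatr_eq0//; apply/eqP => E; apply: n0; lia.
have -> : mon a.+1 i j = c_ k^-1 * (c_ k * mon a.+1 i j).
  by rewrite mulrA -rmorphM mulVf// rmorph1 mul1r.
have -> := D_mon a i j; apply: QZ; rewrite addrC; apply: (QD).
  exact: IH.
rewrite addrC; apply: (QD); first exact: IH.
rewrite addrC; apply: (QD) => //; apply: IH; lia.
Qed.

Lemma nice_ev_word w : nice_word [seq ev f | f <- w].
Proof. by elim: w => [//|f w IH] /=; apply/nice_word_cons; split=> //; exact: nice_ev. Qed.

Definition Vspan F : Prop := exists l : seq (P * seq P),
  (forall r, r \in l -> forall f, f \in r.2 -> polyV f) /\
  F = \sum_(r <- l) ev r.1 * Iint [seq ev f | f <- r.2].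

Lemma VspanD F G : Vspan F -> Vspan G -> Vspan (F + G).
Proof.
move=> [l [hl ->]] [l' [hl' ->]]; exists (l ++ l'); split; last by rewrite big_cat.
by move=> r; rewrite mem_cat => /orP[/hl|/hl'].
Qed.

Lemma VspanM b F : Vspan F -> Vspan (ev b * F).
Proof.
move=> [l [hl ->]]; exists [seq (b * r.1, r.2) | r <- l]; split.
  by move=> _ /mapP[r rl ->] /=; exact: hl.
by rewrite big_map mulr_sumr; apply: eq_bigr => r _; rewrite evM mulrA.
Qed.

Lemma VspanZ c F : Vspan F -> Vspan (c *: F).
Proof. by move=> /(VspanM (c_ c)); rewrite ev_c -scalerAl mul1r. Qed.

Lemma VspanB F G : Vspan F -> Vspan G -> Vspan (F - G).
Proof. by move=> hF hG; apply: VspanD => //; rewrite -scaleN1r; exact: VspanZ. Qed.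

Lemma Vspan_word w : (forall f, f \in w -> polyV f) -> Vspan (Iint [seq ev f | f <- w]).
Proof.
move=> hw; exists [:: (1, w)]; split=> [r|]; last by rewrite big_seq1 ev1 mul1r.
by rewrite inE => /eqP ->.
Qed.

(* Integration by parts turns a letter D h into shorter words. *)
Lemma Vspan_D n u h v : (forall w, size w = n -> Vspan (Iint [seq ev f | f <- w])) ->
  size (u ++ v) = n -> Vspan (Iint [seq ev f | f <- u ++ D h :: v]).
Proof.
move=> IH; have [nh nh' hh] := And3 (nice_ev h) (nice_ev (D h)) (hder_ev h).
have V1 : Vspan 1 by rewrite -Iint_nil; exact: (@Vspan_word [::]).
have Vev p : Vspan (ev p) by rewrite -[ev p]mulr1; exact: VspanM.
case/lastP: u => [|u f]; case: v => [|g v]; rewrite /= ?cats0 => sn.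
- rewrite (Iint_parts1 nh nh' hh); apply: VspanB => //.
  have -> : (fun=> fourier (ev h) 0) = (fourier (ev h) 0)%:A :> hfun R.
    by apply/funext => t; exact/esym/mulr1.
  exact: VspanZ.
- rewrite (Iint_parts nh nh' hh (nice_ev g) (@nice_ev_word v)) -evM; apply: VspanB.
    exact: (IH (h * g :: v)).
  by apply: VspanM; exact: (IH (g :: v)).
- rewrite cats1 !map_rcons (Iint_parts_last nh nh' hh (@nice_ev_word u) (nice_ev f)) -evM -!map_rcons.
  apply: VspanB; [apply: VspanZ; exact: IH|apply: IH].
  by rewrite -sn !size_rcons.
- rewrite cat_rcons map_cat /= (Iint_parts_mid nh nh' hh (@nice_ev_word u) (nice_ev f) (nice_ev g) (@nice_ev_word v)).
  have s2 f' g' : size (u ++ f' :: v) = n -> size (u ++ g' :: v) = n by rewrite !size_cat.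
  rewrite -!evM; apply: VspanB.
    have := IH (u ++ f :: h * g :: v); rewrite map_cat /=; apply.
    by rewrite -sn !size_cat size_rcons /= addnS.
  have := IH (u ++ f * h :: g :: v); rewrite map_cat /=; apply.
  by rewrite -sn !size_cat size_rcons /= addnS.
Qed.

(** The outer induction is on the length. Within a word the letters are treated from left to right,
    u being the part already in V: writing f = m + D q, multilinearity moves m into u, and [Vspan_D]
    deals with the other word. *)
Lemma Vspan_Iint w : Vspan (Iint [seq ev f | f <- w]).
Proof.
suff H n w' : size w' = n -> Vspan (Iint [seq ev f | f <- w']) by exact: H.
elim: n w' => [|n IH] w' sw; first by rewrite (size0nil sw); exact: Vspan_word.
suff K v u : size (u ++ v) = n.+1 -> (forall f, f \in u -> polyV f) ->
    Vspan (Iint [seq ev f | f <- u ++ v]) by exact: (K w' [::]).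
elim: v u => [|f v IHv] u suv hu; first by rewrite cats0; exact: Vspan_word.
have [m [q [hm E]]] := polyV_D f.
have -> : [seq ev f | f <- u ++ f :: v] = [seq ev f | f <- u] ++ (1 *: ev (D q) + ev m) :: [seq ev f | f <- v].
  by rewrite map_cat /= E evD scale1r addrC.
rewrite (Iint_multilinear 1 (@nice_ev_word u) (@nice_ev_word v) (nice_ev (D q)) (nice_ev m)) scale1r.
have E1 g : [seq ev f | f <- u] ++ ev g :: [seq ev f | f <- v] = [seq ev f | f <- u ++ g :: v].
  by rewrite map_cat.
rewrite !E1; apply: VspanD.
  by apply: Vspan_D IH _; move: suv; rewrite !size_cat /= addnS => -[].
rewrite -cat_rcons; apply: IHv.
  by move: suv; rewrite -cat_rcons !size_cat !size_rcons.
by move=> g; rewrite mem_rcons inE => /orP[/eqP ->|/hu].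
Qed.

End Range.

(** * The isomorphism *)

Section QuasimodularAlgebra.
Variables (R : realType) (P : poly3 R[i]).
Local Notation C := R[i].
Implicit Types (p q m : P) (f : hfun R).
Local Notation c_ := (p3c P).
Local Notation x := (p3x P).
Local Notation y := (p3y P).
Local Notation z := (p3z P).
Local Notation dx := (@dx C P).
Local Notation ev := (@ev R P).

Lemma alg_genX (X : set (hfun R)) f : X f -> alg_gen X f.
Proof. by move=> Xf N [_]; apply. Qed.

Lemma alg_gen_ind (X N : set (hfun R)) : is_subalg N -> (forall f, X f -> N f) -> forall f, alg_gen X f -> N f.
Proof. by move=> hN XN f; apply. Qed.

Lemma alg_genD (X : set (hfun R)) f g : alg_gen X f -> alg_gen X g -> alg_gen X (f + g).
Proof. by have [_ h _] := alg_gen_subalg X; rewrite -{2}[f]scale1r; exact: h. Qed.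

Lemma alg_genM (X : set (hfun R)) f g : alg_gen X f -> alg_gen X g -> alg_gen X (f * g).
Proof. by have [_ _ h] := alg_gen_subalg X; exact: h. Qed.

Lemma alg_gen_cst (X : set (hfun R)) c : alg_gen X c%:A.
Proof.
have [h1 h _] := alg_gen_subalg X; have h0 : alg_gen X 0.
  by rewrite -(addNr (1 : hfun R)) -scaleN1r; exact: h.
by rewrite -[c%:A]addr0; exact: h.
Qed.

Lemma alg_genXn (X : set (hfun R)) f n : alg_gen X f -> alg_gen X (f ^+ n).
Proof.
move=> hf; elim: n => [|n IH]; last by rewrite exprS; exact: alg_genM.
by have [h1 _ _] := alg_gen_subalg X.
Qed.

Lemma QM_evP f : alg_gen [set @E2 R; @E4 R; @E6 R] f <-> exists p, f = ev p.
Proof.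
split; last first.
  move=> [p ->]; elim/alg_ind: p => [c|p q hp hq|p q hp hq|||].
  - by rewrite ev_c; exact: alg_gen_cst.
  - by rewrite evD; exact: alg_genD.
  - by rewrite evM; exact: alg_genM.
  - by rewrite ev_x; apply: alg_genX; left; left.
  - by rewrite ev_y; apply: alg_genX; left; right.
  - by rewrite ev_z; apply: alg_genX; right.
move: f; apply: alg_gen_ind.
  split.
  - by exists 1; rewrite ev1.
  - by move=> c _ _ [p ->] [q ->]; exists (c_ c * p + q); rewrite evD evZ.
  - by move=> _ _ [p ->] [q ->]; exists (p * q); rewrite evM.
move=> f [[->|->]|->]; first by exists x; rewrite ev_x.
  by exists y; rewrite ev_y.
by exists z; rewrite ev_z.
Qed.

Lemma modforms_evP f : modforms f <-> exists m, dx m = 0 /\ f = ev m.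
Proof.
split.
  move: f; apply: alg_gen_ind.
    split.
    - by exists 1; rewrite ev1 -(rmorph1 c_) dx_c.
    - move=> c _ _ [p [hp ->]] [q [hq ->]]; exists (c_ c * p + q); rewrite evD evZ.
      by rewrite raddfD /= dxM dx_c hp hq mul0r mulr0 !addr0.
    - by move=> _ _ [p [hp ->]] [q [hq ->]]; exists (p * q); rewrite evM dxM hp hq mul0r mulr0 addr0.
  by move=> f [->|->]; [exists y; rewrite ev_y dx_y|exists z; rewrite ev_z dx_z].
have c0 : modforms (0 : hfun R) by rewrite -(scale0r 1); exact: alg_gen_cst.
move=> [m [dm ->]]; rewrite (phi_sum (leqnn (size (phi m)))) rmorph_sum /=.
elim/big_ind: _ => // [f1 f2|n _]; first exact: alg_genD.
have dn : dx (phi m)`_n = 0.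
  have -> : dx (phi m)`_n = (phi (dx m) * 'X)`_n by rewrite phi_dx coef_map.
  by rewrite dm rmorph0 mul0r coef0.
apply: (@hom_dx_ind _ _ n (fun p => modforms (ev p))) (hom_phi_coef n m) dn => [|c i j p _ hp]; first by rewrite ev0.
rewrite evD !evM ev_c !evX ev_y ev_z.
apply: alg_genD => //; apply: alg_genM; first exact: alg_gen_cst.
by apply: alg_genM; apply: alg_genXn; apply: alg_genX; [left|right].
Qed.

Lemma Vset_evP f : Vset f <-> exists p, polyV p /\ f = ev p.
Proof.
split=> [[c [g [/modforms_evP[m [dm ->]] ->]]]|[p [[c dp] ->]]].
  exists (c_ c * x + m); rewrite evD evZ ev_x; split=> //; exists c.
  by rewrite raddfD /= dxM dx_c mul0r add0r dm addr0 /dx der_x mulr1.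
exists c, (ev (p - c_ c * x)); split; last by rewrite evD evN evZ ev_x addrC subrK.
apply/modforms_evP; exists (p - c_ c * x); split=> //.
by rewrite raddfB /= dxM dx_c mul0r add0r dp /dx der_x mulr1 subrr.
Qed.

Lemma QM_ev (g : QM R) : exists p, val g = ev p.
Proof. by apply/QM_evP/asboolP; exact: (valP g). Qed.

Lemma ev_QM p : exists g : QM R, val g = ev p.
Proof.
have h : alg_gen_pred [set @E2 R; @E4 R; @E6 R] (ev p) by apply/asboolP/QM_evP; exists p.
by exists (exist _ (ev p) h).
Qed.

Lemma V_ev (f : V R) : exists p, polyV p /\ val f = ev p.
Proof. by apply/Vset_evP/asboolP; exact: (valP f). Qed.

Lemma ev_V p : polyV p -> exists f : V R, val f = ev p.
Proof.
move=> hp; have h : Vpred (ev p) by apply/asboolP/Vset_evP; exists p.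
by exists (exist _ (ev p) h).
Qed.

Lemma nice_V (s : seq (V R)) : nice_word [seq val h | h <- s].
Proof.
elim: s => [//|h s IH] /=; apply/nice_word_cons; split=> //.
by have [p [_ ->]] := V_ev h; exact: nice_ev.
Qed.

End QuasimodularAlgebra.

(** * Finite independent families and collection of terms *)

Section LinearAlgebra.

(** V comes without a basis, but an element of the tensor product involves finitely many letters;
    this provides independent letters spanning them. *)
Lemma indep_family (K : fieldType) (U : lmodType K) (fs : seq U) : exists (m : nat) (e : 'I_m -> U),
  (forall g : 'I_m -> K, \sum_j g j *: e j = 0 -> forall j, g j = 0) /\
  (forall f, f \in fs -> exists g : 'I_m -> K, f = \sum_j g j *: e j).
Proof.
elim: fs => [|f fs [m [e [ind sp]]]].
  by exists 0%N, (fun=> 0); split=> // g _ [].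
have [[g fg]|nf] := pselect (exists g : 'I_m -> K, f = \sum_j g j *: e j).
  exists m, e; split=> // h; rewrite inE => /orP[/eqP ->|/sp//].
  by exists g.
exists m.+1, (fun i => if unlift ord0 i is Some j then e j else f).
have E (g : 'I_m.+1 -> K) : \sum_i g i *: (if unlift ord0 i is Some j then e j else f) =
    g ord0 *: f + \sum_j g (fintype.lift ord0 j) *: e j.
  rewrite big_ord_recl unlift_none; congr (_ + _).
  by apply: eq_bigr => j _; rewrite liftK.
split=> [g|h]; last first.
  rewrite inE => /orP[/eqP ->|/sp[g ->]].
    exists (fun i => if unlift ord0 i is Some j then 0 else 1); rewrite E unlift_none scale1r.
    by rewrite big1 ?addr0// => j _; rewrite liftK scale0r.
  exists (fun i => if unlift ord0 i is Some j then g j else 0); rewrite E unlift_none scale0r add0r.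
  by apply: eq_bigr => j _; rewrite liftK.
rewrite E => g0; have [z|nz] := eqVneq (g ord0) 0.
  rewrite z scale0r add0r in g0; move=> i; have [j ->|->//] := unliftP ord0 i.
  exact: (ind (fun j => g (fintype.lift ord0 j)) g0).
exfalso; apply: nf; exists (fun j => - (g ord0)^-1 * g (fintype.lift ord0 j)).
rewrite -[LHS]scale1r -(mulVf nz) -scalerA (_ : g ord0 *: f = - \sum_j g (fintype.lift ord0 j) *: e j).
  by rewrite scalerN -scaleNr scaler_sumr; apply: eq_bigr => j _; rewrite scalerA.
by apply/eqP; rewrite -subr_eq0 opprK g0.
Qed.

Lemma multilinear_sum (K : comNzRingType) (U M : lmodType K) (f : seq U -> M) (I : Type) (r : seq I)
  (g : I -> K) (e : I -> U) u v : multilinear f ->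
  f (u ++ (\sum_(i <- r) g i *: e i) :: v) = \sum_(i <- r) g i *: f (u ++ e i :: v).
Proof.
move=> fl; have f0 : f (u ++ 0 :: v) = 0.
  by have := fl u v (-1) 0 0; rewrite scaler0 addr0 scaleN1r addNr.
by elim: r => [|i r IH]; rewrite ?big_nil// !big_cons fl IH.
Qed.

Lemma shuffle_map (T T' : Type) (h : T -> T') s t :
  shuffle [seq h i | i <- s] [seq h i | i <- t] = [seq [seq h i | i <- w] | w <- shuffle s t].
Proof.
elim: s t => [//|a s IHs] t; elim: t => [|b t IHt]; first by rewrite !shuffles0.
rewrite [LHS](shuffle_cons (h a) _ (h b) _) (shuffle_cons a s b t) map_cat; congr (_ ++ _).
  transitivity (map (cons (h a)) (map (map h) (shuffle s (b :: t)))); first by rewrite -IHs.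
  by rewrite -!map_comp.
transitivity (map (cons (h b)) (map (map h) (shuffle (a :: s) t))); first by rewrite -IHt.
by rewrite -!map_comp.
Qed.

Lemma sum_collect (I : eqType) (A : nmodType) (M : nmodType) (T : A -> I -> M) (U : seq I) (l : seq (A * I)) :
  (forall i, T 0 i = 0) -> (forall a b i, T (a + b) i = T a i + T b i) -> uniq U ->
  (forall r, r \in [seq r.2 | r <- l] -> r \in U) ->
  \sum_(r <- l) T r.1 r.2 = \sum_(i <- U) T (\sum_(r <- l | r.2 == i) r.1) i.
Proof.
move=> T0 TD uU; elim: l => [|r l IH] lU.
  by rewrite big_nil big1// => i _; rewrite big_nil T0.
rewrite big_cons IH => [|i il]; last by apply: lU; rewrite /= inE il orbT.
have rU : r.2 \in U by apply: lU; rewrite /= inE eqxx.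
rewrite (bigD1_seq r.2)//= [RHS](bigD1_seq r.2)//= big_cons eqxx TD addrA; congr (_ + _).
by apply: eq_bigr => i ir; rewrite big_cons eq_sym (negPf ir).
Qed.

End LinearAlgebra.

(** * The comparison map, its kernel and its range *)

Section Comparison.
Variable R : realType.
Local Notation C := R[i].
Implicit Types (a g : QM R) (s t : seq (V R)) (b : shuf (V R)).

Definition psi : shuf (V R) -> hfun R :=
  @pres_lift _ _ (@shuf_rel C (V R)) _ (fun s : seq (V R) => Iint [seq val f | f <- s]).

Lemma psi_rel r : @shuf_rel C (V R) r -> fglift (fun s : seq (V R) => Iint [seq val f | f <- s]) r = 0.
Proof.
have P := poly3_exists C.
move: r; apply/fglift_shuf_rel => u v c f g; rewrite !map_cat /=.
have nV (h : V R) : nice (val h) by have [p [_ ->]] := V_ev P h; exact: nice_ev.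
exact: Iint_multilinear (@nice_V R P u) (@nice_V R P v) (nV f) (nV g).
Qed.

Lemma psi_linear : linear psi.
Proof. exact: pres_lift_linear psi_rel. Qed.

Lemma psi_word s : psi (word s) = Iint [seq val f | f <- s].
Proof. exact: pres_liftU psi_rel _. Qed.

Lemma psi0 : psi 0 = 0. Proof. exact: linear_for0 psi_linear. Qed.
Lemma psi1 : psi 1 = 1. Proof. by rewrite -word_nil psi_word Iint_nil. Qed.
Lemma psiD b b' : psi (b + b') = psi b + psi b'.
Proof. by have := psi_linear 1 b b'; rewrite !scale1r. Qed.

Lemma psiM b b' : psi (b * b') = psi b * psi b'.
Proof.
have P := poly3_exists C.
move: b; apply: pres_ind => [|c s b IH]; first by rewrite mul0r psi0 mul0r.
rewrite -/(word s) mulrDl !psi_linear mulrDl -IH -!scalerAl psi_linear; congr (_ *: _ + _).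
move: {IH b} b'; apply: pres_ind => [|d t b' IH']; first by rewrite mulr0 psi0 mulr0.
rewrite -/(word t) mulrDr psi_linear mulrDr -IH' -!scalerAr psi_linear; congr (_ *: _ + _).
rewrite word_mul !psi_word -(Iint_shuffle (@nice_V R P s) (@nice_V R P t)) shuffle_map big_map.
rewrite (big_morph psi psiD psi0); apply: eq_bigr => w _; exact: psi_word.
Qed.

Definition Phi : tens (QM R) (shuf (V R)) -> hfun R :=
  @pres_lift _ _ (@tens_rel C (QM R) (shuf (V R))) _ (fun ab => val ab.1 * psi ab.2).

Lemma Phi_rel r : @tens_rel C (QM R) (shuf (V R)) r -> fglift (fun ab => val ab.1 * psi ab.2) r = 0.
Proof.
move: r; apply: fglift_tens_rel => [b c a a'|a c b b'] /=.
  by rewrite [LHS]mulrDl -scalerAl.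
by rewrite psi_linear mulrDr -scalerAr.
Qed.

Lemma Phi_linear : linear (Phi : @presmod C _ (@tens_rel C (QM R) (shuf (V R))) -> hfun R).
Proof. exact: pres_lift_linear Phi_rel. Qed.

Lemma Phi_tensor a b : Phi (tensor a b) = val a * psi b.
Proof. exact: (pres_liftU Phi_rel). Qed.

Lemma PhiB : zmod_morphism Phi.
Proof.
have PhiD x y : Phi (x + y) = Phi x + Phi y by have := Phi_linear 1 x y; rewrite !scale1r.
by move=> x y; apply: (addIr (Phi y)); rewrite -PhiD !subrK.
Qed.

HB.instance Definition _ := GRing.isZmodMorphism.Build _ _ Phi PhiB.

Lemma PhiM : GRing.monoid_morphism Phi.
Proof.
split; first by rewrite -[1]tensor_one Phi_tensor psi1 mulr1.
move=> x y; move: x; apply: tens_ind => [|a b x IH]; first by rewrite mul0r raddf0 mul0r.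
rewrite mulrDl !raddfD /= mulrDl -IH; congr (_ + _).
move: {IH x} y; apply: tens_ind => [|a' b' y IHy]; first by rewrite mulr0 raddf0 mulr0.
rewrite mulrDr !raddfD /= mulrDr -IHy; congr (_ + _).
by rewrite tensor_mul !Phi_tensor psiM mulrACA.
Qed.

HB.instance Definition _ := GRing.isMonoidMorphism.Build _ _ Phi PhiM.

Lemma PhiZ g (x : tens (QM R) (shuf (V R))) : Phi (g *: x) = val g * Phi x.
Proof.
by rewrite [g *: x](_ : _ = tensor g 1 * x)// rmorphM /= Phi_tensor psi1 mulr1.
Qed.

Lemma tensor0r a : tensor a (0 : shuf (V R)) = 0.
Proof. by apply: (addIr (tensor a 0)); rewrite -tensorDr !add0r. Qed.

Lemma tensor0l b : tensor (0 : QM R) b = 0.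
Proof. by apply: (addIr (tensor 0 b)); rewrite -tensorDl !add0r. Qed.

Lemma tens_words (x : tens (QM R) (shuf (V R))) :
  exists l : seq (QM R * seq (V R)), x = \sum_(r <- l) tensor r.1 (word r.2).
Proof.
move: x; apply: tens_ind => [|a b x [l ->]]; first by exists [::]; rewrite big_nil.
suff [l' ->] : exists l' : seq (QM R * seq (V R)), tensor a b = \sum_(r <- l') tensor r.1 (word r.2).
  by exists (l' ++ l); rewrite big_cat.
move: b; apply: pres_ind => [|c s b [l' E]]; first by exists [::]; rewrite big_nil tensor0r.
exists ((c *: a, s) :: l'); rewrite big_cons tensorDr E; congr (_ + _).
by rewrite tensorZ.
Qed.

Section Letters.
Variables (J : finType) (e : J -> V R).

Definition in_letters (x : tens (QM R) (shuf (V R))) : Prop :=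
  exists l : seq (QM R * seq J), x = \sum_(r <- l) tensor r.1 (word [seq e j | j <- r.2]).

Lemma in_letters_sum (I : eqType) (r : seq I) (F : I -> tens (QM R) (shuf (V R))) :
  (forall i, i \in r -> in_letters (F i)) -> in_letters (\sum_(i <- r) F i).
Proof.
elim: r => [|i r IH] h; first by exists [::]; rewrite !big_nil.
have [l El] := h i (mem_head _ _).
have [l' El'] : in_letters (\sum_(j <- r) F j) by apply: IH => j jr; apply: h; rewrite inE jr orbT.
by exists (l ++ l'); rewrite big_cons El El' big_cat.
Qed.

(** The letters are expanded one at a time; u is the part already rewritten. *)
Lemma in_letters_word s u a : (forall f, f \in s -> exists g : J -> C, f = \sum_j g j *: e j) ->
  in_letters (tensor a (word ([seq e j | j <- u] ++ s))).
Proof.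
elim: s u a => [|f s IH] u a hs; first by exists [:: (a, u)]; rewrite cats0 big_seq1.
have [g ->] := hs f (mem_head _ _).
rewrite (multilinear_sum _ _ _ _ _ (@word_multilinear C (V R))).
rewrite (big_morph (tensor a) (tensorDr a) (tensor0r a)); apply: in_letters_sum => j _.
rewrite -tensorZ -cat_rcons -map_rcons; apply: IH => h hs'; apply: hs; rewrite inE hs' orbT//.
Qed.

End Letters.

(** The letters of x are expanded in an independent family, and equal words are collected. Then x is
    a combination of distinct words in finitely many independent letters, whose coefficients vanish
    by [Iint_indep]. *)
Lemma Phi_eq0 (x : tens (QM R) (shuf (V R))) : Phi x = 0 -> x = 0.
Proof.
have P := poly3_exists C.
have [l0 E0] := tens_words x.
have [m [e [ind sp]]] := indep_family (flatten [seq r.2 | r <- l0]).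
have [l El] : in_letters e x.
  rewrite E0; apply: in_letters_sum => r rl; apply: (in_letters_word [::]) => f fr.
  by apply: sp; apply/flattenP; exists r.2 => //; apply: map_f.
pose L := \max_(r <- l) size r.2.
pose b u := \sum_(r <- l | r.2 == u) r.1.
have lL u : u \in [seq r.2 | r <- l] -> (size u <= L)%N.
  by move=> /mapP[r rl ->]; exact: (leq_bigmax_seq (F := fun r : QM R * seq 'I_m => size r.2)).
have Ex : x = \sum_(u <- words_le 'I_m L) tensor (b u) (word [seq e j | j <- u]).
  rewrite El (@sum_collect _ _ _ (fun a u => tensor a (word [seq e j | j <- u])) (words_le 'I_m L)) //.
  - by move=> u; exact: tensor0l.
  - by move=> a a' u; exact: tensorDl.
  - exact: uniq_words_le.
  - by move=> u /lL; rewrite mem_words_le.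
have /choice[a ha] : forall u, exists p : P, val (b u) = ev p by move=> u; exact: QM_ev.
have /choice[v hv] : forall j, exists p : P, polyV p /\ val (e j) = ev p by move=> j; exact: V_ev.
rewrite {1}Ex raddf_sum => F0.
have b0 u : (L < size u)%N -> b u = 0.
  move=> Lu; rewrite /b big_seq_cond big1// => r /andP[rl /eqP ru].
  by have := lL r.2 (map_f _ rl); rewrite ru leqNgt Lu.
have a0 u : a u = 0.
  apply: (@Iint_indep R P 'I_m v _ _ L a) => [j|g g0 j|w Lw|].
  - by have [] := hv j.
  - apply: (ind g); apply: val_inj.
    have vD : {morph (val : V R -> hfun R) : f h / f + h} by [].
    rewrite (big_morph _ vD erefl); transitivity (@ev R P 0); last exact: ev0.
    rewrite -g0 rmorph_sum; apply: eq_bigr => i _.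
    by rewrite /= evZ -(hv i).2.
  - by apply: ev_inj; rewrite -ha b0// ev0.
  - rewrite -[RHS]F0; apply: eq_bigr => w _; rewrite /= Phi_tensor psi_word ha; congr (_ * Iint _).
    by rewrite -map_comp; apply: eq_map => j; rewrite /= (hv j).2.
rewrite Ex big1// => u _; have -> : b u = 0 by apply: val_inj; rewrite ha a0 ev0.
exact: tensor0l.
Qed.

Lemma Phi_range : range Phi = IQM R.
Proof.
have P := poly3_exists C.
apply/seteqP; split=> [F [x _ <-]|F [s ->]].
  have [l ->] := tens_words x.
  have /choice[h hh] : forall f : V R, exists g : QM R, val g = val f.
    by move=> f; have [p [_ ->]] := V_ev P f; exact: ev_QM.
  exists [seq (r.1, [seq h f | f <- r.2]) | r <- l].
  rewrite raddf_sum big_map; apply: eq_bigr => r _; rewrite /= Phi_tensor psi_word; congr (_ * Iint _).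
  by rewrite -map_comp; apply: eq_map => f; rewrite /= hh.
have word_range a w : exists x, Phi x = val a * Iint [seq val f | f <- (w : seq (QM R))].
  have /choice[h hh] : forall g : QM R, exists p : P, val g = ev p by move=> g; exact: QM_ev.
  have -> : [seq val f | f <- w] = [seq ev f | f <- [seq h f | f <- w]].
    by rewrite -map_comp; apply: eq_map => f; rewrite /= hh.
  have [l [hl ->]] := Vspan_Iint [seq h f | f <- w]; elim: l hl => [|r l IH] hl.
    by exists 0; rewrite raddf0 big_nil mulr0.
  have [|x Ex] := IH; first by move=> r' r'l; apply: hl; rewrite inE r'l orbT.
  have [g hg] := ev_QM r.1.
  have [s' Es'] : exists s' : seq (V R), [seq val f | f <- s'] = [seq ev f | f <- r.2].
    elim: (r.2) (hl r (mem_head _ _)) => [|p r' IHr] hr; first by exists [::].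
    have [s' Es'] : exists s' : seq (V R), [seq val f | f <- s'] = [seq ev f | f <- r'].
      by apply: IHr => q qr; apply: hr; rewrite inE qr orbT.
    have [f hf] := ev_V (hr p (mem_head _ _)).
    by exists (f :: s'); rewrite /= hf Es'.
  exists (a *: tensor g (word s') + x).
  by rewrite raddfD /= PhiZ Phi_tensor psi_word hg Es' Ex big_cons mulrDr.
elim: s => [|r s [x _ IH]]; first by exists 0 => //; rewrite raddf0 big_nil.
have [t Et] := word_range r.1 r.2.
by exists (t + x) => //; rewrite raddfD /= Et IH big_cons.
Qed.

End Comparison.

(** [IQM] is a subset of [hfun R], so the isomorphism appears as an injective ring morphism into
    [hfun R] with this range. Linearity over [QM] and the values on words determine it. *)
Theorem theorem4p3 (R : realType) :
  exists phi : {rmorphism tens (QM R) (shuf (V R)) -> hfun R},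
    [/\ (forall (g : QM R) (x : tens (QM R) (shuf (V R))),
           phi (g *: x) = val g * phi x),
        (forall fs : seq (V R),
           phi (tensor (1 : QM R) (word fs)) = Iint [seq val f | f <- fs]),
        injective phi
      & range phi = IQM R].
Proof.
exists (@Phi R); split.
- exact: PhiZ.
- by move=> fs; rewrite /= Phi_tensor psi_word; exact: mul1r.
- by move=> x y E; apply/subr0_eq/Phi_eq0; rewrite raddfB /= E subrr.
- exact: Phi_range.
Qed.
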